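(* Let $n\ge0$ be an integer and let $f_n$ and $A_n$ be as in the context. Then $\sigma_c(A_n)=[0,\infty)$, $\sigma_r(A_n)=\emptyset$, and $\sigma_p(A_n)$ consists of exactly $n$ real numbers $\lambda_1,\dots,\lambda_n$ with $0>\lambda_1>\lambda_2>\dots>\lambda_n$ (so $\sigma_p(A_0)=\emptyset$).
   Context: $H:=L^2_w(0,1)$, $w(\rho)=\frac{\rho^2}{(1-\rho^2)^2}$. $\mathcal D(A):=\{u\in H:\ u,\ \rho^2u'\in AC_{\mathrm{loc}}(0,1),\ \frac1w(-(\rho^2u')'+2u)\in H\}$, $Au:=\frac1w(-(\rho^2u')'+2u)$. For integer $n\ge0$, $f_n$ is the $n$-th self-similar wave map profile: a real-analytic function on $[0,1]$ solving $f''+\frac2\rho f'-\frac{\sin(2f)}{\rho^2(1-\rho^2)}=0$ on $(0,1)$, with $f_n(0)=0$, $f_n(1)=\pi/2$, such that $f_n$ crosses the value $\pi/2$ exactly $n$ times on $[0,1)$ and the function $\theta_n(\rho)=\rho\sqrt{1-\rho^2}f_n'(\rho)$ has exactly $n$ zeros in $(0,1)$ ($f_0(\rho)=2\arctan\rho$). Put $g_n(\rho)=\frac{2(1-\rho^2)\cos(2f_n(\rho))-\rho^2-2(1-\rho^2)^2}{\rho^2}$ and $\mathcal D(A_n)=\mathcal D(A)$, $A_nu=Au+g_nu$. Spectral parts: $\sigma_p$ = eigenvalues; $\lambda\in\sigma_c$ iff $\lambda-A_n$ injective, not surjective, dense range; $\lambda\in\sigma_r$ iff $\lambda-A_n$ injective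 with non-dense range. *)

(* Defs.v *)
From HB Require Import structures.
From mathcomp Require Import all_boot all_order all_algebra.
From mathcomp Require Import all_classical all_reals all_analysis.
From mathcomp Require Import complex.
Set Implicit Arguments.
Unset Strict Implicit.
Unset Printing Implicit Defensive.
Import Order.TTheory GRing.Theory Num.Theory.
Import numFieldNormedType.Exports.
Local Open Scope classical_set_scope.
Local Open Scope ring_scope.

Section WaveMapDefs.
Variable R : realType.

Definition I01 : set R := `]0, 1[%classic.

Definition weight (x : R) : R := x ^+ 2 / (1 - x ^+ 2) ^+ 2.

Definition ReF (u : R -> R[i]) : R -> R := fun x => complex.Re (u x).
Definition ImF (u : R -> R[i]) : R -> R := fun x => complex.Im (u x).

Definition Hnorm2 (u : R -> R[i]) : \bar R :=
  (\int[@lebesgue_measure R]_(x in I01)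
      (weight x * (ReF u x ^+ 2 + ImF u x ^+ 2))%:E)%E.

Definition inH (u : R -> R[i]) : Prop :=
  measurable_fun I01 (ReF u) /\ measurable_fun I01 (ImF u) /\
  (Hnorm2 u < +oo)%E.

Definition ae_eq01 (u v : R -> R[i]) : Prop :=
  {ae @lebesgue_measure R, forall x, I01 x -> u x = v x}.

Definition abs_cont_on (f : R -> R) (a b : R) : Prop :=
  forall eps : R, 0 < eps -> exists2 d : R, 0 < d &
    forall s : seq (R * R),
      all (fun p => (a <= p.1) && (p.1 <= p.2) && (p.2 <= b)) s ->
      pairwise (fun p q => (p.2 <= q.1) || (q.2 <= p.1)) s ->
      \sum_(p <- s) (p.2 - p.1) < d ->
      \sum_(p <- s) `|f p.2 - f p.1| < eps.

Definition AC_loc01 (f : R -> R) : Prop :=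
  forall a b : R, 0 < a -> b < 1 -> abs_cont_on f a b.

Definition cAC_loc01 (u : R -> R[i]) : Prop :=
  AC_loc01 (ReF u) /\ AC_loc01 (ImF u).

Definition cderive (u : R -> R[i]) (x : R) : R[i] :=
  Complex (derive1 (ReF u) x) (derive1 (ImF u) x).

(* graph of A: u \in D(A) and A u = v (in H, i.e. up to a.e. equality) *)
Definition A_graph (u v : R -> R[i]) : Prop :=
  inH u /\ cAC_loc01 u /\
  exists p : R -> R[i],
    cAC_loc01 p /\
    ae_eq01 p (fun x => (x ^+ 2)%:C%C * cderive u x) /\
    inH v /\
    ae_eq01 v (fun x => ((weight x)^-1)%:C%C * (- cderive p x + 2 * u x)).

Definition Ag_graph (g : R -> R) (u v : R -> R[i]) : Prop :=
  inH v /\ exists v0, A_graph u v0 /\ ae_eq01 v (fun x => v0 x + (g x)%:C%C * u x).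

Definition res_graph (g : R -> R) (lam : R[i]) (u h : R -> R[i]) : Prop :=
  inH h /\ exists v, Ag_graph g u v /\ ae_eq01 h (fun x => lam * u x - v x).

Definition res_injective (g : R -> R) (lam : R[i]) : Prop :=
  forall u1 u2 h, res_graph g lam u1 h -> res_graph g lam u2 h -> ae_eq01 u1 u2.

Definition res_surjective (g : R -> R) (lam : R[i]) : Prop :=
  forall h, inH h -> exists u, res_graph g lam u h.

Definition res_dense_range (g : R -> R) (lam : R[i]) : Prop :=
  forall h, inH h -> forall eps : R, 0 < eps ->
    exists u k, res_graph g lam u k /\
      (Hnorm2 (fun x => (k x - h x)%R) < eps%:E)%E.

Definition sigma_p (g : R -> R) (lam : R[i]) : Prop := ~ res_injective g lam.
Definition sigma_c (g : R -> R) (lam : R[i]) : Prop :=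
  res_injective g lam /\ ~ res_surjective g lam /\ res_dense_range g lam.
Definition sigma_r (g : R -> R) (lam : R[i]) : Prop :=
  res_injective g lam /\ ~ res_dense_range g lam.

Definition real_analytic01 (f : R -> R) : Prop :=
  forall x0 : R, 0 <= x0 <= 1 -> exists2 r : R, 0 < r &
    exists a : nat -> R, forall x : R, 0 <= x <= 1 -> `|x - x0| < r ->
      (series (fun k => a k * (x - x0) ^+ k) @ \oo --> f x).

Definition exactly_n_points (n : nat) (P : R -> Prop) : Prop :=
  exists s : seq R, [/\ uniq s, size s = n & forall x, x \in s <-> P x].

Definition wm_profile (n : nat) (f : R -> R) : Prop :=
  real_analytic01 f /\
  (forall x : R, 0 < x < 1 ->
     derive1 (derive1 f) x + 2 / x * derive1 f x
       - sin (2 * f x) / (x ^+ 2 * (1 - x ^+ 2)) = 0) /\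
  f 0 = 0 /\ f 1 = pi / 2 /\
  exactly_n_points n (fun x => 0 <= x < 1 /\ f x = pi / 2) /\
  exactly_n_points n (fun x => 0 < x < 1 /\ x * Num.sqrt (1 - x ^+ 2) * derive1 f x = 0).

Definition potential (f : R -> R) (x : R) : R :=
  (2 * (1 - x ^+ 2) * cos (2 * f x) - x ^+ 2 - 2 * (1 - x ^+ 2) ^+ 2) / x ^+ 2.

End WaveMapDefs.

(* Main.v *)
(** With [p = t^2 u'] the eigenvalue equation becomes a first order system on (0, 1); with
    [k = 1 / (1 - t^2)] and [z = t (sqrt k) u] it reads [z'' = (V - lambda) z] in the variable
    artanh t, where [V] vanishes at infinity.

    Injectivity. If [u] is square integrable, its Wronskian with its conjugate is small at points
    close to 0, where [|u|] increases, and at points close to 1, by an energy estimate for [z]. It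
    has derivative [(Im lambda) w |u|^2] up to sign, hence eigenvalues are real. For [lambda > 0]
    the energy [z'^2 + lambda z^2] stays away from 0 near 1. For [lambda = 0] one compares with the
    zero energy mode [t sqrt(1 - t^2) f'], whose [z] is [t^2 f'] and does not decay.

    Surjectivity off the half line. Dirichlet solutions on intervals exhausting (0, 1) are bounded in
    [L^2] near both end points, and a limit exists because there is no square integrable solution of
    the homogeneous equation.

    The half line. For [lambda >= 0] no solution is square integrable near 1. The regular solution at
    0, cut off to an interval, is therefore not in the range; and the range is dense because the Gram
    determinant of two solutions is unbounded near 1, which allows a cut-off right hand side to be
    corrected, at small cost in [L^2], to one for which the solution vanishes near 1.

    Negative eigenvalues. They are those [lambda] for which the regular solution at 0 is square
    integrable near 1. Its Prüfer angle increases with [lambda], and the eigenvalues are exactly the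
    thresholds above which the angle exceeds [j pi] before 1, one for each [j] reached at
    [lambda = 0]. At zero energy the regular solution is the zero mode, with [n] zeros. *)

Require Import Defs.
From HB Require Import structures.
From mathcomp Require Import all_boot all_order all_algebra.
From mathcomp Require Import all_classical all_reals all_analysis.
From mathcomp Require Import complex measurable_realfun ring lra.
Set Implicit Arguments.
Unset Strict Implicit.
Unset Printing Implicit Defensive.
Import Order.TTheory GRing.Theory Num.Theory.
Import numFieldNormedType.Exports.
Local Open Scope classical_set_scope.
Local Open Scope ring_scope.

(* [lra] is slow in a large context. *)
Ltac order_lra :=
  repeat match goal with
  | H : is_true (_ <= _)%R |- _ => revert H
  | H : is_true (_ < _)%R |- _ => revert H
  | H : @eq _ _ _ |- _ => revert H
  end; clear; lra.

(** The domain asks only for local absolute continuity, so the equation holds almost everywhere, and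
    [derive1] in [A_graph] has a meaning only once such functions are known to be differentiable
    almost everywhere. This is what the covering arguments at the start are for; afterwards
    membership in the graph is equivalent to a first order system for [u] and [p = t^2 u']. Both end
    points are singular. No asymptotic expansion of a solution is used there: each statement about
    an end point is an inequality for a quadratic quantity ([u p], [z q], a Wronskian or an energy),
    integrated from an interior point and set against a bound for the integral of [weight * u^2].
    The Prüfer angle cannot start at 0. It starts at an interior point [rho] such that [Qc f 0 >= 1]
    on (0, [rho]]. Since [Qc] decreases in [lambda], one [rho] serves all [lambda <= 0]: the regular
    solutions are positive up to [rho], and their slopes there are strictly monotone and Lipschitz
    in [lambda], which gives the angle its initial value. *)

Section Derivatives.
Variable R : realType.
Implicit Types (f g : R -> R) (x a b : R).

(** The value of the derivative is an explicit argument: differentiation rules compose as terms, and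
    [dv_eq] rewrites the resulting value once, at the end. *)
Definition dv f x a := is_derive x (1 : R) f a.

Lemma dv_eq f x a b : dv f x a -> a = b -> dv f x b.
Proof. by move=> h <-. Qed.

Lemma dv_cst c x : dv (fun=> c) x 0.
Proof. exact: is_derive_cst. Qed.

Lemma dv_id x : dv id x 1.
Proof. exact: is_derive_id. Qed.

Lemma dvD f g x a b : dv f x a -> dv g x b -> dv (fun t => f t + g t) x (a + b).
Proof. by move=> h1 h2; exact: is_deriveD. Qed.

Lemma dvN f x a : dv f x a -> dv (fun t => - f t) x (- a).
Proof. by move=> h1; exact: is_deriveN. Qed.

Lemma dvB f g x a b : dv f x a -> dv g x b -> dv (fun t => f t - g t) x (a - b).
Proof. by move=> h1 h2; exact: is_deriveB. Qed.

Lemma dvM f g x a b : dv f x a -> dv g x b ->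
  dv (fun t => f t * g t) x (a * g x + f x * b).
Proof.
move=> h1 h2; apply: (@dv_eq _ _ (f x *: b + g x *: a)); first exact: is_deriveM.
by rewrite addrC /GRing.scale /= (mulrC a).
Qed.

Lemma dvZ c f x a : dv f x a -> dv (fun t => c * f t) x (c * a).
Proof.
by move=> h; apply: dv_eq (dvM (dv_cst c x) h) _; rewrite mul0r add0r.
Qed.

Lemma dvX f n x a : dv f x a -> dv (fun t => f t ^+ n) x (n%:R * f x ^+ n.-1 * a).
Proof.
move=> h; elim: n => [|n IH]; first by rewrite !mul0r; exact: dv_cst.
apply: (@dv_eq _ _ (a * f x ^+ n + f x * (n%:R * f x ^+ n.-1 * a))).
  have -> : (fun t => f t ^+ n.+1) = (fun t => f t * f t ^+ n).
    by apply/funext => t; rewrite exprS.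
  exact: dvM.
case: n {IH} => [|n] /=; first by rewrite !expr0; ring.
by rewrite [in RHS]exprS [in LHS]exprS -[n.+2%:R]natr1; ring.
Qed.

Lemma dv_comp f g x a b : dv f (g x) a -> dv g x b -> dv (fun t => f (g t)) x (a * b).
Proof. by move=> h1 h2; exact: is_derive1_comp. Qed.

Lemma dvP f x a : dv f x a <-> derivable f x 1 /\ derive1 f x = a.
Proof.
split; first by move=> [h1 h2]; split => //; rewrite derive1E.
by move=> [h1 h2]; rewrite -h2 derive1E; exact: DeriveDef.
Qed.

Lemma dv_cont f x a : dv f x a -> {for x, continuous f}.
Proof. by move=> [h _]; apply/differentiable_continuous/derivable1_diffP. Qed.

Lemma dv_uniq f x a b : dv f x a -> dv f x b -> a = b.
Proof. by move=> /dvP[_ <-] /dvP[_ <-]. Qed.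

Lemma dvV f x a : f x != 0 -> dv f x a -> dv (fun t => (f t)^-1) x (- a / f x ^+ 2).
Proof.
move=> h0 h; apply: (@dv_eq _ _ (- (f x) ^- 2 *: a)); first exact: is_deriveV.
by rewrite /GRing.scale /=; ring.
Qed.

Lemma dv_exp x : dv expR x (expR x).
Proof. exact: is_derive_expR. Qed.

Lemma dv_ln x : 0 < x -> dv (@ln R) x x^-1.
Proof. exact: is_derive1_ln. Qed.

Lemma dv_sin x : dv sin x (cos x).
Proof. exact: is_derive_sin. Qed.

Lemma dv_cos x : dv cos x (- sin x).
Proof. exact: is_derive_cos. Qed.

Lemma dv_epsP f x a : dv f x a <->
  forall e, 0 < e -> exists2 d, 0 < d & forall y, `|y - x| < d ->
    `|f y - f x - a * (y - x)| <= e * `|y - x|.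
Proof.
split.
- move=> h e e0.
  have : (fun h : R => h^-1 *: (f (h *: (1:R) + x) - f x)) @ 0^' --> a.
    by have [h1 h2] := h; rewrite -h2; exact: h1.
  move/cvgrPdist_le => /(_ e e0); rewrite near_withinE => -[d /= d0 hd].
  exists d => // y yd.
  have [->|yx] := eqVneq y x; first by rewrite !subrr mulr0 subrr normr0 mulr0.
  have yx0 : y - x != 0 by rewrite subr_eq0.
  have := hd (y - x); rewrite /= sub0r normrN => /(_ yd yx0).
  rewrite /GRing.scale /= mulr1 subrK distrC => h3.
  have -> : f y - f x - a * (y - x) = ((y - x)^-1 * (f y - f x) - a) * (y - x).
    by field.
  by rewrite normrM ler_wpM2r.
- move=> h.
  have H : (fun h : R => h^-1 *: (f (h *: (1:R) + x) - f x)) @ 0^' --> a.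
    apply/cvgrPdist_le => e e0; rewrite near_withinE.
    have [d d0 hd] := h e e0.
    exists d => //= t; rewrite /= sub0r normrN => td t0.
    have := hd (t + x); rewrite addrK => /(_ td) h3.
    rewrite /GRing.scale /= mulr1 distrC.
    have -> : t^-1 * (f (t + x) - f x) - a = (f (t + x) - f x - a * t) / t by field.
    by rewrite normrM normfV ler_pdivrMr// normr_gt0.
  apply: DeriveDef; last by apply/cvg_lim.
  by apply/cvg_ex; exists a.
Qed.

Lemma dv_local f g x a l r : l < x < r -> (forall y, l < y < r -> f y = g y) ->
  dv f x a -> dv g x a.
Proof.
move=> /andP[lx xr] fg /dv_epsP h; apply/dv_epsP => e e0.
have [d d0 hd] := h e e0.
exists (Num.min d (Num.min (x - l) (r - x))).
  by rewrite !lt_min d0 !subr_gt0 lx xr.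
move=> y; rewrite !lt_min => /and3P[yd yl yr].
rewrite -!fg; first exact: hd.
  by apply/andP; split.
move: yl yr; rewrite ltr_norml => /andP[? _]; rewrite ltr_norml => /andP[_ ?]; order_lra.
Qed.

Lemma contP f x : {for x, continuous f} <->
  forall e, 0 < e -> exists2 d, 0 < d & forall y, `|y - x| < d -> `|f y - f x| < e.
Proof.
split.
- move=> /cvgrPdist_lt h e e0; have [d /= d0 hd] := h e e0.
  by exists d => // y yd; rewrite distrC; apply: hd; rewrite /= distrC.
- move=> h; apply/cvgrPdist_lt => e e0; have [d d0 hd] := h e e0.
  by exists d => //= y /= yd; rewrite distrC; apply: hd; rewrite distrC.
Qed.

Lemma dv_within f df a b : (forall x, a <= x <= b -> dv f x (df x)) ->
  {within `[a, b], continuous f}.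
Proof.
move=> h; apply: continuous_in_subspaceT => x; rewrite inE /= in_itv /= => hx.
exact: dv_cont (h _ hx).
Qed.

Lemma cont_within f a b : (forall x, a <= x <= b -> {for x, continuous f}) ->
  {within `[a, b], continuous f}.
Proof.
by move=> h; apply: continuous_in_subspaceT => x; rewrite inE /= in_itv /=; exact: h.
Qed.

Lemma dv_mvt f df a b : a < b -> (forall x, a <= x <= b -> dv f x (df x)) ->
  exists2 c, a < c < b & f b - f a = df c * (b - a).
Proof.
move=> ab h; have [||c] := @MVT R f df a b ab; last by rewrite in_itv /=; exists c.
  by move=> x; rewrite in_itv /= => /andP[/ltW ? /ltW ?]; apply: h; apply/andP.
exact: dv_within h.
Qed.

Lemma dv_mono f df a b : a <= b -> (forall x, a <= x <= b -> dv f x (df x)) ->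
  (forall x, a < x < b -> 0 <= df x) -> f a <= f b.
Proof.
rewrite le_eqVlt => /predU1P[->//|ab] h h0.
have [c cab e] := dv_mvt ab h.
by rewrite -subr_ge0 e mulr_ge0 ?h0// subr_ge0 ltW.
Qed.

Lemma dv_smono f df a b : a < b -> (forall x, a <= x <= b -> dv f x (df x)) ->
  (forall x, a < x < b -> 0 < df x) -> f a < f b.
Proof.
move=> ab h h0; have [c cab e] := dv_mvt ab h.
by rewrite -subr_gt0 e mulr_gt0 ?h0// subr_gt0.
Qed.

Lemma dv_le f df g dg a b : a <= b -> (forall x, a <= x <= b -> dv f x (df x)) ->
  (forall x, a <= x <= b -> dv g x (dg x)) ->
  (forall x, a < x < b -> df x <= dg x) -> f b - f a <= g b - g a.
Proof.
move=> ab h1 h2 h; have := @dv_mono (fun x => g x - f x) (fun x => dg x - df x) a b ab.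
move=> H; have {H} : g a - f a <= g b - f b; last by order_lra.
apply: H => x xab; first by apply: dvB; [exact: h2|exact: h1].
by rewrite subr_ge0; exact: h.
Qed.

Lemma dv_const f a b : a <= b -> (forall x, a <= x <= b -> dv f x 0) -> f a = f b.
Proof.
move=> ab h; apply/eqP; rewrite eq_le; apply/andP; split.
  by apply: (dv_mono ab h).
have : - f a <= - f b; last by order_lra.
apply: (@dv_mono (fun x => - f x) (fun=> 0) _ _ ab) => // x xab.
by apply: dv_eq (dvN (h x xab)) _; rewrite oppr0.
Qed.

Lemma ivt0 f a b : a <= b -> (forall x, a <= x <= b -> {for x, continuous f}) ->
  f a * f b <= 0 -> exists2 c, a <= c <= b & f c = 0.
Proof.
move=> ab cf ff; have [] := @IVT R f a b 0 ab (cont_within cf).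
  by rewrite [_ <= 0]leNgt [0 <= _]leNgt lt_min gt_max; apply/andP; split;
    apply/negP => /andP[? ?]; nra.
by move=> c; rewrite in_itv /= => ? ?; exists c.
Qed.

(** The point is the infimum of the set where [f <= 0]. Continuity excludes a positive value there
    and, since [f] is positive before it, also a negative one. *)
Lemma first_zero f a b : a <= b -> (forall x, a <= x <= b -> {for x, continuous f}) ->
  0 < f a -> f b <= 0 -> exists c, [/\ a < c <= b, f c = 0 & forall x, a <= x < c -> 0 < f x].
Proof.
move=> ab cf fa fb.
pose A := [set x | a <= x <= b /\ f x <= 0].
have Ab : A b by split => //; rewrite ab lexx.
have hA : has_inf A by split; [exists b|exists a => x [/andP[]]].
pose c := inf A.
have ac : a <= c by apply: lb_le_inf; [exists b|move=> x [/andP[]]].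
have cb : c <= b by exact: ge_inf hA.2 _ Ab.
have pos x : a <= x < c -> 0 < f x.
  move=> /andP[ax xc]; rewrite ltNge; apply/negP => fx.
  have : c <= x; last by rewrite leNgt xc.
  by apply: (ge_inf hA.2); split => //; rewrite ax (le_trans (ltW xc)).
have cc : {for c, continuous f} by apply: cf; rewrite ac cb.
have fc0 : f c <= 0.
  rewrite leNgt; apply/negP => fc.
  have [d d0 hd] := (contP f c).1 cc _ fc.
  have [x Ax xd] := @inf_adherent _ _ _ d0 hA.
  have cx : c <= x by exact: ge_inf hA.2 _ Ax.
  case: Ax => _ fx0.
  have := hd x; rewrite ger0_norm ?subr_ge0// ltrBlDr addrC => /(_ xd).
  by rewrite ltr_norml => /andP[? _]; order_lra.
have aneqc : a != c by apply: contraTneq fa => ->; rewrite -leNgt.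
have ac' : a < c by rewrite lt_neqAle aneqc.
exists c; split => //; first by rewrite ac'.
apply/eqP; rewrite eq_le fc0 /= leNgt; apply/negP => fcn.
have nfc : 0 < - f c by rewrite oppr_gt0.
have [d d0 hd] := (contP f c).1 cc _ nfc.
pose x := Num.max a (c - d / 2).
have xc : x < c by rewrite gt_max ac' /=; order_lra.
have ax : a <= x by rewrite le_max lexx.
have xd : c - d / 2 <= x by rewrite le_max lexx orbT.
have fx := pos x; rewrite ax xc in fx; have {}fx := fx isT.
have := hd x; rewrite ltr0_norm ?subr_lt0// => H.
have {}H : `|f x - f c| < - f c by apply: H; order_lra.
by move: H; rewrite ltr_norml => /andP[_ ?]; order_lra.
Qed.

End Derivatives.

(** * Absolutely continuous functions *)
Section AbsCont.
Variable R : realType.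
Implicit Types (f g : R -> R) (x a b : R).
Local Notation mu := (@lebesgue_measure R).
Local Notation lo := ((wlength idfun)^*)%mu.

Lemma ae_imp (P Q : R -> Prop) : {ae mu, forall x, P x} ->
  (forall x, P x -> Q x) -> {ae mu, forall x, Q x}.
Proof. by move=> h1 h; apply: negligibleS h1 => x /= nQ Px; apply: nQ; exact: h. Qed.

Lemma ae_imp2 (P Q S : R -> Prop) : {ae mu, forall x, P x} -> {ae mu, forall x, Q x} ->
  (forall x, P x -> Q x -> S x) -> {ae mu, forall x, S x}.
Proof.
move=> h1 h2 h; apply: negligibleS (negligibleU h1 h2) => x /= nS.
by have [Px|] := pselect (P x); [right => Qx; apply: nS; exact: h|left].
Qed.

Definition nonoverlap (p q : R * R) : bool := (p.2 <= q.1) || (q.2 <= p.1).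

Definition cell a b (p : R * R) : bool := (a <= p.1) && (p.1 <= p.2) && (p.2 <= b).

Lemma cell_ge0 a b (s : seq (R * R)) : all (cell a b) s -> 0 <= \sum_(p <- s) (p.2 - p.1).
Proof.
move=> /allP h; rewrite big_seq sumr_ge0// => p /h /andP[/andP[_ ?] _].
by rewrite subr_ge0.
Qed.

(* A Cousin covering argument: [N] is covered by an open set of small measure, on which absolute
   continuity controls the increments of [f]; elsewhere the local slopes are almost nonnegative. *)
Lemma abs_cont_mono f a b (N : set R) : a <= b -> abs_cont_on f a b ->
  mu.-negligible N ->
  (forall x, a <= x <= b -> ~ N x -> forall e, 0 < e -> exists2 d, 0 < d &
     forall y z, x - d < y -> y <= x -> x <= z -> z < x + d -> - e * (z - y) <= f z - f y) ->
  f a <= f b.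
Proof.
move=> ab AC N0 loc; apply/ler_addgt0Pr => e0 e0p.
(* The loss is at most [e] per unit of length away from the exceptional intervals, and at most one
   further [e] on them; the summand 1 pays for the latter. *)
pose e := e0 / (b - a + 1).
have ba1 : 0 < b - a + 1 by rewrite ltr_wpDl// subr_ge0.
have ep : 0 < e by rewrite divr_gt0.
have [dl dlp hAC] := AC e ep.
have [U [oU NU mU]] := outer_measure_open_le N (divr_gt0 dlp (@ltr0Sn R 1)).
move/negligible_outer_measure : (N0) => N00.
have {}mU : (mu U <= (dl / 2)%:E)%E by rewrite (le_trans mU)// N00 add0e.
(* Invariant of the covering argument: up to [x], the increment of [f] is bounded below by the slope
   loss plus the increments over a family of nonoverlapping intervals, whose total length is
   controlled by the measure of [U] below [x]. *)
pose inv x (s : seq (R * R)) := [/\ all (cell a x) s, pairwise nonoverlap s,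
  ((\sum_(p <- s) (p.2 - p.1))%:E <= mu (U `&` `]-oo, x]))%E &
  - e * (x - a) + \sum_(p <- s) (f p.2 - f p.1) <= f x - f a].
pose P x := exists s, inv x s.
have Pa : P a.
  exists [::]; split => //; rewrite big_nil ?measure_ge0// subrr mulr0.
  by rewrite addr0 subrr.
(* The invariant passes across every point: at a point of [N] the interval [[y], [z]] lies in [U]
   and joins the family, elsewhere the slope condition applies. *)
have step x : a <= x <= b -> exists2 d, 0 < d & forall y z, a <= y ->
    x - d < y -> y <= x -> x <= z -> z < x + d -> P y -> P z.
  move=> xab; have [Nx|Nx] := pselect (N x).
    have [d /= d0 dU] := oU _ (NU _ Nx).
    exists d => // y z ay yx1 yx xz zx [s [s1 s2 s3 s4]].
    have yz : y <= z by exact: le_trans xz.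
    exists ((y, z) :: s); split => /=.
    - rewrite {1}/cell /= ay yz lexx /=; apply/allP => p ps.
      move/allP : s1 => /(_ p ps) /andP[h1 h2]; rewrite /cell h1 /=.
      exact: le_trans yz.
    - rewrite s2 andbT; apply/allP => p ps.
      move/allP : s1 => /(_ p ps) /andP[h1 h2].
      by rewrite /nonoverlap /= h2 orbT.
    - rewrite big_cons /= addrC EFinD.
      have -> : U `&` `]-oo, z] = (U `&` `]-oo, y]) `|` `]y, z].
        apply/seteqP; split => t /=; rewrite !in_itv /=.
          by move=> [Ut tz]; have [ty|ty] := leP t y; [left|right].
        move=> [[Ut ty]|/andP[yt tz]]; split => //; first exact: le_trans yz.
        apply: dU; rewrite /= ltr_norml; apply/andP; split; order_lra.
      rewrite measureU//; last 2 first.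
      + by apply: measurableI => //; exact: measurable_realfun.open_measurable.
      + apply/seteqP; split => t //=; rewrite !in_itv /=.
        by move=> [[_ h1] /andP[h2 _]]; move: (lt_le_trans h2 h1); rewrite ltxx.
      rewrite leeD//; suff : ((z - y)%:E <= lebesgue_measure `]y, z]%classic)%E by [].
      rewrite lebesgue_measure_itv /= lte_fin; case: ltP => // zy.
      by rewrite lee_fin subr_le0.
    - rewrite big_cons /=.
      have : - e * (z - a) <= - e * (y - a) by rewrite !mulNr lerN2 ler_pM2l// lerD2r.
      order_lra.
  have [d d0 hd] := loc x xab Nx e ep.
  exists d => // y z ay yx1 yx xz zx [s [s1 s2 s3 s4]].
  have yz : y <= z by exact: le_trans xz.
  exists s; split => //.
  - apply/allP => p ps; move/allP : s1 => /(_ p ps) /andP[h1 h2]; rewrite /cell h1 /=.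
    exact: le_trans yz.
  - apply: (le_trans s3); rewrite le_measure// ?inE.
    + by apply: measurableI => //; exact: measurable_realfun.open_measurable.
    + by apply: measurableI => //; exact: measurable_realfun.open_measurable.
    + by apply: setIS => t /=; rewrite !in_itv /= => /le_trans; apply.
  - have := hd y z yx1 yx xz zx; nra.
(* The supremum of the points that satisfy the invariant is reached, and passed unless it is [b], by
   [step] at the supremum itself. *)
have Pb : P b.
  pose A := [set x | a <= x <= b /\ P x].
  have Aa : A a by split => //; rewrite lexx ab.
  have hA : has_sup A by split; [exists a|exists b => x [/andP[]]].
  pose c := sup A.
  have ac : a <= c by exact: ub_le_sup hA.2 _ Aa.
  have cb : c <= b by apply: ge_sup; [exists a|move=> x [/andP[]]].
  have [d d0 hd] := step c (introT andP (conj ac cb)).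
  have [y [/andP[ay yb] Py] yc] := sup_adherent d0 hA.
  have yc' : y <= c by apply: (ub_le_sup hA.2); split => //; rewrite ay yb.
  have [cb'|bc] := ltP c b; last first.
    have -> : b = c by apply/le_anti; rewrite bc cb.
    by apply: (hd y c) => //; order_lra.
  pose z := Num.min (c + d / 2) b.
  have zP : P z.
    apply: (hd y z) => //; first by rewrite le_min cb andbT; order_lra.
    by rewrite gt_min; apply/orP; left; order_lra.
  have : z <= c.
    apply: (ub_le_sup hA.2); split => //.
    by rewrite ge_min lexx orbT andbT le_min ab andbT; order_lra.
  by rewrite ge_min => /orP[|]; order_lra.
have [s [s1 s2 s3 s4]] := Pb.
have slt : \sum_(p <- s) (p.2 - p.1) < dl.
  have : (((\sum_(p <- s) (p.2 - p.1))%:E) <= (dl / 2)%:E)%E.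
    apply: (le_trans s3); apply: le_trans mU; rewrite le_measure// ?inE.
    + by apply: measurableI => //; exact: measurable_realfun.open_measurable.
    + exact: measurable_realfun.open_measurable.
  by rewrite lee_fin; order_lra.
have := hAC s s1 s2 slt => hs.
have : `|\sum_(p <- s) (f p.2 - f p.1)| < e.
  by apply: le_lt_trans hs; exact: ler_norm_sum.
rewrite ltr_norml => /andP[h1 h2].
have : e * (b - a + 1) = e0 by rewrite /e mulfVK// gt_eqF.
move: s4; rewrite mulNr; nra.
Qed.

(** [f] is an indefinite Lebesgue integral of [df]. This takes the place of [dv] when the right hand
    side of the equation is only square integrable. *)
Definition acd f df := AC_loc01 f /\ {ae mu, forall x, I01 x -> dv f x (df x)}.

Lemma I01P x : I01 x <-> 0 < x < 1.
Proof. by rewrite /I01 /= in_itv. Qed.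

Lemma acd_mono f df a b : 0 < a -> a <= b -> b < 1 -> acd f df ->
  {ae mu, forall x, a <= x <= b -> 0 <= df x} -> f a <= f b.
Proof.
move=> a0 ab b1 [h1 h2] h3.
have [N N0 hN] : exists2 N : set R, mu.-negligible N &
    forall x, ~ N x -> a <= x <= b -> dv f x (df x) /\ 0 <= df x.
  have : {ae mu, forall x, (I01 x -> dv f x (df x)) /\ (a <= x <= b -> 0 <= df x)}.
    by apply: (ae_imp2 h2 h3) => x *; split.
  move=> h; exists (~` [set x | (I01 x -> dv f x (df x)) /\ (a <= x <= b -> 0 <= df x)]) => //.
  move=> x /contrapT [H1 H2] xab; split; last exact: H2.
  by apply: H1; apply/I01P; move: xab => /andP[? ?]; apply/andP; split; order_lra.
apply: (@abs_cont_mono f a b N ab (h1 a b a0 b1) N0) => x xab Nx e e0.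
have [/dv_epsP hd h0] := hN x Nx xab.
have [d d0 {}hd] := hd e e0.
exists d => // y z h3' h4 h5 h6.
have hz : `|z - x| < d by rewrite ger0_norm ?subr_ge0//; order_lra.
have hy : `|y - x| < d by rewrite ler0_norm ?subr_le0//; order_lra.
have := hd z hz; have := hd y hy.
rewrite (ger0_norm (_ : 0 <= z - x)) ?subr_ge0// (ler0_norm (_ : y - x <= 0)) ?subr_le0//.
rewrite !ler_norml => /andP[? ?] /andP[? ?].
have : 0 <= df x * (z - y) by rewrite mulr_ge0// subr_ge0 (le_trans h4).
order_lra.
Qed.

Lemma acd_congr f df dg : acd f df -> {ae mu, forall x, I01 x -> df x = dg x} -> acd f dg.
Proof.
by move=> [h1 h2] h3; split => //; apply: (ae_imp2 h2 h3) => x H1 H2 Ix; rewrite -H2//; exact: H1.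
Qed.

Lemma AC_loc01D f g : AC_loc01 f -> AC_loc01 g -> AC_loc01 (fun x => f x + g x).
Proof.
move=> hf hg a b a0 b1 e e0.
have e2 : 0 < e / 2 by order_lra.
have [d1 d10 h1] := hf a b a0 b1 _ e2.
have [d2 d20 h2] := hg a b a0 b1 _ e2.
exists (Num.min d1 d2); first by rewrite lt_min d10.
move=> s s1 s2; rewrite lt_min => /andP[s3 s4].
rewrite (splitr e); apply: le_lt_trans (ltrD (h1 s s1 s2 s3) (h2 s s1 s2 s4)).
rewrite -big_split /=; apply: ler_sum => p _.
have -> : f p.2 + g p.2 - (f p.1 + g p.1) = (f p.2 - f p.1) + (g p.2 - g p.1) by ring.
exact: ler_normD.
Qed.

Lemma AC_loc01_cont f x : AC_loc01 f -> 0 < x < 1 -> {for x, continuous f}.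
Proof.
move=> hf /andP[x0 x1]; apply/contP => e e0.
have [d d0 h] := hf (x / 2) ((x + 1) / 2) ltac:(lra) ltac:(lra) e e0.
exists (Num.min d (Num.min (x / 2) ((1 - x) / 2))).
  by rewrite !lt_min d0 /=; apply/andP; split; order_lra.
move=> y; rewrite !lt_min => /and3P[yd y1 y2].
have [xy|yx] := leP x y.
  move: yd y1 y2; rewrite (ger0_norm (_ : 0 <= y - x)) ?subr_ge0// => yd y1 y2.
  have := h [:: (x, y)]; rewrite !big_seq1 /= => -> //.
  by rewrite andbT xy andbT; apply/andP; split; order_lra.
move: yd y1 y2; rewrite (ltr0_norm (_ : y - x < 0)) ?subr_lt0// !opprB => yd y1 y2.
have := h [:: (y, x)]; rewrite !big_seq1 /= distrC => -> //.
by rewrite andbT (ltW yx) andbT; apply/andP; split; order_lra.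
Qed.

Lemma cont_bounded f a b : (forall x, a <= x <= b -> {for x, continuous f}) ->
  exists2 M, 0 < M & forall x, a <= x <= b -> `|f x| <= M.
Proof.
move=> cf; have [ab|ba] := leP a b; last first.
  by exists 1 => // x /andP[h1 h2]; move: (le_trans h1 h2); rewrite leNgt ba.
have [c1 _ h1] := EVT_max ab (cont_within cf).
have [c2 _ h2] := EVT_min ab (cont_within cf).
exists (`|f c1| + `|f c2| + 1) => [|x xab]; first by rewrite ltr_wpDl// addr_ge0.
have := h1 x; have := h2 x; rewrite in_itv /= xab => /(_ isT) ? /(_ isT) ?.
have := ler_norm (f c1); have := ler_norm (- f c2); rewrite normrN => ? ?.
by rewrite ler_norml; apply/andP; split; have := normr_ge0 (f c1);
  have := normr_ge0 (f c2); order_lra.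
Qed.

Lemma AC_loc01M f g : AC_loc01 f -> AC_loc01 g -> AC_loc01 (fun x => f x * g x).
Proof.
move=> hf hg a b a0 b1 e e0.
have itv x : a <= x <= b -> 0 < x < 1 by move=> /andP[? ?]; apply/andP; split; order_lra.
have [M1 M10 B1] := @cont_bounded f a b (fun x h => AC_loc01_cont hf (itv x h)).
have [M2 M20 B2] := @cont_bounded g a b (fun x h => AC_loc01_cont hg (itv x h)).
have e1 : 0 < e / (2 * M2) by rewrite divr_gt0// mulr_gt0.
have e2 : 0 < e / (2 * M1) by rewrite divr_gt0// mulr_gt0.
have [d1 d10 h1] := hf a b a0 b1 _ e1.
have [d2 d20 h2] := hg a b a0 b1 _ e2.
exists (Num.min d1 d2); first by rewrite lt_min d10.
move=> s s1 s2; rewrite lt_min => /andP[s3 s4].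
have H1 := h1 s s1 s2 s3; have H2 := h2 s s1 s2 s4.
have -> : e = M2 * (e / (2 * M2)) + M1 * (e / (2 * M1)) by field; rewrite !gt_eqF.
have : M2 * (\sum_(p <- s) `|f p.2 - f p.1|) + M1 * (\sum_(p <- s) `|g p.2 - g p.1|) <
  M2 * (e / (2 * M2)) + M1 * (e / (2 * M1)) by rewrite ltrD// ltr_pM2l.
apply: le_lt_trans; rewrite !mulr_sumr -big_split /= !big_seq; apply: ler_sum => p ps.
move/allP : s1 => /(_ p ps) /andP[/andP[p1 p2] p3].
have -> : f p.2 * g p.2 - f p.1 * g p.1 = g p.2 * (f p.2 - f p.1) + f p.1 * (g p.2 - g p.1) by ring.
apply: (le_trans (ler_normD _ _)); rewrite !normrM lerD//.
  by rewrite ler_wpM2r// B2// p3 (le_trans p1).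
by rewrite ler_wpM2r// B1// p1 (le_trans p2).
Qed.

Lemma C1_AC_loc01 f df : (forall x, 0 < x < 1 -> dv f x (df x)) ->
  (forall x, 0 < x < 1 -> {for x, continuous df}) -> AC_loc01 f.
Proof.
move=> hf cf a b a0 b1 e e0.
have itv x : a <= x <= b -> 0 < x < 1 by move=> /andP[? ?]; apply/andP; split; order_lra.
have [M M0 B] := @cont_bounded df a b (fun x h => cf x (itv x h)).
exists (e / M); first by rewrite divr_gt0.
move=> s s1 s2; rewrite ltr_pdivlMr// => s3.
apply: le_lt_trans s3; rewrite mulr_suml !big_seq; apply: ler_sum => p ps.
move/allP : s1 => /(_ p ps) /andP[/andP[p1 p2] p3].
move: p2; rewrite le_eqVlt => /predU1P[->|p2]; first by rewrite !subrr normr0 mul0r.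
have [|c /andP[c1 c2] ->] := @dv_mvt _ f df p.1 p.2 p2.
  by move=> x /andP[x1 x2]; apply: hf; apply: itv; rewrite (le_trans p1)// (le_trans x2).
rewrite normrM (gtr0_norm (_ : 0 < p.2 - p.1)) ?subr_gt0// mulrC ler_pM2l ?subr_gt0//.
by apply: B; rewrite (le_trans p1 (ltW c1)) (le_trans (ltW c2)).
Qed.

Lemma acd_C1 f df : (forall x, 0 < x < 1 -> dv f x (df x)) ->
  (forall x, 0 < x < 1 -> {for x, continuous df}) -> acd f df.
Proof.
move=> hf cf; split; first exact: C1_AC_loc01 hf cf.
by apply: aeW => x /I01P; exact: hf.
Qed.

Lemma acdD f df g dg : acd f df -> acd g dg ->
  acd (fun x => f x + g x) (fun x => df x + dg x).
Proof.
move=> [h1 h2] [h3 h4]; split; first exact: AC_loc01D.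
by apply: (ae_imp2 h2 h4) => x H1 H2 Ix; apply: dvD; [exact: H1|exact: H2].
Qed.

Lemma acdM f df g dg : acd f df -> acd g dg ->
  acd (fun x => f x * g x) (fun x => df x * g x + f x * dg x).
Proof.
move=> [h1 h2] [h3 h4]; split; first exact: AC_loc01M.
by apply: (ae_imp2 h2 h4) => x H1 H2 Ix; apply: dvM; [exact: H1|exact: H2].
Qed.

Lemma acd_cst c : acd (fun=> c) (fun=> 0).
Proof.
by apply: acd_C1 => x _; [exact: dv_cst|exact: cvg_cst].
Qed.

Lemma acdZ c f df : acd f df -> acd (fun x => c * f x) (fun x => c * df x).
Proof.
move=> h; apply: acd_congr (acdM (acd_cst c) h) _.
by apply: aeW => x _; rewrite mul0r add0r.
Qed.

Lemma acdN f df : acd f df -> acd (fun x => - f x) (fun x => - df x).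
Proof.
move=> h; have [h1 h2] := acdZ (-1) h.
have -> : (fun x => - f x) = (fun x => -1 * f x) by apply/funext => x; rewrite mulN1r.
have -> : (fun x => - df x) = (fun x => -1 * df x) by apply/funext => x; rewrite mulN1r.
by split.
Qed.

Lemma acdB f df g dg : acd f df -> acd g dg ->
  acd (fun x => f x - g x) (fun x => df x - dg x).
Proof. by move=> h1 h2; exact: acdD h1 (acdN h2). Qed.

Lemma acd_le f df g dg a b : 0 < a -> a <= b -> b < 1 -> acd f df -> acd g dg ->
  {ae mu, forall x, a <= x <= b -> df x <= dg x} -> f b - f a <= g b - g a.
Proof.
move=> a0 ab b1 h1 h2 h3.
have : g a - f a <= g b - f b; last by order_lra.
apply: (acd_mono a0 ab b1 (acdB h2 h1)).
by apply: (ae_imp h3) => x H xab; rewrite subr_ge0; exact: H.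
Qed.

Lemma acd_const f a b : 0 < a -> a <= b -> b < 1 -> acd f (fun=> 0) -> f a = f b.
Proof.
move=> a0 ab b1 h.
have h0 : acd (fun=> 0) (fun=> (0:R)) by exact: acd_cst.
have H1 := acd_le a0 ab b1 h h0 ltac:(exact: aeW).
have H2 := acd_le a0 ab b1 h0 h ltac:(exact: aeW).
order_lra.
Qed.

End AbsCont.

(** * Vitali coverings by intervals of prescribed slope *)

Section AEDerivable.
Variable R : realType.
Implicit Types (f : R -> R) (x a b c : R) (p q : R * R) (s : seq (R * R)).
Local Notation mu := (@lebesgue_measure R).
Local Notation lo := ((wlength idfun)^*)%mu.

(** A lower derivate condition at [x], over intervals that contain [x] in their interior, so that
    their end points can be moved slightly. Upper derivates are handled as lower derivates of
    [- f]. *)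
Definition slope_lt f c x := forall d, 0 < d -> exists p,
  [/\ p.1 < x < p.2, p.2 - p.1 < d & f p.2 - f p.1 < c * (p.2 - p.1)].

Definition cells s : set R := [set x | exists2 p, p \in s & p.1 <= x <= p.2].

(** Allows the end points of an interval of small slope to be replaced by rational ones, which makes
    the covering family countable. *)
Lemma slope_lt_open f c a b : {for a, continuous f} -> {for b, continuous f} ->
  f b - f a < c * (b - a) -> exists2 m, 0 < m & forall x y, `|x - a| < m -> `|y - b| < m ->
  f y - f x < c * (y - x).
Proof.
move=> ca cb fab; pose g := fun x y => c * (y - x) - (f y - f x).
have g3 : 0 < (c * (b - a) - (f b - f a)) / 6 by rewrite divr_gt0// subr_gt0.
have ch x : {for x, continuous f} -> {for x, continuous (fun y => c * y - f y)}.
  by move=> cfx; apply: cvgB => //; apply: cvgM; [exact: cvg_cst|exact: cvg_id].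
have [e1 e10 h1] := (contP _ _).1 (ch _ ca) _ g3.
have [e2 e20 h2] := (contP _ _).1 (ch _ cb) _ g3.
exists (Num.min e1 e2) => [|x y]; first by rewrite lt_min e10.
rewrite !lt_min => /andP[/h1 + _] /andP[_ /h2]; rewrite !ltr_norml => /andP[? ?] /andP[? ?].
order_lra.
Qed.

(** The intervals in [O] with rational centre and radius and with slope at most [c] form a Vitali
    cover of [E]; a finite disjoint subfamily then leaves out outer measure less than [eta]. *)
Lemma vitali_slopes f c (O E : set R) a b : open O -> O `<=` `]a, b[ ->
  (forall x, O x -> {for x, continuous f}) -> E `<=` O ->
  (forall x, E x -> slope_lt f c x) -> forall eta, 0 < eta -> exists s,
  [/\ pairwise (@nonoverlap R) s,
      forall p, p \in s -> [/\ p.1 < p.2, `[p.1, p.2] `<=` O &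
         f p.2 - f p.1 <= c * (p.2 - p.1)] &
      (lo (E `\` cells s) < eta%:E)%E].
Proof.
move=> oO Oab cf EO hE eta eta0.
(* The index [n] encodes a rational centre and radius. The default value and the replacement of
   nonpositive radii by 1 keep every ball nondegenerate; [F] selects the useful ones. *)
pose cr (n : nat) : rat * rat := odflt (0, 1) (unpickle n).
pose rr n : R := if 0 < (cr n).2 then ratr (cr n).2 else 1.
pose cc n : R := ratr (cr n).1.
have rr0 n : 0 < rr n by rewrite /rr; case: ifPn => // h; rewrite ltr0q.
pose B n := ball (cc n) (rr n).
have rB n : (radius (B n))%:num = rr n by rewrite radius_ball_num// ltW.
have B0 n : 0 < (radius (B n))%:num by rewrite rB.
have clB n : closure (B n) = `[cc n - rr n, cc n + rr n]%classic.
  by rewrite /B closure_ballE closed_ball_itv.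
pose F := [set n | closure (B n) `<=` O /\
  f (cc n + rr n) - f (cc n - rr n) <= c * (cc n + rr n - (cc n - rr n))].
have Efin : (mu E < +oo)%E.
  apply: (@le_lt_trans _ _ (mu `]a, b[%classic)).
    by apply: le_outer_measure; exact: subset_trans Oab.
  by rewrite lebesgue_measure_itv /=; case: ifP => _; rewrite -?EFinD ltry.
have VC : vitali_cover E B F.
  split=> [n|x Ex e e0]; first exact: is_ball_ball.
  have Ox := EO _ Ex.
  have [d1 /= d10 d1O] := oO _ Ox.
  have [|p [/andP[px1 px2] pd pf]] := hE x Ex (Num.min d1 e); first by rewrite lt_min d10.
  move: pd; rewrite lt_min => /andP[pd1 pd2].
  have Oin y : p.1 <= y <= p.2 -> O y.
    by move=> /andP[y1 y2]; apply: d1O; rewrite /= ltr_norml; apply/andP; split; order_lra.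
  have Op1 : O p.1 by apply: Oin; rewrite lexx /=; order_lra.
  have Op2 : O p.2 by apply: Oin; rewrite lexx andbT; order_lra.
  have [m m0 hm] := slope_lt_open (cf _ Op1) (cf _ Op2) pf.
  have [q1 q1P] := @rat_in_itvoo R p.1 (Num.min x (p.1 + m)) ltac:(by rewrite lt_min px1 ltrDl).
  have [q2 q2P] := @rat_in_itvoo R (Num.max x (p.2 - m)) p.2 ltac:(by rewrite gt_max px2 gtrBl).
  move: q1P; rewrite in_itv /= lt_min => /and3P[q11 q12 q13].
  move: q2P; rewrite in_itv /= gt_max => /andP[/andP[q21 q22] q23].
  have q12' : q1 < q2 by rewrite -(ltr_rat R) (lt_trans q12).
  exists (pickle ((q1 + q2) / 2, (q2 - q1) / 2)).
  set n := pickle _.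
  have crE : cr n = ((q1 + q2) / 2, (q2 - q1) / 2) by rewrite /cr pickleK.
  have r0 : 0 < (q2 - q1) / 2 by rewrite divr_gt0// subr_gt0.
  have rrE : rr n = (ratr q2 - ratr q1) / 2.
    by rewrite /rr crE r0 rmorphM rmorphB /= fmorphV rmorph_nat.
  have ccE : cc n = (ratr q1 + ratr q2) / 2.
    by rewrite /cc crE rmorphM rmorphD /= fmorphV rmorph_nat.
  have E1 : cc n - rr n = ratr q1 by rewrite rrE ccE; field.
  have E2 : cc n + rr n = ratr q2 by rewrite rrE ccE; field.
  move: q11 q12 q13 q21 q22 q23 E1 E2 rrE ccE.
  move: (ratr q1) (ratr q2) => x1 x2 q11 q12 q13 q21 q22 q23 E1 E2 rrE ccE.
  have xx : x1 < x2 by exact: lt_trans q12 q21.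
  have hs : f x2 - f x1 < c * (x2 - x1).
    apply: hm; [rewrite gtr0_norm; move: q11 q13|rewrite ltr0_norm; move: q22 q23];
      by clear => *; order_lra.
  split.
  - rewrite /F /= clB E1 E2; split.
      move=> y; rewrite /= in_itv /= => /andP[h1 h2]; apply: Oin.
      by rewrite (le_trans (ltW q11))//= (le_trans h2)// ltW.
    exact/ltW.
  - by rewrite /B /ball /= rrE ccE ltr_norml; move: q12 q21; clear => *; apply/andP; split; order_lra.
  - by rewrite rB rrE; move: q11 q12 q21 q23 pd2 px1 px2; clear => *; order_lra.
have [G [GF tG hG]] := vitali_theorem_corollary B0 Efin VC eta0.
pose pr n := (cc n - rr n, cc n + rr n).
exists (map pr (finmap.enum_fset G)); split.
- rewrite pairwise_map; apply/(pairwiseP 0%N) => i j iG jG ij.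
  set n := nth _ _ i; set k := nth _ _ j.
  have nG : n \in finmap.enum_fset G by rewrite mem_nth.
  have kG : k \in finmap.enum_fset G by rewrite mem_nth.
  have nk : n != k.
    by rewrite /n /k nth_uniq ?(ltn_eqF ij)//; exact: finmap.fset_uniq.
  move/trivIsetP : tG => /(_ n k nG kG nk) /= tnk.
  rewrite /nonoverlap /= /pr /=.
  have [//|h1] := leP (cc n + rr n) (cc k - rr k).
  have [//|h2] := leP (cc k + rr k) (cc n - rr n).
  exfalso.
  have : (closure (B n) `&` closure (B k)) (Num.max (cc n - rr n) (cc k - rr k)).
    rewrite !clB /= !in_itv /= !le_max !ge_max !lexx orbT /=.
    have := rr0 n; have := rr0 k => ? ?.
    by repeat (apply/andP; split); order_lra.
  by rewrite tnk.
- move=> p /mapP[n nG ->]; have [h1 h2] := GF n nG; split => //=.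
  + by have := rr0 n; order_lra.
  + by rewrite -clB.
- apply: le_lt_trans hG; apply: le_outer_measure => x [Ex nx]; split => //.
  move=> h; apply: nx.
  move: h; rewrite -bigcup_seq => -[n /= nG]; rewrite clB /= in_itv /= => hn.
  by exists (pr n) => //; apply/mapP; exists n.
Qed.

(** The intervals complementary to [s] carry the remaining length and the remaining increment of
    [f]. The induction cuts the list at its first interval into what lies on its left and what lies
    on its right. *)
Lemma gaps f a b s : a <= b -> all (cell a b) s -> pairwise (@nonoverlap R) s ->
  exists g, [/\ all (cell a b) g, pairwise (@nonoverlap R) g,
    \sum_(p <- g) (p.2 - p.1) = b - a - \sum_(p <- s) (p.2 - p.1) &
    \sum_(p <- g) (f p.2 - f p.1) = f b - f a - \sum_(p <- s) (f p.2 - f p.1)].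
Proof.
elim: {s}(size s) {-2}s (leqnn (size s)) a b => [|n IH] [|p s]; rewrite ?ltnS//= => sn a b ab.
- by move=> _ _; exists [:: (a, b)]; rewrite !big_seq1 !big_nil !subr0 /= /cell /= !lexx ab.
- by move=> _ _; exists [:: (a, b)]; rewrite !big_seq1 !big_nil !subr0 /= /cell /= !lexx ab.
move=> /andP[pab sab] /andP[ps pws].
move: pab => /andP[/andP[ap pp] pb].
pose P (q : R * R) := q.2 <= p.1.
pose s1 := [seq q <- s | P q]; pose s2 := [seq q <- s | ~~ P q].
have c1 : all (cell a p.1) s1.
  apply/allP => q; rewrite mem_filter => /andP[h1 h2].
  by move/allP : sab => /(_ q h2) /andP[h3 _]; rewrite /cell h3.
have c2 : all (cell p.2 b) s2.
  apply/allP => q; rewrite mem_filter => /andP[h1 h2].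
  move: h1; rewrite /P => /negbTE h1.
  move/allP : ps => /(_ q h2); rewrite /nonoverlap h1 orbF => h3.
  by move/allP : sab => /(_ q h2) /andP[/andP[_ h4] h5]; rewrite /cell h3 h4 h5.
have z1 : (size s1 <= n)%N by rewrite size_filter (leq_trans (count_size _ _)).
have z2 : (size s2 <= n)%N by rewrite size_filter (leq_trans (count_size _ _)).
have p1 : pairwise (@nonoverlap R) s1 by apply: subseq_pairwise pws; exact: filter_subseq.
have p2 : pairwise (@nonoverlap R) s2 by apply: subseq_pairwise pws; exact: filter_subseq.
have [g1 [a1 b1 d1 e1]] := IH s1 z1 a p.1 ap c1 p1.
have [g2 [a2 b2 d2 e2]] := IH s2 z2 p.2 b pb c2 p2.
have bs (F : R * R -> R) : \sum_(q <- s) F q = \sum_(q <- s1) F q + \sum_(q <- s2) F q.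
  by rewrite (bigID P) /= !big_filter.
exists (g1 ++ g2); split.
- rewrite all_cat; apply/andP; split; apply/allP => q.
    move/allP : a1 => /[apply] /andP[h1 h2]; rewrite /cell h1 /=.
    by rewrite (le_trans h2)// (le_trans pp).
  move/allP : a2 => /[apply] /andP[/andP[h1 h2] h3]; rewrite /cell h2 h3 !andbT.
  by rewrite (le_trans ap)// (le_trans pp).
- rewrite pairwise_cat b1 b2 !andbT; apply/allrelP => q r.
  move/allP : a1 => /[apply] /andP[_ h1]; move/allP : a2 => /[apply] /andP[/andP[h2 _] _].
  by rewrite /nonoverlap (le_trans h1)// (le_trans pp).
- rewrite big_cat /= d1 d2 big_cons bs; ring.
- rewrite big_cat /= e1 e2 big_cons bs; ring.
Qed.

Lemma lo_itv a b : a <= b -> lo `[a, b]%classic = (b - a)%:E.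
Proof.
move=> ab; rewrite -[LHS]/(mu `[a, b]%classic) lebesgue_measure_itv /= lte_fin.
by case: ltP => // ba; have -> : b - a = 0 by order_lra.
Qed.

Lemma lo_cells s : (forall p, p \in s -> p.1 <= p.2) ->
  (lo (cells s) <= (\sum_(p <- s) (p.2 - p.1))%:E)%E.
Proof.
elim: s => [|p s IH] h.
  rewrite big_nil (_ : cells [::] = set0) ?outer_measure0//.
  by apply/seteqP; split => // x [].
rewrite big_cons EFinD.
apply: (@le_trans _ _ (lo (`[p.1, p.2]%classic `|` cells s))).
  apply: le_outer_measure => x [q]; rewrite inE => /predU1P[->|qs] xq.
    by left; rewrite /= in_itv.
  by right; exists q.
apply: (le_trans (outer_measureU2 _ _ _)); rewrite leeD//.
  suff : (lo `[p.1, p.2]%classic <= (p.2 - p.1)%:E)%E by [].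
  by rewrite lo_itv// h// mem_head.
by apply: IH => q qs; apply: h; rewrite inE qs orbT.
Qed.

(** Nonoverlapping closed intervals may share end points, but their interiors are disjoint and have
    the same lengths. *)
Lemma cells_measure (O : set R) s : open O -> pairwise (@nonoverlap R) s ->
  (forall p, p \in s -> p.1 < p.2 /\ `[p.1, p.2] `<=` O) ->
  ((\sum_(p <- s) (p.2 - p.1))%:E <= mu O)%E.
Proof.
move=> oO ps hs.
pose U (t : seq (R * R)) : set R := [set x | exists2 p, p \in t & p.1 < x < p.2].
have UE p t : U (p :: t) = `]p.1, p.2[%classic `|` U t.
  apply/seteqP; split => x /=; rewrite in_itv /=.
    by move=> [q]; rewrite inE => /predU1P[->|qt] xq; [left|right; exists q].
  move=> [xp|[q qt xq]]; first by exists p => //; exact: mem_head.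
  by exists q => //; rewrite inE qt orbT.
have mU t : measurable (U t).
  elim: t => [|p t IH]; last by rewrite UE; exact: measurableU.
  by rewrite (_ : U [::] = set0)//; apply/seteqP; split => // x [].
have UO t : (forall p, p \in t -> p.1 < p.2 /\ `[p.1, p.2] `<=` O) -> U t `<=` O.
  move=> ht x [p /ht[p12 pO] /andP[xp px]]; apply: pO; rewrite /= in_itv /=.
  by rewrite !ltW.
have H : ((\sum_(p <- s) (p.2 - p.1))%:E <= mu (U s))%E.
  elim: s ps hs => [|p s IH] /=; first by rewrite big_nil.
  move=> /andP[ps pws] hs; rewrite big_cons EFinD UE measureU//; last 2 first.
    exact: mU.
    apply/seteqP; split => // x /= [+ [q qs xq]]; rewrite in_itv /= => xp.
    move/allP : ps => /(_ q qs) /orP[|].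
    - by move: xp xq; clear => /andP[_ ?] /andP[? _] ?; order_lra.
    - by move: xp xq; clear => /andP[? _] /andP[_ ?] ?; order_lra.
  rewrite leeD//; last first.
    by apply: IH => // q qs; apply: hs; rewrite inE qs orbT.
  suff : ((p.2 - p.1)%:E <= lebesgue_measure `]p.1, p.2[%classic)%E by [].
  rewrite lebesgue_measure_itv /= lte_fin; case: ltP => // p21.
  by rewrite lee_fin subr_le0.
apply: (le_trans H); apply: le_measure; rewrite ?inE; [exact: mU| |exact: UO].
exact: measurable_realfun.open_measurable.
Qed.

(** Inside the intervals of [s], the points of [E] also lie in intervals of slope at least [c], of
    total length [J]. Removing these leaves gaps with [J] less length and at least [c * J] less
    increment, and [J] is nearly the outer measure of [E] inside [s]. *)
Lemma dense_gaps f c (E : set R) s eta : 0 < eta ->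
  (forall p, p \in s -> p.1 < p.2 /\ forall x, p.1 <= x <= p.2 -> {for x, continuous f}) ->
  pairwise (@nonoverlap R) s ->
  (forall x, E x -> slope_lt (fun x => - f x) (- c) x) ->
  exists (g : seq (R * R)) (J : R), [/\ forall q, q \in g -> exists2 p, p \in s & cell p.1 p.2 q,
    pairwise (@nonoverlap R) g,
    \sum_(p <- g) (p.2 - p.1) = \sum_(p <- s) (p.2 - p.1) - J,
    \sum_(p <- g) (f p.2 - f p.1) <= \sum_(p <- s) (f p.2 - f p.1) - c * J &
    (lo (E `&` cells s) <= (J + (size s)%:R * eta)%:E)%E].
Proof.
move=> eta0 + + hE; elim: s => [|p s IH] hs.
  move=> _; exists [::], 0; rewrite !big_nil mulr0 subr0 mul0r addr0; split => //.
  rewrite (_ : E `&` _ = set0) ?outer_measure0//.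
  by apply/seteqP; split => // x [_ []].
move=> /= /andP[ps pws].
have [|//|g [J [g1 g2 g3 g4 g5]]] := IH.
  by move=> q qs; apply: hs; rewrite inE qs orbT.
have [p12 cp] := hs p (mem_head _ _).
have cp' x : `]p.1, p.2[%classic x -> {for x, continuous (fun y => - f y)}.
  rewrite /= in_itv /= => /andP[x1 x2]; apply: cvgN; apply: cp.
  by rewrite (ltW x1) (ltW x2).
have opp : open `]p.1, p.2[%classic by exact: interval_open.
have [|js [j1 j2 j3]] := @vitali_slopes (fun y => - f y) (- c) `]p.1, p.2[%classic
   (E `&` `]p.1, p.2[%classic) p.1 p.2 opp (@subset_refl _ _) cp'
   (@subIsetr _ _ _) _ _ eta0.
  by move=> x [Ex _]; exact: hE.
have jc : all (cell p.1 p.2) js.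
  apply/allP => q /j2[q12 qO _].
  have := qO q.1; have := qO q.2; rewrite /= !in_itv /= !lexx (ltW q12).
  by move=> /(_ isT)/andP[_ /ltW h2] /(_ isT)/andP[/ltW h1 _]; rewrite /cell h1 h2 (ltW q12).
have [h [h1 h2 h3 h4]] := gaps f (ltW p12) jc j1.
exists (h ++ g), (\sum_(q <- js) (q.2 - q.1) + J); split.
- move=> q; rewrite mem_cat => /orP[qh|/g1[r rs qr]].
    by exists p; [exact: mem_head|move/allP : h1; apply].
  by exists r => //; rewrite inE rs orbT.
- rewrite pairwise_cat h2 g2 !andbT; apply/allrelP => q r qh rg.
  move/allP : h1 => /(_ q qh) /andP[/andP[a1 a2] a3].
  have [t ts /andP[/andP[b1 b2] b3]] := g1 r rg.
  move/allP : ps => /(_ t ts) /orP[c1|c1]; apply/orP; [left|right].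
    by rewrite (le_trans a3)// (le_trans c1).
  by rewrite (le_trans b3)// (le_trans c1).
- by rewrite big_cat /= big_cons h3 g3; ring.
- rewrite big_cat /= big_cons h4.
  have : c * (\sum_(q <- js) (q.2 - q.1)) <= \sum_(q <- js) (f q.2 - f q.1).
    rewrite mulr_sumr !big_seq; apply: ler_sum => q /j2[_ _].
    by clear => *; order_lra.
  by move: g4; clear => *; order_lra.
- rewrite [size _]/= -natr1.
  (* The covering took place in an open interval, so the two end points of [p] are counted
     separately. *)
  apply: (@le_trans _ _ (lo (([set p.1] `|` [set p.2]) `|` (E `&` `]p.1, p.2[ `\` cells js) `|`
    cells js `|` (E `&` cells s)))%E).
    apply: le_outer_measure => x [Ex [q]]; rewrite inE => /predU1P[->|qs] xq; last first.
      by right; split => //; exists q.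
    left; have [jx|jx] := pselect (cells js x); [by right|left].
    have [->|x1] := eqVneq x p.1; first by left; left.
    have [->|x2] := eqVneq x p.2; first by left; right.
    right; split => //; split => //; move: xq => /andP[y1 y2]; rewrite /= in_itv /=.
    by apply/andP; split; rewrite lt_neqAle ?y1 ?y2 andbT // eq_sym.
  have l1 x : lo [set x] = 0%E by have := lebesgue_measure_set1 x.
  apply: (@le_trans _ _ (((0 + 0) + eta%:E + (\sum_(q <- js) (q.2 - q.1))%:E) +
     (J + (size s)%:R * eta)%:E)%E).
    apply: (le_trans (outer_measureU2 _ _ _)); rewrite leeD//.
    apply: (le_trans (outer_measureU2 _ _ _)); rewrite leeD//; last first.
      by apply: lo_cells => q /j2[/ltW].
    apply: (le_trans (outer_measureU2 _ _ _)); rewrite leeD//; last exact: ltW.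
    apply: (le_trans (outer_measureU2 _ _ _)).
    by suff : (lo [set p.1] + lo [set p.2] <= 0 + 0)%E by []; rewrite !l1.
  rewrite adde0 add0e -!EFinD lee_fin; order_lra.
Qed.

(** If the set had outer measure [m > 0], it would be covered by intervals of slope at most [r] and,
    inside these, by intervals of slope at least [s], both of total length close to [m]. The gaps
    between the two families would be arbitrarily short while the increment over them is below a
    negative multiple of [(s - r) * m], against absolute continuity. *)
Lemma AC_slopes_null f a b (r s : R) : 0 < a -> b < 1 -> AC_loc01 f -> r < s ->
  mu.-negligible [set x | [/\ a < x < b, slope_lt f r x & slope_lt (fun x => - f x) (- s) x]].
Proof.
move=> a0 b1 hf rs; set E := [set x | _].
apply/negligible_outer_measure/eqP; apply: contrapT => /negP E0.
have EI : E `<=` `]a, b[%classic by move=> x [h _ _]; rewrite /= in_itv.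
have Efin : lo E \is a fin_num.
  rewrite ge0_fin_numE ?outer_measure_ge0//.
  apply: (@le_lt_trans _ _ (mu `]a, b[%classic)); first exact: le_outer_measure.
  by rewrite lebesgue_measure_itv /=; case: ifP => _; rewrite -?EFinD ltry.
pose m := fine (lo E).
have mE : lo E = m%:E by rewrite fineK.
have m0 : 0 < m.
  by rewrite -lte_fin -mE lt_neqAle eq_sym E0 outer_measure_ge0.
have e0 : 0 < (s - r) * m / 8 by rewrite divr_gt0// mulr_gt0// subr_gt0.
have [dl dl0 hAC] := hf a b a0 b1 _ e0.
have s0 : 0 < 8 * (`|s| + 1) by rewrite mulr_gt0// ltr_wpDl.
(* The gaps turn out shorter than [D]. The bound by [m] keeps the outer intervals longer than
   [m / 2], the bound by [dl] makes absolute continuity applicable, and the last one makes [s] times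
   the length of the gaps negligible. *)
pose D := Num.min (Num.min m dl) ((s - r) * m / (8 * (`|s| + 1))).
have D0 : 0 < D by rewrite !lt_min m0 dl0 /= divr_gt0// mulr_gt0// subr_gt0.
have Dm : D <= m by rewrite /D !ge_min lexx.
have Ddl : D <= dl by rewrite /D !ge_min lexx orbT.
have Ds : `|s| * D <= (s - r) * m / 8.
  have : D <= (s - r) * m / (8 * (`|s| + 1)) by rewrite /D !ge_min lexx !orbT.
  by rewrite ler_pdivlMr//; move: D0; clear => *; order_lra.
have D4 : 0 < D / 4 by rewrite divr_gt0.
have [U [oU EU mU]] := outer_measure_open_le E D4.
pose O := U `&` `]a, b[%classic.
have oO : open O by apply: openI => //; exact: interval_open.
have EO : E `<=` O by move=> x Ex; split; [exact: EU|exact: EI].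
have mO : (mu O <= (m + D / 4)%:E)%E.
  rewrite EFinD -mE; apply: le_trans mU.
  by apply: le_measure; rewrite ?inE; [exact: measurable_realfun.open_measurable
    |exact: measurable_realfun.open_measurable|exact: subIsetl].
have cO x : O x -> {for x, continuous f}.
  move=> [_]; rewrite /= in_itv /= => /andP[ax xb]; apply: AC_loc01_cont hf _.
  by rewrite (lt_trans a0)//= (lt_trans xb).
have [|Is [i1 i2 i3]] := @vitali_slopes f r O E a b oO (@subIsetr _ _ _) cO EO _ _ D4.
  by move=> x [].
pose eta := D / (4 * (size Is).+1%:R).
have eta0 : 0 < eta by rewrite divr_gt0// mulr_gt0.
have [|x []//|g [J [g1 g2 g3 g4 g5]]] := @dense_gaps f s E Is eta eta0 _ i1 _.
  move=> p /i2[p12 pO _]; split => // x xp; apply: cO; apply: pO.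
  by rewrite /= in_itv.
have Ileq : \sum_(p <- Is) (p.2 - p.1) <= m + D / 4.
  rewrite -lee_fin; apply: le_trans mO; apply: cells_measure => // p /i2[? ? _].
  by split.
have Neta : (size Is)%:R * eta <= D / 4.
  have -> : D / 4 = (size Is).+1%:R * eta.
    have : 0 < (size Is).+1%:R :> R by [].
    by rewrite /eta; move: ((size Is).+1%:R : R) => N N0; field; rewrite gt_eqF.
  by rewrite ler_pM2r// ler_nat.
have mJ : m <= D / 4 + (J + (size Is)%:R * eta).
  rewrite -lee_fin -mE EFinD.
  apply: (@le_trans _ _ (lo ((E `\` cells Is) `|` (E `&` cells Is)))).
    apply: le_outer_measure => x Ex.
    by have [cx|cx] := pselect (cells Is x); [right|left].
  by apply: (le_trans (outer_measureU2 _ _ _)); rewrite leeD// ltW.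
have gcell : all (cell a b) g.
  apply/allP => q /g1[p /i2[p12 pO _] /andP[/andP[q1 q2] q3]].
  have [_] := pO p.1 ltac:(by rewrite /= in_itv /= lexx ltW).
  have [_] := pO p.2 ltac:(by rewrite /= in_itv /= lexx andbT ltW).
  rewrite /= !in_itv /= => /andP[_ h2] /andP[h1 _].
  by rewrite /cell q2 (le_trans (ltW h1))//= (le_trans q3)// ltW.
have gl : \sum_(p <- g) (p.2 - p.1) < dl.
  by move: g3 Ileq Neta mJ D0 Ddl; clear => *; order_lra.
have gl0 := cell_ge0 gcell.
have := hAC g gcell g2 gl => hs.
have : `|\sum_(p <- g) (f p.2 - f p.1)| < (s - r) * m / 8.
  by apply: le_lt_trans hs; exact: ler_norm_sum.
rewrite ltr_norml => /andP[h1 _].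
have hI : \sum_(p <- Is) (f p.2 - f p.1) <= r * (\sum_(p <- Is) (p.2 - p.1)).
  by rewrite mulr_sumr !big_seq; apply: ler_sum => q /i2[_ _].
have sg : s * (\sum_(p <- g) (p.2 - p.1)) <= (s - r) * m / 8.
  apply: le_trans Ds; apply: (le_trans (ler_norm _)); rewrite normrM ler_wpM2l//.
  by rewrite ger0_norm//; move: g3 Ileq Neta mJ D0; clear => *; order_lra.
have SI : m / 2 <= \sum_(p <- Is) (p.2 - p.1).
  by move: g3 gl0 Neta mJ Dm; clear => *; order_lra.
move: g3 g4 h1 hI sg SI rs m0; clear.
set gL := \sum_(p <- g) (p.2 - p.1); set gF := \sum_(p <- g) (f p.2 - f p.1).
set IL := \sum_(p <- Is) (p.2 - p.1); set IF := \sum_(p <- Is) (f p.2 - f p.1).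
move=> -> g4 h1 hI sg SI rs m0; nra.
Qed.

End AEDerivable.

(** * Almost everywhere differentiability of locally absolutely continuous functions *)

Section ACDerivable.
Variable R : realType.
Implicit Types (f : R -> R) (x a b c : R).
Local Notation mu := (@lebesgue_measure R).
Local Notation lo := ((wlength idfun)^*)%mu.

(** Disjoint intervals of slope at least [n] with total length below [dl] have total increment below
    1, hence total length below [1 / n]. *)
Lemma AC_upslope_null f a b : 0 < a -> b < 1 -> AC_loc01 f ->
  mu.-negligible [set x | a < x < b /\ forall n, slope_lt (fun x => - f x) (- n%:R) x].
Proof.
move=> a0 b1 hf; set E := [set x | _].
have [dl dl0 hAC] := hf a b a0 b1 _ (@ltr01 R).
(* Overlapping windows of length [dl / 2]: covering intervals inside one window automatically have
   total length below [dl]. *)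
pose O (k : nat) := `]k%:R * (dl / 4) - dl / 8, (k%:R + 1) * (dl / 4) + dl / 8[%classic `&` `]a, b[%classic.
have ON k : mu.-negligible (E `&` O k).
  apply/negligible_outer_measure/eqP; rewrite eq_le outer_measure_ge0 andbT.
  apply/lee_addgt0Pr => e e0; rewrite add0e.
  have oO : open (O k) by apply: openI; exact: interval_open.
  have OI : O k `<=` `]a, b[%classic by exact: subIsetr.
  have cO x : O k x -> {for x, continuous (fun y => - f y)}.
    move=> /OI; rewrite /= in_itv /= => /andP[ax xb]; apply: cvgN; apply: AC_loc01_cont hf _.
    by rewrite (lt_trans a0)//= (lt_trans xb).
  have e2 : 0 < e / 2 by order_lra.
  pose n := (Num.truncn (2 / e)).+1.
  have nE : 2 / e < n%:R by rewrite /n truncnS_gt.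
  have [|s [s1 s2 s3]] := @vitali_slopes R (fun y => - f y) (- n%:R) (O k) (E `&` O k) a b oO OI cO
    (@subIsetr _ _ _) _ _ e2.
    by move=> x [[_ h] _]; exact: h.
  have sc : all (cell a b) s.
    apply/allP => p /s2[p12 pO _].
    have := OI _ (pO p.1 ltac:(by rewrite /= in_itv /= lexx ltW)).
    have := OI _ (pO p.2 ltac:(by rewrite /= in_itv /= lexx ltW)).
    rewrite /= !in_itv /= => /andP[_ /ltW h1] /andP[/ltW h2 _].
    by rewrite /cell h1 h2 ltW.
  have sl : \sum_(p <- s) (p.2 - p.1) < dl.
    rewrite -lte_fin; apply: (@le_lt_trans _ _ (mu (O k))).
      by apply: cells_measure => // p /s2[? ? _]; split.
    apply: (@le_lt_trans _ _ (mu `]k%:R * (dl / 4) - dl / 8, (k%:R + 1) * (dl / 4) + dl / 8[%classic)).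
      apply: le_measure; rewrite ?inE; [exact: measurable_realfun.open_measurable|by []|exact: subIsetl].
    rewrite lebesgue_measure_itv /= lte_fin; case: ifP => _; last by rewrite lte_fin.
    by rewrite -EFinB lte_fin; move: dl0; clear => *; order_lra.
  have : `|\sum_(p <- s) (f p.2 - f p.1)| < 1.
    by apply: le_lt_trans (hAC s sc s1 sl); exact: ler_norm_sum.
  rewrite ltr_norml => /andP[_ h1].
  have h2 : n%:R * (\sum_(p <- s) (p.2 - p.1)) <= \sum_(p <- s) (f p.2 - f p.1).
    rewrite mulr_sumr !big_seq; apply: ler_sum => p /s2[_ _].
    by move: (n%:R : R); clear => n ?; order_lra.
  have s0 := cell_ge0 sc.
  have h3 : \sum_(p <- s) (p.2 - p.1) <= e / 2.
    rewrite ltr_pdivrMr// in nE.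
    move: h1 h2 s0 nE e0; move: (n%:R : R) (\sum_(p <- s) (p.2 - p.1)) (\sum_(p <- s) (f p.2 - f p.1)).
    by clear => n S F *; nra.
  apply: (@le_trans _ _ (lo ((E `&` O k) `\` cells s `|` cells s))).
    apply: le_outer_measure => x EOx.
    by have [cx|cx] := pselect (cells s x); [right|left].
  rewrite (splitr e) EFinD; apply: (le_trans (outer_measureU2 _ _ _)); rewrite leeD//; first exact: ltW.
  apply: (@le_trans _ _ (\sum_(p <- s) (p.2 - p.1))%:E); last by rewrite lee_fin.
  by apply: lo_cells => p /s2[/ltW].
apply: negligibleS (negligible_bigcup ON) => x Ex.
have [/andP[ax xb] _] := Ex.
have x4 : 0 <= x / (dl / 4) by rewrite divr_ge0//; move: ax a0 dl0; clear => *; order_lra.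
exists (Num.truncn (x / (dl / 4))) => //; split => //; split; last by rewrite /= in_itv /= ax.
have := truncn_itv x4; rewrite /= in_itv /= -(natr1 (Num.truncn _)).
have dl4 : 0 < dl / 4 by order_lra.
rewrite ler_pdivlMr// ltr_pdivrMr//; move: (_%:R : R) => k.
by move: dl0; clear => ? /andP[? ?]; apply/andP; split; order_lra.
Qed.

(** [L] is the upper derivate, and the condition on rational pairs says that the lower derivate is
    not smaller. This controls intervals around [x]; by continuity one end of such an interval may
    tend to [x], which gives the difference quotients at [x]. *)
Lemma slopes_derivable f x : {for x, continuous f} ->
  (forall r s : rat, r < s -> slope_lt f (ratr r) x -> ~ slope_lt (fun y => - f y) (- ratr s) x) ->
  (exists n : nat, ~ slope_lt (fun y => - f y) (- n%:R) x) ->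
  (exists n : nat, ~ slope_lt (fun y => - - f y) (- n%:R) x) -> exists L, dv f x L.
Proof.
move=> cf rs [n1 hn1] [n2 hn2].
have notS g c : ~ slope_lt g c x -> exists2 d, 0 < d & forall p q, p < x -> x < q -> q - p < d ->
    c * (q - p) <= g q - g p.
  move=> h; apply: contrapT => h1; apply: h => d d0; apply: contrapT => h2; apply: h1.
  exists d => // p q px xq pq; rewrite leNgt; apply/negP => h3; apply: h2.
  by exists (p, q); split => //=; rewrite px xq.
pose A := [set s | ~ slope_lt (fun y => - f y) (- s) x].
have [d2 d20 hd2] := notS _ _ hn2.
have hA : has_inf A.
  split; [by exists n1%:R|exists (- n2%:R) => s /notS[d d0 hd]].
  pose m := Num.min d d2 / 4.
  have m0 : 0 < m by rewrite divr_gt0// lt_min d0.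
  have md : m <= d / 4 by rewrite ler_pM2r// ge_min lexx.
  have md2 : m <= d2 / 4 by rewrite ler_pM2r// ge_min lexx orbT.
  have := hd (x - m) (x + m) ltac:(lra) ltac:(lra) ltac:(lra).
  have := hd2 (x - m) (x + m) ltac:(lra) ltac:(lra) ltac:(lra).
  have -> : x + m - (x - m) = 2 * m by ring.
  move: (n2%:R : R) (f (x + m)) (f (x - m)) m0; clear => *; nra.
pose L := inf A; exists L; apply/dv_epsP => e e0.
have e2 : 0 < e / 2 by order_lra.
have [s As sL] := inf_adherent e2 hA.
have [d1 d10 hd1] := notS _ _ As.
have [r rP] := @rat_in_itvoo R (L - e / 2) (L - e / 4) ltac:(lra).
have [t tP] := @rat_in_itvoo R (L - e / 4) L ltac:(lra).
move: rP tP; rewrite !in_itv /= => /andP[r1 r2] /andP[t1 t2].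
have rt : r < t by rewrite -(ltr_rat R) (lt_trans r2).
have tA : slope_lt (fun y => - f y) (- ratr t) x.
  apply: contrapT => h; have : L <= ratr t by exact: ge_inf hA.2 _ h.
  by rewrite leNgt t2.
have [d3 d30 hd3] : exists2 d, 0 < d & forall p q, p < x -> x < q -> q - p < d ->
    ratr r * (q - p) <= f q - f p.
  by apply: notS => h; exact: rs rt h tA.
pose m := Num.min d1 d3 / 2.
have m0 : 0 < m by rewrite divr_gt0// lt_min d10.
have md1 : m <= d1 / 2 by rewrite ler_pM2r// ge_min lexx.
have md3 : m <= d3 / 2 by rewrite ler_pM2r// ge_min lexx orbT.
have key p q : p < x -> x < q -> q - p < 2 * m -> `|f q - f p - L * (q - p)| <= e / 2 * (q - p).
  move=> px xq pq.
  have := hd1 p q px xq ltac:(order_lra); have := hd3 p q px xq ltac:(order_lra).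
  have {sL} sL : s < L + e / 2 by exact: sL.
  have k1 : 0 <= (L + e / 2 - s) * (q - p) by apply: mulr_ge0; order_lra.
  have k2 : 0 <= (ratr r - (L - e / 2)) * (q - p) by apply: mulr_ge0; order_lra.
  move: k1 k2; rewrite ler_norml; clear => *.
  by apply/andP; split; order_lra.
exists m => // y ym.
have cg : {for x, continuous (fun z => f z - L * z + e / 2 * z)}.
  by apply: cvgD; [apply: cvgB => //|]; apply: cvgM; (try exact: cvg_cst); exact: cvg_id.
have cg' : {for x, continuous (fun z => f z - L * z - e / 2 * z)}.
  by apply: cvgB; [apply: cvgB => //|]; apply: cvgM; (try exact: cvg_cst); exact: cvg_id.
have [->|yx] := eqVneq y x; first by rewrite !subrr mulr0 subrr normr0 mulr0.
have ez : 0 < e / 2 * `|y - x| by rewrite mulr_gt0// normr_gt0 subr_eq0.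
have [u1 u10 hu1] := (contP _ _).1 cg _ ez.
have [u2 u20 hu2] := (contP _ _).1 cg' _ ez.
pose v := Num.min m (Num.min u1 u2) / 2.
have v0 : 0 < v by rewrite divr_gt0// !lt_min m0 u10.
have vm : v <= m / 2 by rewrite ler_pM2r// ge_min lexx.
have vu1 : v <= u1 / 2 by rewrite ler_pM2r// !ge_min lexx orbT.
have vu2 : v <= u2 / 2 by rewrite ler_pM2r// !ge_min lexx !orbT.
clearbody v m L; clear - key v0 vm vu1 vu2 hu1 hu2 ym ez yx.
have [xy|yx'] := ltP x y.
  move: ym ez; rewrite (gtr0_norm (_ : 0 < y - x)) ?subr_gt0// => ym ez.
  have := key (x - v) y ltac:(order_lra) xy ltac:(order_lra).
  have w1 : `|x - v - x| < u1 by rewrite ltr0_norm; order_lra.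
  have w2 : `|x - v - x| < u2 by rewrite ltr0_norm; order_lra.
  have := hu1 _ w1; have := hu2 _ w2; rewrite (gtr0_norm (_ : 0 < y - x)) ?subr_gt0//.
  rewrite !ltr_norml !ler_norml; move: (f (x - v)) => fv.
  by clear => /andP[? ?] /andP[? ?] /andP[? ?]; apply/andP; split; order_lra.
have {yx'}yx : y < x by rewrite lt_neqAle yx yx'.
move: ym ez; rewrite (ltr0_norm (_ : y - x < 0)) ?subr_lt0// => ym ez.
have := key y (x + v) yx ltac:(order_lra) ltac:(order_lra).
have w1 : `|x + v - x| < u1 by rewrite gtr0_norm; order_lra.
have w2 : `|x + v - x| < u2 by rewrite gtr0_norm; order_lra.
have := hu1 _ w1; have := hu2 _ w2; rewrite (ltr0_norm (_ : y - x < 0)) ?subr_lt0//.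
rewrite !ltr_norml !ler_norml; move: (f (x + v)) => fv.
by clear => /andP[? ?] /andP[? ?] /andP[? ?]; apply/andP; split; order_lra.
Qed.

Lemma AC_ae_derivable f : AC_loc01 f -> {ae mu, forall x, I01 x -> derivable f x 1}.
Proof.
move=> hf; pose a n : R := n.+2%:R^-1.
have hNf : AC_loc01 (fun y => - f y).
  move=> c d c0 d1 e e0; have [dl dl0 h] := hf c d c0 d1 e e0; exists dl => // s s1 s2 s3.
  apply: le_lt_trans (h s s1 s2 s3); apply: ler_sum => p _.
  by rewrite opprK addrC distrC.
have a0 n : 0 < a n by rewrite invr_gt0.
have a1 n : 1 - a n < 1 by have := a0 n; order_lra.
pose E1 n := [set x | a n < x < 1 - a n /\ forall k, slope_lt (fun x => - f x) (- k%:R) x].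
pose E2 n := [set x | a n < x < 1 - a n /\ forall k, slope_lt (fun x => - - f x) (- k%:R) x].
pose rs k : rat * rat := odflt (0, 1) (unpickle k).
pose E3 n k := [set x | (rs k).1 < (rs k).2 /\ [/\ a n < x < 1 - a n, slope_lt f (ratr (rs k).1) x &
   slope_lt (fun x => - f x) (- ratr (rs k).2) x]].
have N1 n : mu.-negligible (E1 n) by exact: (AC_upslope_null (a0 n) (a1 n) hf).
have N2 n : mu.-negligible (E2 n) by exact: (AC_upslope_null (a0 n) (a1 n) hNf).
have N3 n : mu.-negligible (\bigcup_k E3 n k).
  apply: negligible_bigcup => k; have [h|h] := boolP ((rs k).1 < (rs k).2); last first.
    suff -> : E3 n k = set0 by exact: negligible_set0.
    by apply/seteqP; split => // x [h1]; rewrite h1 in h.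
  have h' : ratr (rs k).1 < ratr (rs k).2 :> R by rewrite ltr_rat.
  have := AC_slopes_null (a0 n) (a1 n) hf h'.
  by apply: negligibleS => x [].
have N := negligibleU (negligibleU (negligible_bigcup N1) (negligible_bigcup N2)) (negligible_bigcup N3).
apply: negligibleS N => x /= nx; apply: contrapT => h; apply: nx => /I01P /andP[x0 x1].
pose m := Num.min x (1 - x).
have m0 : 0 < m by rewrite lt_min x0 subr_gt0.
pose n := Num.truncn m^-1.
have nm : a n < m.
  rewrite /a -[ltRHS]invrK ltf_pV2 ?posrE ?invr_gt0//.
  by apply: (lt_trans (truncnS_gt _)); rewrite ltr_nat.
have nx : a n < x < 1 - a n.
  have h1 : m <= x by rewrite ge_min lexx.
  have h2 : m <= 1 - x by rewrite ge_min lexx orbT.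
  by move: nm h1 h2; clear => *; apply/andP; split; order_lra.
clearbody n; clear nm.
have In (k : nat) : [set: nat] k by [].
have H1 : exists k : nat, ~ slope_lt (fun y => - f y) (- k%:R) x.
  apply: contrapT => /forallNP h1; apply: h; left; left; exists n; first exact: In.
  by split; [exact: nx|move=> k; apply: contrapT; exact: h1].
have H2 : exists k : nat, ~ slope_lt (fun y => - - f y) (- k%:R) x.
  apply: contrapT => /forallNP h1; apply: h; left; right; exists n; first exact: In.
  by split; [exact: nx|move=> k; apply: contrapT; exact: h1].
have H3 r s : r < s -> slope_lt f (ratr r) x -> ~ slope_lt (fun y => - f y) (- ratr s) x.
  move=> r_s h1 h2; apply: h; right; exists n; first exact: In.
  exists (pickle (r, s)); first exact: In.
  have E : rs (pickle (r, s)) = (r, s) by rewrite /rs pickleK.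
  rewrite /E3 /mkset E.
  by split; [exact: r_s|split; [exact: nx|exact: h1|exact: h2]].
have cf : {for x, continuous f} by apply: AC_loc01_cont hf _; rewrite x0.
by have [L /dvP[]] := slopes_derivable cf H3 H1 H2.
Qed.

Lemma AC_acd f : AC_loc01 f -> acd f (derive1 f).
Proof.
move=> h; split => //; apply: ae_imp (AC_ae_derivable h) _ => x H Ix.
by apply/dvP; split => //; exact: H.
Qed.

End ACDerivable.

(** * Primitives of locally integrable functions *)
Section Primitives.
Variable R : realType.
Implicit Types (f r : R -> R) (x a b c : R).
Local Notation mu := (@lebesgue_measure R).

Lemma exhaust01 x : 0 < x < 1 -> exists n : nat, n.+2%:R^-1 < x < 1 - n.+2%:R^-1.
Proof.
move=> /andP[x0 x1]; pose m := Num.min x (1 - x).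
have m0 : 0 < m by rewrite lt_min x0 subr_gt0.
have h1 : m <= x by rewrite ge_min lexx.
have h2 : m <= 1 - x by rewrite ge_min lexx orbT.
exists (Num.truncn m^-1); set n := Num.truncn _.
have : n.+2%:R^-1 < m.
  rewrite -[ltRHS]invrK ltf_pV2 ?posrE ?invr_gt0//.
  by apply: (lt_trans (truncnS_gt _)); rewrite ltr_nat.
move: (n.+2%:R^-1 : R) => q; move: h1 h2; clear => *; apply/andP; split; order_lra.
Qed.

Definition L1loc r := forall a b, 0 < a -> b < 1 -> mu.-integrable `[a, b] (EFin \o r).

Definition prim r t0 x : R :=
  if t0 <= x then \int[mu]_(t in `]t0, x]) r t else - \int[mu]_(t in `]x, t0]) r t.

Lemma prim0 r t0 : prim r t0 t0 = 0.
Proof. by rewrite /prim lexx (_ : `]t0, t0]%classic = set0) ?Rintegral_set0// set_itvoc0. Qed.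

Lemma primB r t0 x y : L1loc r -> 0 < t0 < 1 -> 0 < x -> x <= y -> y < 1 ->
  prim r t0 y - prim r t0 x = \int[mu]_(t in `]x, y]) r t.
Proof.
move=> hr /andP[t00 t01] x0 xy y1.
have H u v w : 0 < u -> u <= v -> v <= w -> w < 1 -> \int[mu]_(t in `]u, w]) r t =
   \int[mu]_(t in `]u, v]) r t + \int[mu]_(t in `]v, w]) r t.
  move=> u0 uv vw w1.
  have : mu.-integrable [set` Interval (BRight u) (BRight w)] (EFin \o r).
    apply: (integrableS _ _ _ (hr u w u0 w1)) => // t /=.
    by rewrite !in_itv /= => /andP[/ltW-> ->].
  move=> /(@Rintegral_itvB R r (BRight u) (BRight w) v); rewrite !bnd_simp => /(_ uv vw) <-.
  by ring.
rewrite /prim; have [t0y|yt0] := leP t0 y; have [t0x|xt0] := leP t0 x.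
- by rewrite (H t0 x y t00 t0x xy y1); ring.
- by rewrite (H x t0 y x0 (ltW xt0) t0y y1) opprK addrC.
- by move: (le_lt_trans t0x (le_lt_trans xy yt0)); rewrite ltxx.
- by rewrite (H x y t0 x0 xy (ltW yt0) t01); ring.
Qed.

Lemma L1loc_restrict r a b : L1loc r -> 0 < a -> b < 1 ->
  mu.-integrable setT (EFin \o (r \_ `[a, b])).
Proof.
move=> hr a0 b1; rewrite -restrict_EFin; apply/integrable_restrict => //=.
by rewrite setTI; exact: hr.
Qed.

Lemma prim_AC r t0 : L1loc r -> 0 < t0 < 1 -> AC_loc01 (prim r t0).
Proof.
move=> hr ht0 a b a0 b1 e e0.
pose f := r \_ `[a, b].
have fi : mu.-integrable setT (EFin \o f).
  exact: L1loc_restrict.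
have [d [d0 hd]] := integral_normr_continuous fi e0.
exists d => // s s1 s2 s3.
pose W (t : seq (R * R)) : set R := [set x | exists2 p, p \in t & p.1 < x <= p.2].
have WE p t : W (p :: t) = `]p.1, p.2]%classic `|` W t.
  apply/seteqP; split => x /=; rewrite in_itv /=.
    by move=> [q]; rewrite inE => /predU1P[->|qt] xq; [left|right; exists q].
  move=> [xp|[q qt xq]]; first by exists p => //; exact: mem_head.
  by exists q => //; rewrite inE qt orbT.
have W0 : W [::] = set0 by apply/seteqP; split => // x [].
have mW t : measurable (W t).
  by elim: t => [|p t IH]; [rewrite W0|rewrite WE; exact: measurableU].
have muW : (mu (W s) <= (\sum_(p <- s) (p.2 - p.1))%:E)%E.
  elim: s s1 {s2 s3} => [|p s IH] /=; first by rewrite W0 big_nil measure0.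
  move=> /andP[/andP[/andP[p1 p2] p3] s1]; rewrite big_cons EFinD WE.
  apply: (le_trans (measureU2 _ _ _)) => //; first exact: mW.
  rewrite leeD//; last exact: IH.
  suff : (lebesgue_measure `]p.1, p.2]%classic <= (p.2 - p.1)%:E)%E by [].
  by rewrite lebesgue_measure_itv /= lte_fin; case: ifP => // _; rewrite lee_fin subr_ge0.
apply: (@le_lt_trans _ _ (\int[mu]_(x in W s) `|f x|)); last first.
  by apply: hd; [exact: mW|apply: (le_lt_trans muW); rewrite lte_fin].
elim: s s1 s2 {s3 muW} => [|p s IH] /=; first by rewrite W0 big_nil Rintegral_set0.
move=> /andP[/andP[/andP[p1 p2] p3] s1] /andP[s2 s3].
have fiW A : measurable A -> mu.-integrable A (EFin \o (fun x => `|f x|)).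
  move=> mA; have := integrable_abse (integrableS measurableT mA (@subsetT _ _) fi).
  by rewrite /comp; under eq_fun do rewrite abse_EFin.
rewrite big_cons WE Rintegral_setU//; last 3 first.
- exact: mW.
- by apply: fiW; apply: measurableU => //; exact: mW.
- apply/disj_setPS => x /= [+ [q qs xq]]; rewrite in_itv /= => xp.
  move/allP : s2 => /(_ q qs) /orP[|]; move: xp xq; clear.
    by move=> /andP[_ ?] /andP[? _] ?; order_lra.
  by move=> /andP[? _] /andP[_ ?] ?; order_lra.
rewrite lerD//; last exact: IH.
rewrite primB//; [|exact: lt_le_trans p1|exact: le_lt_trans p3 b1].
have -> : \int[mu]_(t in `]p.1, p.2]) r t = \int[mu]_(t in `]p.1, p.2]) f t.
  apply: eq_Rintegral => x; rewrite inE /= in_itv /= => /andP[x1 x2].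
  by rewrite /f patchE mem_set//= in_itv /= (le_trans p1 (ltW x1)) (le_trans x2).
by apply: le_normr_Rintegral => //; exact: integrableS fi.
Qed.

(** The differentiation theorem is applied to the cut-offs of [r] to an exhausting sequence of
    compact intervals, whose primitives agree with [prim r t0] locally up to a constant. *)
Lemma prim_acd r t0 : L1loc r -> 0 < t0 < 1 -> acd (prim r t0) r.
Proof.
move=> hr ht0; split; first exact: prim_AC.
pose c n : R := n.+2%:R^-1; pose d n : R := 1 - n.+2%:R^-1.
have c0 n : 0 < c n by rewrite /c invr_gt0.
have d1 n : d n < 1 by rewrite /d ltrBlDr ltrDl.
pose f n := r \_ `[c n, d n].
have fi n : mu.-integrable setT (EFin \o f n).
  exact: L1loc_restrict.
pose J n x := \int[mu]_(t in `]-oo, x]) f n t.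
have fI n y : mu.-integrable `]-oo, y] (EFin \o f n).
  by apply: integrableS (fi n).
have J' n : {ae mu, forall x, derivable (J n) x 1 /\ derive1 (J n) x = f n x}.
  apply: FTC1Ny; first exact: fI.
  by apply: open_integrable_locally; [exact: openT|exact: fi].
have JE n x y : c n <= x -> x <= y -> y <= d n -> J n y - J n x = \int[mu]_(t in `]x, y]) r t.
  move=> cx xy yd.
  have /= := @Rintegral_itvB R (f n) -oo%O (BRight y) x (fI n y).
  rewrite !bnd_simp => /(_ isT xy) ->.
  apply: eq_Rintegral => t; rewrite inE /= in_itv /= => /andP[x1 x2].
  by rewrite /f patchE mem_set//= in_itv /= (le_trans cx (ltW x1)) (le_trans x2).
have := negligible_bigcup J'; apply: negligibleS => x /= nx.
apply: contrapT => h; apply: nx => /I01P x01.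
have [n1 /andP[n1a n1b]] := exhaust01 x01; have [n2 /andP[n2a n2b]] := exhaust01 ht0.
pose n := maxn n1 n2.
have cn1 : c n <= c n1 by rewrite /c lef_pV2 ?posrE// ler_nat !ltnS leq_maxl.
have cn2 : c n <= c n2 by rewrite /c lef_pV2 ?posrE// ler_nat !ltnS leq_maxr.
have ctd : c n < t0 < d n.
  by rewrite (le_lt_trans cn2 n2a) (lt_le_trans n2b)// /d lerD2l lerN2.
have cxd : c n < x < d n.
  by rewrite (le_lt_trans cn1 n1a) (lt_le_trans n1b)// /d lerD2l lerN2.
have JF y : c n < y < d n -> J n y - J n t0 = prim r t0 y.
  move=> /andP[cy yd]; move: (ctd) => /andP[ct td].
  have [t0y|/ltW yt0] := leP t0 y.
    by rewrite (JE _ _ _ (ltW ct) t0y (ltW yd)) /prim t0y.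
  rewrite -opprB (JE _ _ _ (ltW cy) yt0 (ltW td)) -(primB hr ht0)//.
  - by rewrite prim0 sub0r opprK.
  - exact: lt_trans cy.
  - exact: lt_trans td _.
have [Jd Jx] : derivable (J n) x 1 /\ derive1 (J n) x = f n x.
  by apply: contrapT => h'; apply: h; exists n.
have dJ : dv (J n) x (f n x) by apply/dvP.
have -> : r x = f n x.
  by move: (cxd) => /andP[cx xd]; rewrite /f patchE mem_set//= in_itv /= !ltW.
apply: (dv_local cxd JF); apply: dv_eq (dvB dJ (dv_cst _ _)) _.
by rewrite subr0.
Qed.

Lemma cont_L1loc r : (forall x, 0 < x < 1 -> {for x, continuous r}) -> L1loc r.
Proof.
move=> cr a b a0 b1; apply: continuous_compact_integrable; first exact: segment_compact.
apply: cont_within => x /andP[ax xb]; apply: cr.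
by rewrite (lt_le_trans a0)//= (le_lt_trans xb).
Qed.

Lemma prim_dv r t0 x : (forall x, 0 < x < 1 -> {for x, continuous r}) -> 0 < t0 < 1 ->
  0 < x < 1 -> dv (prim r t0) x (r x).
Proof.
move=> cr ht0 hx; have hr := cont_L1loc cr.
apply/dv_epsP => e e0.
have [d d0 hd] := (contP r x).1 (cr x hx) e e0.
have /andP[x0 x1] := hx.
pose m := Num.min d (Num.min x (1 - x)).
have m0 : 0 < m by rewrite !lt_min d0 x0 subr_gt0.
have md : m <= d by rewrite ge_min lexx.
have mx : m <= x by rewrite !ge_min lexx orbT.
have mx1 : m <= 1 - x by rewrite !ge_min lexx !orbT.
have key u v : x - m < u -> u <= v -> v < x + m -> u <= x <= v ->
   `|prim r t0 v - prim r t0 u - r x * (v - u)| <= e * (v - u).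
  move=> hu uv hv /andP[ux xv].
  have u0 : 0 < u by move: hu mx; clear => *; order_lra.
  have v1 : v < 1 by move: hv mx1; clear => *; order_lra.
  rewrite (primB hr ht0 u0 uv v1).
  have iuv (c : R) : mu.-integrable `]u, v] (EFin \o (fun=> c)).
    apply: (@integrableS _ _ _ mu `[u, v]%classic) => //.
      by move=> t /=; rewrite !in_itv /= => /andP[/ltW-> ->].
    apply: continuous_compact_integrable; first exact: segment_compact.
    by apply: cont_within => t _; exact: cvg_cst.
  have ir : mu.-integrable `]u, v] (EFin \o r).
    apply: (integrableS _ _ _ (hr u v u0 v1)) => // t /=.
    by rewrite !in_itv /= => /andP[/ltW-> ->].
  have cst (c : R) : \int[mu]_(t in `]u, v]) c = c * (v - u).
    rewrite Rintegral_cst//; congr (_ * _).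
    transitivity (fine (lebesgue_measure `]u, v]%classic)) => //.
    rewrite lebesgue_measure_itv /= lte_fin; case: ltP => //= vu.
    by apply/esym/eqP; rewrite subr_eq0 eq_le uv vu.
  have rt t : `]u, v]%classic t -> `|r t - r x| < e.
    rewrite /= in_itv /= => /andP[t1 t2]; apply: hd; rewrite ltr_norml.
    by move: t1 t2 hu hv md ux xv; clear => *; apply/andP; split; order_lra.
  have h1 : \int[mu]_(t in `]u, v]) r t <= \int[mu]_(t in `]u, v]) (r x + e).
    apply: le_Rintegral => // t /rt; rewrite ltr_norml => /andP[_].
    by rewrite ltrBlDl => /ltW.
  have h2 : \int[mu]_(t in `]u, v]) (r x - e) <= \int[mu]_(t in `]u, v]) r t.
    apply: le_Rintegral => // t /rt; rewrite ltr_norml => /andP[+ _].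
    by rewrite ltrBrDl => /ltW.
  rewrite !cst in h1 h2; rewrite ler_norml; move: h1 h2; move: (\int[mu]_(t in `]u, v]) r t).
  by clear => I *; apply/andP; split; order_lra.
exists m => // y; have [xy|/ltW yx] := leP x y => ym.
  rewrite ger0_norm ?subr_ge0// in ym.
  rewrite (ger0_norm (_ : 0 <= y - x)) ?subr_ge0//; apply: key => //; rewrite ?lexx//.
    by rewrite ltrBlDr ltrDl.
  by rewrite addrC -ltrBlDr.
rewrite ler0_norm ?subr_le0// opprB in ym.
rewrite (ler0_norm (_ : y - x <= 0)) ?subr_le0// opprB.
have -> : prim r t0 y - prim r t0 x - r x * (y - x) =
  - (prim r t0 x - prim r t0 y - r x * (x - y)) by ring.
rewrite normrN; apply: key => //; rewrite ?lexx ?andbT//.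
  by rewrite ltrBlDr addrC -ltrBlDr.
by rewrite ltrDl.
Qed.

End Primitives.

(** * Integrability on (0, 1) in terms of bounded primitives *)

Section BoundedPrimitives.
Variable R : realType.
Implicit Types (f r : R -> R) (x a b c C : R).
Local Notation mu := (@lebesgue_measure R).

(** Denominators from 2 on keep the end points in order; the half open form is the one produced by
    [primB]. *)
Definition itvn (n : nat) : set R := `]n.+2%:R^-1, 1 - n.+2%:R^-1]%classic.

Lemma itvn_gt0 n : 0 < n.+2%:R^-1 :> R.
Proof. by rewrite invr_gt0. Qed.

Lemma itvn_le n : n.+2%:R^-1 <= 1 - n.+2%:R^-1 :> R.
Proof.
have : n.+2%:R^-1 <= 2^-1 :> R by rewrite lef_pV2 ?posrE// ler_nat.
by move: (n.+2%:R^-1 : R); clear => *; order_lra.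
Qed.

Lemma itvn_lt1 n : 1 - n.+2%:R^-1 < 1 :> R.
Proof. by rewrite ltrBlDr ltrDl itvn_gt0. Qed.

Lemma itvn_sub01 n : itvn n `<=` @I01 R.
Proof.
move=> x; rewrite /itvn /= in_itv /= => /andP[h1 h2]; apply/I01P.
by rewrite (lt_trans (itvn_gt0 n) h1) (le_lt_trans h2 (itvn_lt1 n)).
Qed.

Lemma bigcup_itvn : \bigcup_n itvn n = @I01 R.
Proof.
apply/seteqP; split => x; first by move=> [n _ /itvn_sub01].
move=> /I01P /exhaust01 [n /andP[h1 h2]]; exists n => //.
by rewrite /itvn /= in_itv /= h1 ltW.
Qed.

Lemma measurable_I01 : measurable (@I01 R).
Proof. exact: measurable_itv. Qed.

Lemma measurable_itvn n : measurable (itvn n).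
Proof. exact: measurable_itv. Qed.

Lemma nondecreasing_itvn : nondecreasing_seq itvn.
Proof.
move=> m n mn; rewrite subsetEset => x; rewrite /itvn /= !in_itv /= => /andP[h1 h2].
have : n.+2%:R^-1 <= m.+2%:R^-1 :> R by rewrite lef_pV2 ?posrE// ler_nat !ltnS.
by move: (n.+2%:R^-1 : R) (m.+2%:R^-1 : R) h1 h2; clear => *; apply/andP; split; order_lra.
Qed.

Lemma cvg_itvn r : measurable_fun (@I01 R) r -> (forall x, I01 x -> 0 <= r x) ->
  (\int[mu]_(x in itvn n) (r x)%:E @[n --> \oo] --> \int[mu]_(x in @I01 R) (r x)%:E)%E.
Proof.
move=> mr r0; rewrite -bigcup_itvn; apply: ge0_nondecreasing_set_cvg_integral.
- exact: nondecreasing_itvn.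
- exact: measurable_itvn.
- move=> n; apply/measurable_EFinP; apply: measurable_funS mr; first exact: measurable_I01.
  exact: itvn_sub01.
- by move=> n x /itvn_sub01 hx; rewrite lee_fin r0.
Qed.

Lemma int01_le r C : measurable_fun (@I01 R) r -> (forall x, I01 x -> 0 <= r x) ->
  (forall n, (\int[mu]_(x in itvn n) (r x)%:E <= C%:E)%E) ->
  (\int[mu]_(x in @I01 R) (r x)%:E <= C%:E)%E.
Proof.
move=> mr r0 h; have cv := cvg_itvn mr r0.
rewrite -(cvg_lim _ cv)//; apply: lime_le; first by apply/cvg_ex; eexists; exact: cv.
exact: nearW.
Qed.

Lemma int01_tail r : measurable_fun (@I01 R) r -> (forall x, I01 x -> 0 <= r x) ->
  (\int[mu]_(x in @I01 R) (r x)%:E < +oo)%E -> forall e, 0 < e -> exists n,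
  (\int[mu]_(x in @I01 R `\` itvn n) (r x)%:E < e%:E)%E.
Proof.
move=> mr r0 roo e e0.
have mE : measurable_fun (@I01 R) (EFin \o r) by exact/measurable_EFinP.
have rE x : I01 x -> (0 <= (EFin \o r) x)%E by move=> ?; rewrite lee_fin r0.
set I := (\int[mu]_(x in @I01 R) (r x)%:E)%E in roo.
have I0 : (0 <= I)%E by apply: integral_ge0.
have If : I \is a fin_num by rewrite ge0_fin_numE.
have H n : (I = \int[mu]_(x in itvn n) (r x)%:E + \int[mu]_(x in @I01 R `\` itvn n) (r x)%:E)%E.
  rewrite /I -{1}(setDUK (@itvn_sub01 n)) ge0_integral_setU//.
  - exact: measurable_itvn.
  - by apply: measurableD; [exact: measurable_I01|exact: measurable_itvn].
  - by rewrite setDUK//; exact: itvn_sub01.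
  - by rewrite setDUK//; exact: itvn_sub01.
  - by apply/disj_setPS => x [? []].
have cv : (\int[mu]_(x in itvn n) (r x)%:E @[n --> \oo] --> I)%E := cvg_itvn mr r0.
rewrite -(fineK If) in cv; have /fine_cvgP[_ /cvgrPdist_lt /(_ e e0)[n _ hn]] := cv.
exists n; have := hn n (leqnn n); rewrite /= => hn'.
have := H n; move: hn'.
set A := (\int[mu]_(x in itvn n) (r x)%:E)%E; set B := (\int[mu]_(x in _) _)%E => hn' HI.
have A0 : (0 <= A)%E by apply: integral_ge0 => x /itvn_sub01 /rE.
have B0 : (0 <= B)%E by apply: integral_ge0 => x [/rE].
have Af : A \is a fin_num by rewrite ge0_fin_numE// (le_lt_trans _ roo)// HI leeDl.
have Bf : B \is a fin_num by rewrite ge0_fin_numE// (le_lt_trans _ roo)// HI leeDr.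
rewrite -(fineK Bf) lte_fin; apply: le_lt_trans hn'.
have E : fine I = fine A + fine B by transitivity (fine (A + B)%E); [congr fine|exact: fineD].
have -> : fine B = fine I - fine A by rewrite E addrC addKr.
exact: ler_norm.
Qed.

Lemma integral_prim r a b t0 : L1loc r -> 0 < t0 < 1 -> 0 < a -> a <= b -> b < 1 ->
  (\int[mu]_(x in `]a, b]) (r x)%:E = (prim r t0 b - prim r t0 a)%:E)%E.
Proof.
move=> hr ht0 a0 ab b1; rewrite (primB hr ht0 a0 ab b1) fineK//.
apply: integrable_fin_num => //; apply: (integrableS _ _ _ (hr a b a0 b1)) => // t /=.
by rewrite !in_itv /= => /andP[/ltW-> ->].
Qed.

Lemma int01_prim r : measurable_fun (@I01 R) r -> (forall x, I01 x -> 0 <= r x) ->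
  (\int[mu]_(x in @I01 R) (r x)%:E < +oo)%E -> L1loc r /\
  exists C, forall t0 a b, 0 < t0 < 1 -> 0 < a -> a <= b -> b < 1 ->
    prim r t0 b - prim r t0 a <= C.
Proof.
move=> mr r0 roo.
have mE : measurable_fun (@I01 R) (EFin \o r) by exact/measurable_EFinP.
have rE x : I01 x -> (0 <= (EFin \o r) x)%E by move=> ?; rewrite lee_fin r0.
have Ir : mu.-integrable (@I01 R) (EFin \o r).
  apply/integrableP; split => //; apply: le_lt_trans roo.
  apply: ge0_le_integral => //; first exact: measurable_I01.
  - exact: measurableT_comp.
  - by move=> x Ix; rewrite /= ger0_norm ?r0.
have hr : L1loc r.
  move=> a b a0 b1; apply: integrableS Ir => //; first exact: measurable_I01.
  move=> x /=; rewrite in_itv /= => /andP[h1 h2]; apply/I01P.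
  by rewrite (lt_le_trans a0 h1) (le_lt_trans h2).
split => //; exists (fine (\int[mu]_(x in @I01 R) (r x)%:E)) => t0 a b ht0 a0 ab b1.
rewrite -lee_fin fineK ?ge0_fin_numE ?integral_ge0// -integral_prim//.
apply: ge0_subset_integral => //; first exact: measurable_I01.
move=> x /=; rewrite in_itv /= => /andP[h1 h2]; apply/I01P.
by rewrite (lt_trans a0 h1) (le_lt_trans h2).
Qed.

Lemma cont_measurable01 r : (forall x, 0 < x < 1 -> {for x, continuous r}) ->
  measurable_fun (@I01 R) r.
Proof.
move=> cr; apply: open_continuous_measurable_fun; first exact: interval_open.
by move=> x; rewrite inE => /I01P; exact: cr.
Qed.

(** For a continuous nonnegative [r] this is finiteness of the integral ([summable01P]), in a form
    that can be proved and used by comparing derivatives. *)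
Definition summable01 r := exists C, forall a b, 0 < a -> a <= b -> b < 1 ->
  prim r 2^-1 b - prim r 2^-1 a <= C.

Lemma half01 : 0 < (2^-1 : R) < 1.
Proof. by apply/andP; split; order_lra. Qed.

Lemma summable01P r : (forall x, 0 < x < 1 -> {for x, continuous r}) ->
  (forall x, 0 < x < 1 -> 0 <= r x) ->
  (\int[mu]_(x in @I01 R) (r x)%:E < +oo)%E <-> summable01 r.
Proof.
move=> cr r0; have mr := cont_measurable01 cr.
have r0' x : I01 x -> 0 <= r x by move/I01P; exact: r0.
split.
  by move=> /(int01_prim mr r0') [_ [C hC]]; exists C => a b *; apply: hC => //; exact: half01.
move=> [C hC]; apply: (@le_lt_trans _ _ C%:E); last exact: ltry.
apply: int01_le => // n.
rewrite /itvn (integral_prim (cont_L1loc cr) half01 (itvn_gt0 n) (itvn_le n) (itvn_lt1 n)).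
by rewrite lee_fin; apply: hC; [exact: itvn_gt0|exact: itvn_le|exact: itvn_lt1].
Qed.

End BoundedPrimitives.

(** * Linear systems of differential equations on (0, 1) *)
Section LinearODE.
Variable R : realType.
Implicit Types (t a b C K : R).

Lemma geo_small C e : 0 < e -> exists n : nat, C * 2^-1 ^+ n < e.
Proof.
move=> e0; have [C0|C0] := leP C 0.
  by exists 0; rewrite expr0 mulr1; apply: le_lt_trans e0.
have h1 : C / e < (Num.truncn (C / e)).+1%:R by exact: truncnS_gt.
exists (Num.truncn (C / e)).+1; move: h1; move: (Num.truncn _).+1 => n h1.
have h2 : n%:R < 2 ^+ n :> R by rewrite -natrX ltr_nat ltn_expl.
rewrite exprVn ltr_pdivrMr ?exprn_gt0//.
by rewrite ltr_pdivrMr// in h1; move: h1 h2; move: (n%:R : R) (2 ^+ n : R); clear -e0 => *; nra.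
Qed.

(** The brackets [u n - 2 C q n] and [u n + 2 C q n] are nested; the limit is the supremum of the
    lower ones. *)
Lemma geo_limit (u : nat -> R) C : (forall n, `|u n.+1 - u n| <= C * 2^-1 ^+ n) ->
  exists l, forall n, `|u n - l| <= 2 * C * 2^-1 ^+ n.
Proof.
move=> hu; pose q n : R := 2^-1 ^+ n.
have qS n : q n.+1 = q n / 2 by rewrite /q exprS mulrC.
have lo m n : (m <= n)%N -> u m - 2 * C * q m <= u n - 2 * C * q n.
  elim: n => [|n IH]; first by rewrite leqn0 => /eqP->.
  rewrite leq_eqVlt => /predU1P[->//|]; rewrite ltnS => /IH h; apply: (le_trans h).
  by have := hu n; rewrite qS -/(q n) ler_norml => /andP[? ?]; order_lra.
have hi m n : (m <= n)%N -> u n + 2 * C * q n <= u m + 2 * C * q m.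
  elim: n => [|n IH]; first by rewrite leqn0 => /eqP->.
  rewrite leq_eqVlt => /predU1P[->//|]; rewrite ltnS => /IH h; apply: le_trans h.
  by have := hu n; rewrite qS -/(q n) ler_norml => /andP[? ?]; order_lra.
have C0 : 0 <= C by have := hu 0%N; rewrite expr0 mulr1; apply: le_trans; exact: normr_ge0.
have q0 n : 0 <= C * q n by rewrite mulr_ge0// exprn_ge0.
have cross m n : u m - 2 * C * q m <= u n + 2 * C * q n.
  have := lo m (maxn m n) (leq_maxl _ _); have := hi n (maxn m n) (leq_maxr _ _).
  by have := q0 (maxn m n); order_lra.
pose A := [set u n - 2 * C * q n | n in [set: nat]].
have An n : A (u n - 2 * C * q n) by exists n.
have hA : has_sup A.
  by split; [exists (u 0 - 2 * C * q 0); exact: An|exists (u 0 + 2 * C * q 0) => _ [n _ <-]].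
exists (sup A) => n; rewrite -/(q n) ler_norml; apply/andP; split.
  have : sup A <= u n + 2 * C * q n by apply: ge_sup; [exact: hA.1|move=> _ [m _ <-]].
  order_lra.
have : u n - 2 * C * q n <= sup A by exact: (ub_le_sup hA.2 (An n)).
by order_lra.
Qed.

(** [S] is signed and increasing, so one majorant serves on both sides of [t0]. *)
Lemma dv_bound (F dF S dS : R -> R) t0 a b : a <= t0 <= b -> F t0 = 0 -> S t0 = 0 ->
  (forall t, a <= t <= b -> dv F t (dF t)) -> (forall t, a <= t <= b -> dv S t (dS t)) ->
  (forall t, a <= t <= b -> `|dF t| <= dS t) -> forall t, a <= t <= b -> `|F t| <= `|S t|.
Proof.
move=> /andP[at0 t0b] F0 S0 hF hS h t /andP[ta tb].
have nF s : a <= s <= b -> dv (fun x => - F x) s (- dF s) by move=> /hF /dvN.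
have [tt0|/ltW t0t] := leP t t0.
  have sub s : t <= s <= t0 -> a <= s <= b.
    by move=> /andP[h1 h2]; rewrite (le_trans ta h1) (le_trans h2).
  have sub' s : t < s < t0 -> a <= s <= b by move=> /andP[h1 h2]; apply: sub; rewrite !ltW.
  have h1 := dv_le tt0 (fun s hs => hF s (sub s hs)) (fun s hs => hS s (sub s hs))
    (fun s hs => le_trans (ler_norm _) (h s (sub' s hs))).
  have h2 := dv_le tt0 (fun s hs => nF s (sub s hs)) (fun s hs => hS s (sub s hs))
    (fun s hs => le_trans (ler_norm _) (eq_rect_r (fun z => z <= _) (h s (sub' s hs)) (normrN _))).
  rewrite F0 S0 in h1 h2; have hS0 : S t <= 0 by order_lra.
  by rewrite (ler0_norm hS0) ler_norml; apply/andP; split; order_lra.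
have sub s : t0 <= s <= t -> a <= s <= b.
  by move=> /andP[h1 h2]; rewrite (le_trans at0 h1) (le_trans h2).
have sub' s : t0 < s < t -> a <= s <= b by move=> /andP[h1 h2]; apply: sub; rewrite !ltW.
have h1 := dv_le t0t (fun s hs => hF s (sub s hs)) (fun s hs => hS s (sub s hs))
  (fun s hs => le_trans (ler_norm _) (h s (sub' s hs))).
have h2 := dv_le t0t (fun s hs => nF s (sub s hs)) (fun s hs => hS s (sub s hs))
  (fun s hs => le_trans (ler_norm _) (eq_rect_r (fun z => z <= _) (h s (sub' s hs)) (normrN _))).
rewrite F0 S0 in h1 h2; have hS0 : 0 <= S t by order_lra.
by rewrite (ger0_norm hS0) ler_norml; apply/andP; split; order_lra.
Qed.

(** A cluster point in place of a convergent subsequence: each application needs only one late index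
    close to the limit. *)
Lemma bolzano_weierstrass_fin (d : nat) (x : nat -> 'I_d -> R) C :
  (forall n i, `|x n i| <= C) -> exists y : 'I_d -> R,
  forall e, 0 < e -> forall N, exists2 n, (N <= n)%N & forall i, `|x n i - y i| < e.
Proof.
move=> hx; pose A := [set v : 'rV[R]_d | forall i, `[- C, C]%classic (v ord0 i)].
have cA : compact A by apply: (@rV_compact R d (fun=> `[- C, C]%classic)) => i; exact: segment_compact.
pose F : set_system 'rV[R]_d := (fun n => \row_i x n i) @ \oo.
have [|v [Av cl]] := cA F _.
  by exists 0%N => // n _ i; rewrite mxE /= in_itv /= -ler_norml.
exists (fun i => v ord0 i) => e e0 N.
have [_ [[n /= Nn <-] [_ vn]]] := cl [set \row_i x n i | n in [set n | (N <= n)%N]] (ball v e)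
  ltac:(by exists N => // n /= Nn; exists n) (nbhsx_ballx v e e0).
exists n => // i; have := vn ord0 i; rewrite mxE /ball /= distrC; exact.
Qed.

(** The normalization is what keeps a limit of such vectors from vanishing. Applied to five
    coefficients subject to four boundary conditions. *)
Lemma lin_kernel (n m : nat) (A : 'I_n -> 'I_m -> R) : (m < n)%N ->
  exists v : 'I_n -> R, \sum_i v i ^+ 2 = 1 /\ forall j, \sum_i v i * A i j = 0.
Proof.
move=> mn; pose M := \matrix_(i, j) A i j.
have : kermx M != 0.
  rewrite -mxrank_eq0 mxrank_ker -lt0n subn_gt0.
  exact: leq_ltn_trans (rank_leq_col M) mn.
move/rowV0Pn => [v /sub_kermxP vM v0].
pose s := \sum_i v ord0 i ^+ 2.
have s0 : 0 < s.
  rewrite lt_neqAle sumr_ge0 ?andbT; last by move=> i _; exact: sqr_ge0.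
  apply: contra v0; rewrite eq_sym psumr_eq0; last by move=> i _; exact: sqr_ge0.
  move=> /allP h; apply/eqP/rowP => i; rewrite mxE; apply/eqP.
  by have := h i (mem_index_enum _); rewrite sqrf_eq0.
exists (fun i => v ord0 i / Num.sqrt s); split.
  under eq_bigr do rewrite expr_div_n sqr_sqrtr ?(ltW s0)//.
  by rewrite -mulr_suml divff// gt_eqF.
move=> j; have /rowP /(_ j) := vM; rewrite !mxE => h.
under eq_bigr do rewrite mulrAC.
rewrite -mulr_suml -[RHS](mul0r (Num.sqrt s)^-1); congr (_ * _); rewrite -[RHS]h.
by apply: eq_bigr => i _; rewrite mxE.
Qed.

Lemma gronwall_right (N dN : R -> R) K c a b : a <= b -> 0 <= K -> 0 <= c ->
  (forall t, a <= t <= b -> dv N t (dN t)) ->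
  (forall t, a <= t <= b -> dN t <= K * N t + c) ->
  N b <= expR (K * (b - a)) * (N a + c * (b - a)).
Proof.
move=> ab K0 c0 hN h.
pose E t := expR (- (K * (t - a))).
have hE t : dv E t (- K * E t).
  apply: dv_eq (dv_comp (dv_exp _) (dvN (dvZ K (dvB (dv_id t) (dv_cst a t))))) _.
  by rewrite /E subr0 mulr1; ring.
pose H t := c * (t - a) - N t * E t.
have hH t : a <= t <= b -> dv H t (c - (dN t * E t + N t * (- K * E t))).
  move=> tab; apply: dv_eq (dvB (dvZ c (dvB (dv_id t) (dv_cst a t))) (dvM (hN t tab) (hE t))) _.
  by rewrite subr0 mulr1.
have Ha : H a = - N a by rewrite /H /E !subrr !mulr0 oppr0 expR0 mulr1 sub0r.
have Eb : E b * expR (K * (b - a)) = 1 by rewrite /E expRN mulVf// gt_eqF// expR_gt0.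
have e0 := expR_gt0 (K * (b - a)).
have H1 : - N a <= c * (b - a) - N b * E b.
  rewrite -Ha; apply: (dv_mono ab hH) => t /andP[h1 h2]; have tab : a <= t <= b by rewrite !ltW.
  have E0 : 0 < E t by exact: expR_gt0.
  have E1 : E t <= 1 by rewrite -expR0 ler_expR oppr_le0 mulr_ge0// subr_ge0 ltW.
  have := ler_wpM2r (ltW E0) (h t tab); have : c * E t <= c by rewrite ler_piMr.
  by move: (E t) (N t) (dN t); clear => *; order_lra.
have -> : N b = expR (K * (b - a)) * (N b * E b) by rewrite mulrCA [_ * E b]mulrC Eb mulr1.
by rewrite ler_pM2l//; order_lra.
Qed.

Lemma gronwall_left (N dN : R -> R) K c a b : a <= b -> 0 <= K -> 0 <= c ->
  (forall t, a <= t <= b -> dv N t (dN t)) ->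
  (forall t, a <= t <= b -> - dN t <= K * N t + c) ->
  N a <= expR (K * (b - a)) * (N b + c * (b - a)).
Proof.
move=> ab K0 c0 hN h.
have opp t : dv (fun s : R => - s) t (-1) by exact: dvN (dv_id t).
have := @gronwall_right (fun t => N (- t)) (fun t => - dN (- t)) K c (- b) (- a).
rewrite !opprK addrC => H; have {}H := H _ K0 c0; rewrite lerN2 in H.
apply: H => // t /andP[h1 h2].
  apply: dv_eq (dv_comp (hN (- t) _) (opp t)) _; last by rewrite mulrN1.
  by rewrite lerNr h2 lerNl h1.
by apply: h; rewrite lerNr h2 lerNl h1.
Qed.

Lemma cont_sum d (f : 'I_d -> R -> R) t : (forall i, {for t, continuous (f i)}) ->
  {for t, continuous (fun s => \sum_i f i s)}.
Proof.
elim: d f => [|d IH] f h.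
  have -> : (fun s => \sum_i f i s) = (fun=> 0) by apply/funext => s; rewrite big_ord0.
  exact: cvg_cst.
have -> : (fun s => \sum_i f i s) = (fun s => f ord0 s + \sum_i f (lift ord0 i) s).
  by apply/funext => s; rewrite big_ord_recl.
by apply: cvgD; [exact: h|apply: IH => i; exact: h].
Qed.

Lemma cont_bounded_fam (I : finType) (f : I -> R -> R) a b :
  (forall i t, a <= t <= b -> {for t, continuous (f i)}) ->
  exists2 M, 0 < M & forall i t, a <= t <= b -> `|f i t| <= M.
Proof.
move=> cf.
have /choice[m hm] i : exists m, 0 < m /\ forall t, a <= t <= b -> `|f i t| <= m.
  by have [m m0 hm] := cont_bounded (cf i); exists m.
exists (1 + \sum_i m i).
  by rewrite ltr_wpDr// sumr_ge0// => i _; rewrite ltW// (hm i).1.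
move=> i t tab; apply: (le_trans ((hm i).2 t tab)).
rewrite (bigD1 i)//= addrCA lerDl addr_ge0// sumr_ge0// => j _.
by rewrite ltW// (hm j).1.
Qed.

(* Picard iteration; the contraction factor 1/2 comes from the weight [cosh (2 K (t - t0))]. *)
Lemma picard d (M : 'I_d -> 'I_d -> R -> R) (G : 'I_d -> R -> R) t0 : 0 < t0 < 1 ->
  (forall i j t, 0 < t < 1 -> {for t, continuous (M i j)}) ->
  (forall i t, 0 < t < 1 -> {for t, continuous (G i)}) ->
  exists Z : 'I_d -> R -> R, forall i, Z i t0 = G i t0 /\ forall t, 0 < t < 1 ->
    dv (fun s => Z i s - G i s) t (\sum_j M i j t * Z j t).
Proof.
move=> ht0 cM cG; have /andP[t00 t01] := ht0.
pose T (Z : 'I_d -> R -> R) i t := G i t + prim (fun s => \sum_j M i j s * Z j s) t0 t.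
pose Zs n := iter n T G.
have cMZ (Z : 'I_d -> R -> R) : (forall i t, 0 < t < 1 -> {for t, continuous (Z i)}) ->
    forall i t, 0 < t < 1 -> {for t, continuous (fun s => \sum_j M i j s * Z j s)}.
  by move=> cZ i t ht; apply: cont_sum => j; apply: cvgM; [exact: cM|exact: cZ].
have cZs n i t : 0 < t < 1 -> {for t, continuous (Zs n i)}.
  elim: n i t => [|n IH] i t ht; first exact: cG.
  apply: cvgD; first exact: cG.
  exact: (dv_cont (prim_dv (cMZ _ IH i) ht0 ht)).
have dpr Z i t : (forall i t, 0 < t < 1 -> {for t, continuous (Z i)}) -> 0 < t < 1 ->
    dv (prim (fun s => \sum_j M i j s * Z j s) t0) t (\sum_j M i j t * Z j t).
  by move=> cZ ht; exact: (prim_dv (cMZ Z cZ i) ht0 ht).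
(* The coefficients may be unbounded at 0 and 1, so the constants belong to a window around [t0],
   while the iterates [Zs] are defined on all of (0, 1). *)
have bound a b : 0 < a -> a <= t0 <= b -> b < 1 -> exists K B : R, [/\ 0 < K, 0 < B,
    (forall i t, a <= t <= b -> forall (z : 'I_d -> R) e, (forall j, `|z j| <= e) ->
       `|\sum_j M i j t * z j| <= K * e) &
    forall n i t, a <= t <= b -> `|Zs n.+1 i t - Zs n i t| <= B * 2^-1 ^+ n].
  move=> a0 atb b1.
  have sub t : a <= t <= b -> 0 < t < 1.
    by move=> /andP[h1 h2]; rewrite (lt_le_trans a0 h1) (le_lt_trans h2 b1).
  have [m m0 hm] := @cont_bounded_fam ('I_d * 'I_d)%type (fun ij => M ij.1 ij.2) a b
    (fun ij t h => cM ij.1 ij.2 t (sub t h)).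
  have [B B0 hB] := @cont_bounded_fam 'I_d (fun i t => Zs 1%N i t - Zs 0%N i t) a b
    (fun i t h => cvgB (cZs 1%N i t (sub t h)) (cZs 0%N i t (sub t h))).
  pose K : R := 1 + d%:R * m.
  have K0 : 0 < K by rewrite /K ltr_wpDr// mulr_ge0// ltW.
  have hK i t : a <= t <= b -> forall (z : 'I_d -> R) e, (forall j, `|z j| <= e) ->
       `|\sum_j M i j t * z j| <= K * e.
    move=> tab z e hz; have e0 : 0 <= e by exact: le_trans (normr_ge0 _) (hz i).
    apply: (le_trans (ler_norm_sum _ _ _)).
    apply: (@le_trans _ _ (\sum_(j < d) m * e)).
      by apply: ler_sum => j _; rewrite normrM ler_pM// (hm (i, j)).
    by rewrite sumr_const card_ord -mulr_natl mulrA /K mulrDl lerDr mul1r.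
  pose u t : R := 2 * K * (t - t0).
  pose E t := expR (u t) + expR (- u t).
  pose S t := (expR (u t) - expR (- u t)) / 2.
  have du t : dv u t (2 * K).
    by apply: dv_eq (dvZ (2 * K) (dvB (dv_id t) (dv_cst t0 t))) _; rewrite subr0 mulr1.
  have dS t : dv S t (K * E t).
    have := dvM (dvB (dv_comp (dv_exp _) (du t)) (dv_comp (dv_exp _) (dvN (du t)))) (dv_cst 2^-1 t).
    by move=> h; apply: dv_eq h _; rewrite /E; field.
  have S0 : S t0 = 0 by rewrite /S /u subrr mulr0 oppr0 subrr mul0r.
  have SE t : `|S t| <= E t / 2.
    have h1 := expR_gt0 (u t); have h2 := expR_gt0 (- u t).
    by rewrite /S /E ler_norml; apply/andP; split; order_lra.
  have E1 t : 1 <= E t.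
    have h1 := expR_ge1Dx (u t); have h2 := expR_ge1Dx (- u t).
    by rewrite /E; order_lra.
  have [c c0 hc] : exists2 c, 0 < c & forall t, a <= t <= b -> `|E t| <= c.
    apply: cont_bounded => t _; apply: cvgD.
      exact: (dv_cont (dv_comp (dv_exp _) (du t))).
    exact: (dv_cont (dv_comp (dv_exp _) (dvN (du t)))).
  have key n : forall i t, a <= t <= b -> `|Zs n.+1 i t - Zs n i t| <= B * 2^-1 ^+ n * E t.
    elim: n => [|n IH] i t tab.
      rewrite expr0 mulr1; apply: (le_trans (hB i t tab)).
      by rewrite ler_peMr// ltW.
    pose F s := prim (fun s => \sum_j M i j s * Zs n.+1 j s) t0 s -
                prim (fun s => \sum_j M i j s * Zs n j s) t0 s.
    have -> : Zs n.+2 i t - Zs n.+1 i t = F t by rewrite /Zs !iterS /T /F; ring.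
    have q0 : 0 <= B * 2^-1 ^+ n by rewrite mulr_ge0 ?exprn_ge0// ltW.
    apply: (@le_trans _ _ `|B * 2^-1 ^+ n * S t|); last first.
      rewrite normrM ger0_norm//.
      apply: (@le_trans _ _ (B * 2^-1 ^+ n * (E t / 2))); first by rewrite ler_wpM2l.
      by rewrite exprS [leLHS](_ : _ = B * (2^-1 * 2^-1 ^+ n) * E t)//; ring.
    apply: (@dv_bound F (fun s => \sum_j M i j s * Zs n.+1 j s - \sum_j M i j s * Zs n j s)
      (fun s => B * 2^-1 ^+ n * S s) (fun s => B * 2^-1 ^+ n * (K * E s)) t0 a b) => //.
    - by rewrite /F !prim0 subrr.
    - by rewrite S0 mulr0.
    - move=> s /sub hs; apply: dvB; apply: dpr => //; exact: cZs.
    - by move=> s _; exact: dvZ.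
    - move=> s hs; rewrite -sumrB.
      under eq_bigr do rewrite -mulrBr.
      rewrite mulrCA; apply: hK => // j; exact: IH.
  exists K, (B * c); split => //; first exact: mulr_gt0.
  move=> n i t tab; apply: (le_trans (key n i t tab)).
  rewrite mulrAC ler_wpM2r ?exprn_ge0// ler_wpM2l ?(ltW B0)//.
  exact: le_trans (ler_norm _) (hc t tab).
pose lims i t : set R := [set l | exists C, forall n, `|Zs n i t - l| <= C * 2^-1 ^+ n].
(* The limit is characterized pointwise, without reference to a window, so that the limits obtained
   on different windows are the same function. The default 0 is not reached for [t] in (0, 1). *)
pose Z i t := xget 0 (lims i t).
have lim_uniq i t l l' : lims i t l -> lims i t l' -> l = l'.
  move=> [C hC] [C' hC']; apply/eqP; rewrite -subr_eq0 -normr_le0.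
  apply/ler_addgt0Pr => e e0; rewrite add0r.
  have [n hn] := @geo_small (C + C') e e0.
  have := hC n; have := hC' n; rewrite mulrDl in hn; move: hn.
  move: (C * _) (C' * _) (Zs n i t) => x y z; clear.
  by rewrite !ler_norml => ? /andP[? ?] /andP[? ?]; apply/andP; split; order_lra.
have Zbound a b : 0 < a -> a <= t0 <= b -> b < 1 -> exists2 C, 0 <= C & forall n i t,
    a <= t <= b -> `|Zs n i t - Z i t| <= C * 2^-1 ^+ n.
  move=> a0 atb b1; have [K [B [_ B0 _ hB]]] := bound a b a0 atb b1.
  exists (2 * B) => [|n i t tab]; first by rewrite mulr_ge0// ltW.
  have [l hl] := geo_limit (fun n => hB n i t tab).
  have ll : lims i t l by exists (2 * B).
  have lZ : lims i t (Z i t) by apply: (@xgetPex _ 0 (lims i t)); exists l.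
  by rewrite (lim_uniq i t _ _ lZ ll).
have window t : 0 < t < 1 -> exists a b, [/\ 0 < a, a <= t0 <= b, b < 1 & a < t < b].
  move=> /andP[h0 h1]; exists (Num.min t t0 / 2), ((Num.max t t0 + 1) / 2).
  have m0 : 0 < Num.min t t0 by rewrite lt_min h0.
  have m1 : Num.max t t0 < 1 by rewrite gt_max h1.
  have m2 : Num.min t t0 <= t by rewrite ge_min lexx.
  have m3 : Num.min t t0 <= t0 by rewrite ge_min lexx orbT.
  have m4 : t <= Num.max t t0 by rewrite le_max lexx.
  have m5 : t0 <= Num.max t t0 by rewrite le_max lexx orbT.
  move: m0 m1 m2 m3 m4 m5; move: (Num.min t t0) (Num.max t t0); clear => *.
  by split; try (apply/andP; split); order_lra.
have cZ i t : 0 < t < 1 -> {for t, continuous (Z i)}.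
  move=> ht; have [a [b [a0 atb b1 tab]]] := window t ht.
  have [C C0 hC] := Zbound a b a0 atb b1.
  apply/contP => e e0; have e3 : 0 < e / 3 by order_lra.
  have [n hn] := geo_small C e3.
  have [dl dl0 hd] := (contP _ _).1 (cZs n i t ht) _ e3.
  have /andP[ta tb] := tab.
  exists (Num.min dl (Num.min (t - a) (b - t))); first by rewrite !lt_min dl0 !subr_gt0 ta tb.
  move=> s; rewrite !lt_min => /and3P[s1 s2 s3].
  have sab : a <= s <= b.
    move: s2 s3; clear; rewrite !ltr_norml => /andP[? ?] /andP[? ?].
    by apply/andP; split; order_lra.
  have tab' : a <= t <= b by rewrite !ltW.
  have := hd s s1; have := hC n i s sab; have := hC n i t tab'; move: hn.
  move: (C * _) (Zs n i s) (Zs n i t) (Z i s) (Z i t); clear => c z1 z2 z3 z4 ?.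
  by rewrite !ler_norml !ltr_norml => /andP[? ?] /andP[? ?] /andP[? ?];
    apply/andP; split; order_lra.
exists Z => i.
have fix_ t : 0 < t < 1 -> Z i t = G i t + prim (fun s => \sum_j M i j s * Z j s) t0 t.
  move=> ht; have [a [b [a0 atb b1 /andP[/ltW ta /ltW tb]]]] := window t ht.
  have tab : a <= t <= b by rewrite ta tb.
  have [C C0 hC] := Zbound a b a0 atb b1.
  have [K [B [K0 B0 hK _]]] := bound a b a0 atb b1.
  have sub s : a <= s <= b -> 0 < s < 1.
    by move=> /andP[h1 h2]; rewrite (lt_le_trans a0 h1) (le_lt_trans h2 b1).
  apply/eqP; rewrite -subr_eq0 -normr_le0; apply/ler_addgt0Pr => e e0; rewrite add0r.
  have [n hn] := @geo_small (C + K * C) e e0.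
  pose F s := prim (fun s => \sum_j M i j s * Zs n j s) t0 s -
              prim (fun s => \sum_j M i j s * Z j s) t0 s.
  have q0 : 0 <= C * 2^-1 ^+ n by rewrite mulr_ge0 ?exprn_ge0.
  have hF : `|F t| <= `|K * (C * 2^-1 ^+ n) * (t - t0)|.
    apply: (@dv_bound F (fun s => \sum_j M i j s * Zs n j s - \sum_j M i j s * Z j s)
      (fun s => K * (C * 2^-1 ^+ n) * (s - t0)) (fun=> K * (C * 2^-1 ^+ n)) t0 a b) => //.
    - by rewrite /F !prim0 subrr.
    - by rewrite subrr mulr0.
    - by move=> s /sub hs; apply: dvB; apply: dpr => //; exact: cZs.
    - move=> s _; apply: dv_eq (dvZ _ (dvB (dv_id s) (dv_cst t0 s))) _.
      by rewrite subr0 mulr1.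
    - move=> s hs; rewrite -sumrB.
      under eq_bigr do rewrite -mulrBr.
      by apply: hK => // j; exact: hC.
  have F1 : `|F t| <= K * C * 2^-1 ^+ n.
    apply: (le_trans hF); rewrite normrM ger0_norm; last by rewrite mulr_ge0// ltW.
    rewrite -mulrA ler_piMr//; first by rewrite mulr_ge0// ltW.
    have /andP[h1 h2] := ht; rewrite ler_norml.
    by move: h1 h2 t00 t01; clear => *; apply/andP; split; order_lra.
  have ZS : Zs n.+1 i t = G i t + prim (fun s => \sum_j M i j s * Zs n j s) t0 t by [].
  have := hC n.+1 i t tab.
  have -> : Z i t - (G i t + prim (fun s => \sum_j M i j s * Z j s) t0 t) =
     F t - (Zs n.+1 i t - Z i t) by rewrite ZS /F; ring.
  move=> h; apply: (le_trans (ler_normB _ _)); apply: le_trans (ltW hn).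
  rewrite mulrDl addrC lerD//; apply: (le_trans h); rewrite exprS mulrCA.
  by rewrite ler_piMl//; order_lra.
split; first by rewrite fix_// prim0 addr0.
move=> t ht; apply: (dv_local ht) (dpr Z i t cZ ht) => s hs.
by rewrite fix_// addrC addKr.
Qed.

End LinearODE.

(** * The wave map profile *)
Section Profile.
Variable R : realType.
Implicit Types (t a b C K x y : R) (c : nat -> R).

(* [(n + 1) z^n (y - z) <= y^(n+1)] for [0 <= z < y] turns a convergent series at [y] into a
   bound for the differentiated series at [z]. *)
Lemma pow_diff_le z y n : 0 <= z -> z <= y -> n.+1%:R * z ^+ n * (y - z) <= y ^+ n.+1 - z ^+ n.+1.
Proof.
move=> z0 zy; elim: n => [|n IH]; first by rewrite mul1r expr0 mul1r !expr1.
have y0 : 0 <= y by exact: le_trans zy.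
have zn : 0 <= z ^+ n by rewrite exprn_ge0.
have zn1 : 0 <= z ^+ n.+1 by rewrite exprn_ge0.
rewrite -natr1.
have h1 : y * (n.+1%:R * z ^+ n * (y - z)) <= y * (y ^+ n.+1 - z ^+ n.+1) by rewrite ler_wpM2l.
have h2 : n.+1%:R * z ^+ n.+1 * (y - z) <= y * (n.+1%:R * z ^+ n * (y - z)).
  rewrite exprS; have : 0 <= (y - z) * (n.+1%:R * z ^+ n * (y - z)).
    by rewrite !mulr_ge0// subr_ge0.
  by move: (n.+1%:R : R) (z ^+ n); clear => N Z; order_lra.
rewrite [y ^+ n.+2]exprS [z ^+ n.+2]exprS.
move: h1 h2; move: (n.+1%:R * z ^+ n * (y - z)) (n.+1%:R : R) (z ^+ n.+1) (y ^+ n.+1); clear => *; order_lra.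
Qed.

Lemma cvg_pseries_diffs c K z : cvgn (pseries c K) -> `|z| < `|K| ->
  cvgn (pseries (pseries_diffs c) z).
Proof.
move=> cK zK; pose y := (`|z| + `|K|) / 2.
have z0 := normr_ge0 z.
have [zy yK] : `|z| < y /\ y < `|K| by rewrite /y; split; order_lra.
have y0 : 0 < y by exact: le_lt_trans zy.
have h : cvgn (pseries (fun i => `|c i|) y).
  by apply: is_cvg_pseries_inside_norm cK _; rewrite gtr0_norm.
apply: normed_cvg.
pose b n := (y - `|z|)^-1 * (`|c n.+1| * y ^+ n.+1).
apply: (@series_le_cvg _ _ b) => [n|n|n|].
- exact: normr_ge0.
- by rewrite /b mulr_ge0 ?invr_ge0 ?subr_ge0 ?(ltW zy)// mulr_ge0 ?exprn_ge0// ltW.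
- rewrite /= /pseries_diffs /b normrM (normrM _.+1%:R) normr_nat normrX.
  rewrite ler_pdivlMl ?subr_gt0//.
  have -> : (y - `|z|) * (n.+1%:R * `|c n.+1| * `|z| ^+ n) =
    `|c n.+1| * (n.+1%:R * `|z| ^+ n * (y - `|z|)) by ring.
  rewrite ler_wpM2l//; apply: le_trans (pow_diff_le n z0 (ltW zy)) _.
  by rewrite gerBl exprn_ge0.
- rewrite (_ : series b = (fun n => (y - `|z|)^-1 * (pseries (fun i => `|c i|) y n.+1 - `|c 0%N|))).
    apply: is_cvgMr; apply: is_cvgB; last exact: is_cvg_cst.
    have /cvg_ex[l hl] : cvg (pseries (fun i => `|c i|) y @ \oo) by exact: h.
    by apply: (cvgP l); move: hl; rewrite -cvg_shiftS.
  apply/funext => n; rewrite /series /pseries /series /= /b -mulr_sumr; congr (_ * _).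
  by rewrite big_nat_recl//= expr0 mulr1 addrC addKr.
Qed.

Lemma pseries_dv c K y : cvgn (pseries c K) -> `|y| < `|K| ->
  dv (fun x => limn (pseries c x)) y (limn (pseries (pseries_diffs c) y)).
Proof.
(* Two radii between [|y|] and [|K|]: the once differentiated series converges at [K1], and
   therefore the twice differentiated one at [K2]. *)
move=> cK yK; pose K1 := (`|y| + 2 * `|K|) / 3; pose K2 := (2 * `|y| + `|K|) / 3.
have y0 := normr_ge0 y.
have K10 : 0 < K1 by rewrite /K1; order_lra.
have K20 : 0 < K2 by rewrite /K2; order_lra.
have h1 : cvgn (pseries (pseries_diffs c) K1).
  by apply: cvg_pseries_diffs cK _; rewrite gtr0_norm// /K1; order_lra.
have K12 : `|K2| < `|K1| by rewrite !gtr0_norm// /K1 /K2; order_lra.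
apply: (@pseries_snd_diffs _ c K2 y).
- by apply: is_cvg_pseries_inside cK _; rewrite gtr0_norm// /K2; order_lra.
- exact: is_cvg_pseries_inside h1 K12.
- exact: cvg_pseries_diffs h1 K12.
- by rewrite (gtr0_norm K20) /K2; order_lra.
Qed.

Lemma norm_sin_le x : `|sin x| <= `|x|.
Proof.
have : `|sin x| <= `|x - 0|.
  apply: (@dv_bound R sin cos (fun s => s - 0) (fun=> 1) 0 (- `|x|) `|x|).
  - by rewrite oppr_le0 normr_ge0.
  - exact: sin0.
  - by rewrite subrr.
  - by move=> t _; exact: dv_sin.
  - by move=> t _; apply: dv_eq (dvB (dv_id t) (dv_cst 0 t)) _; rewrite subr0.
  - by move=> t _; rewrite ler_norml cos_geN1 cos_le1.
  - by rewrite -ler_norml.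
by rewrite subr0.
Qed.

Lemma cos2_ge x : 1 - 2 * x ^+ 2 <= cos (2 * x).
Proof.
have -> : cos (2 * x) = 1 - 2 * sin x ^+ 2.
  have -> : 2 * x = x *+ 2 by rewrite mulr_natl.
  by rewrite cos_mulr2n; have := cos2Dsin2 x; move: (cos x) (sin x) => C S; clear; lra.
have := norm_sin_le x; rewrite -(ler_pXn2r (ltn0Sn 1)) ?nnegrE// !real_normK ?num_real//.
by order_lra.
Qed.

End Profile.

(** * Differentiability of the profile, its end point bounds, and the coefficients of the linearized
    equation *)

Section ProfileFacts.
Variable R : realType.
Implicit Types (t a b C K x y : R) (f u p : R -> R).

(** The expansion is given only for arguments in [0, 1], hence on one side at an end point. Its
    convergence at a single point [x1] other than [x0] already makes the power series differentiable
    on a two-sided neighbourhood; [f] agrees with it inside [0, 1]. *)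
Lemma analytic_local f x0 : real_analytic01 f -> 0 <= x0 <= 1 ->
  exists (c : nat -> R) (r : R), [/\ 0 < r,
    forall y, `|y| < r -> dv (fun x => limn (pseries c x)) y (limn (pseries (pseries_diffs c) y)),
    forall y, `|y| < r -> dv (fun x => limn (pseries (pseries_diffs c) x)) y
       (limn (pseries (pseries_diffs (pseries_diffs c)) y)) &
    forall x, 0 <= x <= 1 -> `|x - x0| < r -> f x = limn (pseries c (x - x0))].
Proof.
move=> hf h01; have [r0 r00 [c hc]] := hf x0 h01.
have [x1 [hx1 x1r x10]] : exists x1, [/\ 0 <= x1 <= 1, `|x1 - x0| < r0 & x1 - x0 != 0].
  pose e := Num.min (r0 / 2) 4^-1.
  have e0 : 0 < e by rewrite lt_min divr_gt0//= invr_gt0.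
  have er : e < r0 by rewrite gt_min; apply/orP; left; order_lra.
  have e4 : e <= 4^-1 by rewrite ge_min lexx orbT.
  have /andP[x0a x0b] := h01.
  have [h|h] := leP x0 2^-1.
    exists (x0 + e); rewrite addrAC subrr add0r; split; last exact: lt0r_neq0.
      by apply/andP; split; order_lra.
    by rewrite gtr0_norm.
  exists (x0 - e); rewrite addrAC subrr add0r oppr_eq0 normrN; split; last exact: lt0r_neq0.
    by apply/andP; split; order_lra.
  by rewrite gtr0_norm.
have cK : cvgn (pseries c (x1 - x0)) by apply/cvg_ex; exists (f x1); exact: hc.
pose K := x1 - x0; have K0 : 0 < `|K| by rewrite normr_gt0.
exists c, (`|K| / 2); split; first by rewrite divr_gt0.
- by move=> y hy; apply: pseries_dv cK _; apply: lt_le_trans hy _; rewrite ler_pdivrMr//; order_lra.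
- move=> y hy; apply: (@pseries_dv _ _ (`|K| / 2)).
    by apply: cvg_pseries_diffs cK _; rewrite normrM normr_id gtr0_norm//; order_lra.
  by rewrite normrM normr_id (gtr0_norm (_ : 0 < 2^-1)).
- move=> x hx xr; apply/esym/cvg_lim => //; apply: hc => //.
  by apply: lt_trans x1r; rewrite -/K; order_lra.
Qed.

Lemma analytic_dv f t : real_analytic01 f -> 0 < t < 1 ->
  dv f t (derive1 f t) /\ dv (derive1 f) t (derive1 (derive1 f) t).
Proof.
move=> hf ht; have h01 : 0 <= t <= 1 by move: ht => /andP[? ?]; rewrite !ltW.
have [c [r [r0 h1 h2 h3]]] := analytic_local hf h01.
have /andP[t0 t1] := ht.
pose e := Num.min r (Num.min t (1 - t)).
have e0 : 0 < e by rewrite !lt_min r0 t0 subr_gt0.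
have er : e <= r by rewrite ge_min lexx.
have et : e <= t by rewrite !ge_min lexx orbT.
have et1 : e <= 1 - t by rewrite !ge_min lexx !orbT.
have win y : t - e < y < t + e -> 0 <= y <= 1 /\ `|y - t| < r.
  move=> /andP[? ?]; split; first by apply/andP; split; order_lra.
  by rewrite ltr_norml; apply/andP; split; order_lra.
have sh y : dv (fun s : R => s - t) y 1.
  by apply: dv_eq (dvB (dv_id y) (dv_cst t y)) _; rewrite subr0.
have hd y : t - e < y < t + e -> dv f y (limn (pseries (pseries_diffs c) (y - t))).
  move=> hy; have [_ yr] := win y hy.
  apply: (@dv_local _ (fun s => limn (pseries c (s - t))) f y _ _ _ hy).
    by move=> z /win[z1 z2]; rewrite h3.
  by apply: dv_eq (@dv_comp _ (fun x => limn (pseries c x)) (fun s => s - t) y _ _ (h1 _ yr) (sh y)) _; rewrite mulr1.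
have tt : t - e < t < t + e by rewrite ltrBlDr ltrDl e0.
have [_ tr] := win t tt.
have d1 := hd t tt; split; first by have [_ ->] := (dvP _ _ _).1 d1.
have d2 : dv (derive1 f) t (limn (pseries (pseries_diffs (pseries_diffs c)) (t - t)) * 1).
  apply: (@dv_local _ (fun s => limn (pseries (pseries_diffs c) (s - t))) _ t _ _ _ tt).
    by move=> z /hd /dvP[_ ->].
  exact: (@dv_comp _ (fun x => limn (pseries (pseries_diffs c) x)) (fun s => s - t) t _ _ (h2 _ tr) (sh t)).
by have [_ ->] := (dvP _ _ _).1 d2.
Qed.

(** Covers the end points, where [f] is constrained on one side only and a derivative on the line
    need not exist. *)
Lemma analytic_lip f x0 : real_analytic01 f -> 0 <= x0 <= 1 ->
  exists C r, [/\ 0 < C, 0 < r & forall t, 0 <= t <= 1 -> `|t - x0| < r ->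
    `|f t - f x0| <= C * `|t - x0|].
Proof.
move=> hf h01; have [c [r [r0 h1 _ h3]]] := analytic_local hf h01.
have [d d0 hd] := (dv_epsP _ _ _).1 (h1 0 ltac:(by rewrite normr0)) 1 ltr01.
set g := limn (pseries (pseries_diffs c) 0) in hd.
exists (`|g| + 1), (Num.min r d); split; [by rewrite ltr_wpDl|by rewrite lt_min r0|].
move=> t ht; rewrite lt_min => /andP[tr td].
rewrite (h3 t ht tr) (h3 x0 h01) ?subrr ?normr0//.
have := hd (t - x0); rewrite subr0 => /(_ td).
set A := limn (pseries c (t - x0)) - _ => h.
have -> : A = (A - g * (t - x0)) + g * (t - x0) by ring.
apply: (le_trans (ler_normD _ _)); rewrite normrM mulrDl mul1r addrC lerD2l.
by rewrite mul1r in h.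
Qed.

(** The data extracted from the profile: its equation multiplied by [t^2], in divergence form,
    linear bounds for [f] at 0 and for [f - pi / 2] at 1 in place of analyticity, and the zeros of
    [theta_n], which are those of [f']. *)
Definition wave_profile f (f1 : R -> R) (n : nat) : Prop :=
  [/\ forall t, 0 < t < 1 -> dv f t (f1 t),
      forall t, 0 < t < 1 -> dv (fun s => s ^+ 2 * f1 s) t (sin (2 * f t) / (1 - t ^+ 2)),
      exists C r, [/\ 0 < C, 0 < r < 1 & forall t, 0 < t < r -> `|f t| <= C * t],
      exists C r, [/\ 0 < C, 0 < r < 1 & forall t, r < t < 1 -> `|f t - pi / 2| <= C * (1 - t)] &
      exactly_n_points n (fun t => 0 < t < 1 /\ f1 t = 0)].

Lemma wm_wave_profile f n : wm_profile n f -> wave_profile f (derive1 f) n.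
Proof.
move=> [hf [ode [f0 [f1 [_ hz]]]]]; split.
- by move=> t ht; have [] := analytic_dv hf ht.
- move=> t ht; have [d1 d2] := analytic_dv hf ht.
  apply: dv_eq (dvM (dvX 2 (dv_id t)) d2) _.
  have /andP[t0 t1] := ht; have := ode t ht.
  move: (derive1 (derive1 f) t) (derive1 f t) (sin _) => F2 F1 S /=; rewrite expr1 => h.
  have t20 : 1 - t ^+ 2 != 0 by rewrite gt_eqF//; nra.
  have tn : t != 0 by rewrite gt_eqF.
  have -> : F2 = S / (t ^+ 2 * (1 - t ^+ 2)) - 2 / t * F1 by order_lra.
  by field; rewrite t20 tn.
- have h00 : 0 <= (0 : R) <= 1 by rewrite lexx ler01.
  have [C [r [C0 r0 h]]] := analytic_lip hf h00.
    exists C, (Num.min r 2^-1); split => //.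
      by rewrite lt_min r0 gt_min /=; apply/andP; split; [|apply/orP; right]; order_lra.
    move=> t /andP[t0]; rewrite lt_min => /andP[tr t2].
    by have := h t; rewrite subr0 f0 subr0 (gtr0_norm t0); apply => //; apply/andP; split; order_lra.
- have h11 : 0 <= (1 : R) <= 1 by rewrite lexx ler01.
  have [C [r [C0 r0 h]]] := analytic_lip hf h11.
    exists C, (Num.max (1 - r) 2^-1); split => //.
      by rewrite lt_max gt_max; apply/andP; split; [apply/orP; right|apply/andP; split]; order_lra.
    move=> t /andP[+ t1]; rewrite gt_max => /andP[tr t2].
    have e : `|t - 1| = 1 - t by rewrite ltr0_norm; order_lra.
    have := h t; rewrite e f1; apply; first by apply/andP; split; order_lra.
    order_lra.
- have [s [s1 s2 s3]] := hz; exists s; split => // x; rewrite s3; split.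
    move=> [hx /eqP]; rewrite !mulf_eq0 => /orP[/orP[]|/eqP//].
      by rewrite gt_eqF//; case/andP: hx.
    by rewrite sqrtr_eq0 => h; move: hx h => /andP[? ?] ?; exfalso; nra.
  by move=> [hx ->]; rewrite mulr0.
Qed.

(** Equal to [2 + w (g - a)], with the factors [t^2] cancelled, so that [A_n u = a u] reads
    [(t^2 u')' = Qc u]. *)
Definition Qc f a t := (2 * cos (2 * f t) * (1 - t ^+ 2) - t ^+ 2) / (1 - t ^+ 2) ^+ 2 - a * weight t.

Definition rsol f a u p := forall t, 0 < t < 1 ->
  dv u t (p t / t ^+ 2) /\ dv p t (Qc f a t * u t).

Lemma sub_sqr_gt0 t : 0 < t < 1 -> 0 < 1 - t ^+ 2.
Proof. by move=> /andP[? ?]; nra. Qed.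

Lemma weight_gt0 t : 0 < t < 1 -> 0 < weight t.
Proof.
move=> h; rewrite /weight divr_gt0// exprn_gt0//; first by case/andP: h.
exact: sub_sqr_gt0.
Qed.

Lemma weight_ge t : 0 < t < 1 -> t ^+ 2 <= weight t.
Proof.
move=> h; have h1 := sub_sqr_gt0 h; have /andP[t0 t1] := h.
rewrite /weight ler_pdivlMr ?exprn_gt0//.
by rewrite ler_piMr ?sqr_ge0// expr_le1 ?ltW//; nra.
Qed.

Lemma cont_X2 t : {for t, continuous (fun s : R => s ^+ 2)}.
Proof. exact: (dv_cont (dvX 2 (dv_id t))). Qed.

Lemma cont_1X2 t : {for t, continuous (fun s : R => 1 - s ^+ 2)}.
Proof. exact: (dv_cont (dvB (dv_cst 1 t) (dvX 2 (dv_id t)))). Qed.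

Lemma cont_div f (g : R -> R) t : g t != 0 -> {for t, continuous f} -> {for t, continuous g} ->
  {for t, continuous (fun s : R => f s / g s)}.
Proof. by move=> g0 cf cg; apply: cvgM => //; apply: cvgV. Qed.

Lemma cont_weight t : 0 < t < 1 -> {for t, continuous (@weight R)}.
Proof.
move=> h; apply: cont_div; last 2 first.
- exact: cont_X2.
- exact: (dv_cont (dvX 2 (dvB (dv_cst 1 t) (dvX 2 (dv_id t))))).
- by rewrite expf_neq0// gt_eqF// sub_sqr_gt0.
Qed.

End ProfileFacts.

(** * The coefficient and the derivative of the profile near 0 *)

Section ZeroEnergy.
Variable R : realType.
Implicit Types (t a b C K x y : R) (f u p : R -> R).

Lemma cont_cos2f f f1 n t : wave_profile f f1 n -> 0 < t < 1 ->
  {for t, continuous (fun s => cos (2 * f s))}.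
Proof.
move=> [h _ _ _ _] ht; exact: (dv_cont (dv_comp (dv_cos _) (dvZ 2 (h t ht)))).
Qed.

Lemma cont_Qc f f1 n a t : wave_profile f f1 n -> 0 < t < 1 -> {for t, continuous (Qc f a)}.
Proof.
move=> wp ht; apply: cvgB; last first.
  by apply: cvgM; [exact: cvg_cst|exact: cont_weight].
apply: (@cont_div R (fun s => 2 * cos (2 * f s) * (1 - s ^+ 2) - s ^+ 2)
  (fun s => (1 - s ^+ 2) ^+ 2) t).
- by rewrite expf_neq0// gt_eqF// sub_sqr_gt0.
- apply: cvgB; last exact: cont_X2.
  apply: cvgM; last exact: cont_1X2.
  by apply: cvgM; [exact: cvg_cst|exact: cont_cos2f wp ht].
- exact: (dv_cont (dvX 2 (dvB (dv_cst 1 t) (dvX 2 (dv_id t))))).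
Qed.

(** The coefficient tends to 2 at 0, because [f] is of order [t] and the weight vanishes there. The
    bound by 1 serves the positivity arguments near 0, the bound by the weight the energy estimate
    for Dirichlet solutions. *)
Lemma Qc_ge f f1 n a : wave_profile f f1 n -> exists t1, [/\ 0 < t1, t1 < 1 &
  forall t, 0 < t <= t1 -> 1 <= Qc f a t /\ weight t <= Qc f a t].
Proof.
move=> [_ _ [C [r [C0 /andP[r0 r1] hC]]] _ _].
(* [D] collects the coefficients of [t^2] in the corrections to the limit; together they stay below
   1/8 for [t <= e]. *)
pose D := 2 + 4 * C ^+ 2 + 4 * `|a|.
have D0 : 0 < D by rewrite /D; have := sqr_ge0 C; have := normr_ge0 a; order_lra.
pose e := Num.min (r / 2) (Num.min 2^-1 (4 * D)^-1).
have D4 : 0 < (4 * D)^-1 by rewrite invr_gt0; order_lra.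
have e0 : 0 < e by rewrite !lt_min D4 andbT; apply/andP; split; order_lra.
have er : e <= r / 2 by rewrite ge_min lexx.
have e2 : e <= 2^-1 by rewrite !ge_min lexx orbT.
have eD : e <= (4 * D)^-1 by rewrite !ge_min lexx !orbT.
exists e; split => //; first by order_lra.
move=> t /andP[t0 te].
have t2 : t <= 2^-1 by order_lra.
have tD : 4 * D * t <= 1.
  have : t <= (4 * D)^-1 by exact: le_trans eD.
  by rewrite -div1r ler_pdivlMr ?mulr_gt0// mulrC.
have fC : f t ^+ 2 <= C ^+ 2 * t ^+ 2.
  rewrite -exprMn -real_normK ?num_real// lerXn2r ?nnegrE//; last first.
    by apply: hC; apply/andP; split; order_lra.
  by rewrite mulr_ge0// ltW.
have c2 := cos2_ge (f t); have c1 := cos_le1 (2 * f t).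
have w0 : weight t <= 2 * t ^+ 2.
  rewrite /weight ler_pdivrMr; last by rewrite exprn_gt0//; nra.
  have st2 := sqr_ge0 t; have T4 : t ^+ 2 <= 4^-1 by nra.
  have h : 2^-1 <= (1 - t ^+ 2) ^+ 2 by move: T4 st2; move: (t ^+ 2); clear => *; nra.
  by move: h st2; move: ((1 - t ^+ 2) ^+ 2) (t ^+ 2); clear => *; nra.
have wp : 0 <= weight t by rewrite ltW// weight_gt0//; apply/andP; split; order_lra.
have aw : a * weight t <= `|a| * (2 * t ^+ 2).
  by apply: (@le_trans _ _ (`|a| * weight t)); [rewrite ler_wpM2r// ler_norm|rewrite ler_wpM2l].
have tt : 4 * D * t ^+ 2 <= 2^-1 by rewrite expr2 mulrA; nra.
have sC := sqr_ge0 C; have a0 := normr_ge0 a; have st := sqr_ge0 t.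
have small : 2 * t ^+ 2 + 4 * (C ^+ 2 * t ^+ 2) + 4 * (`|a| * t ^+ 2) <= 8^-1.
  by move: tt; rewrite /D; move: (t ^+ 2) (C ^+ 2) (`|a|); clear => *; order_lra.
have nn : 0 <= C ^+ 2 * t ^+ 2 /\ 0 <= `|a| * t ^+ 2 by split; rewrite mulr_ge0.
have num1 : 5 / 4 <= (2 * cos (2 * f t) * (1 - t ^+ 2) - t ^+ 2) / (1 - t ^+ 2) ^+ 2.
  rewrite ler_pdivlMr; last by rewrite exprn_gt0//; nra.
  case: nn => n1 n2; move: small c2 c1 fC st n1 n2.
  move: (cos (2 * f t)) (f t ^+ 2) (C ^+ 2 * t ^+ 2) (`|a| * t ^+ 2) (t ^+ 2); clear => c F X Y T.
  move=> *; have : T <= 16^-1 by order_lra.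
  have : 3 / 4 <= c by order_lra.
  by nra.
rewrite /Qc; case: nn => n1 n2; move: num1 aw w0 small n1 n2 wp; move: (_ / _ ^+ 2) (weight t) => q w.
move: (a * w) (`|a|) (t ^+ 2) (C ^+ 2); clear => *; split; order_lra.
Qed.

(* [P = t^2 f'] satisfies [P' = sin (2 f) / (1 - t^2)], so it is Lipschitz at both end points. *)
Lemma P_near0 f f1 n : wave_profile f f1 n -> exists C r, [/\ 0 < C, 0 < r < 1 &
  forall t, 0 < t < r -> `|t ^+ 2 * f1 t| <= C * t ^+ 2].
Proof.
move=> [h1 h2 [C [r [C0 /andP[r0 r1] hC]]] _ _].
pose P t := t ^+ 2 * f1 t.
exists (2 * C), (Num.min r 2^-1); split; first by rewrite mulr_gt0.
  by rewrite lt_min r0 gt_min r1 /= andbT invr_gt0.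
move=> t /andP[t0]; rewrite lt_min => /andP[tr t2]; rewrite leNgt -/(P t); apply/negP => hP.
have lip s : 0 < s -> s <= t -> `|P t - P s| <= 2 * C * t ^+ 2.
  move=> s0 st.
  have sub x : s <= x <= t -> 0 < x < 1 by move=> /andP[? ?]; apply/andP; split; order_lra.
  have hb x : s < x < t -> `|sin (2 * f x) / (1 - x ^+ 2)| <= 4 * C * x.
    move=> /andP[sx xt]; have x1 : x ^+ 2 < 4^-1 by rewrite expr2; nra.
    have := hC x ltac:(apply/andP; split; order_lra) => fx.
    rewrite normrM normfV (gtr0_norm (_ : 0 < 1 - x ^+ 2)); last order_lra.
    rewrite ler_pdivrMr; last order_lra.
    apply: (le_trans (norm_sin_le _)); rewrite normrM (gtr0_norm (_ : 0 < 2))//.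
    have : 0 <= C * x by rewrite mulr_ge0//; order_lra.
    by move: fx x1; move: (`|f x|) (x ^+ 2) => F X; clear -C0 => *; nra.
  have dx x : dv (fun x => 2 * C * x ^+ 2) x (4 * C * x).
    by apply: dv_eq (dvZ (2 * C) (dvX 2 (dv_id x))) _; rewrite /= expr1; ring.
  have l1 := dv_le st (fun x hx => h2 x (sub x hx)) (fun x _ => dx x)
    (fun x hx => le_trans (ler_norm _) (hb x hx)).
  have l2 := dv_le st (fun x hx => dvN (h2 x (sub x hx))) (fun x _ => dx x)
    (fun x hx => le_trans (ler_norm _) (eq_rect_r (fun z => z <= _) (hb x hx) (normrN _))).
  have : 0 <= C * s ^+ 2 by rewrite mulr_ge0 ?sqr_ge0// ltW.
  by move: l1 l2; rewrite -/(P t) -/(P s) ler_norml; clear => *; apply/andP; split; order_lra.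
(* If the bound failed at [t], the estimate [lip] would give [|P| >= eta] on all of (0, [t]]; then
   [|f'|] would be at least [eta / s^2] and [f] unbounded at 0. *)
pose eta := `|P t| - 2 * C * t ^+ 2.
have eta0 : 0 < eta by rewrite subr_gt0.
have big s : 0 < s -> s <= t -> eta <= P s * Num.sg (P t).
  move=> s0 st; have := lip s s0 st; rewrite /eta.
  have [pt|pt|pt] := ltrgt0P (P t).
  - by rewrite gtr0_sg// ler_norml => /andP[? ?]; order_lra.
  - by rewrite ltr0_sg// ler_norml => /andP[? ?]; order_lra.
  - by move: hP; rewrite pt normr0 => hP; have := sqr_ge0 t; nra.
(* So small that [eta / s] exceeds [eta / t + 2 C t], the bound that follows from [|f| <= C t]. *)
pose s := Num.min (t / 2) (eta / (2 * C * t + 2 * eta / t + 1)).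
have den : 0 < 2 * C * t + 2 * eta / t + 1.
  by rewrite ltr_wpDl// addr_ge0// ?mulr_ge0 ?invr_ge0// ltW.
have s0 : 0 < s by rewrite lt_min !divr_gt0.
have st : s <= t by rewrite ge_min; apply/orP; left; order_lra.
have sden : s * (2 * C * t + 2 * eta / t + 1) <= eta.
  by rewrite -ler_pdivlMr// ge_min lexx orbT.
have sub x : s <= x <= t -> 0 < x < 1 by move=> /andP[? ?]; apply/andP; split; order_lra.
have l := @dv_le R (fun x => - (eta * x^-1)) (fun x => eta / x ^+ 2) (fun x => Num.sg (P t) * f x)
   (fun x => Num.sg (P t) * f1 x) s t st.
have {l} : - (eta * t^-1) - - (eta * s^-1) <= Num.sg (P t) * f t - Num.sg (P t) * f s.
  apply: l.
  - move=> x /sub /andP[x0 _].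
    apply: dv_eq (dvN (dvZ eta (dvV _ (dv_id x)))) _; first by rewrite gt_eqF.
    by rewrite mulN1r mulrN opprK.
  - by move=> x /sub hx; apply: dvZ; exact: h1.
  - move=> x /andP[sx xt]; have x0 : 0 < x by order_lra.
    rewrite ler_pdivrMr ?exprn_gt0//.
    by have := big x x0 (ltW xt); rewrite /P; order_lra.
have ft := hC t ltac:(apply/andP; split; order_lra).
have fs := hC s ltac:(apply/andP; split; order_lra).
have sgb x : `|Num.sg (P t) * x| <= `|x|.
  by rewrite normrM normr_sg; case: (P t != 0); rewrite ?mul1r ?mul0r.
have := le_trans (sgb (f t)) ft; have := le_trans (sgb (f s)) fs.
rewrite !ler_norml => /andP[k1 k2] /andP[k3 k4] k5.
have k6 : eta * s^-1 <= eta * t^-1 + 2 * C * t.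
  have : C * s <= C * t by rewrite ler_wpM2l// ltW.
  order_lra.
have k7 : eta <= s * (eta * t^-1 + 2 * C * t).
  by rewrite -ler_pdivrMl// mulrC.
have : 0 < s * (eta / t + 1) by rewrite mulr_gt0// ltr_wpDl// divr_ge0 ?ltW.
by move: k7 sden; clear => *; order_lra.
Qed.

(** The finitely many zeros stay away from 1. This is how vanishing of [f'] near 1 is excluded. *)
Lemma infinite_zeros n (f : R -> R) r : r < 1 ->
  exactly_n_points n (fun t => 0 < t < 1 /\ f t = 0) ->
  ~ (forall t, 0 < t < 1 -> r < t -> f t = 0).
Proof.
move=> r1 [s [_ _ hs]] h0.
have [m [m1 m0 rm hm]] : exists m, [/\ m < 1, 0 < m, r < m & forall x, x \in s -> x <= m].
  have : forall x, x \in s -> x < 1 by move=> x /hs[/andP[]].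
  elim: s {hs} => [_|x s IH hx].
    pose m := Num.max r 0; exists ((m + 1) / 2).
    have : r <= m by rewrite le_max lexx.
    have : 0 <= m by rewrite le_max lexx orbT.
    have : m < 1 by rewrite gt_max r1 ltr01.
    by clearbody m; clear => *; split => //; order_lra.
  have [|m [m1 m0 rm hm]] := IH; first by move=> y ys; apply: hx; rewrite inE ys orbT.
  exists (Num.max m x); split.
  - by rewrite gt_max m1 hx// mem_head.
  - by rewrite lt_max m0.
  - by rewrite lt_max rm.
  - by move=> y; rewrite inE le_max => /predU1P[->|/hm->//]; rewrite lexx orbT.
have hx : 0 < (m + 1) / 2 < 1 by apply/andP; split; order_lra.
have /hs/hm : 0 < (m + 1) / 2 < 1 /\ f ((m + 1) / 2) = 0.
  by split => //; apply: h0 => //; order_lra.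
order_lra.
Qed.

End ZeroEnergy.

(** * The derivative of the profile near 1, and the zero energy mode *)

Section ZeroMode.
Variable R : realType.
Implicit Types (t a b C K x y : R) (f u p : R -> R).

Lemma dv_abs_le (F dF G dG : R -> R) a b : a <= b ->
  (forall x, a <= x <= b -> dv F x (dF x)) -> (forall x, a <= x <= b -> dv G x (dG x)) ->
  (forall x, a < x < b -> `|dF x| <= dG x) -> `|F b - F a| <= G b - G a.
Proof.
move=> ab hF hG h.
have l1 := dv_le ab hF hG (fun x hx => le_trans (ler_norm _) (h x hx)).
have l2 := dv_le ab (fun x hx => dvN (hF x hx)) hG
  (fun x hx => le_trans (ler_norm _) (eq_rect_r (fun z => z <= _) (h x hx) (normrN _))).
by rewrite ler_norml; apply/andP; split; order_lra.
Qed.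

Lemma le_lim1 x y K t : t < 1 -> 0 <= K -> (forall s, t < s < 1 -> x <= y + K * (1 - s)) -> x <= y.
Proof.
move=> t1 K0 h; apply/ler_addgt0Pr => e e0.
pose d := Num.min ((1 - t) / 2) (e / (K + 1)).
have K1 : 0 < K + 1 by rewrite ltr_wpDl.
have d0 : 0 < d by rewrite lt_min !divr_gt0// subr_gt0.
have dt : d <= (1 - t) / 2 by rewrite ge_min lexx.
have de : d * (K + 1) <= e by rewrite -ler_pdivlMr// ge_min lexx orbT.
have hd := h (1 - d) ltac:(apply/andP; split; lra).
have Kd : K * d <= e by rewrite mulrDr mulr1 in de; order_lra.
by order_lra.
Qed.

Lemma sin2_pi2 x : `|sin (2 * x)| <= 2 * `|x - pi / 2|.
Proof.
have -> : 2 * x = 2 * (x - pi / 2) + pi by order_lra.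
by rewrite sinDpi normrN; apply: le_trans (norm_sin_le _) _; rewrite normrM ger0_norm.
Qed.

(** A uniqueness statement at the singular point 1. [P] is Lipschitz, so if it is not bounded away
    from 0 near 1, then [|P| <= B (1 - t)]. This yields [|f - pi / 2| <= 2 B (1 - t)^2] and, through
    the equation for [P'], the same bound for [P] with [B / 2]. By iteration [P] vanishes near 1,
    against the finite number of zeros of [f']. *)
Lemma P_near1 f f1 n : wave_profile f f1 n -> exists k B r, [/\ 0 < k, 0 < r < 1 &
  forall t, r < t < 1 -> k <= `|t ^+ 2 * f1 t| <= B].
Proof.
move=> [h1 h2 _ [C [r0 [C0 /andP[r00 r01] hC]]] hz].
pose P t := t ^+ 2 * f1 t.
(* Beyond 3/4 one has [1 - t <= 1/4], which turns [2 B (1 - t)^2] into at most half of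
   [B (1 - t)]. *)
pose r := Num.max r0 (3 / 4).
have r1 : r < 1 by rewrite gt_max r01; order_lra.
have rr0 : r0 <= r by rewrite le_max lexx.
have r34 : 3 / 4 <= r by rewrite le_max lexx orbT.
have dP' B t : r < t < 1 -> `|f t - pi / 2| <= B * (1 - t) ->
   `|sin (2 * f t) / (1 - t ^+ 2)| <= 2 * B.
  move=> /andP[rt t1] hB.
  have tt : 0 < 1 - t ^+ 2 by nra.
  rewrite normrM normfV (gtr0_norm tt) ler_pdivrMr//.
  apply: (le_trans (sin2_pi2 _)).
  have B0 : 0 <= B * (1 - t) by exact: le_trans (normr_ge0 _) hB.
  have : B * (1 - t) * 1 <= B * (1 - t) * (1 + t) by rewrite ler_wpM2l//; order_lra.
  by move: hB; clear; rewrite expr2; order_lra.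
have lip s t : r < s -> s <= t -> t < 1 -> `|P t - P s| <= 2 * C * (t - s).
  move=> rs st t1; rewrite mulrBr.
  apply: (@dv_abs_le P (fun x => sin (2 * f x) / (1 - x ^+ 2)) (fun x => 2 * C * x) (fun=> 2 * C)) => //.
  - by move=> x /andP[? ?]; apply: h2; apply/andP; split; order_lra.
  - by move=> x _; apply: dv_eq (dvZ (2 * C) (dv_id x)) _; rewrite mulr1.
  - by move=> x /andP[? ?]; apply: dP'; [apply/andP; split; order_lra|apply: hC; apply/andP; split; order_lra].
have [k [r' [k0 rr' r'1 hk]]] : exists k r', [/\ 0 < k, r < r', r' < 1 &
    forall t, r' < t < 1 -> k <= `|P t|].
  apply: contrapT => hn.
  have small k r' : 0 < k -> r < r' -> r' < 1 -> exists2 t, r' < t < 1 & `|P t| < k.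
    move=> k0 rr' r'1; apply: contrapT => h; apply: hn; exists k, r'; split => // t ht.
    by rewrite leNgt; apply/negP => h'; apply: h; exists t.
  have H0 t : r < t < 1 -> `|P t| <= 2 * C * (1 - t).
    move=> /andP[rt t1]; apply/ler_addgt0Pr => e e0.
    have [s /andP[ts s1] Ps] := small e t e0 rt t1.
    have := lip t s rt (ltW ts) s1; rewrite ler_norml => /andP[? ?].
    have : 2 * C * (s - t) <= 2 * C * (1 - t) by rewrite ler_wpM2l//; order_lra.
    move: Ps; rewrite ltr_norml => /andP[? ?] ?.
    by rewrite ler_norml; apply/andP; split; order_lra.
  have Hn m t : r < t < 1 -> `|P t| <= 2 * C * 2^-1 ^+ m * (1 - t).
    elim: m t => [|m IH] t ht; first by rewrite expr0 mulr1; exact: H0.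
    set B := 2 * C * 2^-1 ^+ m in IH.
    have B0 : 0 <= B by rewrite /B !mulr_ge0 ?exprn_ge0// ltW.
    have -> : 2 * C * 2^-1 ^+ m.+1 = B / 2 by rewrite /B exprS; field.
    have hf s : r < s < 1 -> `|f s - pi / 2| <= 2 * B * (1 - s) ^+ 2.
      move=> /andP[rs s1]; apply: (le_lim1 s1 (ltW C0)) => z /andP[sz z1].
      have : `|f z - f s| <= - 2 * B * (1 - z) ^+ 2 - (- 2 * B * (1 - s) ^+ 2).
        apply: (@dv_abs_le f f1 (fun x => - 2 * B * (1 - x) ^+ 2) (fun x => 4 * B * (1 - x)) s z (ltW sz)).
        - by move=> x /andP[? ?]; apply: h1; apply/andP; split; order_lra.
        - move=> x _; apply: dv_eq (dvZ (- 2 * B) (dvX 2 (dvB (dv_cst 1 x) (dv_id x)))) _.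
          by rewrite /= expr1; ring.
        - move=> x /andP[sx xz]; have := IH x ltac:(apply/andP; split; order_lra).
          rewrite /P normrM (ger0_norm (sqr_ge0 x)) => hx.
          have x2 : 4^-1 <= x ^+ 2 by nra.
          have := normr_ge0 (f1 x); move: hx x2; move: (x ^+ 2) (`|f1 x|) => X F; clear -B0.
          by nra.
      have := hC z ltac:(apply/andP; split; order_lra); have : 0 <= B * (1 - z) ^+ 2 by rewrite mulr_ge0 ?sqr_ge0.
      rewrite !ler_norml; clear => ? /andP[? ?] /andP[? ?].
      by apply/andP; split; order_lra.
    move: ht => /andP[rt t1]; apply: (le_lim1 t1 B0) => z /andP[tz z1].
    have : `|P z - P t| <= - 2 * B * (1 - z) ^+ 2 - (- 2 * B * (1 - t) ^+ 2).
      apply: (@dv_abs_le P (fun x => sin (2 * f x) / (1 - x ^+ 2)) (fun x => - 2 * B * (1 - x) ^+ 2)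
        (fun x => 4 * B * (1 - x)) t z (ltW tz)).
      - by move=> x /andP[? ?]; apply: h2; apply/andP; split; order_lra.
      - move=> x _; apply: dv_eq (dvZ (- 2 * B) (dvX 2 (dvB (dv_cst 1 x) (dv_id x)))) _.
        by rewrite /= expr1; ring.
      - move=> x /andP[tx xz]; have hx : r < x < 1 by apply/andP; split; order_lra.
        have h' : `|f x - pi / 2| <= 2 * B * (1 - x) * (1 - x).
          by have := hf x hx; rewrite expr2 mulrA.
        by have := dP' _ x hx h'; clear; lra.
    have := IH z ltac:(apply/andP; split; order_lra); have : 0 <= B * (1 - z) ^+ 2 by rewrite mulr_ge0 ?sqr_ge0.
    have : B * (1 - t) ^+ 2 <= B * (1 - t) / 4.
      have q : (1 - t) ^+ 2 <= (1 - t) / 4 by rewrite expr2 ler_wpM2l//; order_lra.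
      by rewrite -mulrA ler_wpM2l.
    rewrite !ler_norml; clear => ? ? /andP[? ?] /andP[? ?].
    by apply/andP; split; order_lra.
  apply: (infinite_zeros r1 hz) => t ht rt; have /andP[t0 t1] := ht.
  have : P t = 0.
    apply/eqP; rewrite -normr_le0; apply/ler_addgt0Pr => e e0; rewrite add0r.
    have [m hm] := geo_small (2 * C) e0.
    apply: le_trans (ltW hm); apply: (le_trans (Hn m t ltac:(apply/andP; split; order_lra))).
    by rewrite ler_piMr ?mulr_ge0 ?exprn_ge0// ?ltW//; order_lra.
  by move/eqP; rewrite mulf_eq0 expf_eq0 /= gt_eqF// => /eqP.
have hs : r < (r' + 1) / 2 < 1 by apply/andP; split; order_lra.
exists k, (`|P r'| + 2 * C), r'; split => //; first by apply/andP; split; order_lra.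
move=> t /andP[rt t1]; rewrite -/(P t) hk ?rt//=.
have := lip r' t rr' (ltW rt) t1 => hl.
have -> : P t = P r' + (P t - P r') by ring.
apply: (le_trans (ler_normD _ _)); rewrite lerD2l; apply: (le_trans hl).
by rewrite ler_piMr ?mulr_ge0 ?(ltW C0)//; order_lra.
Qed.

Definition zmode f1 t : R := t * Num.sqrt (1 - t ^+ 2) * f1 t.
(** This is [t^2] times the derivative of [zmode f1], with [f''] eliminated by the equation of the
    profile. *)
Definition zmode_p f f1 t : R := t / Num.sqrt (1 - t ^+ 2) * (sin (2 * f t) - t * f1 t).

(* [(sinh x) d_x f] solves the linearized equation at zero energy, [rho = tanh x]. *)
Lemma zmode_rsol f f1 n : wave_profile f f1 n -> rsol f 0 (zmode f1) (zmode_p f f1).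
Proof.
move=> [h1 h2 _ _ _] t ht; have t2 := sub_sqr_gt0 ht; have /andP[t0 t1] := ht.
have tn : t != 0 by rewrite gt_eqF.
pose P t := t ^+ 2 * f1 t.
have s0 : 0 < Num.sqrt (1 - t ^+ 2) by rewrite sqrtr_gt0.
have sn : Num.sqrt (1 - t ^+ 2) != 0 by rewrite gt_eqF.
have ss : Num.sqrt (1 - t ^+ 2) ^+ 2 = 1 - t ^+ 2 by rewrite sqr_sqrtr// ltW.
have ds : dv (fun x => Num.sqrt (1 - x ^+ 2)) t (- t / Num.sqrt (1 - t ^+ 2)).
  apply: dv_eq (@dv_comp _ Num.sqrt (fun x => 1 - x ^+ 2) t _ _ (is_derive1_sqrt t2)
    (dvB (dv_cst 1 t) (dvX 2 (dv_id t)))) _.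
  by rewrite /= expr1; field.
have dP : dv P t (sin (2 * f t) / (1 - t ^+ 2)) by exact: h2.
have df := h1 t ht.
have win x : 0 < x < 1 -> x != 0 by move=> /andP[? _]; rewrite gt_eqF.
have dti : dv (fun x => x^-1) t (- 1 / t ^+ 2) by exact: dvV tn (dv_id t).
have dsi : dv (fun x => (Num.sqrt (1 - x ^+ 2))^-1) t (- (- t / Num.sqrt (1 - t ^+ 2)) / Num.sqrt (1 - t ^+ 2) ^+ 2).
  exact: (@dvV _ (fun x => Num.sqrt (1 - x ^+ 2)) t _ sn ds).
have dsin : dv (fun x => sin (2 * f x)) t (cos (2 * f t) * (2 * f1 t)).
  exact: dv_comp (dv_sin _) (dvZ 2 df).
split.
- apply: (@dv_local _ (fun x => P x * x^-1 * Num.sqrt (1 - x ^+ 2)) _ t _ 0 1 ht).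
    by move=> x /win xn; rewrite /P /zmode; field.
  apply: dv_eq (dvM (dvM dP dti) ds) _.
  rewrite /zmode_p /P; move: sn ss; move: (Num.sqrt _) (sin _) (f1 t) => S Z F sn ss; rewrite -ss.
  transitivity (Z / (S * t) - F * (S ^+ 2 + t ^+ 2) / S); first by field; rewrite sn tn.
  by rewrite ss subrK; field; rewrite sn tn.
- apply: (@dv_local _ (fun x => x * (Num.sqrt (1 - x ^+ 2))^-1 * (sin (2 * f x) - P x * x^-1)) _ t _ 0 1 ht).
    by move=> x /win xn; rewrite /P /zmode_p; congr (_ * (_ - _)); field.
  apply: dv_eq (dvM (dvM (dv_id t) dsi) (dvB dsin (dvM dP dti))) _.
  rewrite /zmode /Qc /P mul0r subr0.
  move: sn ss; move: (Num.sqrt _) (sin _) (cos _) (f1 t) => S Z c F sn ss.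
  rewrite -ss.
  transitivity ((S ^+ 2 + t ^+ 2) / S ^+ 3 * (Z - t * F) + 2 * c * t * F / S - Z / S ^+ 3 + t * F / S).
    by field; rewrite sn tn.
  have e : t ^+ 2 = 1 - S ^+ 2 by rewrite ss opprB addrC subrK.
  by rewrite {1}ss subrK e; field.
Qed.

End ZeroMode.

(** * Solutions of the eigenvalue equation *)
Section Solutions.
Variable R : realType.
Implicit Types (t a b C K x y : R) (f u p h : R -> R).

Local Lemma and4_2 (A B C D : Prop) : [/\ A, B, C & D] -> B. Proof. by case. Qed.
Local Lemma and4_4 (A B C D : Prop) : [/\ A, B, C & D] -> D. Proof. by case. Qed.

(* Real and imaginary parts of a solution for [lambda = a + i b], with [p = t^2 u']. *)
Definition hsol f a b u1 p1 u2 p2 := forall t, 0 < t < 1 ->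
  [/\ dv u1 t (p1 t / t ^+ 2), dv p1 t (Qc f a t * u1 t + b * weight t * u2 t),
      dv u2 t (p2 t / t ^+ 2) & dv p2 t (Qc f a t * u2 t - b * weight t * u1 t)].

(** Real and imaginary parts of [(lambda - A_n) u = h]. Here [u] is continuously differentiable
    because [p] is continuous, while [p] is only absolutely continuous because [h] is only locally
    integrable against the weight. *)
Definition csol f a b h1 h2 u1 p1 u2 p2 :=
  [/\ forall t, 0 < t < 1 -> dv u1 t (p1 t / t ^+ 2),
      acd p1 (fun t => Qc f a t * u1 t + b * weight t * u2 t + weight t * h1 t),
      forall t, 0 < t < 1 -> dv u2 t (p2 t / t ^+ 2) &
      acd p2 (fun t => Qc f a t * u2 t - b * weight t * u1 t + weight t * h2 t)].

(** [F] and the primitive of the continuous function [dF] differ by a function with derivative zero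
    almost everywhere, hence by a constant. *)
Lemma acd_cont_dv F (dF : R -> R) : acd F dF -> (forall t, 0 < t < 1 -> {for t, continuous dF}) ->
  forall t, 0 < t < 1 -> dv F t (dF t).
Proof.
move=> hF cF t ht.
have dG s : 0 < s < 1 -> dv (prim dF 2^-1) s (dF s) by move=> hs; apply: prim_dv => //; exact: half01.
have hG : acd (prim dF 2^-1) dF by apply: acd_C1.
have h0 : acd (fun s => F s - prim dF 2^-1 s) (fun=> 0).
  by apply: acd_congr (acdB hF hG) _; apply: aeW => s _; rewrite subrr.
pose c := F 2^-1 - prim dF 2^-1 2^-1.
have e s : 0 < s < 1 -> prim dF 2^-1 s + c = F s.
  move=> /andP[s0 s1].
  have -> : c = F s - prim dF 2^-1 s; last by ring.
  have [hs|/ltW hs] := leP 2^-1 s.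
    by apply: (acd_const _ hs s1 h0); order_lra.
  by apply/esym; apply: (acd_const s0 hs _ h0); order_lra.
apply: (dv_local ht e); apply: dv_eq (dvD (dG t ht) (dv_cst c t)) _.
by rewrite addr0.
Qed.

Lemma cont_inv2 t : 0 < t < 1 -> {for t, continuous (fun s : R => (s ^+ 2)^-1)}.
Proof.
move=> /andP[t0 _]; have h : t ^+ 2 != 0 by rewrite expf_neq0// gt_eqF.
exact: (dv_cont (@dvV R (fun s => s ^+ 2) t _ h (dvX 2 (dv_id t)))).
Qed.

(** The inhomogeneous terms enter through their primitives [R1] and [R2], which are continuous even
    if the terms themselves are only locally integrable; hence Picard iteration with continuous data
    is enough. *)
Lemma sys_ex f f1 n a b (R1 R2 : R -> R) t0 (x1 y1 x2 y2 : R) : wave_profile f f1 n -> 0 < t0 < 1 ->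
  (forall t, 0 < t < 1 -> {for t, continuous R1}) ->
  (forall t, 0 < t < 1 -> {for t, continuous R2}) -> R1 t0 = 0 -> R2 t0 = 0 ->
  exists u1 p1 u2 p2, [/\ u1 t0 = x1, p1 t0 = y1, u2 t0 = x2, p2 t0 = y2 &
   forall t, 0 < t < 1 -> [/\ dv u1 t (p1 t / t ^+ 2),
      dv (fun s => p1 s - R1 s) t (Qc f a t * u1 t + b * weight t * u2 t),
      dv u2 t (p2 t / t ^+ 2) &
      dv (fun s => p2 s - R2 s) t (Qc f a t * u2 t - b * weight t * u1 t)]].
Proof.
move=> wp ht0 c1 c2 r1 r2.
pose M (i j : 'I_4) : R -> R := match val i, val j with
  | 0%N, 1%N => fun t => (t ^+ 2)^-1
  | 1%N, 0%N => Qc f a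
  | 1%N, 2%N => fun t => b * weight t
  | 2%N, 3%N => fun t => (t ^+ 2)^-1
  | 3%N, 2%N => Qc f a
  | 3%N, 0%N => fun t => - b * weight t
  | _, _ => fun=> 0 end.
pose G (i : 'I_4) : R -> R := match val i with
  | 0%N => fun=> x1 | 1%N => fun t => y1 + R1 t | 2%N => fun=> x2 | _ => fun t => y2 + R2 t end.
have cw e t : 0 < t < 1 -> {for t, continuous (fun s => e * weight s)}.
  by move=> ht; apply: cvgM; [exact: cvg_cst|exact: cont_weight].
have c0 (e t : R) : {for t, continuous (fun=> e)} by exact: cvg_cst.
have cM i j t : 0 < t < 1 -> {for t, continuous (M i j)}.
  by move=> ht; rewrite /M; case: i => [[|[|[|[|?]]]] ?]; case: j => [[|[|[|[|?]]]] ?] //=;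
    try exact: cw; try exact: c0; try exact: cont_inv2; exact: cont_Qc wp ht.
have cG i t : 0 < t < 1 -> {for t, continuous (G i)}.
  move=> ht; rewrite /G; case: i => [[|[|[|[|?]]]] ?] //=; try exact: c0.
    by apply: cvgD; [exact: cvg_cst|exact: c1].
  by apply: cvgD; [exact: cvg_cst|exact: c2].
have [Z hZ] := picard ht0 cM cG.
pose i0 : 'I_4 := ord0; pose i1 : 'I_4 := lift ord0 ord0.
pose i2 : 'I_4 := lift ord0 (lift ord0 ord0).
pose i3 : 'I_4 := lift ord0 (lift ord0 (lift ord0 ord0)).
exists (Z i0), (Z i1), (Z i2), (Z i3).
have [z0 d0] := hZ i0; have [z1 d1] := hZ i1; have [z2 d2] := hZ i2; have [z3 d3] := hZ i3.
split; [by rewrite z0|by rewrite z1 /G /= r1 addr0|by rewrite z2|by rewrite z3 /G /= r2 addr0|].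
move=> t ht.
have s0 := d0 t ht; have s1 := d1 t ht; have s2 := d2 t ht; have s3 := d3 t ht.
rewrite !big_ord_recl big_ord0 /M /G /= in s0 s1 s2 s3.
split.
- have := dvD s0 (dv_cst x1 t); have -> : (fun s => Z i0 s - x1 + x1) = Z i0.
    by apply/funext => s; rewrite subrK.
  by move=> H; apply: dv_eq H _; rewrite -/i1; ring.
- have := dvD s1 (dv_cst y1 t); have -> : (fun s => Z i1 s - (y1 + R1 s) + y1) = (fun s => Z i1 s - R1 s).
    by apply/funext => s; ring.
  by move=> H; apply: dv_eq H _; rewrite -/i2; ring.
- have := dvD s2 (dv_cst x2 t); have -> : (fun s => Z i2 s - x2 + x2) = Z i2.
    by apply/funext => s; rewrite subrK.
  by move=> H; apply: dv_eq H _; rewrite -/i3; ring.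
- have := dvD s3 (dv_cst y2 t); have -> : (fun s => Z i3 s - (y2 + R2 s) + y2) = (fun s => Z i3 s - R2 s).
    by apply/funext => s; ring.
  by move=> H; apply: dv_eq H _; rewrite -/i2; ring.
Qed.

Lemma hsol_ex f f1 n a b t0 (x1 y1 x2 y2 : R) : wave_profile f f1 n -> 0 < t0 < 1 ->
  exists u1 p1 u2 p2, [/\ u1 t0 = x1, p1 t0 = y1, u2 t0 = x2, p2 t0 = y2 & hsol f a b u1 p1 u2 p2].
Proof.
move=> wp ht0.
have c0 t : 0 < t < 1 -> {for t, continuous (fun=> 0 : R)} by move=> _; exact: cvg_cst.
have [u1 [p1 [u2 [p2 [? ? ? ? h]]]]] := sys_ex a b x1 y1 x2 y2 wp ht0 c0 c0 erefl erefl.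
exists u1, p1, u2, p2; split => // t /h[d1 d2 d3 d4].
have e (q : R -> R) : (fun s => q s - 0) = q by apply/funext => s; rewrite subr0.
by rewrite !e in d2 d4; split.
Qed.

Lemma csol_ex f f1 n a b h1 h2 t0 (x1 y1 x2 y2 : R) : wave_profile f f1 n -> 0 < t0 < 1 ->
  L1loc (fun t => weight t * h1 t) -> L1loc (fun t => weight t * h2 t) ->
  exists u1 p1 u2 p2, [/\ u1 t0 = x1, p1 t0 = y1, u2 t0 = x2, p2 t0 = y2 & csol f a b h1 h2 u1 p1 u2 p2].
Proof.
move=> wp ht0 l1 l2.
have a1 := prim_acd l1 ht0; have a2 := prim_acd l2 ht0.
have [u1 [p1 [u2 [p2 [e1 e2 e3 e4 h]]]]] := sys_ex a b x1 y1 x2 y2 wp ht0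
  (fun t ht => AC_loc01_cont a1.1 ht) (fun t ht => AC_loc01_cont a2.1 ht) (prim0 _ _) (prim0 _ _).
exists u1, p1, u2, p2; split => //.
have c1 t : 0 < t < 1 -> {for t, continuous u1} by move=> /h[d _ _ _]; exact: dv_cont d.
have c2 t : 0 < t < 1 -> {for t, continuous u2} by move=> /h[_ _ d _]; exact: dv_cont d.
have cw e t : 0 < t < 1 -> {for t, continuous (fun s => e * weight s)}.
  by move=> ht; apply: cvgM; [exact: cvg_cst|exact: cont_weight].
split.
- by move=> t /h[].
- have := acdD (acd_C1 (fun t ht => and4_2 (h t ht)) _) a1.
  have -> : (fun x => p1 x - prim (fun t => weight t * h1 t) t0 x + prim (fun t => weight t * h1 t) t0 x) = p1.
    by apply/funext => s; rewrite subrK.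
  apply => t ht; apply: cvgD; apply: cvgM; [exact: cont_Qc wp ht|exact: c1|exact: cw|exact: c2].
- by move=> t /h[].
- have := acdD (acd_C1 (fun t ht => and4_4 (h t ht)) _) a2.
  have -> : (fun x => p2 x - prim (fun t => weight t * h2 t) t0 x + prim (fun t => weight t * h2 t) t0 x) = p2.
    by apply/funext => s; rewrite subrK.
  apply => t ht; apply: cvgB; apply: cvgM; [exact: cont_Qc wp ht|exact: c2|exact: cw|exact: c1].
Qed.

Lemma hsol_cont f a b u1 p1 u2 p2 : hsol f a b u1 p1 u2 p2 -> forall t, 0 < t < 1 ->
  [/\ {for t, continuous u1}, {for t, continuous p1}, {for t, continuous u2} & {for t, continuous p2}].
Proof. by move=> h t /h[d1 d2 d3 d4]; split; [exact: dv_cont d1|exact: dv_cont d2|exact: dv_cont d3|exact: dv_cont d4]. Qed.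

Lemma hsol_csol f f1 n a b u1 p1 u2 p2 : wave_profile f f1 n -> hsol f a b u1 p1 u2 p2 ->
  csol f a b (fun=> 0) (fun=> 0) u1 p1 u2 p2.
Proof.
move=> wp h; have cc := hsol_cont h.
have cw e t : 0 < t < 1 -> {for t, continuous (fun s => e * weight s)}.
  by move=> ht; apply: cvgM; [exact: cvg_cst|exact: cont_weight].
split; try by move=> t /h[].
- apply: acd_congr (acd_C1 (fun t ht => and4_2 (h t ht)) _) _.
    by move=> t ht; have [? ? ? ?] := cc t ht; apply: cvgD; apply: cvgM => //; [exact: cont_Qc wp ht|exact: cw].
  by apply: aeW => t _; rewrite mulr0 addr0.
- apply: acd_congr (acd_C1 (fun t ht => and4_4 (h t ht)) _) _.
    by move=> t ht; have [? ? ? ?] := cc t ht; apply: cvgB; apply: cvgM => //; [exact: cont_Qc wp ht|exact: cw].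
  by apply: aeW => t _; rewrite mulr0 addr0.
Qed.

Lemma csol_hsol f f1 n a b u1 p1 u2 p2 : wave_profile f f1 n ->
  csol f a b (fun=> 0) (fun=> 0) u1 p1 u2 p2 -> hsol f a b u1 p1 u2 p2.
Proof.
move=> wp [h1 h2 h3 h4].
have cw e t : 0 < t < 1 -> {for t, continuous (fun s => e * weight s)}.
  by move=> ht; apply: cvgM; [exact: cvg_cst|exact: cont_weight].
have c1 t : 0 < t < 1 -> {for t, continuous u1} by move=> /h1; exact: dv_cont.
have c2 t : 0 < t < 1 -> {for t, continuous u2} by move=> /h3; exact: dv_cont.
have a2 : acd p1 (fun t => Qc f a t * u1 t + b * weight t * u2 t).
  by apply: acd_congr h2 _; apply: aeW => t _; rewrite mulr0 addr0.
have a4 : acd p2 (fun t => Qc f a t * u2 t - b * weight t * u1 t).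
  by apply: acd_congr h4 _; apply: aeW => t _; rewrite mulr0 addr0.
move=> t ht; split; [exact: h1| |exact: h3|].
- apply: acd_cont_dv a2 _ t ht => s hs; apply: cvgD; apply: cvgM;
    [exact: cont_Qc wp hs|exact: c1|exact: cw|exact: c2].
- apply: acd_cont_dv a4 _ t ht => s hs; apply: cvgB; apply: cvgM;
    [exact: cont_Qc wp hs|exact: c2|exact: cw|exact: c1].
Qed.

Lemma csolD f a b h1 h2 u1 p1 u2 p2 h1' h2' u1' p1' u2' p2' :
  csol f a b h1 h2 u1 p1 u2 p2 -> csol f a b h1' h2' u1' p1' u2' p2' ->
  csol f a b (fun t => h1 t + h1' t) (fun t => h2 t + h2' t) (fun t => u1 t + u1' t)
    (fun t => p1 t + p1' t) (fun t => u2 t + u2' t) (fun t => p2 t + p2' t).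
Proof.
move=> [a1 a2 a3 a4] [b1 b2 b3 b4]; split.
- by move=> t ht; apply: dv_eq (dvD (a1 t ht) (b1 t ht)) _; rewrite mulrDl.
- by apply: acd_congr (acdD a2 b2) _; apply: aeW => t _; ring.
- by move=> t ht; apply: dv_eq (dvD (a3 t ht) (b3 t ht)) _; rewrite mulrDl.
- by apply: acd_congr (acdD a4 b4) _; apply: aeW => t _; ring.
Qed.

Lemma csolZ c f a b h1 h2 u1 p1 u2 p2 :
  csol f a b h1 h2 u1 p1 u2 p2 ->
  csol f a b (fun t => c * h1 t) (fun t => c * h2 t) (fun t => c * u1 t)
    (fun t => c * p1 t) (fun t => c * u2 t) (fun t => c * p2 t).
Proof.
move=> [a1 a2 a3 a4]; split.
- by move=> t ht; apply: dv_eq (dvZ c (a1 t ht)) _; rewrite mulrA.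
- by apply: acd_congr (acdZ c a2) _; apply: aeW => t _; ring.
- by move=> t ht; apply: dv_eq (dvZ c (a3 t ht)) _; rewrite mulrA.
- by apply: acd_congr (acdZ c a4) _; apply: aeW => t _; ring.
Qed.

Lemma csol_congr f a b h1 h2 h1' h2' u1 p1 u2 p2 : csol f a b h1 h2 u1 p1 u2 p2 ->
  {ae @lebesgue_measure R, forall t, I01 t -> h1 t = h1' t} ->
  {ae @lebesgue_measure R, forall t, I01 t -> h2 t = h2' t} ->
  csol f a b h1' h2' u1 p1 u2 p2.
Proof.
move=> [a1 a2 a3 a4] e1 e2; split => //.
- by apply: acd_congr a2 _; apply: ae_imp e1 _ => t H It; rewrite H.
- by apply: acd_congr a4 _; apply: ae_imp e2 _ => t H It; rewrite H.
Qed.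

(** Gronwall for the sum of the squares, from [t0] in both directions, on compact intervals where
    the coefficients are bounded. *)
Lemma hsol_uniq f f1 n a b u1 p1 u2 p2 t0 : wave_profile f f1 n -> hsol f a b u1 p1 u2 p2 ->
  0 < t0 < 1 -> u1 t0 = 0 -> p1 t0 = 0 -> u2 t0 = 0 -> p2 t0 = 0 ->
  forall t, 0 < t < 1 -> [/\ u1 t = 0, p1 t = 0, u2 t = 0 & p2 t = 0].
Proof.
move=> wp H ht0 e1 e2 e3 e4.
pose N t := u1 t ^+ 2 + p1 t ^+ 2 + (u2 t ^+ 2 + p2 t ^+ 2).
pose dN t := 2 * (u1 t * (p1 t / t ^+ 2)) + 2 * (p1 t * (Qc f a t * u1 t + b * weight t * u2 t)) +
  (2 * (u2 t * (p2 t / t ^+ 2)) + 2 * (p2 t * (Qc f a t * u2 t - b * weight t * u1 t))).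
have hN t : 0 < t < 1 -> dv N t (dN t).
  move=> /H[a1 a2 a3 a4].
  apply: dv_eq (dvD (dvD (dvX 2 a1) (dvX 2 a2)) (dvD (dvX 2 a3) (dvX 2 a4))) _.
  by rewrite /dN /= !expr1; ring.
have N0 : N t0 = 0 by rewrite /N e1 e2 e3 e4 !expr0n /= !addr0.
have bnd c d : 0 < c -> d < 1 -> exists2 K, 0 <= K & forall t, c <= t <= d -> `|dN t| <= K * N t.
  move=> c0 d1.
  have sub t : c <= t <= d -> 0 < t < 1 by move=> /andP[? ?]; apply/andP; split; order_lra.
  have [A A0 hA] := @cont_bounded R (fun s => (s ^+ 2)^-1) c d (fun t q => cont_inv2 (sub t q)).
  have [B B0 hB] := @cont_bounded R (Qc f a) c d (fun t q => @cont_Qc R f f1 n a t wp (sub t q)).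
  have cw e t : 0 < t < 1 -> {for t, continuous (fun s => e * weight s)}.
    by move=> ht; apply: cvgM; [exact: cvg_cst|exact: cont_weight].
  have [D D0 hD] := @cont_bounded R (fun s => b * weight s) c d (fun t q => cw b t (sub t q)).
  exists (A + B + D) => [|t tcd]; first by order_lra.
  have := hA t tcd; have := hB t tcd; have := hD t tcd.
  rewrite /dN /N; move: (t ^- 2) (Qc f a t) (b * weight t) (u1 t) (p1 t) (u2 t) (p2 t).
  clear => q1 q2 q3 v1 w1 v2 w2; rewrite !ler_norml => /andP[k1 k2] /andP[k3 k4] /andP[k5 k6].
  have sq (x y q M : R) : - M <= q -> q <= M -> `|2 * (x * y) * q| <= M * (x ^+ 2 + y ^+ 2).
    move=> m1 m2; have M0 : 0 <= M by order_lra.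
    rewrite normrM mulrC ler_pM//; first by rewrite ler_norml m1.
    by have := sqr_ge0 (x - y); have := sqr_ge0 (x + y); rewrite ler_norml !expr2 => *; apply/andP; split; order_lra.
  have s1 := sq v1 w1 q1 A k5 k6; have s2 := sq v2 w2 q1 A k5 k6.
  have s3 := sq v1 w1 q2 B k3 k4; have s4 := sq v2 w2 q2 B k3 k4.
  have s5 := sq w1 v2 q3 D k1 k2; have s6 := sq w2 v1 q3 D k1 k2.
  move: s1 s2 s3 s4 s5 s6; rewrite !ler_norml.
  by clear => /andP[? ?] /andP[? ?] /andP[? ?] /andP[? ?] /andP[? ?] /andP[? ?]; apply/andP; split; order_lra.
have NZ t : 0 < t < 1 -> N t <= 0.
  move=> /andP[h0 h1]; have /andP[t00 t01] := ht0.
  have [tt|/ltW tt] := leP t0 t.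
    have [K K0 hK] := bnd t0 t t00 h1.
    have := @gronwall_right R N dN K 0 t0 t tt K0 (lexx 0).
    rewrite N0 mul0r addr0 mulr0; apply.
      by move=> s /andP[? ?]; apply: hN; apply/andP; split; order_lra.
    by move=> s /hK; rewrite ler_norml addr0 => /andP[].
  have [K K0 hK] := bnd t t0 h0 t01.
  have := @gronwall_left R N dN K 0 t t0 tt K0 (lexx 0).
  rewrite N0 mul0r addr0 mulr0; apply.
    by move=> s /andP[? ?]; apply: hN; apply/andP; split; order_lra.
  by move=> s /hK; rewrite ler_norml addr0 lerNl => /andP[].
move=> t /NZ; rewrite /N.
have h1 := sqr_ge0 (u1 t); have h2 := sqr_ge0 (p1 t); have h3 := sqr_ge0 (u2 t); have h4 := sqr_ge0 (p2 t).
by move=> h; split; apply/eqP; rewrite -sqrf_eq0 eq_le; apply/andP; split => //; order_lra.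
Qed.

Lemma rsol_hsol f a b u p : b = 0 -> rsol f a u p -> hsol f a b u p (fun=> 0) (fun=> 0).
Proof.
move=> -> h t ht; have [d1 d2] := h t ht; split => //.
- by apply: dv_eq d2 _; rewrite mulr0 addr0.
- by apply: dv_eq (dv_cst 0 t) _; rewrite mul0r.
- by apply: dv_eq (dv_cst 0 t) _; rewrite !mul0r mulr0 subrr.
Qed.

Lemma hsol_rsol f a u1 p1 u2 p2 : hsol f a 0 u1 p1 u2 p2 -> rsol f a u1 p1 /\ rsol f a u2 p2.
Proof.
move=> h; split => t /h[d1 d2 d3 d4]; split => //.
- by apply: dv_eq d2 _; rewrite !mul0r addr0.
- by apply: dv_eq d4 _; rewrite !mul0r subr0.
Qed.

Lemma rsol_ex f f1 n a t0 x y : wave_profile f f1 n -> 0 < t0 < 1 ->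
  exists u p, [/\ u t0 = x, p t0 = y & rsol f a u p].
Proof.
move=> wp ht0; have [u1 [p1 [u2 [p2 [e1 e2 _ _ /hsol_rsol[h _]]]]]] := hsol_ex a 0 x y 0 0 wp ht0.
by exists u1, p1.
Qed.

Lemma rsol_uniq f f1 n a u p t0 : wave_profile f f1 n -> rsol f a u p -> 0 < t0 < 1 ->
  u t0 = 0 -> p t0 = 0 -> forall t, 0 < t < 1 -> u t = 0 /\ p t = 0.
Proof.
move=> wp /(rsol_hsol erefl) h ht0 e1 e2 t ht.
by have [] := hsol_uniq wp h ht0 e1 e2 erefl erefl ht.
Qed.

Lemma rsolD f a u p u' p' : rsol f a u p -> rsol f a u' p' ->
  rsol f a (fun t => u t + u' t) (fun t => p t + p' t).
Proof.
move=> h h' t ht; have [a1 a2] := h t ht; have [b1 b2] := h' t ht; split.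
- by apply: dv_eq (dvD a1 b1) _; rewrite mulrDl.
- by apply: dv_eq (dvD a2 b2) _; rewrite mulrDr.
Qed.

Lemma rsolZ c f a u p : rsol f a u p -> rsol f a (fun t => c * u t) (fun t => c * p t).
Proof.
move=> h t ht; have [a1 a2] := h t ht; split.
- by apply: dv_eq (dvZ c a1) _; rewrite mulrA.
- by apply: dv_eq (dvZ c a2) _; rewrite mulrCA.
Qed.

Lemma rsol_cont f a u p t : rsol f a u p -> 0 < t < 1 -> {for t, continuous u} /\ {for t, continuous p}.
Proof. by move=> h /h[d1 d2]; split; [exact: dv_cont d1|exact: dv_cont d2]. Qed.

End Solutions.

(** * Behaviour of square integrable solutions at the end points *)
Section EndPoints.
Variable R : realType.
Implicit Types (t a b c C K x y : R) (f u p h r : R -> R).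

Definition summ0 t1 r := exists C, forall a b, 0 < a -> a <= b -> b <= t1 ->
  prim r 2^-1 b - prim r 2^-1 a <= C.
Definition summ1 t1 r := exists C, forall a b, t1 <= a -> a <= b -> b < 1 ->
  prim r 2^-1 b - prim r 2^-1 a <= C.

Lemma summable_summ0 t1 r : t1 < 1 -> summable01 r -> summ0 t1 r.
Proof. by move=> t11 [C hC]; exists C => a b a0 ab bt; apply: hC => //; exact: le_lt_trans t11. Qed.

Lemma summable_summ1 t1 r : 0 < t1 -> summable01 r -> summ1 t1 r.
Proof. by move=> t10 [C hC]; exists C => a b ta ab b1; apply: hC => //; exact: lt_le_trans ta. Qed.

Lemma summ_summable t1 r : 0 < t1 < 1 -> (forall t, 0 < t < 1 -> {for t, continuous r}) ->
  (forall t, 0 < t < 1 -> 0 <= r t) -> summ0 t1 r -> summ1 t1 r -> summable01 r.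
Proof.
move=> /andP[t10 t11] cr r0 [C hC] [D hD]; exists (C + D) => a b a0 ab b1.
have mono x y : 0 < x -> x <= y -> y < 1 -> prim r 2^-1 x <= prim r 2^-1 y.
  move=> x0 xy y1; have sub z : x <= z <= y -> 0 < z < 1 by move=> /andP[? ?]; apply/andP; split; order_lra.
  apply: (dv_mono xy (fun z hz => prim_dv cr (half01 R) (sub z hz))) => z /andP[z1 z2].
  by apply: r0; apply: sub; rewrite !ltW.
have C0 : 0 <= C by have := hC t1 t1 t10 (lexx _) (lexx _); order_lra.
have D0 : 0 <= D by have := hD t1 t1 (lexx _) (lexx _) t11; order_lra.
have [bt|/ltW tb] := leP b t1; first by have := hC a b a0 ab bt; order_lra.
have [at1|/ltW ta] := leP a t1; last by have := hD a b ta ab b1; order_lra.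
by have := hC a t1 a0 at1 (lexx _); have := hD t1 b (lexx _) tb b1; order_lra.
Qed.

Section Pair.
Variables (u1 p1 u2 p2 : R -> R).
(** For [u = u1 + i u2] and [p = p1 + i p2], [Y] is [|u|^2], and [G], [W] are the real and the
    imaginary part of [conj(u) p]. *)
Local Notation Y t := (u1 t ^+ 2 + u2 t ^+ 2).
Local Notation G t := (u1 t * p1 t + u2 t * p2 t).
Local Notation W t := (u1 t * p2 t - u2 t * p1 t).
Hypothesis du1 : forall t, 0 < t < 1 -> dv u1 t (p1 t / t ^+ 2).
Hypothesis du2 : forall t, 0 < t < 1 -> dv u2 t (p2 t / t ^+ 2).

Lemma dv_Y t : 0 < t < 1 -> dv (fun s => Y s) t (2 * G t / t ^+ 2).
Proof.
move=> ht; apply: dv_eq (dvD (dvX 2 (du1 ht)) (dvX 2 (du2 ht))) _.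
by rewrite /= !expr1; ring.
Qed.

Lemma cont_wY t : 0 < t < 1 -> {for t, continuous (fun s => weight s * Y s)}.
Proof. by move=> ht; apply: cvgM; [exact: cont_weight|exact: dv_cont (dv_Y ht)]. Qed.

Lemma dv_S t : 0 < t < 1 -> dv (prim (fun s => weight s * Y s) 2^-1) t (weight t * Y t).
Proof. by move=> ht; apply: (prim_dv cont_wY (half01 R)). Qed.

Lemma wY_ge0 t : 0 < t < 1 -> 0 <= weight t * Y t.
Proof. by move=> ht; rewrite mulr_ge0 ?addr_ge0 ?sqr_ge0// ltW// weight_gt0. Qed.

Lemma cauchy_G t : G t ^+ 2 + W t ^+ 2 = Y t * (p1 t ^+ 2 + p2 t ^+ 2).
Proof. by ring. Qed.

Section Zero.
(** The derivative of [G] is kept abstract so that the estimates apply both to one complex solution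
    and to two real solutions with different parameters. *)
Variables (Gd : R -> R) (t1 : R).
Hypothesis ht1 : 0 < t1 < 1.
Hypothesis dG : forall t, 0 < t <= t1 -> dv (fun s => G s) t (Gd t).
Hypothesis hGd : forall t, 0 < t <= t1 -> (p1 t ^+ 2 + p2 t ^+ 2) / t ^+ 2 + Y t <= Gd t.
Hypothesis hS : summ0 t1 (fun s => weight s * Y s).

Let in01 t : 0 < t <= t1 -> 0 < t < 1.
Proof. by move=> /andP[? ?]; have /andP[_ t11] := ht1; apply/andP; split => //; exact: le_lt_trans t11. Qed.

(* If [G < 0] somewhere then [t^2 G] stays below a negative constant down to 0, so that [Y] is at
   least of order [t^-3] and not integrable against [t^2]. *)
Lemma end0_G t : 0 < t <= t1 -> 0 <= G t.
Proof.
move=> hs; rename t into s; rewrite leNgt; apply/negP => Gs; have /andP[s0 st1] := hs.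
pose c := - (s ^+ 2 * G s).
have c0 : 0 < c by rewrite oppr_gt0 pmulr_rlt0// exprn_gt0.
have sub t x : 0 < t -> t <= x <= s -> 0 < x <= t1.
  by move=> t0 /andP[h1 h2]; rewrite (lt_le_trans t0 h1) (le_trans h2).
have H1 t : 0 < t -> t <= s -> t ^+ 2 * G t <= - c.
  move=> t0 ts; rewrite /c opprK.
  apply: (@dv_mono R (fun x => x ^+ 2 * G x) (fun x => 2 * x * G x + x ^+ 2 * Gd x) t s ts).
    move=> x hx; apply: dv_eq (dvM (dvX 2 (dv_id x)) (dG (sub t x t0 hx))) _.
    by rewrite /= expr1 mulr1.
  move=> x /andP[tx xs]; have hx : 0 < x <= t1 by apply: (sub t x t0); rewrite !ltW.
  have x0 : 0 < x by case/andP: hx.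
  (* The derivative [2 x G + x^2 Gd] is at least [|p + x u|^2]. *)
  have := hGd hx; rewrite -(ler_pM2l (exprn_gt0 2 x0)).
  have -> : x ^+ 2 * ((p1 x ^+ 2 + p2 x ^+ 2) / x ^+ 2 + Y x) = p1 x ^+ 2 + p2 x ^+ 2 + x ^+ 2 * Y x.
    by field; rewrite gt_eqF.
  move=> h; have := sqr_ge0 (p1 x + x * u1 x); have := sqr_ge0 (p2 x + x * u2 x).
  by move: h; move: (Gd x) (p1 x) (p2 x) (u1 x) (u2 x); rewrite !expr2 => *; lra.
(* [Y' = 2 G / x^2 <= - 2 c / x^4] integrates to [k / x^3]. *)
pose k := 2 * c / 3.
have k0 : 0 < k by rewrite /k; lra.
have dinv3 x : 0 < x -> dv (fun x => (x ^+ 3)^-1) x (- 3 / x ^+ 4).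
  move=> x0; have x3 : x ^+ 3 != 0 by rewrite expf_neq0// gt_eqF.
  apply: dv_eq (@dvV R (fun x => x ^+ 3) x _ x3 (dvX 3 (dv_id x))) _.
  by rewrite /=; field; rewrite gt_eqF.
have H2 t : 0 < t -> t <= s -> Y s - k / s ^+ 3 <= Y t - k / t ^+ 3.
  move=> t0 ts; rewrite -lerN2.
  apply: (@dv_mono R (fun x => - (Y x - k * (x ^+ 3)^-1)) (fun x => - (2 * G x / x ^+ 2 - k * (- 3 / x ^+ 4))) t s ts).
    move=> x hx; have hx' := sub t x t0 hx; have x0 : 0 < x by case/andP: hx'.
    by apply: dvN; apply: dvB; [apply: dv_Y; exact: in01|apply: dvZ; exact: dinv3].
  move=> x /andP[tx xs]; have hx : 0 < x <= t1 by apply: (sub t x t0); rewrite !ltW.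
  have x0 : 0 < x by case/andP: hx.
  have -> : - (2 * G x / x ^+ 2 - k * (- 3 / x ^+ 4)) = 2 * (- c - x ^+ 2 * G x) / x ^+ 4.
    by rewrite /k; field; rewrite gt_eqF.
  by rewrite divr_ge0 ?exprn_ge0 ?(ltW x0)// mulr_ge0// subr_ge0 H1// ltW.
pose M := `|Y s - k / s ^+ 3|.
have M0 : 0 <= M by exact: normr_ge0.
have H3 t : 0 < t -> t <= s -> k / t - M <= weight t * Y t.
  move=> t0 ts; have ht : 0 < t < 1 by apply: in01; rewrite t0 (le_trans ts).
  have /andP[_ tlt1] := ht.
  apply: (@le_trans _ _ (t ^+ 2 * Y t)); last first.
    by rewrite ler_wpM2r ?weight_ge// addr_ge0 ?sqr_ge0.
  have h : - M + k / t ^+ 3 <= Y t.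
    have := H2 t t0 ts; have : - M <= Y s - k / s ^+ 3 by rewrite lerNl ler_normr lexx orbT.
    by lra.
  have := ler_wpM2l (ltW (exprn_gt0 2 t0)) h.
  have -> : t ^+ 2 * (- M + k / t ^+ 3) = - (t ^+ 2 * M) + k / t by field; rewrite gt_eqF.
  have : t ^+ 2 * M <= M by rewrite ler_piMl// expr_le1// ltW.
  by lra.
have [C hC] := hS.
have H4 t : 0 < t -> t <= s -> k * ln s - k * ln t - M <= C.
  move=> t0 ts; apply: le_trans (hC t s t0 ts st1).
  have := @dv_le R (fun x => k * ln x - M * x) (fun x => k * x^-1 - M)
    (prim (fun s => weight s * Y s) 2^-1) (fun x => weight x * Y x) t s ts.
  move=> /(_ _ _ _) H; have {H} : k * ln s - M * s - (k * ln t - M * t) <=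
     prim (fun s => weight s * Y s) 2^-1 s - prim (fun s => weight s * Y s) 2^-1 t.
    apply: H.
    - move=> x hx; have /andP[x0 _] := sub t x t0 hx.
      by apply: dv_eq (dvB (dvZ k (dv_ln x0)) (dvZ M (dv_id x))) _; rewrite mulr1.
    - by move=> x hx; apply: dv_S; apply: in01; exact: (sub t x t0 hx).
    - by move=> x /andP[tx xs]; apply: H3; [exact: lt_trans tx|exact: ltW].
  have : M * (s - t) <= M.
    have /andP[_ s1] := in01 hs; rewrite ler_piMr//; move: s1 t0; lra.
  by lra.
(* The integral of [weight * Y] from [t] to [s] is at least [k ln (s / t) - M], which exceeds [C] at
   [t = s exp(- N)]. *)
pose N := (`|C| + M + 1) / k.
have N0 : 0 <= N by rewrite divr_ge0 ?(ltW k0)// !addr_ge0.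
have tpos : 0 < s * expR (- N) by rewrite mulr_gt0// expR_gt0.
have := H4 _ tpos _; rewrite lnM ?posrE ?expR_gt0// expRK.
have -> : k * ln s - k * (ln s + - N) - M = k * N - M by ring.
rewrite /N mulrCA divff ?mulr1; last by rewrite gt_eqF.
move=> H; have {}H : `|C| + M + 1 - M <= C.
  by apply: H; rewrite ler_piMr ?(ltW s0)// expR_le1 oppr_le0.
by have := ler_norm C; lra.
Qed.

Lemma end0_Y s t : 0 < s -> s <= t -> t <= t1 -> Y s <= Y t.
Proof.
move=> s0 st tt1.
have sub x : s <= x <= t -> 0 < x <= t1.
  by move=> /andP[h1 h2]; rewrite (lt_le_trans s0 h1) (le_trans h2).
apply: (dv_mono st (fun x hx => dv_Y (in01 (sub x hx)))) => x /andP[sx xt].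
have hx : 0 < x <= t1 by apply: sub; rewrite !ltW.
by rewrite divr_ge0 ?sqr_ge0// mulr_ge0// end0_G.
Qed.

(** [W^2 <= Y |p|^2] and [Y] is bounded near 0, being monotone. So [|W| >= e] near 0 would give
    [|p|^2 >= k], hence [G' >= k / x^2], and [G] would become negative towards 0, against
    [end0_G]. *)
Lemma end0_W e t2 : 0 < e -> 0 < t2 <= t1 -> exists2 t, 0 < t < t2 & `|W t| < e.
Proof.
move=> e0 /andP[t20 t21]; apply: contrapT => hn.
have hW t : 0 < t < t2 -> e <= `|W t|.
  by move=> ht; rewrite leNgt; apply/negP => h; apply: hn; exists t.
pose s := t2 / 2; have s0 : 0 < s by rewrite divr_gt0.
have st2 : s < t2 by rewrite /s; lra.
have st1 : s <= t1 by exact: le_trans (ltW st2) t21.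
pose M := Y s + 1; have M0 : 0 < M by rewrite /M ltr_wpDl// addr_ge0 ?sqr_ge0.
pose k := e ^+ 2 / M; have k0 : 0 < k by rewrite divr_gt0// exprn_gt0.
have sub t x : 0 < t -> t <= x <= s -> 0 < x <= t1.
  by move=> t0 /andP[h1 h2]; rewrite (lt_le_trans t0 h1) (le_trans h2).
have H t : 0 < t -> t <= s -> G t + k / t <= G s + k / s.
  move=> t0 ts.
  apply: (@dv_mono R (fun x => G x + k * x^-1) (fun x => Gd x + k * (- 1 / x ^+ 2)) t s ts).
    move=> x hx; have hx' := sub t x t0 hx; have x0 : 0 < x by case/andP: hx'.
    apply: dvD; [exact: dG|apply: dvZ].
    by apply: (@dvV R id x _ _ (dv_id x)); rewrite gt_eqF.
  move=> x /andP[tx xs]; have hx : 0 < x <= t1 by apply: (sub t x t0); rewrite !ltW.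
  have x0 : 0 < x by case/andP: hx.
  have Wx : e ^+ 2 <= W x ^+ 2.
    rewrite -[leRHS]real_normK ?num_real// lerXn2r ?nnegrE ?(ltW e0)//.
    by apply: hW; rewrite x0 (lt_trans xs).
  have YM : Y x <= M.
    by rewrite /M; have := end0_Y x0 (ltW xs) st1; lra.
  have p0 : 0 <= p1 x ^+ 2 + p2 x ^+ 2 by rewrite addr_ge0 ?sqr_ge0.
  have kp : k <= p1 x ^+ 2 + p2 x ^+ 2.
    rewrite /k ler_pdivrMr// mulrC; apply: (le_trans Wx).
    apply: (@le_trans _ _ (G x ^+ 2 + W x ^+ 2)); first by rewrite lerDr sqr_ge0.
    by rewrite cauchy_G ler_wpM2r.
  have := hGd hx; have Y0 : 0 <= Y x by rewrite addr_ge0 ?sqr_ge0.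
  have : k / x ^+ 2 <= (p1 x ^+ 2 + p2 x ^+ 2) / x ^+ 2.
    by rewrite ler_wpM2r// invr_ge0 sqr_ge0.
  have -> : k * (-1 / x ^+ 2) = - (k / x ^+ 2) by rewrite mulN1r mulrN.
  by move: Y0; lra.
have Gs0 : 0 <= G s by apply: end0_G; rewrite s0.
pose D := G s + k / s + 1.
have D0 : 0 < D.
  by rewrite /D; have := divr_ge0 (ltW k0) (ltW s0); move: Gs0; lra.
pose t := Num.min s (k / D).
have t0 : 0 < t by rewrite lt_min s0 divr_gt0.
have ts : t <= s by rewrite ge_min lexx.
have tD : t <= k / D by rewrite ge_min lexx orbT.
have h1 := H t t0 ts.
have h2 : 0 <= G t by apply: end0_G; rewrite t0 (le_trans ts).
have : D <= k / t by rewrite ler_pdivlMr// mulrC -ler_pdivlMr.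
by rewrite /D; move: h1 h2; lra.
Qed.

End Zero.
End Pair.
End EndPoints.

(** * The equation near 1 *)
Section NearOne.
Variable R : realType.
Implicit Types (t a b c C K M x y : R) (f u p h r z q : R -> R).

Definition sq t : R := Num.sqrt (1 - t ^+ 2).
Definition kk t : R := (1 - t ^+ 2)^-1.
(** The [V] of [z'' = (V - lambda) z]. Its decay like [1 - t^2] at 1 ([Vc_le]) is what the estimates
    there rest on. *)
Definition Vc f t : R := 2 * cos (2 * f t) * (1 - t ^+ 2) / t ^+ 2.
(* [z] and its derivative in the variable artanh t: [z' = k q]. *)
Definition zz u t : R := t * u t / sq t.
Definition qq u p t : R := u t / sq t + p t * sq t / t.

Lemma sq_gt0 t : 0 < t < 1 -> 0 < sq t.
Proof. by move=> ht; rewrite sqrtr_gt0 sub_sqr_gt0. Qed.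

Lemma sq_sqr t : 0 < t < 1 -> sq t ^+ 2 = 1 - t ^+ 2.
Proof. by move=> ht; rewrite sqr_sqrtr// ltW// sub_sqr_gt0. Qed.

Lemma kkE t : 0 < t < 1 -> kk t = (sq t ^+ 2)^-1.
Proof. by move=> ht; rewrite /kk sq_sqr. Qed.

Lemma weightE t : 0 < t < 1 -> weight t = t ^+ 2 / sq t ^+ 4.
Proof. by move=> ht; rewrite /weight -sq_sqr// -exprM. Qed.

Lemma kk_gt0 t : 0 < t < 1 -> 0 < kk t.
Proof. by move=> ht; rewrite invr_gt0 sub_sqr_gt0. Qed.

Lemma dv_sq t : 0 < t < 1 -> dv sq t (- t / sq t).
Proof.
move=> ht; have h := sub_sqr_gt0 ht; have s0 := sq_gt0 ht.
have h1 : dv (fun s => 1 - s ^+ 2) t (- (2 * t)).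
  by apply: dv_eq (dvB (dv_cst 1 t) (dvX 2 (dv_id t))) _; rewrite /= expr1; ring.
apply: dv_eq (@dv_comp _ Num.sqrt (fun x => 1 - x ^+ 2) t _ _ (is_derive1_sqrt h) h1) _.
by rewrite -/(sq t); field; rewrite gt_eqF.
Qed.

Lemma dv_zz u p t : 0 < t < 1 -> dv u t (p t / t ^+ 2) -> dv (zz u) t (kk t * qq u p t).
Proof.
move=> ht du; have s0 := sq_gt0 ht; have /andP[t0 _] := ht.
have sn : sq t != 0 by rewrite gt_eqF.
have h := dvM (dvM (dv_id t) du) (dvV sn (dv_sq ht)).
apply: dv_eq h _; rewrite /qq kkE//.
have e : sq t ^+ 2 = 1 - t ^+ 2 by exact: sq_sqr.
transitivity (u t * (sq t ^+ 2 + t ^+ 2) / sq t ^+ 3 + p t / (t * sq t)); first by rewrite /=; field; rewrite sn gt_eqF.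
by rewrite {1}e subrK mulr1; field; rewrite sn gt_eqF.
Qed.

Lemma dv_qq u p P t : 0 < t < 1 -> dv u t (p t / t ^+ 2) -> dv p t P ->
  dv (qq u p) t (P * sq t / t + t * u t / sq t ^+ 3).
Proof.
move=> ht du dp; have s0 := sq_gt0 ht; have /andP[t0 _] := ht.
have sn : sq t != 0 by rewrite gt_eqF.
have tn : t != 0 by rewrite gt_eqF.
have h := dvD (dvM du (dvV sn (dv_sq ht))) (dvM (dvM dp (dv_sq ht)) (@dvV R id t _ tn (dv_id t))).
apply: dv_eq h _.
have e : sq t ^+ 2 = 1 - t ^+ 2 by exact: sq_sqr.
transitivity (P * sq t / t + t * u t / sq t ^+ 3 + p t * (1 - t ^+ 2 - sq t ^+ 2) / (t ^+ 2 * sq t)).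
  by rewrite /=; field; rewrite sn tn.
by rewrite e subrr mulr0 mul0r addr0.
Qed.

Lemma Qc_V f a t : 0 < t < 1 -> Qc f a t = weight t * (Vc f t - 1 - a).
Proof.
move=> ht; have h := sub_sqr_gt0 ht; have /andP[t0 _] := ht.
rewrite /Qc /weight /Vc; move: (cos _) => c; field; rewrite (gt_eqF t0) /=; apply/eqP => e.
by move: h; rewrite e ltxx.
Qed.

Lemma Vc_bound f t : 0 < t < 1 -> `|Vc f t| <= 2 * (1 - t ^+ 2) / t ^+ 2.
Proof.
move=> ht; have h := sub_sqr_gt0 ht; have /andP[t0 _] := ht.
rewrite /Vc !normrM (ger0_norm (ltW h)) (@ger0_norm _ (t ^+ 2)^-1) ?invr_ge0 ?sqr_ge0//.
have i0 : 0 <= (t ^+ 2)^-1 by rewrite invr_ge0 sqr_ge0.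
apply: ler_wpM2r => //; apply: ler_wpM2r; first exact: ltW.
by rewrite [`|2|]ger0_norm// ler_piMr// ler_norml cos_geN1 cos_le1.
Qed.

(** The change of variables is unitary: [weight u^2 dt = z^2 dx], where [dx = kk dt]. *)
Lemma wzz u t : 0 < t < 1 -> kk t * zz u t ^+ 2 = weight t * u t ^+ 2.
Proof.
move=> ht; have s0 := sq_gt0 ht.
by rewrite kkE// weightE// /zz; field; rewrite gt_eqF.
Qed.

Lemma zq_W u p v r t : 0 < t < 1 -> zz u t * qq v r t - zz v t * qq u p t = u t * r t - v t * p t.
Proof.
by move=> ht; have s0 := sq_gt0 ht; have /andP[t0 _] := ht; rewrite /zz /qq; field; rewrite !gt_eqF.
Qed.

Definition zsol f a z q := forall t, 0 < t < 1 ->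
  dv z t (kk t * q t) /\ dv q t (kk t * ((Vc f t - a) * z t)).

Lemma rsol_zsol f a u p : rsol f a u p -> zsol f a (zz u) (qq u p).
Proof.
move=> h t ht; have [du dp] := h t ht; split; first exact: dv_zz.
apply: dv_eq (dv_qq ht du dp) _.
have s0 := sq_gt0 ht; have /andP[t0 _] := ht.
by rewrite Qc_V// weightE// kkE// /zz; field; rewrite !gt_eqF.
Qed.

Lemma zz_eq0 u t : 0 < t < 1 -> (zz u t == 0) = (u t == 0).
Proof.
move=> ht; have s0 := sq_gt0 ht; have /andP[t0 _] := ht.
by rewrite /zz !mulf_eq0 invr_eq0 (gt_eqF s0) (gt_eqF t0) orbF.
Qed.

Lemma zq_eq0 u p t : 0 < t < 1 -> zz u t = 0 -> qq u p t = 0 -> u t = 0 /\ p t = 0.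
Proof.
move=> ht z0; have u0 : u t = 0 by apply/eqP; rewrite -zz_eq0// z0.
have s0 := sq_gt0 ht; have /andP[t0 _] := ht.
rewrite /qq u0 mul0r add0r => /eqP; rewrite !mulf_eq0 invr_eq0 (gt_eqF s0) (gt_eqF t0) !orbF.
by move=> /eqP.
Qed.

(** The function artanh. That it is unbounded at 1 is the source of the contradictions derived near
    that end point. *)
Definition K0 t : R := (ln (1 + t) - ln (1 - t)) / 2.

Lemma dv_K0 t : 0 < t < 1 -> dv K0 t (kk t).
Proof.
move=> /andP[t0 t1]; have h1 : 0 < 1 + t by order_lra.
have h2 : 0 < 1 - t by order_lra.
have d1 : dv (fun s => 1 + s) t 1 by apply: dv_eq (dvD (dv_cst 1 t) (dv_id t)) _; rewrite add0r.
have d2 : dv (fun s => 1 - s) t (- 1) by apply: dv_eq (dvB (dv_cst 1 t) (dv_id t)) _; rewrite sub0r.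
have e1 := @dv_comp R (@ln R) (fun s => 1 + s) t _ _ (dv_ln h1) d1.
have e2 := @dv_comp R (@ln R) (fun s => 1 - s) t _ _ (dv_ln h2) d2.
have := dvZ 2^-1 (dvB e1 e2).
have -> : (fun s => 2^-1 * (ln (1 + s) - ln (1 - s))) = K0 by apply/funext => s; rewrite mulrC.
move=> H; apply: dv_eq H _; rewrite /kk (_ : 1 - t ^+ 2 = (1 - t) * (1 + t)); last by ring.
by field; rewrite !gt_eqF.
Qed.

Lemma K0_le s t : 0 < s -> s <= t -> t < 1 -> K0 s <= K0 t.
Proof.
move=> s0 st t1; have sub x : s <= x <= t -> 0 < x < 1 by move=> /andP[? ?]; apply/andP; split; order_lra.
apply: (dv_mono st (fun x hx => dv_K0 (sub x hx))) => x /andP[h1 h2].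
by apply: ltW; apply: kk_gt0; apply: sub; rewrite !ltW.
Qed.

Lemma K0_unbounded M t1 : 0 < t1 < 1 -> exists2 t, t1 <= t < 1 & M <= K0 t.
Proof.
move=> /andP[t10 t11]; pose s := 1 - expR (- (2 * `|M|)).
have s1 : s < 1 by rewrite /s; have := expR_gt0 (- (2 * `|M|)); order_lra.
exists (Num.max t1 s); first by rewrite le_max lexx /= gt_max t11.
have [hs|hs] := leP s 0.
  have M0 : M <= 0.
    have h : expR 0 <= expR (- (2 * `|M|)) by rewrite expR0; move: hs; rewrite /s; order_lra.
    by move: h; rewrite ler_expR => h; have := normr_ge0 M; have := ler_norm M; order_lra.
  have m1 : t1 <= Num.max t1 s by rewrite le_max lexx.
  have m2 : Num.max t1 s < 1 by rewrite gt_max t11.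
  by apply: (le_trans M0); rewrite /K0 divr_ge0// subr_ge0 ler_ln ?posrE; order_lra.
apply: (@le_trans _ _ (K0 s)); last first.
  by apply: K0_le => //; rewrite ?le_max ?lexx ?orbT// gt_max t11.
have -> : K0 s = (ln (1 + s) + 2 * `|M|) / 2.
  by rewrite /K0 {2}/s (_ : 1 - (1 - expR (- (2 * `|M|))) = expR (- (2 * `|M|))) ?expRK; ring.
have : 0 <= ln (1 + s) by apply: ln_ge0; order_lra.
by have := ler_norm M; order_lra.
Qed.

(** As the integral of [y] is at most [M], [g] is at least [c] artanh minus a constant, so
    eventually [g >= 1]. Then [y] grows at rate 2 in artanh and is eventually at least 1, so its
    integral is infinite. *)
Lemma end1_false (y g gd S : R -> R) c C M t1 : 0 < t1 < 1 -> 0 < c -> 0 <= C ->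
  (forall t, t1 <= t < 1 -> dv y t (2 * (kk t * g t))) ->
  (forall t, t1 <= t < 1 -> dv g t (gd t)) ->
  (forall t, t1 <= t < 1 -> kk t * (c - C * y t) <= gd t) ->
  (forall t, t1 <= t < 1 -> 0 <= y t) ->
  (forall t, t1 <= t < 1 -> dv S t (kk t * y t)) ->
  (forall t, t1 <= t < 1 -> S t - S t1 <= M) -> False.
Proof.
move=> ht1 c0 C0 dy dg hg y0 dS hS; have /andP[t10 t11] := ht1.
have sub s t x : t1 <= s -> t < 1 -> s <= x <= t -> t1 <= x < 1.
  by move=> h1 h2 /andP[h3 h4]; rewrite (le_trans h1 h3) (le_lt_trans h4).
have in01 x : t1 <= x < 1 -> 0 < x < 1 by move=> /andP[h ->]; rewrite (lt_le_trans t10).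
have hgK t : t1 <= t < 1 -> g t1 + c * (K0 t - K0 t1) - C * M <= g t.
  move=> ht; have /andP[t1t tl] := ht.
  have := @dv_le R (fun s => c * K0 s - C * S s) (fun s => c * kk s - C * (kk s * y s)) g gd t1 t t1t.
  have e : C * (S t - S t1) <= C * M by rewrite ler_wpM2l// hS.
  suff H : c * K0 t - C * S t - (c * K0 t1 - C * S t1) <= g t - g t1 by move=> _; move: e H; order_lra.
  apply: (@dv_le R (fun s => c * K0 s - C * S s) (fun s => c * kk s - C * (kk s * y s)) g gd t1 t t1t).
  - move=> x hx; have hx' := sub _ _ _ (lexx t1) tl hx.
    by apply: dvB; apply: dvZ; [apply: dv_K0; exact: in01|exact: dS].
  - by move=> x hx; apply: dg; exact: (sub _ _ _ (lexx t1) tl hx).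
  - move=> x /andP[h1 h2]; have hx : t1 <= x < 1 by rewrite ltW//= (lt_trans h2).
    by apply: le_trans (hg x hx); rewrite le_eqVlt; apply/orP; left; apply/eqP; ring.
have [t3 /andP[t13 t31] hK3] := K0_unbounded ((1 - g t1 + C * M) / c + K0 t1) ht1.
have g1 t : t3 <= t < 1 -> 1 <= g t.
  move=> /andP[t3t tl]; have ht : t1 <= t < 1 by rewrite (le_trans t13).
  apply: le_trans (hgK t ht).
  have : K0 t3 <= K0 t by apply: K0_le => //; order_lra.
  move=> h; have : (1 - g t1 + C * M) / c <= K0 t - K0 t1 by order_lra.
  by rewrite ler_pdivrMr// mulrC => ?; order_lra.
have ht3 : 0 < t3 < 1 by rewrite (lt_le_trans t10).
have [t4 /andP[t34 t41] hK4] := K0_unbounded (K0 t3 + 2^-1) ht3.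
have y1 t : t4 <= t < 1 -> 1 <= y t.
  move=> /andP[t4t tl]; have t3t : t3 <= t by exact: le_trans t4t.
  have : 2 * K0 t - 2 * K0 t3 <= y t - y t3.
    apply: (@dv_le R (fun s => 2 * K0 s) (fun s => 2 * kk s) y _ t3 t t3t _
      (fun x hx => dy x (sub _ _ _ t13 tl hx))).
    - by move=> x hx; apply: dvZ; apply: dv_K0; apply: in01; exact: (sub _ _ _ t13 tl hx).
    - move=> x /andP[h1 h2]; rewrite ler_pM2l// ler_peMr ?g1//.
        by apply/ltW/kk_gt0/in01; rewrite (le_trans t13 (ltW h1)) (lt_trans h2).
      by rewrite (ltW h1) (lt_trans h2).
  have : K0 t4 <= K0 t by apply: K0_le => //; order_lra.
  have : 0 <= y t3 by apply: y0; rewrite t13.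
  by move: hK4; order_lra.
have ht4 : 0 < t4 < 1 by rewrite t41 andbT; order_lra.
have [t5 /andP[t45 t51] hK5] := K0_unbounded (K0 t4 + M - S t4 + S t1 + 1) ht4.
have t14 : t1 <= t4 by exact: le_trans t34.
have : K0 t5 - K0 t4 <= S t5 - S t4.
  apply: (@dv_le R K0 kk S _ t4 t5 t45 _ (fun x hx => dS x (sub _ _ _ t14 t51 hx))).
  - by move=> x hx; apply: dv_K0; apply: in01; exact: (sub _ _ _ t14 t51 hx).
  - move=> x /andP[h1 h2]; rewrite ler_peMr ?y1//.
      by apply/ltW/kk_gt0/in01; rewrite (le_trans t14 (ltW h1)) (lt_trans h2).
    by rewrite (ltW h1) (lt_trans h2).
have : S t5 - S t1 <= M by apply: hS; rewrite t51 (le_trans t14).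
by move: hK5; order_lra.
Qed.

End NearOne.

(** * Square integrable solutions near 1 *)

Section DecayAtOne.
Variable R : realType.
Implicit Types (t a b c C K M x y : R) (f u p h r z q : R -> R).

Lemma Vc_le f t1 t : 0 < t1 -> t1 <= t -> t < 1 -> `|Vc f t| <= 2 / t1 ^+ 2 * (1 - t ^+ 2).
Proof.
move=> t10 t1t tl; have ht : 0 < t < 1 by rewrite tl (lt_le_trans t10).
apply: le_trans (Vc_bound f ht) _; rewrite mulrAC.
have h := sub_sqr_gt0 ht; apply: ler_wpM2r; first by rewrite ltW.
by apply: ler_wpM2l => //; rewrite lef_pV2 ?posrE ?exprn_gt0 ?(lt_le_trans t10)// lerXn2r ?nnegrE//; order_lra.
Qed.

Lemma Vc_le2 f t1 t : 0 < t1 -> t1 <= t -> t < 1 -> `|Vc f t| <= 2 / t1 ^+ 2.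
Proof.
move=> t10 t1t tl; apply: le_trans (Vc_le f t10 t1t tl) _.
rewrite ler_piMr ?divr_ge0 ?sqr_ge0//.
by have := sqr_ge0 t; order_lra.
Qed.

Lemma hsol_zz f a b u1 p1 u2 p2 t : hsol f a b u1 p1 u2 p2 -> 0 < t < 1 ->
  [/\ dv (zz u1) t (kk t * qq u1 p1 t), dv (qq u1 p1) t (kk t * ((Vc f t - a) * zz u1 t + b * zz u2 t)),
      dv (zz u2) t (kk t * qq u2 p2 t) & dv (qq u2 p2) t (kk t * ((Vc f t - a) * zz u2 t - b * zz u1 t))].
Proof.
move=> h ht; have [d1 d2 d3 d4] := h t ht.
have s0 := sq_gt0 ht; have /andP[t0 _] := ht.
split; [exact: dv_zz| |exact: dv_zz|].
- apply: dv_eq (dv_qq ht d1 d2) _.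
  by rewrite Qc_V// weightE// kkE// /zz; field; rewrite !gt_eqF.
- apply: dv_eq (dv_qq ht d3 d4) _.
  by rewrite Qc_V// weightE// kkE// /zz; field; rewrite !gt_eqF.
Qed.

(** [|W| >= e] forces [|z|^2 + |q|^2 >= 2 e]. The derivative of [Re (conj(z) q)] is
    [|q|^2 + (V - a) |z|^2], thus at least [2 e - C |z|^2], where [C] absorbs [V], [a] and the
    [|z|^2] that was added; [end1_false] applies. *)
Lemma end1_W f a b u1 p1 u2 p2 t1 e : hsol f a b u1 p1 u2 p2 -> 0 < t1 < 1 -> 0 < e ->
  summ1 t1 (fun s => weight s * (u1 s ^+ 2 + u2 s ^+ 2)) ->
  exists2 t, t1 < t < 1 & `|u1 t * p2 t - u2 t * p1 t| < e.
Proof.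
move=> h ht1 e0 [M hM]; apply: contrapT => hn; have /andP[t10 t11] := ht1.
pose t2 := (t1 + 1) / 2.
have t12 : t1 < t2 by rewrite /t2; order_lra.
have t21 : t2 < 1 by rewrite /t2; order_lra.
have in01 t : t2 <= t < 1 -> 0 < t < 1 by move=> /andP[? ?]; apply/andP; split; order_lra.
have hW t : t2 <= t < 1 -> e <= `|u1 t * p2 t - u2 t * p1 t|.
  move=> /andP[h1 h2]; rewrite leNgt; apply/negP => H; apply: hn; exists t => //.
  by rewrite h2 (lt_le_trans t12).
have ht2 : 0 < t2 < 1 by rewrite t21 andbT; order_lra.
pose y t := zz u1 t ^+ 2 + zz u2 t ^+ 2.
pose C := 1 + 2 / t1 ^+ 2 + `|a|.
have C00 : 0 <= 2 / t1 ^+ 2 by rewrite divr_ge0 ?sqr_ge0.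
have C0 : 0 <= C by rewrite /C !addr_ge0.
have du1 t : 0 < t < 1 -> dv u1 t (p1 t / t ^+ 2) by move=> /h[].
have du2 t : 0 < t < 1 -> dv u2 t (p2 t / t ^+ 2) by move=> /h[].
have c2e : 0 < 2 * e by rewrite mulr_gt0.
apply: (@end1_false R y (fun t => zz u1 t * qq u1 p1 t + zz u2 t * qq u2 p2 t)
  (fun t => kk t * (qq u1 p1 t ^+ 2 + qq u2 p2 t ^+ 2 + (Vc f t - a) * y t))
  (prim (fun s => weight s * (u1 s ^+ 2 + u2 s ^+ 2)) 2^-1) (2 * e) C M t2 ht2 c2e C0).
- move=> t /in01 ht; have [d1 d2 d3 d4] := hsol_zz h ht.
  by apply: dv_eq (dvD (dvX 2 d1) (dvX 2 d3)) _; rewrite /= !expr1; ring.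
- move=> t /in01 ht; have [d1 d2 d3 d4] := hsol_zz h ht.
  by apply: dv_eq (dvD (dvM d1 d2) (dvM d3 d4)) _; rewrite /y; ring.
- move=> t ht; have ht' := in01 t ht; have /andP[h1 h2] := ht.
  apply: ler_wpM2l; first by rewrite ltW// kk_gt0.
  have w := hW t ht; rewrite -(zq_W u1 p1 u2 p2 ht') in w.
  have hV := Vc_le2 f t10 (ltW (lt_le_trans t12 h1)) h2.
  have y0 : 0 <= y t by rewrite addr_ge0 ?sqr_ge0.
  have hy : - (2 / t1 ^+ 2 + `|a|) * y t <= (Vc f t - a) * y t.
    apply: ler_wpM2r => //; move: hV; rewrite ler_norml => /andP[v1 _].
    by have := ler_norm a; order_lra.
  suff : 2 * e <= qq u1 p1 t ^+ 2 + qq u2 p2 t ^+ 2 + y t by rewrite /C; move: hy; order_lra.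
  have s0 : 0 <= qq u1 p1 t ^+ 2 + qq u2 p2 t ^+ 2 + y t by rewrite addr_ge0// addr_ge0 ?sqr_ge0.
  rewrite -(@ler_pXn2r _ 2) ?nnegrE ?(ltW c2e)//.
  have w2 : e ^+ 2 <= (zz u1 t * qq u2 p2 t - zz u2 t * qq u1 p1 t) ^+ 2.
    by rewrite -[leRHS]real_normK ?num_real// lerXn2r ?nnegrE ?(ltW e0).
  move: w2; rewrite /y; move: (zz u1 t) (zz u2 t) (qq u1 p1 t) (qq u2 p2 t); clear => z1 z2 q1 q2.
  have := sqr_ge0 (q1 ^+ 2 + q2 ^+ 2 - (z1 ^+ 2 + z2 ^+ 2)); have := sqr_ge0 (z1 * q1 + z2 * q2).
  have -> : (q1 ^+ 2 + q2 ^+ 2 + (z1 ^+ 2 + z2 ^+ 2)) ^+ 2 = (q1 ^+ 2 + q2 ^+ 2 - (z1 ^+ 2 + z2 ^+ 2)) ^+ 2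
    + 4 * ((z1 * q1 + z2 * q2) ^+ 2 + (z1 * q2 - z2 * q1) ^+ 2) by ring.
  by rewrite exprMn (_ : 2 ^+ 2 = 4 :> R); [lra|ring].
- by move=> t _; rewrite addr_ge0 ?sqr_ge0.
- move=> t ht; have ht' := in01 t ht; apply: dv_eq (dv_S du1 du2 ht') _.
  by rewrite /y !mulrDr !wzz.
- by move=> t /andP[h1 h2]; apply: hM => //; exact: ltW.
Qed.

Lemma cont_wu2 u p t : (forall t, 0 < t < 1 -> dv u t (p t / t ^+ 2)) -> 0 < t < 1 ->
  {for t, continuous (fun s => weight s * u s ^+ 2)}.
Proof.
move=> du ht; apply: cvgM; first exact: cont_weight.
exact: dv_cont (dvX 2 (du t ht)).
Qed.

Lemma zz_not_summ1 u p t1 d : (forall t, 0 < t < 1 -> dv u t (p t / t ^+ 2)) -> 0 < t1 < 1 -> 0 < d ->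
  (forall t, t1 <= t < 1 -> d <= zz u t ^+ 2) -> ~ summ1 t1 (fun s => weight s * u s ^+ 2).
Proof.
move=> du ht1 d0 hd [M hM]; have /andP[t10 t11] := ht1.
have [t /andP[t1t tl] hK] := K0_unbounded ((M + 1) / d + K0 t1) ht1.
have := hM t1 t (lexx _) t1t tl.
have in01 x : t1 <= x <= t -> 0 < x < 1 by move=> /andP[? ?]; apply/andP; split; order_lra.
have : d * K0 t - d * K0 t1 <= prim (fun s => weight s * u s ^+ 2) 2^-1 t - prim (fun s => weight s * u s ^+ 2) 2^-1 t1.
  apply: (@dv_le R (fun s => d * K0 s) (fun s => d * kk s) _ (fun s => weight s * u s ^+ 2) t1 t t1t).
  - by move=> x /in01 hx; apply: dvZ; exact: dv_K0.
  - by move=> x /in01 hx; apply: (prim_dv (fun t ht => cont_wu2 du ht) (half01 R)).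
  - move=> x /andP[h1 h2]; have hx : 0 < x < 1 by apply: in01; rewrite !ltW.
    rewrite -wzz// mulrC; apply: ler_wpM2l; first by rewrite ltW// kk_gt0.
    by apply: hd; rewrite (ltW h1) (lt_trans h2).
have : (M + 1) / d <= K0 t - K0 t1 by order_lra.
by rewrite ler_pdivrMr// mulrC => ?; order_lra.
Qed.

(** The derivative of the energy [E = q^2 + a z^2] is [2 kk V z q], and [kk V] is bounded near 1
    although [kk] is not. Gronwall keeps [E] above some [c > 0], and [(z q)' = E + (V - 2 a) z^2] in
    artanh, so [end1_false] applies. *)
Lemma rsol_end1_pos f f1 n a u p t1 t : wave_profile f f1 n -> 0 < a -> rsol f a u p -> 0 < t1 < 1 ->
  summ1 t1 (fun s => weight s * u s ^+ 2) -> 0 < t < 1 -> u t = 0.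
Proof.
move=> wp a0 h ht1 [M hM] ht; apply: contrapT => un; have /andP[t10 t11] := ht1.
have hz := rsol_zsol h.
pose z := zz u; pose q := qq u p.
pose E t := q t ^+ 2 + a * z t ^+ 2.
have dE s : 0 < s < 1 -> dv E s (2 * (kk s * Vc f s * (z s * q s))).
  move=> hs; have [dz dq] := hz s hs.
  by apply: dv_eq (dvD (dvX 2 dq) (dvZ a (dvX 2 dz))) _; rewrite /= !expr1 /z /q; ring.
have E1 : 0 < E t1.
  have az0 : 0 <= a * z t1 ^+ 2 by rewrite mulr_ge0 ?sqr_ge0// ltW.
  rewrite lt_def addr_ge0 ?sqr_ge0// andbT paddr_eq0 ?sqr_ge0//.
  rewrite [a * _ == 0]mulf_eq0 (gt_eqF a0) /= !sqrf_eq0; apply/negP => /andP[/eqP q0 /eqP z0].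
  have [u0 p0] := zq_eq0 ht1 z0 q0.
  by apply: un; have [] := rsol_uniq wp h ht1 u0 p0 ht.
pose B := 2 / t1 ^+ 2; have B0 : 0 <= B by rewrite divr_ge0 ?sqr_ge0.
pose K := B * (1 + a^-1); have K00 : 0 <= K by rewrite mulr_ge0// addr_ge0// invr_ge0 ltW.
have kV s : t1 <= s < 1 -> `|kk s * Vc f s| <= B.
  move=> /andP[h1 h2]; have hs : 0 < s < 1 by rewrite h2 (lt_le_trans t10).
  rewrite normrM gtr0_norm ?kk_gt0// /kk mulrC ler_pdivrMr ?sub_sqr_gt0//.
  exact: Vc_le.
pose c := E t1 * expR (- K); have c0 : 0 < c by rewrite mulr_gt0// expR_gt0.
have Ec s : t1 <= s < 1 -> c <= E s.
  move=> /andP[h1 h2].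
  have sub x : t1 <= x <= s -> t1 <= x < 1 by move=> /andP[-> h3]; exact: le_lt_trans h2.
  have in01 x : t1 <= x <= s -> 0 < x < 1 by move=> /sub/andP[h3 ->]; rewrite (lt_le_trans t10).
  have := @gronwall_left R E _ K 0 t1 s h1 K00 (lexx 0) (fun x hx => dE x (in01 x hx)) _.
  have Es0 : 0 <= E s by apply: addr_ge0; [exact: sqr_ge0|apply: mulr_ge0; [exact: ltW|exact: sqr_ge0]].
  rewrite mul0r addr0 => H.
  have {}H : E t1 <= expR (K * (s - t1)) * E s.
    apply: H => x hx; rewrite addr0.
    have /ler_normlP[k1 k2] := kV x (sub x hx).
    have zq1 : `|2 * (z x * q x)| <= (1 + a^-1) * E x.
      have i0 : 0 <= a^-1 by rewrite invr_ge0 ltW.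
      have e1 : (1 + a^-1) * E x = q x ^+ 2 + z x ^+ 2 + (a * z x ^+ 2 + a^-1 * q x ^+ 2).
        by rewrite /E; field; rewrite gt_eqF.
      have := mulr_ge0 (ltW a0) (sqr_ge0 (z x)); have := mulr_ge0 i0 (sqr_ge0 (q x)).
      rewrite e1; have := sqr_ge0 (z x - q x); have := sqr_ge0 (z x + q x).
      move: (a * _) (a^-1 * _) => m1 m2; rewrite ler_norml !expr2 => *; apply/andP; split; order_lra.
    apply: le_trans (ler_norm _) _; rewrite normrN.
    have -> : 2 * (kk x * Vc f x * (z x * q x)) = kk x * Vc f x * (2 * (z x * q x)) by ring.
    have -> : K * E x = B * ((1 + a^-1) * E x) by rewrite /K mulrA.
    by rewrite normrM; apply: ler_pM => //; exact: kV (sub x hx).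
  rewrite /c expRN ler_pdivrMr ?expR_gt0//.
  by apply: (le_trans H); rewrite mulrC ler_wpM2l// ler_expR ler_piMr//; order_lra.
have C0 : 0 <= 2 * a + B by order_lra.
apply: (@end1_false R (fun t => z t ^+ 2) (fun t => z t * q t)
  (fun t => kk t * (q t ^+ 2 + (Vc f t - a) * z t ^+ 2))
  (prim (fun s => weight s * u s ^+ 2) 2^-1) c (2 * a + B) M t1 ht1 c0 C0).
- move=> s /andP[h1 h2]; have hs : 0 < s < 1 by rewrite h2 (lt_le_trans t10).
  by have [dz dq] := hz s hs; apply: dv_eq (dvX 2 dz) _; rewrite /= expr1 /z /q; ring.
- move=> s /andP[h1 h2]; have hs : 0 < s < 1 by rewrite h2 (lt_le_trans t10).
  by have [dz dq] := hz s hs; apply: dv_eq (dvM dz dq) _; rewrite /z /q; ring.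
- move=> s hs; have /andP[h1 h2] := hs; have hs' : 0 < s < 1 by rewrite h2 (lt_le_trans t10).
  apply: ler_wpM2l; first by rewrite ltW// kk_gt0.
  have := Ec s hs; have /ler_normlP[v1 v2] := Vc_le2 f t10 h1 h2.
  have : - B * z s ^+ 2 <= Vc f s * z s ^+ 2 by apply: ler_wpM2r; [exact: sqr_ge0|rewrite lerNl].
  by rewrite /E; order_lra.
- by move=> s _; exact: sqr_ge0.
- move=> s /andP[h1 h2]; have hs : 0 < s < 1 by rewrite h2 (lt_le_trans t10).
  apply: dv_eq (prim_dv (fun t ht => cont_wu2 (fun t ht => (h t ht).1) ht) (half01 R) hs) _.
  by rewrite wzz.
- by move=> s /andP[h1 h2]; exact: hM.
Qed.

Lemma summ1W t1 t2 r : t1 <= t2 -> summ1 t1 r -> summ1 t2 r.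
Proof. by move=> h [M hM]; exists M => a b ha; apply: hM; exact: le_trans ha. Qed.

(** Comparison with [P = t^2 f'], the [z] of the zero mode, which stays between positive constants
    in absolute value by [P_near1]. If the Wronskian [w] is zero, [z] is a multiple of [P];
    otherwise [z / P] diverges like artanh. In neither case is [z] square integrable in artanh. *)
Lemma rsol_end1_0 f f1 n u p t1 t : wave_profile f f1 n -> rsol f 0 u p -> 0 < t1 < 1 ->
  summ1 t1 (fun s => weight s * u s ^+ 2) -> 0 < t < 1 -> u t = 0.
Proof.
move=> wp h ht1 hS ht; apply: contrapT => un; have /andP[t10 t11] := ht1.
have [k [B [r [k0 /andP[r0 r1] hP]]]] := P_near1 wp.
have hz := rsol_zsol h; have hz0 := rsol_zsol (zmode_rsol wp).
pose z := zz u; pose q := qq u p; pose P := zz (zmode f1); pose Pq := qq (zmode f1) (zmode_p f f1).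
have PE s : 0 < s < 1 -> P s = s ^+ 2 * f1 s.
  by move=> hs; have := sq_gt0 hs; rewrite /P /zz /zmode -/(sq s) => s0; field; rewrite gt_eqF.
pose t2 := (Num.max t1 r + 1) / 2.
have m1 : Num.max t1 r < 1 by rewrite gt_max t11.
have mt : t1 <= Num.max t1 r by rewrite le_max lexx.
have mr : r <= Num.max t1 r by rewrite le_max lexx orbT.
have t12 : t1 <= t2 by rewrite /t2; order_lra.
have rt2 : r < t2 by rewrite /t2; order_lra.
have t21 : t2 < 1 by rewrite /t2; order_lra.
have ht2 : 0 < t2 < 1 by rewrite t21 andbT; order_lra.
have in01 s : t2 <= s < 1 -> 0 < s < 1 by move=> /andP[? ?]; apply/andP; split; order_lra.
have bP s : t2 <= s < 1 -> k <= `|P s| <= B.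
  by move=> hs; rewrite PE ?in01//; apply: hP; move: hs => /andP[? ?]; apply/andP; split; order_lra.
have Pn s : t2 <= s < 1 -> P s != 0.
  by move=> /bP/andP[h1 _]; rewrite -normr_gt0; exact: lt_le_trans h1.
have ht2' : t2 <= t2 < 1 by rewrite lexx.
have B0 : 0 < B by have /andP[h1 h2] := bP t2 ht2'; exact: lt_le_trans k0 (le_trans h1 h2).
pose w s := z s * Pq s - P s * q s.
have dw s : 0 < s < 1 -> dv w s 0.
  move=> hs; have [d1 d2] := hz s hs; have [d3 d4] := hz0 s hs.
  by apply: dv_eq (dvB (dvM d1 d4) (dvM d3 d2)) _; rewrite /z /q /P /Pq; ring.
have wc s : t2 <= s < 1 -> w s = w t2.
  move=> /andP[h1 h2]; apply/esym; apply: dv_const h1 _ => x /andP[h3 h4]; apply: dw.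
  by apply: in01; rewrite h3 (le_lt_trans h4).
(* Reduction of order: [(z / P)' = - kk w / P^2]. The factor [- w t2] makes the derivative
   nonnegative for either sign of the Wronskian. *)
have dD s : t2 <= s < 1 -> dv (fun x => - w t2 * (z x / P x)) s (kk s * (w t2 ^+ 2 / P s ^+ 2)).
  move=> hs; have hs' := in01 s hs; have [d1 d2] := hz s hs'; have [d3 d4] := hz0 s hs'.
  apply: dv_eq (dvZ (- w t2) (dvM d1 (dvV (Pn s hs) d3))) _.
  rewrite -(wc s hs) /w -/P -/(P s) -/Pq -/z -/q; move: (Pn s hs); move: (P s) => x xn; field; exact: xn.
have big : exists t3 d, [/\ t2 <= t3 < 1, 0 < d & forall s, t3 <= s < 1 -> d <= z s ^+ 2].
  have [w0|wn] := eqVneq (w t2) 0.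
    have dc s : t2 <= s < 1 -> z s / P s = z t2 / P t2.
      move=> /andP[h1 h2]; apply/esym; apply: (@dv_const R (fun x => z x / P x)) h1 _ => x /andP[h3 h4].
      have hx : t2 <= x < 1 by rewrite h3 (le_lt_trans h4).
      have hx' := in01 x hx; have [d1 d2] := hz x hx'; have [d3 d4] := hz0 x hx'.
      apply: dv_eq (dvM d1 (dvV (Pn x hx) d3)) _.
      have e : z x * Pq x = P x * q x by apply/eqP; rewrite -subr_eq0 -/(w x) wc// w0.
      rewrite -/P -/Pq -/z -/q.
      transitivity (kk x * (P x * q x - z x * Pq x) / P x ^+ 2); last by rewrite e subrr mulr0 mul0r.
      by move: (Pn x hx); move: (P x) => y yn; field.
    pose c0 := z t2 / P t2.
    have cn : c0 != 0.
      apply/negP => /eqP c00; apply: un.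
      have z0 s : t2 <= s < 1 -> z s = 0.
        move=> hs; have := dc s hs; rewrite -/c0 c00 => /eqP.
        by rewrite mulf_eq0 invr_eq0 (negPf (Pn s hs)) orbF => /eqP.
      pose t3 := (t2 + 1) / 2.
      have ht3 : t2 < t3 < 1 by rewrite /t3; apply/andP; split; order_lra.
      have ht3' : t2 <= t3 < 1 by move: ht3 => /andP[/ltW -> ->].
      have q0 : q t3 = 0.
        have [d1 _] := hz t3 (in01 _ ht3').
        have d2 : dv z t3 0.
          apply: (@dv_local R (fun=> 0) z t3 0 t2 1 ht3 _ (dv_cst 0 t3)) => x /andP[h3 h4].
          by rewrite z0// (ltW h3).
        have /eqP := dv_uniq d1 d2; rewrite mulf_eq0 gt_eqF ?kk_gt0 ?in01//=.
        by move=> /eqP.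
      have [u0 p0] := zq_eq0 (in01 _ ht3') (z0 _ ht3') q0.
      by have [] := rsol_uniq wp h (in01 _ ht3') u0 p0 ht.
    exists t2, ((k * c0) ^+ 2); split; [by rewrite lexx|by rewrite exprn_even_gt0//= mulf_neq0// gt_eqF|].
    move=> s hs; have -> : z s = P s * c0 by rewrite /c0 -(dc s hs) mulrC divfK ?Pn.
    have e x : (x * c0) ^+ 2 = x ^+ 2 * c0 ^+ 2 by rewrite exprMn.
    rewrite !e; apply: ler_wpM2r; first exact: sqr_ge0.
    by rewrite -[leRHS]real_normK ?num_real// lerXn2r ?nnegrE ?(ltW k0)//; have /andP[] := bP s hs.
  have c0 : 0 < w t2 ^+ 2 / B ^+ 2 by apply: divr_gt0; [rewrite lt_def sqr_ge0 sqrf_eq0 wn|rewrite exprn_gt0].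
  pose c := w t2 ^+ 2 / B ^+ 2; pose D s := - w t2 * (z s / P s).
  have [t3 /andP[t23 t31] hK] := K0_unbounded ((`|w t2| - D t2) / c + K0 t2) ht2.
  exists t3, (k ^+ 2); split; [by rewrite t23|by rewrite exprn_gt0|].
  move=> s /andP[t3s s1]; have hs : t2 <= s < 1 by rewrite s1 (le_trans t23).
  have hD : c * K0 s - c * K0 t2 <= D s - D t2.
    have t2s := le_trans t23 t3s.
    have sub x : t2 <= x <= s -> t2 <= x < 1 by move=> /andP[-> h3]; exact: le_lt_trans s1.
    apply: (@dv_le R (fun x => c * K0 x) (fun x => c * kk x) D _ t2 s t2s _ (fun x hx => dD x (sub x hx))).
      by move=> x hx; apply: dvZ; apply: dv_K0; apply: in01; exact: sub.
    move=> x /andP[h1 h2]; have hx : t2 <= x < 1 by rewrite (ltW h1) (lt_trans h2).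
    rewrite mulrC; apply: ler_wpM2l; first by rewrite ltW// kk_gt0// in01.
    rewrite /c; apply: ler_wpM2l; first exact: sqr_ge0.
    have P2 : 0 < P x ^+ 2 by rewrite lt_def sqr_ge0 sqrf_eq0 Pn.
    have B2 : 0 < B ^+ 2 by rewrite exprn_gt0.
    rewrite lef_pV2 ?posrE//.
    by rewrite -[leLHS]real_normK ?num_real// lerXn2r ?nnegrE ?(ltW B0)//; have /andP[] := bP x hx.
  have Kle : K0 t3 <= K0 s by apply: K0_le => //; order_lra.
  have : (`|w t2| - D t2) / c <= K0 s - K0 t2 by order_lra.
  rewrite ler_pdivrMr// mulrC => Dw.
  have : `|w t2| <= D s by move: hD Dw; order_lra.
  move=> H; have {H} := le_trans H (ler_norm _); rewrite /D normrM normrN ler_pMr ?normr_gt0// => hzP.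
  have Ps := Pn s hs.
  have : `|P s| <= `|z s|.
    by move: hzP; rewrite normrM normfV ler_pdivlMr ?normr_gt0// mul1r.
  have /andP[kP _] := bP s hs => zP.
  by rewrite -[leRHS]real_normK ?num_real// lerXn2r ?nnegrE ?(ltW k0)// (le_trans kP).
have [t3 [d [ht3 d0 hd]]] := big; have /andP[t23 t31] := ht3.
apply: (zz_not_summ1 (fun t ht => (h t ht).1) (in01 _ ht3) d0 hd).
exact: summ1W (le_trans t12 t23) hS.
Qed.

Lemma rsol_end1 f f1 n a u p t1 t : wave_profile f f1 n -> 0 <= a -> rsol f a u p -> 0 < t1 < 1 ->
  summ1 t1 (fun s => weight s * u s ^+ 2) -> 0 < t < 1 -> u t = 0.
Proof.
move=> wp; rewrite le_eqVlt => /orP[/eqP <-|a0] h ht1; first exact: rsol_end1_0 wp h ht1.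
exact: rsol_end1_pos wp a0 h ht1.
Qed.

End DecayAtOne.

(** * Regular solutions at 0 *)
Section Regular.
Variable R : realType.
Implicit Types (t a b c d e C K M x y : R) (f u p h r v q : R -> R).

Lemma summ0_bounded t1 r K : t1 < 1 -> (forall t, 0 < t < 1 -> {for t, continuous r}) ->
  (forall t, 0 < t <= t1 -> r t <= K) -> summ0 t1 r.
Proof.
move=> t11 cr hK; exists `|K| => a b a0 ab bt.
have sub x : a <= x <= b -> 0 < x < 1 by move=> /andP[? ?]; apply/andP; split; order_lra.
have : prim r 2^-1 b - prim r 2^-1 a <= K * b - K * a.
  apply: (@dv_le R _ r (fun s => K * s) (fun=> K) a b ab (fun x hx => prim_dv cr (half01 R) (sub x hx))).
    by move=> x _; apply: dv_eq (dvZ K (dv_id x)) _; rewrite mulr1.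
  by move=> x /andP[h1 h2]; apply: hK; apply/andP; split; order_lra.
move=> H; apply: (le_trans H); rewrite -mulrBr; apply: le_trans (ler_norm _) _.
by rewrite normrM ler_piMr// ger0_norm; order_lra.
Qed.

Lemma summ0_le t1 r q : t1 < 1 -> (forall t, 0 < t < 1 -> {for t, continuous r}) ->
  (forall t, 0 < t < 1 -> {for t, continuous q}) ->
  (forall t, 0 < t <= t1 -> r t <= q t) -> summ0 t1 q -> summ0 t1 r.
Proof.
move=> t11 cr cq hK [C hC]; exists C => a b a0 ab bt; apply: le_trans (hC a b a0 ab bt).
have sub x : a <= x <= b -> 0 < x < 1 by move=> /andP[? ?]; apply/andP; split; order_lra.
apply: (dv_le ab (fun x hx => prim_dv cr (half01 R) (sub x hx)) (fun x hx => prim_dv cq (half01 R) (sub x hx))).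
by move=> x /andP[h1 h2]; apply: hK; apply/andP; split; order_lra.
Qed.

Lemma summ1_le t1 r q : 0 < t1 -> (forall t, 0 < t < 1 -> {for t, continuous r}) ->
  (forall t, 0 < t < 1 -> {for t, continuous q}) ->
  (forall t, t1 <= t < 1 -> r t <= q t) -> summ1 t1 q -> summ1 t1 r.
Proof.
move=> t11 cr cq hK [C hC]; exists C => a b a0 ab bt; apply: le_trans (hC a b a0 ab bt).
have sub x : a <= x <= b -> 0 < x < 1 by move=> /andP[? ?]; apply/andP; split; order_lra.
apply: (dv_le ab (fun x hx => prim_dv cr (half01 R) (sub x hx)) (fun x hx => prim_dv cq (half01 R) (sub x hx))).
by move=> x /andP[h1 h2]; apply: hK; apply/andP; split; order_lra.
Qed.

Lemma prim_lin r q c1 c2 t0 a b : 0 < t0 < 1 -> (forall t, 0 < t < 1 -> {for t, continuous r}) ->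
  (forall t, 0 < t < 1 -> {for t, continuous q}) -> 0 < a -> a <= b -> b < 1 ->
  prim (fun t => c1 * r t + c2 * q t) t0 b - prim (fun t => c1 * r t + c2 * q t) t0 a =
  c1 * (prim r t0 b - prim r t0 a) + c2 * (prim q t0 b - prim q t0 a).
Proof.
move=> ht0 cr cq a0 ab b1.
have sub x : a <= x <= b -> 0 < x < 1 by move=> /andP[? ?]; apply/andP; split; order_lra.
have cs t : 0 < t < 1 -> {for t, continuous (fun t => c1 * r t + c2 * q t)}.
  by move=> ht; apply: cvgD; apply: cvgM; [exact: cvg_cst|exact: cr|exact: cvg_cst|exact: cq].
have d1 x (hx : a <= x <= b) := prim_dv cs ht0 (sub x hx).
have d2 x (hx : a <= x <= b) := dvD (dvZ c1 (prim_dv cr ht0 (sub x hx))) (dvZ c2 (prim_dv cq ht0 (sub x hx))).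
by apply/eqP; rewrite eq_le; apply/andP; split;
  [have := dv_le ab d1 d2 (fun x _ => lexx _)|have := dv_le ab d2 d1 (fun x _ => lexx _)]; move=> H; order_lra.
Qed.

Lemma summ0D t1 r q : t1 < 1 -> (forall t, 0 < t < 1 -> {for t, continuous r}) ->
  (forall t, 0 < t < 1 -> {for t, continuous q}) -> summ0 t1 r -> summ0 t1 q ->
  summ0 t1 (fun t => r t + q t).
Proof.
move=> t11 cr cq [C hC] [D hD]; exists (C + D) => a b a0 ab bt.
have -> : (fun t => r t + q t) = (fun t => 1 * r t + 1 * q t) by apply/funext => t; rewrite !mul1r.
rewrite (prim_lin 1 1 (half01 R) cr cq a0 ab (le_lt_trans bt t11)).
by have := hC a b a0 ab bt; have := hD a b a0 ab bt; order_lra.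
Qed.

(** While [p > 0], [u] increases from 0, so [p' = Qc u >= 0] and [p] cannot come down to a first
    zero. *)
Lemma pos_right f a u p s t1 : rsol f a u p -> 0 < s -> s < t1 -> t1 < 1 ->
  (forall t, s <= t <= t1 -> 0 <= Qc f a t) -> u s = 0 -> 0 < p s ->
  forall t, s <= t <= t1 -> 0 <= u t /\ p s <= p t.
Proof.
move=> h s0 st t11 hQ us ps.
have in01 x : s <= x <= t1 -> 0 < x < 1 by move=> /andP[? ?]; apply/andP; split; order_lra.
have um t : s <= t <= t1 -> (forall x, s <= x < t -> 0 < p x) -> forall x, s <= x <= t -> 0 <= u x.
  move=> /andP[h1 h2] hp x /andP[h3 h4]; rewrite -us.
  have sub y : s <= y <= x -> 0 < y < 1 by move=> /andP[? ?]; apply: in01; apply/andP; split; order_lra.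
  apply: (dv_mono h3 (fun y hy => (h y (sub y hy)).1)) => y /andP[h5 h6].
  by rewrite divr_ge0 ?sqr_ge0// ltW// hp// (ltW h5) (lt_le_trans h6).
have pm t : s <= t <= t1 -> (forall x, s <= x < t -> 0 < p x) -> p s <= p t.
  move=> ht hp; have /andP[h1 h2] := ht.
  have sub y : s <= y <= t -> s <= y <= t1 by move=> /andP[? ?]; apply/andP; split; order_lra.
  apply: (dv_mono h1 (fun y hy => (h y (in01 y (sub y hy))).2)) => y /andP[h5 h6].
  have hy : s <= y <= t by rewrite !ltW.
  by rewrite mulr_ge0 ?hQ ?sub// (um t).
have pp t : s <= t <= t1 -> 0 < p t.
  move=> /andP[h1 h2]; rewrite ltNge; apply/negP => pt.
  have cp x : s <= x <= t -> {for x, continuous p}.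
    by move=> /andP[h3 h4]; apply: dv_cont (h x (in01 x _)).2; rewrite h3 (le_trans h4).
  have [c [/andP[c1 c2] pc hc]] := first_zero h1 cp ps pt.
  have : p s <= p c by apply: pm => //; rewrite (ltW c1) (le_trans c2).
  by rewrite pc; order_lra.
move=> t ht; have hp x : s <= x < t -> 0 < p x.
  by move=> /andP[h1 h2]; apply: pp; move: ht => /andP[_ h3]; rewrite h1 (le_trans (ltW h2)).
split; last exact: pm ht hp.
by apply: (um t ht hp); move: ht => /andP[-> _]; rewrite lexx.
Qed.

Lemma dv_W2 f a b u p v q t : rsol f a u p -> rsol f b v q -> 0 < t < 1 ->
  dv (fun s => u s * q s - v s * p s) t (- (b - a) * (weight t * (u t * v t))).
Proof.
move=> h k ht; have [d1 d2] := h t ht; have [d3 d4] := k t ht.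
by apply: dv_eq (dvB (dvM d1 d4) (dvM d3 d2)) _; rewrite /Qc; ring.
Qed.

Lemma W2_const f a u p v q s t : rsol f a u p -> rsol f a v q -> 0 < s -> s <= t -> t < 1 ->
  u s * q s - v s * p s = u t * q t - v t * p t.
Proof.
move=> h k s0 st t1; apply: (@dv_const R (fun s => u s * q s - v s * p s)) st _ => x /andP[h1 h2].
have hx : 0 < x < 1 by apply/andP; split; order_lra.
by apply: dv_eq (dv_W2 h k hx) _; rewrite subrr oppr0 mul0r.
Qed.

Lemma rsol_eq f f1 n a u p v q t0 t : wave_profile f f1 n -> rsol f a u p -> rsol f a v q -> 0 < t0 < 1 ->
  u t0 = v t0 -> p t0 = q t0 -> 0 < t < 1 -> u t = v t /\ p t = q t.
Proof.
move=> wp h k ht0 e1 e2 ht.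
have [] := rsol_uniq wp (rsolD h (rsolZ (-1) k)) ht0 _ _ ht; rewrite ?e1 ?e2 ?mulN1r ?subrr//.
by move=> /eqP + /eqP; rewrite !subr_eq0 => /eqP -> /eqP ->.
Qed.

(** Nonnegativity of [u] and [p] up to [t1] takes the place of a boundary condition at the singular
    point 0; with the normalization at [t1], [d] is the only free datum. *)
Definition regsol f a t1 d u p := [/\ rsol f a u p, u t1 = 1, p t1 = d &
  forall t, 0 < t <= t1 -> 0 <= u t /\ 0 <= p t].

(* A limit of the solutions that vanish at a point tending to 0. *)
Lemma regsol_ex f f1 n a t1 : wave_profile f f1 n -> 0 < t1 < 1 ->
  (forall t, 0 < t <= t1 -> 1 <= Qc f a t) -> exists d u p, regsol f a t1 d u p.
Proof.
move=> wp ht1 hQ; have /andP[t10 t11] := ht1.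
have Q0 s t : 0 < s -> s <= t <= t1 -> 0 <= Qc f a t.
  move=> s0 /andP[h1 h2]; apply: le_trans ler01 (hQ t _); apply/andP; split; order_lra.
have bvp s : 0 < s -> s < t1 -> exists d u p, [/\ rsol f a u p, u t1 = 1, p t1 = d, u s = 0 &
    forall t, s <= t <= t1 -> 0 <= u t /\ 0 <= p t].
  move=> s0 st; have hs : 0 < s < 1 by apply/andP; split; order_lra.
  have [v [q [v0 q1 hv]]] := rsol_ex a 0 1 wp hs.
  have q0 : 0 < q s by rewrite q1.
  have hp := pos_right hv s0 st t11 (fun t => Q0 s t s0) v0 q0.
  have V : 0 < v t1.
    have in01 y : s <= y <= t1 -> 0 < y < 1 by move=> /andP[? ?]; apply/andP; split; order_lra.
    rewrite -v0; apply: (dv_smono st (fun y hy => (hv y (in01 y hy)).1)).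
    move=> y /andP[h1 h2]; have [] := hp y _; first by rewrite !ltW.
    by rewrite q1 => _ ?; rewrite divr_gt0 ?exprn_gt0//; order_lra.
  exists ((v t1)^-1 * q t1), (fun t => (v t1)^-1 * v t), (fun t => (v t1)^-1 * q t).
  split => //; [exact: rsolZ|by rewrite mulVf// gt_eqF|by rewrite v0 mulr0|].
  move=> t ht; have [h1 h2] := hp t ht; have i0 : 0 <= (v t1)^-1 by rewrite invr_ge0 ltW.
  by split; rewrite mulr_ge0//; order_lra.
pose s0 := t1 / 2; have s00 : 0 < s0 by rewrite /s0; order_lra.
have s0t : s0 < t1 by rewrite /s0; order_lra.
have [D [v [q [hv vt1 qt1 vs0 hvp]]]] := bvp s0 s00 s0t.
pose aa (k : nat) := t1 / k.+3%:R.
have aa0 k : 0 < aa k by rewrite divr_gt0// ltr0n.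
have aas k : aa k <= s0.
  by rewrite /aa /s0; apply: ler_wpM2l; [exact: ltW|rewrite lef_pV2 ?posrE ?ltr0n// ler_nat].
have aat k : aa k < t1 by exact: le_lt_trans (aas k) s0t.
have /choice[X hX] k : exists x : R * ((R -> R) * (R -> R)),
   [/\ rsol f a x.2.1 x.2.2, x.2.1 t1 = 1, x.2.2 t1 = x.1 &
    forall t, aa k <= t <= t1 -> 0 <= x.2.1 t /\ 0 <= x.2.2 t].
  by have [d [u [p [e1 e2 e3 e4 e5]]]] := bvp (aa k) (aa0 k) (aat k); exists (d, (u, p)).
have [u2 [p2 [e1 e2 h2]]] := rsol_ex a 0 1 wp ht1.
(* Compactness: the Wronskian with the solution [v] that vanishes at [s0] equals [D - (X k).1] at
   [t1], and it is nonnegative at [s0]. *)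
have dk k : 0 <= (X k).1 <= D.
  have [g1 g2 g3 g4] := hX k; apply/andP; split.
    by rewrite -g3; have [] := g4 t1 _; rewrite ?lexx ?andbT// ltW.
  have := W2_const g1 hv s00 (ltW s0t) t11; rewrite g2 g3 vt1 qt1 vs0 mul0r subr0 !mul1r => W.
  suff : 0 <= (X k).2.1 s0 * q s0 by rewrite W subr_ge0.
  have [? _] := g4 s0 ltac:(by rewrite aas ltW).
  by have [_ ?] := hvp s0 ltac:(by rewrite lexx ltW); rewrite mulr_ge0.
have dk' (k : nat) (i : 'I_1) : `|(X k).1| <= D by have /andP[h3 h4] := dk k; rewrite ger0_norm.
have [y hy] := bolzano_weierstrass_fin dk'.
pose d := y ord0.
have [u [p [u1 p1 hu]]] := rsol_ex a 1 d wp ht1.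
exists d, u, p; split => // t ht; have /andP[t0 tt1] := ht.
have ht' : 0 < t < 1 by apply/andP; split; order_lra.
(* The limit differs from the approximant [X k] by the small factor [d - (X k).1] times a fixed
   solution, so a negative value would already occur for some late [X k]. The projections of the
   pair treat [u] and [p] alike. *)
have key (F : (R -> R) * (R -> R) -> R -> R) : (forall k, F (u, p) t = F (X k).2 t + (d - (X k).1) * F (u2, p2) t) ->
    (forall k, aa k <= t -> 0 <= F (X k).2 t) -> 0 <= F (u, p) t.
  move=> eF F0; rewrite leNgt; apply/negP => neg.
  pose e := - F (u, p) t / (1 + `|F (u2, p2) t|).
  have n0 : 0 < 1 + `|F (u2, p2) t| by have := normr_ge0 (F (u2, p2) t); order_lra.
  have e0 : 0 < e by rewrite divr_gt0// oppr_gt0.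
  have [N hN] : exists N, forall k, (N <= k)%N -> aa k <= t.
    exists (Num.truncn (t1 / t)).+1 => k hk; rewrite /aa ler_pdivrMr ?ltr0n// mulrC -ler_pdivrMr//.
    apply: ltW; apply: lt_le_trans (truncnS_gt _) _.
    by rewrite ler_nat; apply: (leq_trans hk); rewrite -[X in (X <= _)%N]addn0 -addn3 leq_add2l.
  have [k Nk hk] := hy e e0 N; have := F0 k (hN k Nk); have := eF k.
  have : `|(d - (X k).1) * F (u2, p2) t| <= e * `|F (u2, p2) t|.
    by rewrite normrM; apply: ler_wpM2r => //; rewrite distrC ltW//; exact: hk ord0.
  have : e * (1 + `|F (u2, p2) t|) = - F (u, p) t by rewrite /e divfK// gt_eqF.
  move=> E1 /ler_normlP[E2 E3] E4 E5; rewrite E4 in E1; order_lra.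
have eqk k : u t = (X k).2.1 t + (d - (X k).1) * u2 t /\ p t = (X k).2.2 t + (d - (X k).1) * p2 t.
  have [g1 g2 g3 g4] := hX k.
  apply: (rsol_eq wp hu (rsolD g1 (rsolZ (d - (X k).1) h2)) ht1 _ _ ht').
    by rewrite u1 g2 e1 mulr0 addr0.
  by rewrite p1 g3 e2 mulr1; ring.
have g k : aa k <= t -> 0 <= (X k).2.1 t /\ 0 <= (X k).2.2 t.
  by move=> hk; have [_ _ _ g4] := hX k; apply: g4; rewrite hk.
split; [refine (key fst _ _)|refine (key snd _ _)] => k.
- exact: (eqk k).1.
- by move=> /g[].
- exact: (eqk k).2.
- by move=> /g[].
Qed.

Section RegTheory.
Variables (f f1 : R -> R) (n : nat) (t1 : R).
Hypothesis wp : wave_profile f f1 n.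
Hypothesis ht1 : 0 < t1 < 1.

Let t10 : 0 < t1. Proof. by case/andP: ht1. Qed.
Let t11 : t1 < 1. Proof. by case/andP: ht1. Qed.
Let in01 t : 0 < t <= t1 -> 0 < t < 1.
Proof. by move=> /andP[-> h]; exact: le_lt_trans t11. Qed.

Lemma regsol_le1 a d u p t : regsol f a t1 d u p -> 0 < t <= t1 -> u t <= 1.
Proof.
move=> [h u1 _ hp] /andP[t0 tt1]; rewrite -u1.
have sub x : t <= x <= t1 -> 0 < x <= t1 by move=> /andP[h1 ->]; rewrite (lt_le_trans t0).
apply: (dv_mono tt1 (fun x hx => (h x (in01 (sub x hx))).1)) => x /andP[h1 h2].
by rewrite divr_ge0 ?sqr_ge0//; apply: (hp x _).2; rewrite (lt_trans t0) ?ltW.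
Qed.

Lemma weight_le t : 0 < t <= t1 -> weight t <= (1 - t1 ^+ 2)^-2.
Proof.
move=> /andP[t0 tt1]; have ht : 0 < t < 1 by rewrite t0 (le_lt_trans tt1).
have h := sub_sqr_gt0 ht1.
have tt : t ^+ 2 <= t1 ^+ 2 by rewrite lerXn2r ?nnegrE// ltW.
have h' := sub_sqr_gt0 ht; rewrite /weight -[leRHS]mul1r; apply: ler_pM.
- exact: sqr_ge0.
- by rewrite invr_ge0 sqr_ge0.
- by apply: (le_trans tt); have := h; lra.
- rewrite lef_pV2 ?posrE ?exprn_gt0// lerXn2r ?nnegrE ?(ltW h) ?(ltW h')//.
  by move: tt; lra.
Qed.

Lemma regsol_summ0 a d u p : regsol f a t1 d u p -> summ0 t1 (fun s => weight s * u s ^+ 2).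
Proof.
move=> hr; have [h u1 _ hp] := hr.
have cw t : 0 < t < 1 -> {for t, continuous (fun s => weight s * u s ^+ 2)}.
  by move=> ht; exact: cont_wu2 (fun t ht => (h t ht).1) ht.
apply: (summ0_bounded t11 cw).
move=> t ht; apply: (le_trans _ (weight_le ht)); have [u0 _] := hp t ht.
by rewrite ler_piMr ?(ltW (weight_gt0 (in01 ht)))// expr_le1// (regsol_le1 hr).
Qed.

Lemma end0_W2 a b u p v q e t2 : (forall t, 0 < t <= t1 -> 1 <= Qc f a t) ->
  (forall t, 0 < t <= t1 -> 1 <= Qc f b t) -> rsol f a u p -> rsol f b v q ->
  summ0 t1 (fun s => weight s * u s ^+ 2) -> summ0 t1 (fun s => weight s * v s ^+ 2) ->
  0 < e -> 0 < t2 <= t1 -> exists2 t, 0 < t < t2 & `|u t * q t - v t * p t| < e.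
Proof.
move=> Qa Qb h k su sv e0 ht2.
apply: (@end0_W R u p v q (fun t ht => (h t ht).1) (fun t ht => (k t ht).1)
  (fun t => (p t ^+ 2 + q t ^+ 2) / t ^+ 2 + (Qc f a t * u t ^+ 2 + Qc f b t * v t ^+ 2)) t1) => //.
- move=> t ht; have [d1 d2] := h t (in01 ht); have [d3 d4] := k t (in01 ht).
  by apply: dv_eq (dvD (dvM d1 d2) (dvM d3 d4)) _; ring.
- move=> t ht; rewrite lerD2l; apply: lerD; rewrite ler_peMl ?sqr_ge0//; [exact: Qa|exact: Qb].
- have -> : (fun s => weight s * (u s ^+ 2 + v s ^+ 2)) = (fun s => weight s * u s ^+ 2 + weight s * v s ^+ 2).
    by apply/funext => s; rewrite mulrDr.
  exact: summ0D t11 (fun t ht => cont_wu2 (fun t ht => (h t ht).1) ht) (fun t ht => cont_wu2 (fun t ht => (k t ht).1) ht) su sv.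
Qed.

(** Up to a factor there is only one square integrable solution near 0: the Wronskian of two of them
    is constant and arbitrarily small near 0. *)
Lemma regsol_prop a d u p v q t : (forall t, 0 < t <= t1 -> 1 <= Qc f a t) ->
  regsol f a t1 d u p -> rsol f a v q -> summ0 t1 (fun s => weight s * v s ^+ 2) ->
  0 < t < 1 -> v t = v t1 * u t /\ q t = v t1 * p t.
Proof.
move=> Qa hr k sv ht; have [h u1 p1 hp] := hr.
have W0 : u t1 * q t1 - v t1 * p t1 = 0.
  apply/eqP/negPn/negP => Wn; have W0 : 0 < `|u t1 * q t1 - v t1 * p t1| by rewrite normr_gt0.
  have tt : 0 < t1 <= t1 by rewrite t10 lexx.
  have [s /andP[s0 s1]] := end0_W2 Qa Qa h k (regsol_summ0 hr) sv W0 tt.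
  by rewrite (W2_const h k s0 (ltW s1) t11) ltxx.
apply: (rsol_eq wp k (rsolZ (v t1) h) ht1 _ _ ht); first by rewrite u1 mulr1.
by apply/esym/eqP; rewrite -subr_eq0 -oppr_eq0 opprB -[q t1]mul1r -u1 W0.
Qed.

(** [u] is nonnegative and nondecreasing, so a zero would make it vanish on an interval. *)
Lemma regsol_gt0 a d u p t : regsol f a t1 d u p -> 0 < t <= t1 -> 0 < u t.
Proof.
move=> hr ht; have [h u1 p1 hp] := hr; have /andP[t0 tt1] := ht.
rewrite lt_def (hp t ht).1 andbT; apply/negP => /eqP ut.
pose s := t / 2; have s0 : 0 < s by rewrite /s; lra.
have st : s < t by rewrite /s; lra.
have z x : 0 < x <= t -> u x = 0.
  move=> /andP[x0 xt]; apply/eqP; rewrite eq_le (hp x _).1 ?x0 ?(le_trans xt)// andbT -ut.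
  have sub y : x <= y <= t -> 0 < y <= t1 by move=> /andP[? ?]; apply/andP; split; lra.
  apply: (dv_mono xt (fun y hy => (h y (in01 (sub y hy))).1)) => y /andP[h1 h2].
  by rewrite divr_ge0 ?sqr_ge0//; apply: (hp y _).2; apply: sub; rewrite !ltW.
have hs : 0 < s < 1 by apply: in01; rewrite s0 (le_trans (ltW st)).
have ps : p s = 0.
  have ds : dv u s 0.
    apply: (@dv_local R (fun=> 0) u s 0 0 t _ _ (dv_cst 0 s)); first by rewrite s0.
    by move=> y /andP[h1 h2]; rewrite z// h1 ltW.
  have /eqP := dv_uniq (h s hs).1 ds; rewrite mulf_eq0 invr_eq0 expf_eq0 /= (gt_eqF s0) orbF.
  by move=> /eqP.
have us : u s = 0 by apply: z; rewrite s0 ltW.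
have [u10 _] := rsol_uniq wp h hs us ps ht1.
by move: u10; rewrite u1 => /eqP; rewrite oner_eq0.
Qed.

(** The Wronskian of the two regular solutions tends to 0 at 0, equals [c - d] at [t1] and has
    derivative [- (b - a) weight u v]. Positivity of [u] and [v] gives the strict inequality;
    [u, v <= 1] and the bound for the weight give the Lipschitz estimate. Both are needed for the
    initial value of the Prüfer angle. *)
Lemma regsol_cmp a b d c u p v q : (forall t, 0 < t <= t1 -> 1 <= Qc f a t) ->
  (forall t, 0 < t <= t1 -> 1 <= Qc f b t) -> regsol f a t1 d u p -> regsol f b t1 c v q -> a < b ->
  c < d /\ d - c <= (b - a) * (1 - t1 ^+ 2)^-2.
Proof.
move=> Qa Qb hu hv ab; have [h u1 p1 hp] := hu; have [k v1 q1 kp] := hv.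
pose W s := u s * q s - v s * p s.
have Wt : W t1 = c - d by rewrite /W u1 v1 p1 q1 !mul1r.
have dW s : 0 < s < 1 -> dv W s (- (b - a) * (weight s * (u s * v s))) by move=> hs; exact: (dv_W2 h k hs).
have small e t2 : 0 < e -> 0 < t2 <= t1 -> exists2 t, 0 < t < t2 & `|W t| < e.
  exact: end0_W2 Qa Qb h k (regsol_summ0 hu) (regsol_summ0 hv).
have pos s : 0 < s <= t1 -> 0 < weight s * (u s * v s).
  move=> hs; have w0 := weight_gt0 (in01 hs); have u0 := regsol_gt0 hu hs; have v0 := regsol_gt0 hv hs.
  exact: mulr_gt0 w0 (mulr_gt0 u0 v0).
have anti s t : 0 < s -> s <= t -> t <= t1 -> W t <= W s.
  move=> s0 st tt; rewrite -lerN2.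
  have sub x : s <= x <= t -> 0 < x <= t1 by move=> /andP[? ?]; apply/andP; split; lra.
  apply: (dv_mono st (fun x hx => dvN (dW x (in01 (sub x hx))))) => x /andP[h1 h2].
  rewrite -mulNr opprK mulr_ge0 ?subr_ge0 ?(ltW ab)// ltW// pos// sub// !ltW//.
split.
- have T := t10; pose s := t1 / 2; have s0 : 0 < s by rewrite /s; lra.
  have st : s < t1 by rewrite /s; lra.
  have Ws : W s <= 0.
    apply/ler_addgt0Pr => e e0; rewrite add0r.
    have ss : 0 < s <= t1 by rewrite s0 ltW.
    have [t /andP[t0 ts] Wte] := small e s e0 ss.
    by apply: (le_trans (anti t s t0 (ltW ts) (ltW st))); apply: le_trans (ler_norm _) (ltW Wte).
  suff : W t1 < W s by rewrite Wt; lra.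
  rewrite -ltrN2.
  have sub x : s <= x <= t1 -> 0 < x <= t1 by move=> /andP[? ?]; apply/andP; split; lra.
  apply: (dv_smono st (fun x hx => dvN (dW x (in01 (sub x hx))))) => x /andP[h1 h2].
  by rewrite -mulNr opprK mulr_gt0 ?subr_gt0// pos// sub// !ltW.
- apply/ler_addgt0Pr => e e0; pose K := (b - a) * (1 - t1 ^+ 2)^-2.
  have K00 : 0 <= K by rewrite mulr_ge0 ?subr_ge0 ?(ltW ab)// invr_ge0 sqr_ge0.
  have ss : 0 < t1 <= t1 by rewrite t10 lexx.
  have [t /andP[t0 tt] /ltr_normlP[We _]] := small e t1 e0 ss.
  have : - W t1 - - W t <= K * t1 - K * t.
    have sub x : t <= x <= t1 -> 0 < x <= t1 by move=> /andP[? ?]; apply/andP; split; lra.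
    apply: (@dv_le R (fun x => - W x) _ (fun x => K * x) (fun=> K) t t1 (ltW tt) (fun x hx => dvN (dW x (in01 (sub x hx))))).
      by move=> x _; apply: dv_eq (dvZ K (dv_id x)) _; rewrite mulr1.
    move=> x /andP[h1 h2]; have hx : 0 < x <= t1 by apply: sub; rewrite !ltW.
    rewrite -mulNr opprK /K; apply: ler_wpM2l; first by rewrite subr_ge0 ltW.
    have w0 := ltW (weight_gt0 (in01 hx)).
    apply: le_trans (weight_le hx); rewrite ler_piMr//.
    by rewrite mulr_ile1// ?(regsol_le1 hu)// ?(regsol_le1 hv)//; [exact: (hp x hx).1|exact: (kp x hx).1].
  rewrite Wt -mulrBr; have : K * (t1 - t) <= K by rewrite ler_piMr//; have := t11; lra.
  by move: We; rewrite /K; lra.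
Qed.

End RegTheory.
End Regular.

(** * The graph of the operator and the differential equation *)
Section Bridge.
Variable R : realType.
Implicit Types (t a b c e C K M x y : R) (f p r v q : R -> R) (u h w : R -> R[i]).
Local Notation mu := (@lebesgue_measure R).
Local Notation dens u := (fun x => weight x * (ReF u x ^+ 2 + ImF u x ^+ 2)).

Lemma measurable_weight : measurable_fun (@I01 R) (@weight R).
Proof. by apply: cont_measurable01 => x; exact: cont_weight. Qed.

Lemma measurable_dens u : measurable_fun (@I01 R) (ReF u) -> measurable_fun (@I01 R) (ImF u) ->
  measurable_fun (@I01 R) (dens u).
Proof.
move=> m1 m2; apply: measurable_funM; first exact: measurable_weight.
by apply: measurable_funD; apply: measurable_funX.
Qed.

Lemma dens_ge0 u x : I01 x -> 0 <= dens u x.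
Proof. by move=> /I01P hx; rewrite mulr_ge0 ?addr_ge0 ?sqr_ge0// ltW// weight_gt0. Qed.

Lemma integrable_ge0P r : measurable_fun (@I01 R) r -> (forall x, I01 x -> 0 <= r x) ->
  (\int[mu]_(x in @I01 R) (r x)%:E < +oo)%E <-> mu.-integrable (@I01 R) (EFin \o r).
Proof.
move=> mr r0; have e : (\int[mu]_(x in @I01 R) `|(r x)%:E| = \int[mu]_(x in @I01 R) (r x)%:E)%E.
  by apply: eq_integral => x; rewrite inE => Ix; rewrite gee0_abs// lee_fin r0.
split => [h|/integrableP[_]]; last by rewrite /comp e.
by apply/integrableP; split; [exact/measurable_EFinP|rewrite /comp e].
Qed.

Lemma inHP u : inH u <-> [/\ measurable_fun (@I01 R) (ReF u), measurable_fun (@I01 R) (ImF u) &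
  mu.-integrable (@I01 R) (EFin \o dens u)].
Proof.
split => [[m1 [m2 h]]|[m1 m2 h]].
  by split => //; apply/(integrable_ge0P (measurable_dens m1 m2) (@dens_ge0 u)).
by split => //; split => //; apply/(integrable_ge0P (measurable_dens m1 m2) (@dens_ge0 u)).
Qed.

Lemma integrable01_le r q : measurable_fun (@I01 R) r -> (forall x, I01 x -> `|r x| <= q x) ->
  mu.-integrable (@I01 R) (EFin \o q) -> mu.-integrable (@I01 R) (EFin \o r).
Proof.
move=> mr h; apply: le_integrable; [exact: measurable_I01|exact/measurable_EFinP|].
by move=> x Ix /=; rewrite lee_fin; apply: le_trans (h x Ix) (ler_norm _).
Qed.

Lemma inH_le u h w C : measurable_fun (@I01 R) (ReF w) -> measurable_fun (@I01 R) (ImF w) ->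
  (forall x, I01 x -> ReF w x ^+ 2 + ImF w x ^+ 2 <=
     C * ((ReF u x ^+ 2 + ImF u x ^+ 2) + (ReF h x ^+ 2 + ImF h x ^+ 2))) ->
  inH u -> inH h -> inH w.
Proof.
move=> m1 m2 hw /inHP[_ _ iu] /inHP[_ _ ih]; apply/inHP; split => //.
have iC : mu.-integrable (@I01 R) (EFin \o (fun x => C * (dens u x + dens h x))).
  have := @integrableZl _ _ _ mu _ (@measurable_I01 R) C _ (@integrableD _ _ _ mu _ (@measurable_I01 R) _ _ iu ih).
  by apply: eq_integrable; first exact: measurable_I01.
apply: integrable01_le iC; first exact: measurable_dens.
move=> x Ix; rewrite ger0_norm; last exact: (dens_ge0 w Ix).
have w0 : 0 <= weight x by rewrite ltW// weight_gt0//; exact/I01P.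
apply: (le_trans (ler_wpM2l w0 (hw x Ix))); rewrite le_eqVlt; apply/orP; left; apply/eqP; ring.
Qed.

Lemma L1loc_le r q : measurable_fun (@I01 R) r -> (forall x, 0 < x < 1 -> `|r x| <= q x) ->
  L1loc q -> L1loc r.
Proof.
move=> mr h lq a b a0 b1.
have sub : `[a, b]%classic `<=` @I01 R.
  by move=> x /=; rewrite in_itv /= => /andP[h1 h2]; apply/I01P; rewrite (lt_le_trans a0 h1) (le_lt_trans h2 b1).
apply: (le_integrable _ _ _ (lq a b a0 b1)); first exact: measurable_itv.
  by apply/measurable_EFinP; apply: measurable_funS mr => //; exact: measurable_I01.
move=> x /= hx; rewrite lee_fin; apply: le_trans (ler_norm _).
by apply: h; apply/I01P; apply: sub.
Qed.

Lemma L1locD r q : L1loc r -> L1loc q -> L1loc (fun x => r x + q x).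
Proof.
move=> lr lq a b a0 b1; have := @integrableD _ _ _ mu _ (measurable_itv _) _ _ (lr a b a0 b1) (lq a b a0 b1).
by apply: eq_integrable; first exact: measurable_itv.
Qed.

Lemma inH_L1loc u : inH u -> [/\ L1loc (dens u), L1loc (fun x => weight x * ReF u x) &
  L1loc (fun x => weight x * ImF u x)].
Proof.
move=> [m1 [m2 h]].
have [ld _] := int01_prim (measurable_dens m1 m2) (@dens_ge0 u) h.
have lw : L1loc (fun x => weight x + dens u x).
  by apply: L1locD => //; apply: cont_L1loc => x; exact: cont_weight.
have key x (s d : R) : 0 < x < 1 -> 0 <= d -> `|weight x * s| <= weight x + weight x * (s ^+ 2 + d).
  move=> hx d0; have w0 := ltW (weight_gt0 hx); rewrite normrM ger0_norm//.
  rewrite -[X in X + _]mulr1 -mulrDr ler_wpM2l//.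
  by have := sqr_ge0 (`|s| - 2^-1); rewrite -(real_normK (num_real s)) !expr2; order_lra.
split => //; apply: L1loc_le lw; try by apply: measurable_funM => //; exact: measurable_weight.
- by move=> x hx; apply: key => //; exact: sqr_ge0.
- by move=> x hx; rewrite [X in _ + weight x * X]addrC; apply: key => //; exact: sqr_ge0.
Qed.

Lemma inH_contP u : (forall t, 0 < t < 1 -> {for t, continuous (ReF u)}) ->
  (forall t, 0 < t < 1 -> {for t, continuous (ImF u)}) ->
  inH u <-> summable01 (dens u).
Proof.
move=> c1 c2.
have cd t : 0 < t < 1 -> {for t, continuous (dens u)}.
  move=> ht; apply: cvgM; first exact: cont_weight.
  by apply: cvgD; rewrite /= ; apply: cvgM; [exact: c1|exact: c1|exact: c2|exact: c2].
have d0 t : 0 < t < 1 -> 0 <= dens u t by move=> /I01P; exact: dens_ge0.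
rewrite -(summable01P cd d0); split => [[_ []]//|h].
by split; [exact: cont_measurable01|split; [exact: cont_measurable01|]].
Qed.

Lemma norm_cos2B1 x : `|cos (2 * x) - 1| <= 2 * x ^+ 2.
Proof. by have := cos2_ge x; have := cos_le1 (2 * x); rewrite ler_norml => *; apply/andP; split; order_lra. Qed.

(** The singularity of [g] at 0 disappears once [cos (2 f) - 1], of order [t^2], is split off. Hence
    multiplication by [g] preserves the space. *)
Lemma potential_bounded f f1 n : wave_profile f f1 n ->
  exists2 K, 0 < K & forall t, 0 < t < 1 -> `|potential f t| <= K.
Proof.
move=> [_ _ [C [r [C0 /andP[r0 r1] hC]]] _ _].
exists (3 + 4 * C ^+ 2 + 4 / r ^+ 2).
  have r2 : 0 <= 4 / r ^+ 2 by rewrite divr_ge0 ?sqr_ge0.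
  by have := sqr_ge0 C; order_lra.
move=> t ht; have /andP[t0 t1] := ht; have s0 := sub_sqr_gt0 ht.
have -> : potential f t = 2 * (1 - t ^+ 2) * ((cos (2 * f t) - 1) / t ^+ 2) + (1 - 2 * t ^+ 2).
  by rewrite /potential; move: (cos _) => c; field; rewrite gt_eqF.
have t2 : 0 < t ^+ 2 by rewrite exprn_gt0.
have i0 : 0 <= (t ^+ 2)^-1 by rewrite invr_ge0 ltW.
have b : `|(cos (2 * f t) - 1) / t ^+ 2| <= 2 * C ^+ 2 + 2 / r ^+ 2.
  rewrite normrM (ger0_norm i0).
  have C2 := sqr_ge0 C; have r2 : 0 <= 2 / r ^+ 2 by rewrite divr_ge0 ?sqr_ge0.
  have [tr|rt] := ltP t r.
    have hf := hC t ltac:(by rewrite t0 tr).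
    rewrite ler_pdivrMr//; apply: le_trans (norm_cos2B1 _) _.
    have : f t ^+ 2 <= (C * t) ^+ 2.
      rewrite -(real_normK (num_real (f t))) lerXn2r ?nnegrE//.
      by rewrite mulr_ge0 ?(ltW C0) ?(ltW t0).
    rewrite exprMn; move: (f t ^+ 2) => F hF.
    have : 0 <= 2 / r ^+ 2 * t ^+ 2 by rewrite mulr_ge0 ?(ltW t2).
    by order_lra.
  apply: (@le_trans _ _ (2 / t ^+ 2)).
    rewrite ler_wpM2r//; have := cos_le1 (2 * f t); have := cos_geN1 (2 * f t).
    by rewrite ler_norml => *; apply/andP; split; order_lra.
  have : 2 / t ^+ 2 <= 2 / r ^+ 2.
    by apply: ler_wpM2l => //; rewrite lef_pV2 ?posrE ?exprn_gt0// lerXn2r ?nnegrE// ltW.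
  by order_lra.
have b2 : `|1 - 2 * t ^+ 2| <= 3.
  have : t ^+ 2 <= 1 by rewrite expr_le1// ltW.
  by rewrite ler_norml => *; apply/andP; split; order_lra.
apply: le_trans (ler_normD _ _) _.
have : `|2 * (1 - t ^+ 2) * ((cos (2 * f t) - 1) / t ^+ 2)| <= 2 * (2 * C ^+ 2 + 2 / r ^+ 2).
  rewrite normrM; apply: ler_pM => //.
  by rewrite ger0_norm ?mulr_ge0 ?(ltW s0)//; order_lra.
have -> : 4 / r ^+ 2 = 2 * (2 / r ^+ 2) by rewrite mulrA; congr (_ / _); ring.
by order_lra.
Qed.

Lemma cont_potential f f1 n t : wave_profile f f1 n -> 0 < t < 1 -> {for t, continuous (potential f)}.
Proof.
move=> wp ht; have /andP[t0 _] := ht.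
apply: cont_div; [by rewrite expf_neq0// gt_eqF| |exact: cont_X2].
have c1 := @cont_1X2 R t; have c2 := @cont_X2 R t.
apply: cvgB; first apply: cvgB => //; first apply: cvgM.
- by apply: cvgM => //; exact: cvg_cst.
- exact: cont_cos2f wp ht.
- by apply: cvgM; [exact: cvg_cst|apply: cvgM].
Qed.

Lemma weight_potential f t : 0 < t < 1 -> weight t * potential f t = Qc f 0 t - 2.
Proof.
move=> ht; have h := sub_sqr_gt0 ht; have /andP[t0 _] := ht.
rewrite /Qc /weight /potential; move: (cos _) => c; move: h; move: (1 - t ^+ 2) => s s0.
by field; rewrite !gt_eqF.
Qed.

(** [AC_acd] gives the almost everywhere identities for [derive1] their meaning; for [u] the
    derivative [p / t^2] is continuous, so the equation holds at every point. *)
Lemma graph_csol f f1 n (lam : R[i]) u h : wave_profile f f1 n -> res_graph (potential f) lam u h ->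
  [/\ inH h, inH u & exists p1 p2, csol f (complex.Re lam) (complex.Im lam) (ReF h) (ImF h) (ReF u) p1 (ImF u) p2].
Proof.
move=> wp; case: lam => la lb [hh [w [[hw [v0 [[hu [[ac1 ac2] [p [[ap1 ap2] [ep [hv ev]]]]]] ew]]] eh]]].
split => //; exists (ReF p), (ImF p).
have du1 : acd (ReF u) (fun t => ReF p t / t ^+ 2).
  apply: acd_congr (AC_acd ac1) _; apply: ae_imp ep _ => t H It; move/I01P: (It) => /andP[t0 _].
  rewrite /ReF (H It) /cderive /=; move: (derive1 _ t) (derive1 _ t) => d1 d2.
  by field; rewrite gt_eqF.
have du2 : acd (ImF u) (fun t => ImF p t / t ^+ 2).
  apply: acd_congr (AC_acd ac2) _; apply: ae_imp ep _ => t H It; move/I01P: (It) => /andP[t0 _].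
  rewrite /ImF (H It) /cderive /=; move: (derive1 _ t) (derive1 _ t) => d1 d2.
  by field; rewrite gt_eqF.
have E : {ae mu, forall t, I01 t -> h t = Complex la lb * u t -
   (((weight t)^-1)%:C%C * (- cderive p t + 2 * u t) + (potential f t)%:C%C * u t)}.
  apply: ae_imp2 (ae_imp2 ew ev (fun t A B => conj A B)) eh _ => t [A B] C It.
  by rewrite C// A// B.
split.
- apply: acd_cont_dv du1 _ => t ht; rewrite /ReF; apply: cvgM; last exact: cont_inv2.
  exact: (AC_loc01_cont ap1 ht).
- apply: acd_congr (AC_acd ap1) _; apply: ae_imp E _ => t H It; have ht := (I01P t).1 It.
  rewrite [in RHS]/ReF (H It) /cderive /=.
  have w0 := weight_gt0 ht; have -> : Qc f la t = weight t * potential f t + 2 - la * weight t.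
    by rewrite weight_potential// /Qc; ring.
  rewrite /ReF /ImF; case: (u t) => z1 z2 /=; move: (derive1 _ t) (derive1 _ t) => d1 d2.
  by field; rewrite gt_eqF.
- apply: acd_cont_dv du2 _ => t ht; rewrite /ImF; apply: cvgM; last exact: cont_inv2.
  exact: (AC_loc01_cont ap2 ht).
- apply: acd_congr (AC_acd ap2) _; apply: ae_imp E _ => t H It; have ht := (I01P t).1 It.
  rewrite [in RHS]/ImF (H It) /cderive /=.
  have w0 := weight_gt0 ht; have -> : Qc f la t = weight t * potential f t + 2 - la * weight t.
    by rewrite weight_potential// /Qc; ring.
  rewrite /ReF /ImF; case: (u t) => z1 z2 /=; move: (derive1 _ t) (derive1 _ t) => d1 d2.
  by field; rewrite gt_eqF.
Qed.

(** [A_n u] is taken to be [lambda u - h], and [A u] is that minus [g u]; both lie in the space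
    because [g] is bounded. *)
Lemma csol_graph f f1 n (lam : R[i]) u h (p1 p2 : R -> R) : wave_profile f f1 n ->
  csol f (complex.Re lam) (complex.Im lam) (ReF h) (ImF h) (ReF u) p1 (ImF u) p2 ->
  inH h -> inH u -> res_graph (potential f) lam u h.
Proof.
move=> wp [d1 a1 d2 a2] hh hu; split => //.
have [mu1 [mu2 _]] := hu; have [mh1 [mh2 _]] := hh.
have mg : measurable_fun (@I01 R) (potential f) by apply: cont_measurable01 => t ht; exact: cont_potential wp ht.
have [K K0 hK] := potential_bounded wp.
pose w t := lam * u t - h t; pose v0 t := w t - (potential f t)%:C%C * u t.
case: lam @w @v0 d1 a1 d2 a2 => la lb w v0 d1 a1 d2 a2 /=; rewrite /= in a1 a2.
have Rw : ReF w = (fun t => la * ReF u t - lb * ImF u t - ReF h t).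
  by apply/funext => t; rewrite /ReF /ImF /w; case: (u t) => ? ?; case: (h t).
have Iw : ImF w = (fun t => la * ImF u t + lb * ReF u t - ImF h t).
  by apply/funext => t; rewrite /ReF /ImF /w; case: (u t) => ? ?; case: (h t) => ? ? /=.
have Rv : ReF v0 = (fun t => ReF w t - potential f t * ReF u t).
  by apply/funext => t; rewrite /ReF /v0; case: (u t) => ? ?; case: (w t) => ? ? /=; ring.
have Iv : ImF v0 = (fun t => ImF w t - potential f t * ImF u t).
  by apply/funext => t; rewrite /ImF /v0; case: (u t) => ? ?; case: (w t) => ? ? /=; ring.
have mw1 : measurable_fun (@I01 R) (ReF w).
  rewrite Rw; apply: measurable_funB => //; apply: measurable_funB; apply: measurable_funM => //; exact: measurable_cst.
have mw2 : measurable_fun (@I01 R) (ImF w).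
  rewrite Iw; apply: measurable_funB => //; apply: measurable_funD; apply: measurable_funM => //; exact: measurable_cst.
have hw : inH w.
  apply: (inH_le (u := u) (h := h) (C := 2 * (la ^+ 2 + lb ^+ 2) + 2)) => // t It.
  rewrite Rw Iw; move: (ReF u t) (ImF u t) (ReF h t) (ImF h t) => x1 x2 y1 y2.
  have E : 2 * ((la ^+ 2 + lb ^+ 2) * (x1 ^+ 2 + x2 ^+ 2)) + 2 * (y1 ^+ 2 + y2 ^+ 2)
    - ((la * x1 - lb * x2 - y1) ^+ 2 + (la * x2 + lb * x1 - y2) ^+ 2) =
    (la * x1 - lb * x2 + y1) ^+ 2 + (la * x2 + lb * x1 + y2) ^+ 2 by ring.
  have := sqr_ge0 (la * x1 - lb * x2 + y1); have := sqr_ge0 (la * x2 + lb * x1 + y2).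
  have p0 : 0 <= (la ^+ 2 + lb ^+ 2) * (y1 ^+ 2 + y2 ^+ 2) by rewrite mulr_ge0 ?addr_ge0 ?sqr_ge0.
  have q0 : 0 <= x1 ^+ 2 + x2 ^+ 2 by rewrite addr_ge0 ?sqr_ge0.
  by move: E p0 q0; order_lra.
have hv : inH v0.
  apply: (inH_le (u := w) (h := u) (C := 2 + 2 * K ^+ 2)) => //.
  - by rewrite Rv; apply: measurable_funB => //; exact: measurable_funM.
  - by rewrite Iv; apply: measurable_funB => //; exact: measurable_funM.
  move=> t /I01P ht; rewrite Rv Iv; have := hK t ht; move: (potential f t) => g hg.
  have g2 : g ^+ 2 <= K ^+ 2 by rewrite -(real_normK (num_real g)) lerXn2r ?nnegrE// ltW.
  move: (ReF u t) (ImF u t) (ReF w t) (ImF w t) => x1 x2 y1 y2.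
  have E : 2 * (g ^+ 2 * (x1 ^+ 2 + x2 ^+ 2)) + 2 * (y1 ^+ 2 + y2 ^+ 2)
    - ((y1 - g * x1) ^+ 2 + (y2 - g * x2) ^+ 2) = (y1 + g * x1) ^+ 2 + (y2 + g * x2) ^+ 2 by ring.
  have := sqr_ge0 (y1 + g * x1); have := sqr_ge0 (y2 + g * x2).
  have x0 : 0 <= x1 ^+ 2 + x2 ^+ 2 by rewrite addr_ge0 ?sqr_ge0.
  have p0 := ler_wpM2r x0 g2.
  have q0 : 0 <= K ^+ 2 * (y1 ^+ 2 + y2 ^+ 2) by rewrite mulr_ge0 ?addr_ge0 ?sqr_ge0.
  by move: E p0 q0 x0; order_lra.
have der1 t : 0 < t < 1 -> derive1 (ReF u) t = p1 t / t ^+ 2 by move=> /d1/dvP[].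
have der2 t : 0 < t < 1 -> derive1 (ImF u) t = p2 t / t ^+ 2 by move=> /d2/dvP[].
exists w; split; last by apply: aeW => t _; rewrite /w opprB addrC subrK.
split => //; exists v0; split; last by apply: aeW => t _; rewrite /v0 subrK.
split => //; split.
  have c1 t : 0 < t < 1 -> {for t, continuous (fun s => p1 s / s ^+ 2)}.
    by move=> ht; apply: cvgM; [exact: AC_loc01_cont a1.1 ht|exact: cont_inv2].
  have c2 t : 0 < t < 1 -> {for t, continuous (fun s => p2 s / s ^+ 2)}.
    by move=> ht; apply: cvgM; [exact: AC_loc01_cont a2.1 ht|exact: cont_inv2].
  by split; [exact: C1_AC_loc01 d1 c1|exact: C1_AC_loc01 d2 c2].
exists (fun t => Complex (p1 t) (p2 t)); split; first by split; [exact: a1.1|exact: a2.1].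
split.
  apply: aeW => t /I01P ht; rewrite /cderive der1// der2//; have /andP[t0 _] := ht.
  apply/eqP; rewrite eq_complex /=; apply/andP; split; apply/eqP; field; exact: lt0r_neq0.
split => //; apply: ae_imp2 a1.2 a2.2 _ => t A B It; have ht := (I01P t).1 It.
have /dvP[_ e1] := A It; have /dvP[_ e2] := B It; have w0 := weight_gt0 ht.
have Qe : Qc f la t = weight t * potential f t + 2 - la * weight t by rewrite weight_potential// /Qc; ring.
rewrite /cderive; have -> : ReF (fun t => Complex (p1 t) (p2 t)) = p1 by [].
have -> : ImF (fun t => Complex (p1 t) (p2 t)) = p2 by [].
rewrite e1 e2 Qe /v0 /w /ReF /ImF; case: (u t) => x1 x2; case: (h t) => y1 y2.
by apply/eqP; rewrite eq_complex /=; apply/andP; split; apply/eqP; field; rewrite gt_eqF.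
Qed.

Lemma ae_eq0_cont v : (forall t, 0 < t < 1 -> {for t, continuous v}) ->
  {ae mu, forall t, I01 t -> v t = 0} -> forall t, 0 < t < 1 -> v t = 0.
Proof.
move=> cv h t ht; have d := prim_dv cv (half01 R) ht.
have a0 : acd (prim v 2^-1) (fun=> 0).
  by apply: acd_congr (prim_acd (cont_L1loc cv) (half01 R)) h.
have c0 x : 0 < x < 1 -> {for x, continuous (fun=> 0 : R)} by move=> _; exact: cvg_cst.
exact: dv_uniq d (acd_cont_dv a0 c0 ht).
Qed.

Definition no_L2_hsol f a b := forall u1 p1 u2 p2 : R -> R, hsol f a b u1 p1 u2 p2 ->
  summable01 (fun t => weight t * (u1 t ^+ 2 + u2 t ^+ 2)) ->
  forall t, 0 < t < 1 -> u1 t = 0 /\ u2 t = 0.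

Lemma csol_contu f a b (h1 h2 u1 p1 u2 p2 : R -> R) : csol f a b h1 h2 u1 p1 u2 p2 ->
  (forall t, 0 < t < 1 -> {for t, continuous u1}) /\ (forall t, 0 < t < 1 -> {for t, continuous u2}).
Proof. by move=> [d1 _ d2 _]; split => t ht; [exact: dv_cont (d1 t ht)|exact: dv_cont (d2 t ht)]. Qed.

Lemma inH0 : inH (fun=> 0 : R[i]).
Proof.
apply/inH_contP => [t _|t _|]; [exact: cvg_cst|exact: cvg_cst|].
exists 0 => a b a0 ab b1.
have -> : (fun x => weight x * (ReF (fun=> 0 : R[i]) x ^+ 2 + ImF (fun=> 0 : R[i]) x ^+ 2)) = (fun=> 0).
  by apply/funext => x; rewrite /ReF /ImF /= expr0n /= addr0 mulr0.
have c0 x : 0 < x < 1 -> {for x, continuous (fun=> 0 : R)} by move=> _; exact: cvg_cst.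
rewrite (@dv_const R (prim (fun=> 0) 2^-1) a b ab) ?subrr// => x hx.
by apply: (prim_dv c0 (half01 R)); move: hx => /andP[? ?]; apply/andP; split; order_lra.
Qed.

Lemma res_injectiveP f f1 n lam : wave_profile f f1 n ->
  res_injective (potential f) lam <-> no_L2_hsol f (complex.Re lam) (complex.Im lam).
Proof.
move=> wp; split => [inj u1 p1 u2 p2 hs S|no u w h g1 g2].
  have cc := hsol_cont hs.
  pose u t := Complex (u1 t) (u2 t).
  have hu : inH u by apply/inH_contP => // t /cc[].
  have g1 : res_graph (potential f) lam u (fun=> 0).
    by apply: (@csol_graph f f1 n lam u (fun=> 0) p1 p2 wp _ inH0 hu); exact: hsol_csol wp hs.
  have g2 : res_graph (potential f) lam (fun=> 0) (fun=> 0).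
    have z t : 0 < t < 1 -> dv (fun=> 0 : R) t (0 / t ^+ 2) by move=> _; apply: dv_eq (dv_cst 0 t) _; rewrite mul0r.
    apply: (@csol_graph f f1 n lam (fun=> 0) (fun=> 0) (fun=> 0) (fun=> 0) wp _ inH0 inH0).
    by apply: (hsol_csol wp) => t ht; split; [exact: z| |exact: z|]; apply: dv_eq (dv_cst 0 t) _; rewrite !mulr0 ?addr0 ?subr0.
  have e := inj _ _ _ g1 g2 => t ht.
  split; apply: ae_eq0_cont ht => [x /cc[]//|]; apply: ae_imp e _ => x E Ix; have := E Ix; by case.
have [hh hu [p1 [p2 c1]]] := graph_csol wp g1; have [_ hw [q1 [q2 c2]]] := graph_csol wp g2.
have cd := csolD c1 (csolZ (-1) c2).
have hs : hsol f (complex.Re lam) (complex.Im lam) (fun t => ReF u t + -1 * ReF w t)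
    (fun t => p1 t + -1 * q1 t) (fun t => ImF u t + -1 * ImF w t) (fun t => p2 t + -1 * q2 t).
  by apply: (csol_hsol wp); apply: csol_congr cd _ _; apply: aeW => t _; rewrite mulN1r subrr.
have [cu1 cu2] := csol_contu cd.
pose d t := Complex (ReF u t + -1 * ReF w t) (ImF u t + -1 * ImF w t).
have hd : inH d.
  apply: (inH_le (u := u) (h := w) (C := 2)) => //; try exact: cont_measurable01.
  move=> t _; rewrite /ReF /ImF /d /= /ReF /ImF; move: (complex.Re (u t)) (complex.Re (w t)) (complex.Im (u t)) (complex.Im (w t)).
  move=> x1 y1 x2 y2; have := sqr_ge0 (x1 + y1); have := sqr_ge0 (x2 + y2); rewrite !expr2; order_lra.
have S := (inH_contP (u := d) cu1 cu2).1 hd.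
apply: aeW => t /I01P ht; have [] := no _ _ _ _ hs S t ht; rewrite /ReF /ImF !mulN1r.
move=> /eqP; rewrite subr_eq0 => /eqP e1 /eqP; rewrite subr_eq0 => /eqP e2.
by apply/eqP; rewrite eq_complex e1 e2 !eqxx.
Qed.

End Bridge.

(** * Injectivity and surjectivity off the half line *)
Section Resolvent.
Variable R : realType.
Implicit Types (t a b c e s C K M x y : R) (f p r v q u h : R -> R).

Lemma summable_le r q : (forall t, 0 < t < 1 -> {for t, continuous r}) ->
  (forall t, 0 < t < 1 -> {for t, continuous q}) ->
  (forall t, 0 < t < 1 -> r t <= q t) -> summable01 q -> summable01 r.
Proof.
move=> cr cq hK [C hC]; exists C => a b a0 ab bt; apply: le_trans (hC a b a0 ab bt).
have sub x : a <= x <= b -> 0 < x < 1 by move=> /andP[? ?]; apply/andP; split; order_lra.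
apply: (dv_le ab (fun x hx => prim_dv cr (half01 R) (sub x hx)) (fun x hx => prim_dv cq (half01 R) (sub x hx))).
by move=> x /andP[h1 h2]; apply/hK/sub; rewrite !ltW.
Qed.

Lemma hsol_du f a b u1 p1 u2 p2 : hsol f a b u1 p1 u2 p2 ->
  (forall t, 0 < t < 1 -> dv u1 t (p1 t / t ^+ 2)) /\ (forall t, 0 < t < 1 -> dv u2 t (p2 t / t ^+ 2)).
Proof. by move=> h; split => t /h[]. Qed.

Lemma no_L2_nonneg f f1 n a : wave_profile f f1 n -> 0 <= a -> no_L2_hsol f a 0.
Proof.
move=> wp a0 u1 p1 u2 p2 hs S t ht; have [d1 d2] := hsol_du hs; have [r1 r2] := hsol_rsol hs.
have cY s (hs : 0 < s < 1) := cont_wY d1 d2 hs.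
have h := half01 R; have /andP[h0 _] := h.
have key u p : rsol f a u p -> (forall s, u s ^+ 2 <= u1 s ^+ 2 + u2 s ^+ 2) -> u t = 0.
  move=> hu le; have du s (hs : 0 < s < 1) := (hu s hs).1.
  apply: (rsol_end1 wp a0 hu h _ ht); apply: summable_summ1 => //.
  apply: summable_le S => [s hs'|s hs'|s hs']; [exact: cont_wu2 du hs'|exact: cY|].
  by apply: ler_wpM2l; [exact: ltW (weight_gt0 hs')|exact: le].
by split; [apply: key r1 _ => s; rewrite lerDl sqr_ge0|apply: key r2 _ => s; rewrite lerDr sqr_ge0].
Qed.

Lemma no_L2_nonreal f f1 n a b : wave_profile f f1 n -> b != 0 -> no_L2_hsol f a b.
Proof.
move=> wp bn u1 p1 u2 p2 hs S; have [d1 d2] := hsol_du hs.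
(* The factor [- b] makes [F] nondecreasing for either sign of [b]. *)
pose W t := u1 t * p2 t - u2 t * p1 t; pose F t := - b * W t.
have dF t : 0 < t < 1 -> dv F t (b ^+ 2 * (weight t * (u1 t ^+ 2 + u2 t ^+ 2))).
  move=> ht; have [e1 e2 e3 e4] := hs t ht.
  by apply: dv_eq (dvZ (- b) (dvB (dvM e1 e4) (dvM e3 e2))) _; ring.
have Fm s t : 0 < s -> s <= t -> t < 1 -> F s <= F t.
  move=> s0 st t1; have sub x : s <= x <= t -> 0 < x < 1 by move=> /andP[? ?]; apply/andP; split; order_lra.
  apply: (dv_mono st (fun x hx => dF x (sub x hx))) => x /andP[h1 h2].
  have hx : 0 < x < 1 by apply: sub; rewrite !ltW.
  by rewrite mulr_ge0 ?sqr_ge0// mulr_ge0 ?addr_ge0 ?sqr_ge0// ltW// weight_gt0.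
have b0 : 0 < `|b| by rewrite normr_gt0.
have small t e : `|W t| < e / `|b| -> `|F t| < e.
  by rewrite ltr_pdivlMr// => h; rewrite /F normrM normrN mulrC.
have F0 t : 0 < t < 1 -> F t = 0.
  move=> ht; have /andP[t0 t1] := ht; apply/eqP; rewrite eq_le; apply/andP; split.
    apply/ler_addgt0Pr => e e0; rewrite add0r.
    have [s /andP[ts s1] /small hsm] := end1_W hs ht (divr_gt0 e0 b0) (summable_summ1 t0 S).
    by apply: le_trans (Fm t s t0 (ltW ts) s1) _; apply: le_trans (ler_norm _) (ltW hsm).
  apply/ler_addgt0Pr => e e0.
  have [t3 [t30 t31 hQ]] := Qc_ge a wp.
  have ht3 : 0 < t3 < 1 by rewrite t30.
  have hm : 0 < Num.min t t3 <= t3 by rewrite lt_min t0 t30 ge_min lexx orbT.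
  have in3 x : 0 < x <= t3 -> 0 < x < 1 by move=> /andP[-> h]; exact: le_lt_trans t31.
  have [|x hx|s /andP[s0 st] /small /ltr_normlP[h1 _]] := @end0_W R u1 p1 u2 p2 d1 d2
    (fun t => (p1 t ^+ 2 + p2 t ^+ 2) / t ^+ 2 + Qc f a t * (u1 t ^+ 2 + u2 t ^+ 2)) t3 ht3 _ _
    (summable_summ0 t31 S) (e / `|b|) (Num.min t t3) (divr_gt0 e0 b0) hm.
  - move=> x /in3 hx; have [e1 e2 e3 e4] := hs x hx.
    by apply: dv_eq (dvD (dvM e1 e2) (dvM e3 e4)) _; ring.
  - by rewrite lerD2l ler_peMl ?addr_ge0 ?sqr_ge0//; have [] := hQ x hx.
  - have st' : s <= t by move: st; rewrite lt_min => /andP[/ltW].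
    by have := Fm s t s0 st' t1; order_lra.
move=> t ht; have d0 : dv F t 0.
  by apply: (@dv_local R (fun=> 0) F t 0 0 1 ht _ (dv_cst 0 t)) => y hy; rewrite F0.
have /eqP := dv_uniq (dF t ht) d0.
have w0 := weight_gt0 ht; have b2 : b ^+ 2 != 0 by rewrite sqrf_eq0.
rewrite mulf_eq0 (negPf b2) /= mulf_eq0 (gt_eqF w0) /=.
by rewrite paddr_eq0 ?sqr_ge0// !sqrf_eq0 => /andP[/eqP -> /eqP ->].
Qed.

Lemma csol_G f a b k1 k2 u1 p1 u2 p2 : csol f a b k1 k2 u1 p1 u2 p2 ->
  acd (fun t => u1 t * p1 t + u2 t * p2 t)
      (fun t => (p1 t ^+ 2 + p2 t ^+ 2) / t ^+ 2 + Qc f a t * (u1 t ^+ 2 + u2 t ^+ 2) +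
         weight t * (u1 t * k1 t + u2 t * k2 t)).
Proof.
move=> [d1 a1 d2 a2].
have c1 t : 0 < t < 1 -> {for t, continuous (fun s => p1 s / s ^+ 2)}.
  by move=> ht; apply: cvgM; [exact: AC_loc01_cont a1.1 ht|exact: cont_inv2].
have c2 t : 0 < t < 1 -> {for t, continuous (fun s => p2 s / s ^+ 2)}.
  by move=> ht; apply: cvgM; [exact: AC_loc01_cont a2.1 ht|exact: cont_inv2].
apply: acd_congr (acdD (acdM (acd_C1 d1 c1) a1) (acdM (acd_C1 d2 c2) a2)) _.
by apply: aeW => t _; ring.
Qed.

Lemma csol_W f a b k1 k2 u1 p1 u2 p2 : csol f a b k1 k2 u1 p1 u2 p2 ->
  acd (fun t => u1 t * p2 t - u2 t * p1 t)
      (fun t => - b * (weight t * (u1 t ^+ 2 + u2 t ^+ 2)) + weight t * (u1 t * k2 t - u2 t * k1 t)).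
Proof.
move=> [d1 a1 d2 a2].
have c1 t : 0 < t < 1 -> {for t, continuous (fun s => p1 s / s ^+ 2)}.
  by move=> ht; apply: cvgM; [exact: AC_loc01_cont a1.1 ht|exact: cont_inv2].
have c2 t : 0 < t < 1 -> {for t, continuous (fun s => p2 s / s ^+ 2)}.
  by move=> ht; apply: cvgM; [exact: AC_loc01_cont a2.1 ht|exact: cont_inv2].
apply: acd_congr (acdB (acdM (acd_C1 d1 c1) a2) (acdM (acd_C1 d2 c2) a1)) _.
by apply: aeW => t _; ring.
Qed.

Lemma dv_tk t : 0 < t < 1 -> dv (fun s => s * kk s) t (kk t + 2 * t ^+ 2 * kk t ^+ 2).
Proof.
move=> ht; have h := sub_sqr_gt0 ht; have hn : 1 - t ^+ 2 != 0 by rewrite gt_eqF.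
have h1 : dv (fun s => 1 - s ^+ 2) t (- (2 * t)).
  by apply: dv_eq (dvB (dv_cst 1 t) (dvX 2 (dv_id t))) _; rewrite /= expr1; ring.
apply: dv_eq (dvM (dv_id t) (@dvV R (fun s => 1 - s ^+ 2) t _ hn h1)) _.
by rewrite /kk /=; move: hn; move: (1 - t ^+ 2) => m hn; field.
Qed.

(** Integrated over an interval with [u = 0] at both ends, where the Wronskian term drops out, this
    is the resolvent bound [|u| <= |h| / |Im lambda|]. *)
Lemma energy_nonreal b w x1 x2 y1 y2 : 0 <= w ->
  b ^+ 2 / 2 * (w * (x1 ^+ 2 + x2 ^+ 2)) <=
  - b * (- b * (w * (x1 ^+ 2 + x2 ^+ 2)) + w * (x1 * y2 - x2 * y1)) + 2^-1 * (w * (y1 ^+ 2 + y2 ^+ 2)).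
Proof.
move=> w0; rewrite -subr_ge0.
have -> : - b * (- b * (w * (x1 ^+ 2 + x2 ^+ 2)) + w * (x1 * y2 - x2 * y1)) +
   2^-1 * (w * (y1 ^+ 2 + y2 ^+ 2)) - b ^+ 2 / 2 * (w * (x1 ^+ 2 + x2 ^+ 2)) =
   w / 2 * ((b * x1 - y2) ^+ 2 + (b * x2 + y1) ^+ 2) by field.
by rewrite mulr_ge0 ?addr_ge0 ?sqr_ge0// divr_ge0.
Qed.

(* The first two squares are [k q_i^2] in the notation [qq]. *)
Lemma energy_right t (V a d x1 x2 r1 r2 y1 y2 : R) : 0 < t < 1 -> 0 < d -> d <= V - a ->
  d / 2 * (weight t * (x1 ^+ 2 + x2 ^+ 2)) <=
  (r1 ^+ 2 + r2 ^+ 2) / t ^+ 2 + weight t * (V - 1 - a) * (x1 ^+ 2 + x2 ^+ 2) + weight t * (x1 * y1 + x2 * y2) +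
  ((kk t + 2 * t ^+ 2 * kk t ^+ 2) * (x1 ^+ 2 + x2 ^+ 2) + t * kk t * (2 * (x1 * r1 + x2 * r2) / t ^+ 2)) +
  (2 * d)^-1 * (weight t * (y1 ^+ 2 + y2 ^+ 2)).
Proof.
move=> ht d0 dV; have h := sub_sqr_gt0 ht; have /andP[t0 _] := ht; have w0 := ltW (weight_gt0 ht).
have mn : 1 - t ^+ 2 != 0 by rewrite gt_eqF.
have -> : (r1 ^+ 2 + r2 ^+ 2) / t ^+ 2 + weight t * (V - 1 - a) * (x1 ^+ 2 + x2 ^+ 2) + weight t * (x1 * y1 + x2 * y2) +
  ((kk t + 2 * t ^+ 2 * kk t ^+ 2) * (x1 ^+ 2 + x2 ^+ 2) + t * kk t * (2 * (x1 * r1 + x2 * r2) / t ^+ 2)) +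
  (2 * d)^-1 * (weight t * (y1 ^+ 2 + y2 ^+ 2)) =
  (r1 / t + kk t * x1) ^+ 2 + (r2 / t + kk t * x2) ^+ 2 + weight t * ((V - a) * (x1 ^+ 2 + x2 ^+ 2)) +
  (2 * d)^-1 * (weight t * ((d * x1 + y1) ^+ 2 + (d * x2 + y2) ^+ 2)) - d / 2 * (weight t * (x1 ^+ 2 + x2 ^+ 2)).
  by rewrite /kk /weight; field; rewrite mn !gt_eqF.
have Y0 : 0 <= x1 ^+ 2 + x2 ^+ 2 by rewrite addr_ge0 ?sqr_ge0.
have A := ler_wpM2l w0 (ler_wpM2r Y0 dV).
have B : 0 <= (2 * d)^-1 * (weight t * ((d * x1 + y1) ^+ 2 + (d * x2 + y2) ^+ 2)).
  have i0 : 0 <= (2 * d)^-1 by rewrite invr_ge0; order_lra.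
  by apply: mulr_ge0 => //; apply: mulr_ge0 => //; rewrite addr_ge0 ?sqr_ge0.
have C1 := sqr_ge0 (r1 / t + kk t * x1); have C2 := sqr_ge0 (r2 / t + kk t * x2).
have E : d / 2 * (weight t * (x1 ^+ 2 + x2 ^+ 2)) = 2^-1 * (weight t * (d * (x1 ^+ 2 + x2 ^+ 2))) by field.
by rewrite E; move: A B C1 C2; order_lra.
Qed.

Section Dirichlet.
Variables (f f1 : R -> R) (n : nat) (a b : R).
Hypothesis wp : wave_profile f f1 n.
Variables (k1 k2 u1 p1 u2 p2 : R -> R) (CH : R).
Local Notation wY := (fun t => weight t * (u1 t ^+ 2 + u2 t ^+ 2)).
Local Notation H := (fun t => weight t * (k1 t ^+ 2 + k2 t ^+ 2)).
Hypothesis hu : csol f a b k1 k2 u1 p1 u2 p2.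
Hypothesis lH : L1loc H.
Hypothesis hH : forall x y, 0 < x -> x <= y -> y < 1 -> prim H 2^-1 y - prim H 2^-1 x <= CH.

Let d1 : forall t, 0 < t < 1 -> dv u1 t (p1 t / t ^+ 2). Proof. by case: hu. Qed.
Let d2 : forall t, 0 < t < 1 -> dv u2 t (p2 t / t ^+ 2). Proof. by case: hu. Qed.
Let aH : acd (prim H 2^-1) H. Proof. exact: prim_acd (half01 R). Qed.

Lemma acd_S : acd (prim wY 2^-1) wY.
Proof. exact: acd_C1 (fun t ht => dv_S d1 d2 ht) (fun t ht => cont_wY d1 d2 ht). Qed.

Lemma S_mono x y : 0 < x -> x <= y -> y < 1 -> prim wY 2^-1 x <= prim wY 2^-1 y.
Proof.
move=> x0 xy y1; have sub z : x <= z <= y -> 0 < z < 1 by move=> /andP[? ?]; apply/andP; split; lra.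
apply: (dv_mono xy (fun z hz => dv_S d1 d2 (sub z hz))) => z /andP[h1 h2].
by apply: wY_ge0; apply: sub; rewrite !ltW.
Qed.

Lemma dirichlet_nonreal x y : b != 0 -> 0 < x -> x <= y -> y < 1 ->
  u1 x = 0 -> u2 x = 0 -> u1 y = 0 -> u2 y = 0 ->
  prim wY 2^-1 y - prim wY 2^-1 x <= CH / b ^+ 2.
Proof.
move=> bn x0 xy y1 e1 e2 e3 e4; have b2 : 0 < b ^+ 2 by rewrite lt_def sqr_ge0 sqrf_eq0 bn.
have := acd_le x0 xy y1 (acdZ (b ^+ 2 / 2) acd_S) (acdD (acdZ (- b) (csol_W hu)) (acdZ 2^-1 aH)) _.
rewrite e1 e2 e3 e4 => Hle; rewrite ler_pdivlMr//.
have := hH x0 xy y1.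
suff : b ^+ 2 / 2 * prim wY 2^-1 y - b ^+ 2 / 2 * prim wY 2^-1 x <=
  - b * (0 * p2 y - 0 * p1 y) + 2^-1 * prim H 2^-1 y - (- b * (0 * p2 x - 0 * p1 x) + 2^-1 * prim H 2^-1 x) by lra.
apply: Hle; apply: aeW => t /andP[h1 h2]; have ht : 0 < t < 1 by apply/andP; split; lra.
exact: energy_nonreal (ltW (weight_gt0 ht)).
Qed.

(** [G'] is integrated from the zero of [u]: [Qc >= weight] supplies the norm of [u], and half of it
    absorbs the product of [u] and the right hand side. *)
Lemma dirichlet_left x t1 : (forall t, 0 < t <= t1 -> weight t <= Qc f a t) -> 0 < x -> x <= t1 -> t1 < 1 ->
  u1 x = 0 -> u2 x = 0 ->
  prim wY 2^-1 t1 - prim wY 2^-1 x <= 2 * (u1 t1 * p1 t1 + u2 t1 * p2 t1) + CH.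
Proof.
move=> hQ x0 xt t11 e1 e2.
have := acd_le x0 xt t11 (acdZ 2^-1 acd_S) (acdD (csol_G hu) (acdZ 2^-1 aH)) _.
rewrite e1 e2 => Hle; have := hH x0 xt t11.
suff : 2^-1 * prim wY 2^-1 t1 - 2^-1 * prim wY 2^-1 x <=
  u1 t1 * p1 t1 + u2 t1 * p2 t1 + 2^-1 * prim H 2^-1 t1 - (0 * p1 x + 0 * p2 x + 2^-1 * prim H 2^-1 x) by lra.
apply: Hle; apply: aeW => t /andP[h1 h2].
have ht : 0 < t < 1 by apply/andP; split; lra.
have q0 : weight t <= Qc f a t by apply: hQ; apply/andP; split; lra.
have w0 := weight_gt0 ht.
have p0 : 0 <= (p1 t ^+ 2 + p2 t ^+ 2) / t ^+ 2 by rewrite divr_ge0 ?addr_ge0 ?sqr_ge0.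
have Y0 : 0 <= u1 t ^+ 2 + u2 t ^+ 2 by rewrite addr_ge0 ?sqr_ge0.
have := ler_wpM2r Y0 q0; move: p0; move: (_ / t ^+ 2) (Qc f a t * _) => A B A0 B0.
have : 0 <= weight t * ((u1 t + k1 t) ^+ 2 + (u2 t + k2 t) ^+ 2) by rewrite mulr_ge0 ?addr_ge0 ?sqr_ge0// ltW.
by move: A0 B0; move: (weight t) (u1 t) (u2 t) (k1 t) (k2 t) => *; lra.
Qed.

(** [G + t kk Y] is the real part of [conj(z) q]. The derivative of [G] alone contains [V - 1 - a],
    which may be negative near 1; in terms of [z] the coefficient is [V - a >= d]. *)
Lemma dirichlet_right y t2 d : 0 < d -> (forall t, t2 <= t < 1 -> d <= Vc f t - a) -> 0 < t2 -> t2 <= y -> y < 1 ->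
  u1 y = 0 -> u2 y = 0 ->
  d * (prim wY 2^-1 y - prim wY 2^-1 t2) <=
    - 2 * (u1 t2 * p1 t2 + u2 t2 * p2 t2 + t2 * kk t2 * (u1 t2 ^+ 2 + u2 t2 ^+ 2)) + CH / d.
Proof.
move=> d0 hV t20 ty y1 e1 e2.
have ckk t : 0 < t < 1 -> {for t, continuous (@kk R)} by move=> ht; apply: cvgV; [by rewrite gt_eqF ?sub_sqr_gt0|exact: cont_1X2].
have dY t : 0 < t < 1 -> dv (fun s => s * kk s * (u1 s ^+ 2 + u2 s ^+ 2)) t
    ((kk t + 2 * t ^+ 2 * kk t ^+ 2) * (u1 t ^+ 2 + u2 t ^+ 2) +
     t * kk t * (2 * (u1 t * p1 t + u2 t * p2 t) / t ^+ 2)).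
  by move=> ht; exact: dvM (dv_tk ht) (dv_Y d1 d2 ht).
have aY : acd (fun s => s * kk s * (u1 s ^+ 2 + u2 s ^+ 2)) (fun t => (kk t + 2 * t ^+ 2 * kk t ^+ 2) * (u1 t ^+ 2 + u2 t ^+ 2) +
     t * kk t * (2 * (u1 t * p1 t + u2 t * p2 t) / t ^+ 2)).
  apply: (acd_C1 dY) => t ht; have k := ckk t ht.
  have ci : {for t, continuous (@id R)} by move=> ?.
  have cy := dv_cont (dv_Y d1 d2 ht); have cx := @cont_X2 R t.
  have cG := AC_loc01_cont (csol_G hu).1 ht; have c2 := @cont_inv2 R t ht.
  apply: cvgD; apply: cvgM => //.
  - apply: cvgD => //; apply: cvgM; first by apply: cvgM => //; exact: cvg_cst.
    by apply: cvgM.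
  - by apply: cvgM.
  - by apply: cvgM => //; apply: cvgM => //; exact: cvg_cst.
have := acd_le t20 ty y1 (acdZ (d / 2) acd_S) (acdD (acdD (csol_G hu) aY) (acdZ (2 * d)^-1 aH)) _.
rewrite e1 e2 => Hle; have := hH t20 ty y1.
have E : CH / d = 2 * ((2 * d)^-1 * CH) by field; rewrite gt_eqF.
have i0 : 0 <= (2 * d)^-1 by rewrite invr_ge0; lra.
move=> /(ler_wpM2l i0).
suff : d / 2 * prim wY 2^-1 y - d / 2 * prim wY 2^-1 t2 <=
  0 * p1 y + 0 * p2 y + y * kk y * (0 ^+ 2 + 0 ^+ 2) + (2 * d)^-1 * prim H 2^-1 y -
  (u1 t2 * p1 t2 + u2 t2 * p2 t2 + t2 * kk t2 * (u1 t2 ^+ 2 + u2 t2 ^+ 2) + (2 * d)^-1 * prim H 2^-1 t2).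
  rewrite expr0n /= addr0 mulr0 E; lra.
apply: Hle; apply: aeW => t /andP[h1 h2].
have ht : 0 < t < 1 by apply/andP; split; lra.
by rewrite Qc_V//; apply: energy_right => //; apply: hV; apply/andP; split; lra.
Qed.

End Dirichlet.
End Resolvent.

(** * Uniform bounds for Dirichlet solutions off the half line *)

Section Surjectivity.
Variable R : realType.
Implicit Types (t a b c e C K M x y : R) (f : R -> R).
Local Notation mu := (@lebesgue_measure R).

Lemma L1locZ c (r : R -> R) : L1loc r -> L1loc (fun x => c * r x).
Proof.
move=> lr a b a0 b1; have := @integrableZl _ _ _ mu _ (measurable_itv _) c _ (lr a b a0 b1).
by apply: eq_integrable; first exact: measurable_itv.
Qed.

Lemma csol0 f a b : csol f a b (fun=> 0) (fun=> 0) (fun=> 0) (fun=> 0) (fun=> 0) (fun=> 0).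
Proof.
have z t : 0 < t < 1 -> dv (fun=> 0 : R) t (0 / t ^+ 2) by move=> _; apply: dv_eq (dv_cst 0 t) _; rewrite mul0r.
by split => //; apply: acd_congr (acd_cst 0) _; apply: aeW => t _; rewrite ?mulr0 ?subr0 ?addr0.
Qed.

Lemma csol_sum f a b d (h1 h2 u1 p1 u2 p2 : 'I_d -> R -> R) (v : 'I_d -> R) :
  (forall j, csol f a b (h1 j) (h2 j) (u1 j) (p1 j) (u2 j) (p2 j)) ->
  csol f a b (fun t => \sum_j v j * h1 j t) (fun t => \sum_j v j * h2 j t)
   (fun t => \sum_j v j * u1 j t) (fun t => \sum_j v j * p1 j t)
   (fun t => \sum_j v j * u2 j t) (fun t => \sum_j v j * p2 j t).
Proof.
move=> h; elim: (index_enum _) => [|i s IH].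
  have e (F : 'I_d -> R -> R) : (fun t => \sum_(j <- [::]) v j * F j t) = (fun=> 0).
    by apply/funext => t; rewrite big_nil.
  by rewrite !e; exact: csol0.
have e (F : 'I_d -> R -> R) : (fun t => \sum_(j <- i :: s) v j * F j t) = (fun t => v i * F i t + \sum_(j <- s) v j * F j t).
  by apply/funext => t; rewrite big_cons.
by rewrite !e; exact: csolD (csolZ (v i) (h i)) IH.
Qed.

(** The bound [C] is chosen before the interval [[x], [y]], so it survives the exhaustion of (0, 1);
    it depends only on the size of the data on the fixed middle part [[t1], [t2]] and on the norm of
    the right hand side. *)
Definition dirichlet_bdd f a b t1 t2 := forall M CH, exists C, forall (k1 k2 u1 p1 u2 p2 : R -> R) x y,
  csol f a b k1 k2 u1 p1 u2 p2 -> L1loc (fun t => weight t * (k1 t ^+ 2 + k2 t ^+ 2)) ->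
  (forall x y, 0 < x -> x <= y -> y < 1 -> prim (fun t => weight t * (k1 t ^+ 2 + k2 t ^+ 2)) 2^-1 y -
     prim (fun t => weight t * (k1 t ^+ 2 + k2 t ^+ 2)) 2^-1 x <= CH) ->
  (forall t, t1 <= t <= t2 -> [/\ `|u1 t| <= M, `|p1 t| <= M, `|u2 t| <= M & `|p2 t| <= M]) ->
  0 < x -> x <= t1 -> t2 <= y -> y < 1 -> u1 x = 0 -> u2 x = 0 -> u1 y = 0 -> u2 y = 0 ->
  prim (fun t => weight t * (u1 t ^+ 2 + u2 t ^+ 2)) 2^-1 y - prim (fun t => weight t * (u1 t ^+ 2 + u2 t ^+ 2)) 2^-1 x <= C.

Lemma Vc_small f d : 0 < d -> exists2 t2, 0 < t2 < 1 & forall t, t2 <= t < 1 -> `|Vc f t| <= d.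
Proof.
(* On [1/2, 1) one has [|V| <= 8 (1 - t^2)], which is at most [16 e] beyond [1 - e]. *)
move=> d0; pose e := Num.min (2^-1) (d / 16); exists (1 - e).
  have h1 : 0 < e by rewrite lt_min; apply/andP; split; order_lra.
  have h2 : e <= 2^-1 by rewrite ge_min lexx.
  by apply/andP; split; order_lra.
have h2 : e <= 2^-1 by rewrite ge_min lexx.
have h3 : e <= d / 16 by rewrite ge_min lexx orbT.
move=> t /andP[t2t tl]; have th : 2^-1 <= t by order_lra.
have i0 : 0 < (2^-1 : R) by rewrite invr_gt0.
apply: le_trans (Vc_le f i0 th tl) _.
have -> : 2 / 2^-1 ^+ 2 = 8 :> R by field.
have : 1 - t ^+ 2 <= 2 * e by rewrite expr2; nra.
by order_lra.
Qed.

Lemma dirichlet_bound f f1 n a b : wave_profile f f1 n -> b != 0 \/ a < 0 ->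
  exists t1 t2, [/\ 0 < t1, t1 <= t2, t2 < 1 & dirichlet_bdd f a b t1 t2].
Proof.
move=> wp hab; have [bn|b0] := eqVneq b 0; last first.
  (* For nonreal [lambda] the estimate holds across the whole interval, so the middle part may
     shrink to a point. *)
  exists (2^-1), (2^-1); split; [by rewrite invr_gt0|by []|by have /andP[] := half01 R|].
  move=> M CH; exists (CH / b ^+ 2) => k1 k2 u1 p1 u2 p2 x y hu lH hH _ x0 xt ty y1 e1 e2 e3 e4.
  by apply: (dirichlet_nonreal hu lH hH) => //; exact: le_trans ty.
have a0 : a < 0 by case: hab => //; rewrite bn eqxx.
have [t1 [t10 t11 hQ]] := Qc_ge a wp.
(* Where [|V| <= - a / 2], the coefficient [V - a] is at least [- a / 2]. *)
have d0 : 0 < - a / 2 by order_lra.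
have [s2 /andP[s20 s21] hV] := Vc_small f d0.
pose t2 := Num.max t1 s2.
have t12 : t1 <= t2 by rewrite le_max lexx.
have st2 : s2 <= t2 by rewrite le_max lexx orbT.
have t21 : t2 < 1 by rewrite gt_max t11.
have t20 : 0 < t2 by exact: lt_le_trans t12.
exists t1, t2; split => // M CH.
have sub x : t1 <= x <= t2 -> 0 < x < 1 by move=> /andP[? ?]; apply/andP; split; order_lra.
have [Kw Kw0 hKw] := @cont_bounded R (@weight R) t1 t2 (fun x hx => cont_weight (sub x hx)).
pose d := - a / 2; pose T := t2 * kk t2.
have T0 : 0 <= T by rewrite mulr_ge0 ?(ltW t20)// ltW// kk_gt0// t20.
have M2 := sqr_ge0 M.
exists ((2 * (2 * M ^+ 2) + CH) + Kw * (2 * M ^+ 2) + (2 * (2 * M ^+ 2 + T * (2 * M ^+ 2)) + CH / d) / d).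
move=> k1 k2 u1 p1 u2 p2 x y hu lH hH hM x0 xt ty y1 e1 e2 e3 e4.
have [m1 m2 m3 m4] := hM t1 (introT andP (conj (lexx _) t12)).
have [m1' m2' m3' m4'] := hM t2 (introT andP (conj t12 (lexx _))).
have sq z : `|z| <= M -> z ^+ 2 <= M ^+ 2.
  by move=> h; rewrite -(real_normK (num_real z)) lerXn2r ?nnegrE// (le_trans _ h).
have pr z w : `|z| <= M -> `|w| <= M -> `|z * w| <= M ^+ 2 by move=> h h'; rewrite normrM expr2 ler_pM.
have L := dirichlet_left hu lH hH (fun t ht => (hQ t ht).2) x0 xt t11 e1 e2.
have hV' t : t2 <= t < 1 -> d <= Vc f t - a.
  move=> /andP[h1 h2]; have := hV t ltac:(by rewrite h2 (le_trans st2)).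
  by rewrite ler_norml /d => /andP[+ _]; move: a0; clear; lra.
have Rr := dirichlet_right hu lH hH d0 hV' t20 ty y1 e3 e4.
have [d1 d2] : (forall t, 0 < t < 1 -> dv u1 t (p1 t / t ^+ 2)) /\ (forall t, 0 < t < 1 -> dv u2 t (p2 t / t ^+ 2)) by case: hu.
have mid : prim (fun t => weight t * (u1 t ^+ 2 + u2 t ^+ 2)) 2^-1 t2 - prim (fun t => weight t * (u1 t ^+ 2 + u2 t ^+ 2)) 2^-1 t1 <= Kw * (2 * M ^+ 2).
  have : prim (fun t => weight t * (u1 t ^+ 2 + u2 t ^+ 2)) 2^-1 t2 - prim (fun t => weight t * (u1 t ^+ 2 + u2 t ^+ 2)) 2^-1 t1 <=
     Kw * (2 * M ^+ 2) * t2 - Kw * (2 * M ^+ 2) * t1.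
    apply: (@dv_le R _ _ (fun t => Kw * (2 * M ^+ 2) * t) (fun=> Kw * (2 * M ^+ 2)) t1 t2 t12 (fun t ht => dv_S d1 d2 (sub t ht))).
      by move=> t _; apply: dv_eq (dvZ _ (dv_id t)) _; rewrite mulr1.
    move=> t /andP[h1 h2]; have ht : t1 <= t <= t2 by rewrite !ltW.
    have [n1 _ n3 _] := hM t ht; apply: ler_pM.
    - exact: ltW (weight_gt0 (sub t ht)).
    - by rewrite addr_ge0 ?sqr_ge0.
    - by apply: le_trans (hKw t ht); exact: ler_norm.
    - by have := sq _ n1; have := sq _ n3; clear; lra.
  rewrite -mulrBr => H; apply: (le_trans H); rewrite ler_piMr//; last by move: t10 t21; clear; lra.
  by rewrite mulr_ge0 ?(ltW Kw0)// mulr_ge0.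
have /ler_normlP[P1 P1'] := pr _ _ m1 m2; have /ler_normlP[P2 P2'] := pr _ _ m3 m4.
have /ler_normlP[P3 P3'] := pr _ _ m1' m2'; have /ler_normlP[P4 P4'] := pr _ _ m3' m4'.
have TY : T * (u1 t2 ^+ 2 + u2 t2 ^+ 2) <= T * (2 * M ^+ 2).
  by apply: ler_wpM2l => //; have := sq _ m1'; have := sq _ m3'; clear; lra.
have TY0 : 0 <= T * (u1 t2 ^+ 2 + u2 t2 ^+ 2) by rewrite mulr_ge0 ?addr_ge0 ?sqr_ge0.
have RR : prim (fun t => weight t * (u1 t ^+ 2 + u2 t ^+ 2)) 2^-1 y - prim (fun t => weight t * (u1 t ^+ 2 + u2 t ^+ 2)) 2^-1 t2 <=
   (2 * (2 * M ^+ 2 + T * (2 * M ^+ 2)) + CH / d) / d.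
  rewrite ler_pdivlMr// mulrC; apply: (le_trans Rr); rewrite -/d -/T; move: P3 P3' P4 P4' TY TY0; clear; lra.
by move: L mid RR P1 P1' P2 P2'; clear; lra.
Qed.

Lemma summableZ (r : R -> R) c : 0 <= c -> (forall t, 0 < t < 1 -> {for t, continuous r}) ->
  summable01 r -> summable01 (fun t => c * r t).
Proof.
move=> c0 cr [C hC]; exists (c * C) => a b a0 ab b1.
have -> : (fun t => c * r t) = (fun t => c * r t + 0 * r t) by apply/funext => t; rewrite mul0r addr0.
rewrite (prim_lin c 0 (half01 R) cr cr a0 ab b1) mul0r addr0.
by apply: ler_wpM2l => //; exact: hC.
Qed.

Lemma hsol_zero_data f a b (u1 p1 u2 p2 : R -> R) t0 : hsol f a b u1 p1 u2 p2 -> 0 < t0 < 1 ->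
  (forall t, 0 < t < 1 -> u1 t = 0 /\ u2 t = 0) -> p1 t0 = 0 /\ p2 t0 = 0.
Proof.
move=> h ht z; have [d1 _ d2 _] := h t0 ht; have /andP[t00 _] := ht.
have key (u : R -> R) p : dv u t0 (p / t0 ^+ 2) -> (forall t, 0 < t < 1 -> u t = 0) -> p = 0.
  move=> d zu; have d0 : dv u t0 0 by apply: (@dv_local R (fun=> 0) u t0 0 0 1 ht _ (dv_cst 0 t0)) => y /zu.
  have /eqP := dv_uniq d d0; rewrite mulf_eq0 invr_eq0 expf_eq0 /= (gt_eqF t00) orbF.
  by move=> /eqP.
by split; [apply: key d1 _ => t /z[]|apply: key d2 _ => t /z[]].
Qed.

End Surjectivity.

(** * Surjectivity by exhaustion of (0, 1) *)

Section SquareIntegrableSolution.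
Variable R : realType.
Implicit Types (t a b c e C K M x y : R) (f : R -> R).

Lemma sub01 c d x : 0 < c -> d < 1 -> c <= x <= d -> 0 < x < 1.
Proof. by move=> c0 d1 /andP[cx xd]; rewrite (lt_le_trans c0 cx) (le_lt_trans xd d1). Qed.

(* Normalized combinations of a particular solution and a basis of homogeneous ones, vanishing at both
   ends of an exhausting sequence of intervals, have a limit point; if the particular solution
   disappeared in it, the limit would be a square integrable homogeneous solution. *)
Lemma csol_surjective f f1 n a b (h1 h2 : R -> R) CH : wave_profile f f1 n -> b != 0 \/ a < 0 ->
  no_L2_hsol f a b -> L1loc (fun t => weight t * h1 t) -> L1loc (fun t => weight t * h2 t) ->
  L1loc (fun t => weight t * (h1 t ^+ 2 + h2 t ^+ 2)) ->
  (forall x y, 0 < x -> x <= y -> y < 1 -> prim (fun t => weight t * (h1 t ^+ 2 + h2 t ^+ 2)) 2^-1 y -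
     prim (fun t => weight t * (h1 t ^+ 2 + h2 t ^+ 2)) 2^-1 x <= CH) ->
  exists u1 p1 u2 p2, csol f a b h1 h2 u1 p1 u2 p2 /\
    summable01 (fun t => weight t * (u1 t ^+ 2 + u2 t ^+ 2)).
Proof.
move=> wp hab noL2 l1 l2 lH hH; have hh := half01 R.
have [t1 [t2 [t10 t12 t21 hD]]] := dirichlet_bound wp hab.
(* Index 0 is the particular solution, with right hand side [h] and zero data at 1/2; indices 1 to 4
   are homogeneous solutions with unit data there. *)
pose E (j : 'I_5) : R := (j == ord0)%:R.
pose D (j : 'I_5) (k : nat) : R := (nat_of_ord j == k)%:R.
have /choice[B hB] j : exists B : ((R -> R) * (R -> R)) * ((R -> R) * (R -> R)),
   csol f a b (fun t => E j * h1 t) (fun t => E j * h2 t) B.1.1 B.1.2 B.2.1 B.2.2 /\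
   [/\ B.1.1 2^-1 = D j 1, B.1.2 2^-1 = D j 2, B.2.1 2^-1 = D j 3 & B.2.2 2^-1 = D j 4].
  have L1 : L1loc (fun t => weight t * (E j * h1 t)).
    by have := L1locZ (E j) l1; congr L1loc; apply/funext => t; rewrite mulrCA.
  have L2 : L1loc (fun t => weight t * (E j * h2 t)).
    by have := L1locZ (E j) l2; congr L1loc; apply/funext => t; rewrite mulrCA.
  have [v1 [q1 [v2 [q2 [z1 z2 z3 z4 hv]]]]] := csol_ex a b (D j 1%N) (D j 2%N) (D j 3%N) (D j 4%N) wp hh L1 L2.
  by exists ((v1, q1), (v2, q2)).
pose U (v : 'I_5 -> R) (F : 'I_5 -> R -> R) t := \sum_j v j * F j t.
pose F1 j := (B j).1.1; pose G1 j := (B j).1.2; pose F2 j := (B j).2.1; pose G2 j := (B j).2.2.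
have hU v : csol f a b (fun t => v ord0 * h1 t) (fun t => v ord0 * h2 t) (U v F1) (U v G1) (U v F2) (U v G2).
  have := csol_sum v (fun j => (hB j).1).
  have e (h : R -> R) : (fun t => \sum_j v j * (E j * h t)) = (fun t => v ord0 * h t).
    apply/funext => t; rewrite (bigD1 ord0)//= big1 ?addr0 /E ?eqxx ?mul1r// => i /negPf ->.
    by rewrite mul0r mulr0.
  by rewrite !e.
pose aa k := t1 / k.+2%:R; pose bb k := 1 - (1 - t2) / k.+2%:R.
have half1 : 2^-1 <= 1 :> R by order_lra.
have inv2 k : 0 < (k.+2%:R : R)^-1 <= 2^-1.
  by rewrite invr_gt0 ltr0n lef_pV2 ?posrE ?ltr0n// ler_nat.
have aa0 k : 0 < aa k by rewrite divr_gt0// ltr0n.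
have aat k : aa k <= t1 by have /andP[_ h] := inv2 k; rewrite /aa ler_piMr ?(ltW t10)//; exact: le_trans h half1.
have bbt k : t2 <= bb k < 1.
  have /andP[h' h] := inv2 k; have s : 0 < (1 - t2) / k.+2%:R by rewrite divr_gt0 ?ltr0n// subr_gt0.
  have : (1 - t2) / k.+2%:R <= 1 - t2 by rewrite ler_piMr ?subr_ge0 ?(ltW t21)//; exact: le_trans h half1.
  by rewrite /bb; move: ((1 - t2) / _) s => s' s ?; apply/andP; split; order_lra.
(* Two components vanishing at two end points are four conditions on five coefficients, so a unit
   vector solves them whether or not the Dirichlet problem is uniquely solvable. *)
have /choice[V hV] k : exists v : 'I_5 -> R, \sum_i v i ^+ 2 = 1 /\
   [/\ U v F1 (aa k) = 0, U v F2 (aa k) = 0, U v F1 (bb k) = 0 & U v F2 (bb k) = 0].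
  pose A (i : 'I_5) (j : 'I_4) := match val j with 0%N => F1 i (aa k) | 1%N => F2 i (aa k)
    | 2%N => F1 i (bb k) | _ => F2 i (bb k) end.
  have [v [v1 hv]] := lin_kernel A isT.
  exists v; split => //; split; [exact: (hv (@Ordinal 4 0 isT))|exact: (hv (@Ordinal 4 1 isT))|
    exact: (hv (@Ordinal 4 2 isT))|exact: (hv (@Ordinal 4 3 isT))].
have V1 k i : `|V k i| <= 1.
  have [h _] := hV k; rewrite -(@ler_pXn2r _ 2) ?nnegrE// expr1n real_normK ?num_real// -h.
  by rewrite (bigD1 i)//= lerDl sumr_ge0// => j _; exact: sqr_ge0.
have [y hy] := bolzano_weierstrass_fin V1.
have contF x : 0 < x < 1 -> forall j, [/\ {for x, continuous (F1 j)}, {for x, continuous (G1 j)}, {for x, continuous (F2 j)} & {for x, continuous (G2 j)}].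
  move=> hx j; have [[d1 a1 d2 a2] _] := hB j; split; [exact: dv_cont (d1 x hx)|exact: AC_loc01_cont a1.1 hx|exact: dv_cont (d2 x hx)|exact: AC_loc01_cont a2.1 hx].
have bndF c d : 0 < c -> d < 1 -> exists2 M, 0 < M & forall j x, c <= x <= d -> [/\ `|F1 j x| <= M, `|G1 j x| <= M, `|F2 j x| <= M & `|G2 j x| <= M].
  move=> c0 d1; have sub x : c <= x <= d -> 0 < x < 1 by exact: sub01.
  have [M1 p1 q1] := @cont_bounded_fam R 'I_5 F1 c d (fun j x hx => let: And4 h _ _ _ := contF x (sub x hx) j in h).
  have [M2 p2 q2] := @cont_bounded_fam R 'I_5 G1 c d (fun j x hx => let: And4 _ h _ _ := contF x (sub x hx) j in h).
  have [M3 p3 q3] := @cont_bounded_fam R 'I_5 F2 c d (fun j x hx => let: And4 _ _ h _ := contF x (sub x hx) j in h).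
  have [M4 p4 q4] := @cont_bounded_fam R 'I_5 G2 c d (fun j x hx => let: And4 _ _ _ h := contF x (sub x hx) j in h).
  exists (M1 + M2 + M3 + M4); first by move: p1 p2 p3 p4; clear; lra.
  by move=> j x hx; have := q1 j x hx; have := q2 j x hx; have := q3 j x hx; have := q4 j x hx;
    move: p1 p2 p3 p4; clear => *; split; order_lra.
have Ubnd v F e M x : 0 <= e -> (forall i, `|v i| <= e) -> (forall j, `|F j x| <= M) -> `|U v F x| <= 5 * (e * M).
  move=> e0 hv hF; apply: le_trans (ler_norm_sum _ _ _) _.
  apply: (@le_trans _ _ (\sum_(j < 5) e * M)).
    by apply: ler_sum => j _; rewrite normrM ler_pM.
  by rewrite sumr_const card_ord mulr_natl.
have [M0 M00 hM0] := bndF t1 t2 t10 t21.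
have [C hC] := hD (5 * (1 * M0)) CH.
have SC k : prim (fun t => weight t * (U (V k) F1 t ^+ 2 + U (V k) F2 t ^+ 2)) 2^-1 (bb k) -
   prim (fun t => weight t * (U (V k) F1 t ^+ 2 + U (V k) F2 t ^+ 2)) 2^-1 (aa k) <= C.
  have [_ [e1 e2 e3 e4]] := hV k; have /andP[b1 b2] := bbt k.
  have v2 : V k ord0 ^+ 2 <= 1 by rewrite -(real_normK (num_real (V k ord0))) expr_le1.
  have eH : (fun t => weight t * ((V k ord0 * h1 t) ^+ 2 + (V k ord0 * h2 t) ^+ 2)) =
      (fun t => V k ord0 ^+ 2 * (weight t * (h1 t ^+ 2 + h2 t ^+ 2))) by apply/funext => t; ring.
  have lH' := L1locZ (V k ord0 ^+ 2) lH.
  apply: (hC _ _ _ _ _ _ _ _ (hU (V k))) => //; rewrite ?eH //.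
  - move=> x z x0 xz z1; apply: le_trans (hH x z x0 xz z1).
    apply: (acd_le x0 xz z1 (prim_acd lH' hh) (prim_acd lH hh)); apply: aeW => t /andP[g1 g2].
    have ht : 0 < t < 1 by apply: (sub01 x0 z1); rewrite g1.
    by rewrite ler_piMl// mulr_ge0 ?addr_ge0 ?sqr_ge0// ltW// weight_gt0.
  - move=> t ht; split; apply: Ubnd => // j; by have [] := hM0 j t ht.
have L2y : summable01 (fun t => weight t * (U y F1 t ^+ 2 + U y F2 t ^+ 2)).
  exists (2 * C + 1) => c d c0 cd d1.
  have sub x : c <= x <= d -> 0 < x < 1 by exact: sub01.
  have [M p hM] := bndF c d c0 d1.
  have [Kw Kw0 hKw] := @cont_bounded R (@weight R) c d (fun x hx => cont_weight (sub x hx)).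
  (* Coefficients within [e] of [y] change each component by at most [5 e M], so the density for [y]
     is at most twice the one for [V k] plus [100 e^2 M^2 Kw <= 1]. *)
  pose e := (1 + 100 * M ^+ 2 * Kw)^-1.
  have m0 : 0 <= 100 * M ^+ 2 * Kw by rewrite mulr_ge0 ?(ltW Kw0)// mulr_ge0 ?sqr_ge0.
  have e0 : 0 < e by rewrite invr_gt0; move: m0; clear; lra.
  have e1 : e <= 1 by rewrite invf_le1; move: m0; clear; lra.
  have eM : 100 * e ^+ 2 * M ^+ 2 * Kw <= 1.
    have E1 : e * (1 + 100 * M ^+ 2 * Kw) = 1 by rewrite mulVf// gt_eqF//; move: m0; clear; lra.
    have : e * (e * (100 * M ^+ 2 * Kw)) <= e * (100 * M ^+ 2 * Kw) by rewrite ler_piMl// mulr_ge0// ltW.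
    have -> : 100 * e ^+ 2 * M ^+ 2 * Kw = e * (e * (100 * M ^+ 2 * Kw)) by ring.
    by move: E1 e0; rewrite mulrDr mulr1; clear; lra.
  have [N hN] : exists N, forall k, (N <= k)%N -> aa k <= c /\ d <= bb k.
    exists ((Num.truncn (t1 / c)).+1 + (Num.truncn ((1 - t2) / (1 - d))).+1)%N => k hk.
    have d1' : 0 < 1 - d by rewrite subr_gt0.
    split; rewrite ?/aa ?/bb.
      rewrite ler_pdivrMr ?ltr0n// mulrC -ler_pdivrMr//.
      apply: ltW; apply: lt_le_trans (truncnS_gt _) _; rewrite ler_nat.
      by apply: leq_trans (leq_trans (leq_addr _ _) hk) _; exact: leq_trans (leqnSn _) (leqnSn _).
    suff : (1 - t2) / k.+2%:R <= 1 - d by move: ((1 - t2) / _); clear => s' ?; order_lra.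
    rewrite ler_pdivrMr ?ltr0n// mulrC -ler_pdivrMr//.
    apply: ltW; apply: lt_le_trans (truncnS_gt _) _; rewrite ler_nat.
    by apply: leq_trans (leq_trans (leq_addl _ _) hk) _; exact: leq_trans (leqnSn _) (leqnSn _).
  have [k Nk hk] := hy e e0 N; have [ac bd] := hN k Nk; have /andP[bk1 bk2] := bbt k.
  have [g1 g2] := csol_contu (hU y); have [g3 g4] := csol_contu (hU (V k)).
  have [dy1 _ dy2 _] := hU y; have [dk1 _ dk2 _] := hU (V k).
  have Sk : prim (fun t => weight t * (U (V k) F1 t ^+ 2 + U (V k) F2 t ^+ 2)) 2^-1 d -
     prim (fun t => weight t * (U (V k) F1 t ^+ 2 + U (V k) F2 t ^+ 2)) 2^-1 c <= C.
    have := SC k; have := S_mono (hU (V k)) (aa0 k) ac (le_lt_trans cd d1).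
    by have := S_mono (hU (V k)) (lt_le_trans c0 cd) bd bk2; clear; lra.
  have : prim (fun t => weight t * (U y F1 t ^+ 2 + U y F2 t ^+ 2)) 2^-1 d -
      prim (fun t => weight t * (U y F1 t ^+ 2 + U y F2 t ^+ 2)) 2^-1 c <=
      (2 * prim (fun t => weight t * (U (V k) F1 t ^+ 2 + U (V k) F2 t ^+ 2)) 2^-1 d + d) -
      (2 * prim (fun t => weight t * (U (V k) F1 t ^+ 2 + U (V k) F2 t ^+ 2)) 2^-1 c + c).
    apply: (dv_le cd (fun t ht => dv_S dy1 dy2 (sub t ht)) (fun t ht => dvD (dvZ 2 (dv_S dk1 dk2 (sub t ht))) (dv_id t))).
    move=> t /andP[j1 j2]; have ht : c <= t <= d by rewrite !ltW.
    have w0 := ltW (weight_gt0 (sub t ht)).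
    have dif (F : 'I_5 -> R -> R) : (forall j, `|F j t| <= M) -> (U y F t - U (V k) F t) ^+ 2 <= (5 * (e * M)) ^+ 2.
      move=> hF; have -> : U y F t - U (V k) F t = U (fun i => y i - V k i) F t.
        by rewrite /U -sumrB; apply: eq_bigr => i _; rewrite mulrBl.
      rewrite -(real_normK (num_real (U _ _ _))) lerXn2r ?nnegrE//.
        by rewrite mulr_ge0// mulr_ge0// ltW.
      by apply: Ubnd => //; [exact: ltW|move=> i; rewrite distrC ltW// hk].
    have D1 := dif F1 (fun j => let: And4 h _ _ _ := hM j t ht in h).
    have D2 := dif F2 (fun j => let: And4 _ _ h _ := hM j t ht in h).
    have hw : weight t <= Kw by apply: le_trans (hKw t ht); exact: ler_norm.
    have := ler_wpM2r (_ : 0 <= 4 * (5 * (e * M)) ^+ 2) hw.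
    move=> /(_ ltac:(by rewrite mulr_ge0 ?sqr_ge0)).
    have -> : Kw * (4 * (5 * (e * M)) ^+ 2) = 100 * e ^+ 2 * M ^+ 2 * Kw by ring.
    move=> W1; have {}W1 := le_trans W1 eM.
    apply: le_trans (_ : _ <= 2 * (weight t * (U (V k) F1 t ^+ 2 + U (V k) F2 t ^+ 2)) + weight t * (4 * (5 * (e * M)) ^+ 2)) _;
      last by move: W1; clear; lra.
    have -> : forall A B : R, 2 * (weight t * A) + weight t * B = weight t * (2 * A + B) by move=> *; ring.
    apply: ler_wpM2l => //; move: D1 D2; move: (U y F1 t) (U y F2 t) (U (V k) F1 t) (U (V k) F2 t) ((5 * (e * M)) ^+ 2).
    move=> x1 x2 y1 y2 q D1 D2.
    have := sqr_ge0 (x1 - y1 - y1); have := sqr_ge0 (x2 - y2 - y2); move: D1 D2; rewrite !expr2; clear; lra.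
  by move: Sk c0 d1; clear; lra.
have [y0|yn] := eqVneq (y ord0) 0; last first.
  have hc := csolZ (y ord0)^-1 (hU y).
  exists (fun t => (y ord0)^-1 * U y F1 t), (fun t => (y ord0)^-1 * U y G1 t),
     (fun t => (y ord0)^-1 * U y F2 t), (fun t => (y ord0)^-1 * U y G2 t); split.
    by apply: csol_congr hc _ _; apply: aeW => t _; rewrite mulKf.
  have -> : (fun t => weight t * (((y ord0)^-1 * U y F1 t) ^+ 2 + ((y ord0)^-1 * U y F2 t) ^+ 2)) =
     (fun t => ((y ord0)^-1) ^+ 2 * (weight t * (U y F1 t ^+ 2 + U y F2 t ^+ 2))) by apply/funext => t; ring.
  have [dy1 _ dy2 _] := hU y.
  by apply: summableZ => //; [exact: sqr_ge0|move=> t ht; exact: (@cont_wY R (U y F1) (U y G1) (U y F2) (U y G2) dy1 dy2 t ht)].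
have hs : hsol f a b (U y F1) (U y G1) (U y F2) (U y G2).
  by apply: (csol_hsol wp); apply: csol_congr (hU y) _ _; apply: aeW => t _; rewrite y0 mul0r.
have z := noL2 _ _ _ _ hs L2y.
have [q1 q2] := hsol_zero_data hs hh z; have [z1 z2] := z _ hh.
have val (F : 'I_5 -> R -> R) (i : 'I_5) : (forall j, F j 2^-1 = D j (nat_of_ord i)) -> U y F 2^-1 = y i.
  move=> hF; rewrite /U (bigD1 i)//= hF /D eqxx mulr1 big1 ?addr0// => j ji.
  by rewrite hF /D -val_eqE /= in ji *; rewrite (negPf ji) mulr0.
have y1 : y (@Ordinal 5 1 isT) = 0 by rewrite -z1; apply/esym/val => j; have [_ []] := hB j.
have y2 : y (@Ordinal 5 2 isT) = 0 by rewrite -q1; apply/esym/val => j; have [_ []] := hB j.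
have y3 : y (@Ordinal 5 3 isT) = 0 by rewrite -z2; apply/esym/val => j; have [_ []] := hB j.
have y4 : y (@Ordinal 5 4 isT) = 0 by rewrite -q2; apply/esym/val => j; have [_ []] := hB j.
have yz i : y i = 0.
  case: i => [[|[|[|[|[|//]]]]] hi]; [rewrite -y0|rewrite -y1|rewrite -y2|rewrite -y3|rewrite -y4];
    by congr y; apply: val_inj.
(* All limiting coefficients vanish, but then some [V k] has entries below 1/3 and squared norm at
   most 5/9 instead of 1. *)
have t3 : 0 < 3^-1 :> R by rewrite invr_gt0.
have [k _ hk] := hy 3^-1 t3 0%N; have [s _] := hV k.
have : \sum_i V k i ^+ 2 <= \sum_(i < 5) (9^-1 : R).
  apply: ler_sum => i _; have := hk i; rewrite yz subr0 => h.
  have -> : 9^-1 = (3^-1 : R) ^+ 2 by field.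
  by rewrite -(real_normK (num_real (V k i))) lerXn2r ?nnegrE ?(ltW t3)// ltW.
by rewrite s sumr_const card_ord -mulr_natl; clear; lra.
Qed.

End SquareIntegrableSolution.

(** * The half line: the range is dense but not everything *)
Section HalfLine.
Variable R : realType.
Implicit Types (t a b c e s C K M x y : R) (f p v q u h : R -> R).
Local Notation mu := (@lebesgue_measure R).

(** The derivatives are compared only in the interior, since cut-off right hand sides jump at the
    end points. *)
Lemma acd_eq F G dF dG x y : 0 < x -> x <= y -> y < 1 -> acd F dF -> acd G dG ->
  (forall t : R, x < t < y -> dF t = dG t) -> F y - F x = G y - G x :> R.
Proof.
move=> x0 xy y1 aF aG e.
have E : {ae mu, forall t, t <> x /\ t <> y}.
  have n : mu.-negligible [set x; y].
    apply/negligibleP; first by apply: measurableU; exact: measurable_set1.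
    apply: countable_lebesgue_measure0; apply: finite_set_countable.
    by rewrite finite_setU; split; exact: finite_set1.
  by apply: (negligibleS _ n) => t /= h; apply: contrapT => h'; apply: h; split => tx; apply: h'; [left|right].
have E' : {ae mu, forall t, x <= t <= y -> dF t = dG t}.
  apply: ae_imp E _ => t [tx ty] /andP[h1 h2]; apply: e; rewrite !lt_neqAle h1 h2 !andbT.
  by apply/andP; split; apply/eqP => // h; apply: tx.
by apply/eqP; rewrite eq_le; apply/andP; split; [apply: (acd_le x0 xy y1 aF aG)|apply: (acd_le x0 xy y1 aG aF)];
  apply: ae_imp E' _ => t h /h ->.
Qed.

Definition isol f a h u p := (forall t, 0 < t < 1 -> dv u t (p t / t ^+ 2)) /\
  acd p (fun t => Qc f a t * u t + weight t * h t).

Lemma csol_isol f a (h1 h2 u1 p1 u2 p2 : R -> R) :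
  csol f a 0 h1 h2 u1 p1 u2 p2 <-> isol f a h1 u1 p1 /\ isol f a h2 u2 p2.
Proof.
have e1 : (fun t => Qc f a t * u1 t + 0 * weight t * u2 t + weight t * h1 t) =
  (fun t => Qc f a t * u1 t + weight t * h1 t) by apply/funext => t; rewrite !mul0r addr0.
have e2 : (fun t => Qc f a t * u2 t - 0 * weight t * u1 t + weight t * h2 t) =
  (fun t => Qc f a t * u2 t + weight t * h2 t) by apply/funext => t; rewrite !mul0r subr0.
by rewrite /csol e1 e2; split => [[? ? ? ?]|[[? ?] [? ?]]]; split.
Qed.

Lemma rsol_contw f a u p v q t : rsol f a u p -> rsol f a v q -> 0 < t < 1 ->
  {for t, continuous (fun t => weight t * (u t * v t))}.
Proof.
move=> h k ht; have [c1 _] := rsol_cont h ht; have [c2 _] := rsol_cont k ht.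
by apply: cvgM; [exact: cont_weight|apply: cvgM].
Qed.

Lemma isol_green f f1 n a h u p v q : wave_profile f f1 n -> isol f a h u p -> rsol f a v q ->
  acd (fun t => u t * q t - v t * p t) (fun t => - (weight t * (h t * v t))).
Proof.
move=> wp [d1 a1] k.
have c1 t : 0 < t < 1 -> {for t, continuous (fun s => p s / s ^+ 2)}.
  by move=> ht; apply: cvgM; [exact: AC_loc01_cont a1.1 ht|exact: cont_inv2].
have c2 t : 0 < t < 1 -> {for t, continuous (fun s => q s / s ^+ 2)}.
  by move=> ht; apply: cvgM; [exact: (rsol_cont k ht).2|exact: cont_inv2].
have c3 t : 0 < t < 1 -> {for t, continuous (fun s => Qc f a s * v s)}.
  by move=> ht; apply: cvgM; [exact: cont_Qc wp ht|exact: (rsol_cont k ht).1].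
have aq := acd_C1 (fun t ht => (k t ht).2) c3; have av := acd_C1 (fun t ht => (k t ht).1) c2.
apply: acd_congr (acdB (acdM (acd_C1 d1 c1) aq) (acdM av a1)) _.
by apply: aeW => t _; ring.
Qed.

Lemma W_zero (u p v1 q1 v2 q2 : R) : v1 * q2 - v2 * q1 != 0 ->
  u * q1 - v1 * p = 0 -> u * q2 - v2 * p = 0 -> u = 0 /\ p = 0.
Proof.
move=> n e1 e2; split; apply/eqP; rewrite -(mulIr_eq0 _ (mulIf n)); apply/eqP.
  by transitivity (v1 * (u * q2 - v2 * p) - v2 * (u * q1 - v1 * p)); [ring|rewrite e1 e2; ring].
by transitivity (q1 * (u * q2 - v2 * p) - q2 * (u * q1 - v1 * p)); [ring|rewrite e1 e2; ring].
Qed.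

(* On an interval where the right hand side vanishes, [u] is a solution of the homogeneous
   equation on all of (0, 1). *)
Lemma isol_extend f f1 n a h u p x y x0 : wave_profile f f1 n -> isol f a h u p -> 0 < x -> y < 1 ->
  (forall t, x < t < y -> h t = 0) -> x <= x0 <= y ->
  exists v q, rsol f a v q /\ forall t, x <= t <= y -> u t = v t /\ p t = q t.
Proof.
move=> wp hu xp y1 h0 hx0; have sub t : x <= t <= y -> 0 < t < 1 by exact: sub01.
have [v [q [v0 q0 hv]]] := rsol_ex a (u x0) (p x0) wp (sub _ hx0).
exists v, q; split => // t ht.
have hi : isol f a h (fun t => u t - v t) (fun t => p t - q t).
  have [d1 a1] := hu; split=> [s hs|].
    by apply: dv_eq (dvB (d1 s hs) (hv s hs).1) _; rewrite mulrBl.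
  have c3 s : 0 < s < 1 -> {for s, continuous (fun s => Qc f a s * v s)}.
    by move=> hs; apply: cvgM; [exact: cont_Qc wp hs|exact: (rsol_cont hv hs).1].
  by apply: acd_congr (acdB a1 (acd_C1 (fun t ht => (hv t ht).2) c3)) _; apply: aeW => s _; ring.
have key w r : rsol f a w r -> (u t - v t) * r t - w t * (p t - q t) = 0.
  move=> hw; have aW := isol_green wp hi hw.
  have W0 : (u x0 - v x0) * r x0 - w x0 * (p x0 - q x0) = 0 by rewrite v0 q0 !subrr mul0r mulr0 subrr.
  rewrite -W0; have [tx|/ltW xt] := leP t x0.
    have t0 : 0 < t by case/andP: (sub t ht).
    have x01 : x0 < 1 by case/andP: (sub _ hx0).
    have := acd_eq t0 tx x01 aW (acd_cst 0) _; rewrite subrr => H; apply/esym/eqP; rewrite -subr_eq0; apply/eqP; apply: H.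
    move=> s /andP[s1 s2]; rewrite h0 ?mul0r ?mulr0 ?oppr0//.
    by move: ht hx0 => /andP[g1 _] /andP[_ g2]; rewrite (le_lt_trans g1 s1) (lt_le_trans s2 g2).
  have x00 : 0 < x0 by case/andP: (sub _ hx0).
  have t1 : t < 1 by case/andP: (sub t ht).
  have := acd_eq x00 xt t1 aW (acd_cst 0) _; rewrite subrr => H; apply/eqP; rewrite -subr_eq0; apply/eqP; apply: H.
  move=> s /andP[s1 s2]; rewrite h0 ?mul0r ?mulr0 ?oppr0//.
  by move: ht hx0 => /andP[_ g1] /andP[g2 _]; rewrite (le_lt_trans g2 s1) (lt_le_trans s2 g1).
have [w1 [r1 [e1 e2 /key k1]]] := rsol_ex a 1 0 wp (sub t ht).
have [w2 [r2 [e3 e4 /key k2]]] := rsol_ex a 0 1 wp (sub t ht).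
move: k1 k2; rewrite e1 e2 e3 e4 !mulr0 !mul1r !mulr1 !mul0r subr0 sub0r => /eqP + /eqP.
by rewrite oppr_eq0 !subr_eq0 => /eqP -> /eqP ->.
Qed.

Lemma gram_pos f f1 n a u p x y t0 : wave_profile f f1 n -> rsol f a u p -> 0 < x -> x < y -> y < 1 ->
  0 < t0 < 1 -> u t0 != 0 \/ p t0 != 0 ->
  0 < prim (fun t => weight t * (u t * u t)) 2^-1 y - prim (fun t => weight t * (u t * u t)) 2^-1 x.
Proof.
move=> wp h x0 xy y1 ht0 nz; rewrite ltNge; apply/negP => hle.
have sub t : x <= t <= y -> 0 < t < 1 by exact: sub01.
have cw t ht := @rsol_contw f a u p u p t h h ht.
have dP t (ht : 0 < t < 1) := prim_dv cw (half01 R) ht.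
have mono s t : x <= s -> s <= t -> t <= y -> prim (fun t => weight t * (u t * u t)) 2^-1 s <= prim (fun t => weight t * (u t * u t)) 2^-1 t.
  move=> xs st ty; have sub' z : s <= z <= t -> 0 < z < 1.
    by move=> /andP[h1 h2]; apply: sub; rewrite (le_trans xs h1) (le_trans h2 ty).
  apply: (dv_mono st (fun z hz => dP z (sub' z hz))) => z /andP[h1 h2].
  by rewrite mulr_ge0 -?expr2 ?sqr_ge0// ltW// weight_gt0// sub'// !ltW.
have u0 t : x < t < y -> u t = 0.
  move=> ht; have ht' : 0 < t < 1 by apply: sub; move: ht => /andP[? ?]; rewrite !ltW.
  have d0 : dv (prim (fun t => weight t * (u t * u t)) 2^-1) t 0.
    apply: (@dv_local R (fun=> prim (fun t => weight t * (u t * u t)) 2^-1 x) _ t 0 x y ht _ (dv_cst _ t)).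
    move=> s /andP[h1 h2]; apply/eqP; rewrite eq_le mono ?lexx ?(ltW h1) ?(ltW h2)//=.
    by apply: le_trans (mono s y (ltW h1) (ltW h2) (lexx _)) _; rewrite -subr_le0.
  have /eqP := dv_uniq (dP t ht') d0; rewrite mulf_eq0 gt_eqF ?weight_gt0//= -expr2 sqrf_eq0.
  by move=> /eqP.
pose m := (x + y) / 2.
have hm : x < m < y by rewrite /m; apply/andP; split; order_lra.
have hm' : 0 < m < 1 by apply: sub; move: hm => /andP[? ?]; rewrite !ltW.
have pm : p m = 0.
  have d0 : dv u m 0 by apply: (@dv_local R (fun=> 0) u m 0 x y hm _ (dv_cst 0 m)) => s hs; rewrite u0.
  have m0 : m != 0 by case/andP: hm' => ? _; rewrite gt_eqF.
  have /eqP := dv_uniq (h m hm').1 d0; rewrite mulf_eq0 invr_eq0 expf_eq0 /= (negPf m0) orbF.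
  by move=> /eqP.
have [z1 z2] := rsol_uniq wp h hm' (u0 m hm) pm ht0.
by case: nz; rewrite ?z1 ?z2 eqxx.
Qed.

Lemma summ0_ext x t1 (r : R -> R) : 0 < x -> x <= t1 -> t1 < 1 -> (forall t, 0 < t < 1 -> {for t, continuous r}) ->
  (forall t, 0 < t < 1 -> 0 <= r t) -> summ0 x r -> summ0 t1 r.
Proof.
move=> x0 xt t11 cr r0 [C hC].
have mono s t : 0 < s -> s <= t -> t < 1 -> prim r 2^-1 s <= prim r 2^-1 t.
  move=> s0 st tl; have sub z : s <= z <= t -> 0 < z < 1 by exact: sub01.
  apply: (dv_mono st (fun z hz => prim_dv cr (half01 R) (sub z hz))) => z /andP[? ?].
  by apply: r0; apply: sub; rewrite !ltW.
exists (`|C| + (prim r 2^-1 t1 - prim r 2^-1 x)) => a b a0 ab bt.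
have m1 := mono x t1 x0 xt t11; have m2 := mono b t1 (lt_le_trans a0 ab) bt t11.
have nC := ler_norm C.
have [bx|/ltW xb] := leP b x; first by have := hC a b a0 ab bx; order_lra.
have [ax|/ltW xa] := leP a x; first by have := hC a x a0 ax (lexx _); order_lra.
by have := mono x a x0 xa (le_lt_trans ab (le_lt_trans bt t11)); have := normr_ge0 C; order_lra.
Qed.

(* [h] is the regular solution cut off to an interval: a solution [u] in [L^2] would be a multiple
   of [v] on the left of the interval and zero on its right, but [W(u, v)] changes across it. *)
Lemma isol_not_surjective f f1 n a : wave_profile f f1 n -> 0 <= a ->
  exists h K, [/\ measurable_fun (@I01 R) h, forall t, 0 < t < 1 -> weight t * h t ^+ 2 <= K &
    forall u p, isol f a h u p -> summable01 (fun t => weight t * u t ^+ 2) -> False].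
Proof.
move=> wp a0; have [t1 [t10 t11 hQ]] := Qc_ge a wp; have ht1 : 0 < t1 < 1 by rewrite t10.
have Q1 t : 0 < t <= t1 -> 1 <= Qc f a t by move=> /hQ[].
have [d [v [q hr]]] := regsol_ex wp ht1 Q1; have [hv v1 q1 vp] := hr.
pose h t := if (t1 / 2 <= t) && (t <= t1) then v t else 0.
have [K K0 hK] := @cont_bounded R (fun t => weight t * (v t * v t)) (t1 / 2) t1
  (fun t ht => rsol_contw hv hv (sub01 (divr_gt0 t10 (ltr0n _ 2)) t11 ht)).
exists h, K; split.
- have -> : h = (fun t => \1_(`[t1 / 2, t1]%classic) t * v t).
    apply/funext => t; rewrite /h indicE mem_setE in_itv /=.
    by case: (_ && _); rewrite ?mul1r ?mul0r.
  apply: measurable_funM; first exact: measurable_indic.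
  exact: cont_measurable01 (fun t ht => (rsol_cont hv ht).1).
- move=> t ht; rewrite /h; case: ifPn => [hc|_]; last by rewrite expr0n /= mulr0 ltW.
  by rewrite expr2; apply: le_trans (ler_norm _) (hK t hc).
move=> u p hu S.
have [du _] := hu; have aW := isol_green wp hu hv.
have cu t (ht : 0 < t < 1) := cont_wu2 du ht.
pose x0 := t1 / 3; have x00 : 0 < x0 by rewrite /x0; order_lra.
have x01 : x0 < t1 / 2 by rewrite /x0; order_lra.
have x0t : x0 < t1 by rewrite /x0; order_lra.
have Wx : u x0 * q x0 - v x0 * p x0 = 0.
  have hx : x0 <= x0 <= x0 by rewrite lexx.
  have key x : 0 < x -> x <= x0 -> exists w r, rsol f a w r /\ forall t, x <= t <= x0 -> u t = w t /\ p t = r t.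
    move=> xp xx; apply: (isol_extend wp hu xp (lt_trans x0t t11) _ _ (x0 := x0)); last by rewrite xx lexx.
    by move=> t /andP[_ h2]; rewrite /h leNgt (lt_trans h2 x01).
  have [w [r [hw e0]]] := key x0 x00 (lexx _); have [ew er] := e0 x0 hx.
  (* The homogeneous solution provided by [key] depends on [x]; uniqueness at [x0] identifies all of
     them with [w]. *)
  have e x : 0 < x <= x0 -> u x = w x.
    move=> /andP[xp xx]; have [w' [r' [hw' e']]] := key x xp xx.
    have [g1 g2] := e' x0 ltac:(by rewrite xx lexx).
    have hx01 : 0 < x0 < 1 by rewrite x00 (lt_trans x0t).
    have hx1 : 0 < x < 1 by rewrite xp (le_lt_trans xx)//; case/andP: hx01.
    have [-> _] := rsol_eq wp hw hw' hx01 (etrans (esym ew) g1) (etrans (esym er) g2) hx1.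
    by apply: (e' x _).1; rewrite lexx.
  have cw t (ht : 0 < t < 1) := cont_wu2 (fun t ht => (hw t ht).1) ht.
  have sw : summ0 t1 (fun s => weight s * w s ^+ 2).
    apply: (summ0_ext x00 (ltW x0t) t11 cw) => [t ht|].
      by rewrite mulr_ge0 ?sqr_ge0// ltW// weight_gt0.
    apply: (summ0_le (lt_trans x0t t11) cw cu _ (summable_summ0 (lt_trans x0t t11) S)) => t ht.
    by rewrite e.
  have hx01 : 0 < x0 < 1 by rewrite x00 (lt_trans x0t).
  by rewrite ew er; have [-> ->] := regsol_prop wp ht1 Q1 hr hw sw hx01; ring.
pose y0 := (t1 + 1) / 2; have ty0 : t1 < y0 by rewrite /y0; order_lra.
have y01 : y0 < 1 by rewrite /y0; order_lra.
have hy0 : 0 < y0 < 1 by rewrite (lt_trans t10).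
have Wy : u y0 * q y0 - v y0 * p y0 = 0.
  have key y : y0 <= y -> y < 1 -> exists w r, rsol f a w r /\ forall t, y0 <= t <= y -> u t = w t /\ p t = r t.
    move=> yy yl; apply: (isol_extend wp hu (lt_trans t10 ty0) yl _ _ (x0 := y0)); last by rewrite lexx.
    by move=> t /andP[h1 _]; rewrite /h [t <= t1]leNgt (lt_trans ty0 h1) andbF.
  have [w [r [hw e0]]] := key y0 (lexx _) y01; have [ew er] := e0 y0 ltac:(by rewrite lexx).
  have e x : y0 <= x < 1 -> u x = w x.
    move=> /andP[xx xl]; have [w' [r' [hw' e']]] := key x xx xl.
    have [g1 g2] := e' y0 ltac:(by rewrite lexx).
    have hx1 : 0 < x < 1 by rewrite xl (lt_le_trans _ xx)//; case/andP: hy0.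
    have [-> _] := rsol_eq wp hw hw' hy0 (etrans (esym ew) g1) (etrans (esym er) g2) hx1.
    by apply: (e' x _).1; rewrite lexx andbT.
  have cw t (ht : 0 < t < 1) := cont_wu2 (fun t ht => (hw t ht).1) ht.
  have y00 : 0 < y0 by case/andP: hy0.
  have sw : summ1 y0 (fun s => weight s * w s ^+ 2).
    apply: (summ1_le y00 cw cu _ (summable_summ1 y00 S)) => t ht.
    by rewrite e.
  have wz t : 0 < t < 1 -> w t = 0 by exact: rsol_end1 wp a0 hw hy0 sw.
  have [r0 _] := hsol_zero_data (rsol_hsol erefl hw) hy0 (fun t ht => conj (wz t ht) erefl).
  by rewrite ew er wz// r0 mul0r mulr0 subrr.
have anti x y : 0 < x -> x <= y -> y < 1 -> u y * q y - v y * p y <= u x * q x - v x * p x.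
  move=> xp xy yl; rewrite -subr_le0 -[leRHS](subrr (0 : R)).
  apply: (acd_le xp xy yl aW (acd_cst 0)); apply: aeW => t /andP[g1 g2].
  have ht : 0 < t < 1 by apply: (sub01 xp yl); rewrite g1.
  rewrite oppr_le0 mulr_ge0 ?(ltW (weight_gt0 ht))// /h; case: ifP => _; last by rewrite mul0r.
  by rewrite -expr2 sqr_ge0.
have h20 : 0 < t1 / 2 by rewrite divr_gt0.
have h2t : t1 / 2 < t1 by order_lra.
have n1 : v t1 != 0 \/ q t1 != 0 by left; rewrite v1 oner_eq0.
have := gram_pos wp hv h20 h2t t11 ht1 n1.
have aP := prim_acd (cont_L1loc (fun t ht => rsol_contw hv hv ht)) (half01 R).
have E := acd_eq h20 (ltW h2t) t11 aW (acdN aP).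
have {}E : u t1 * q t1 - v t1 * p t1 - (u (t1 / 2) * q (t1 / 2) - v (t1 / 2) * p (t1 / 2)) =
   - prim (fun t => weight t * (v t * v t)) 2^-1 t1 - - prim (fun t => weight t * (v t * v t)) 2^-1 (t1 / 2).
  by apply: E => t /andP[g1 g2]; rewrite /h (ltW g1) (ltW g2).
have := anti x0 (t1 / 2) x00 (ltW x01) (lt_trans h2t t11); have := anti t1 y0 t10 (ltW ty0) y01.
by move: E; rewrite Wx Wy; order_lra.
Qed.

End HalfLine.

(** * Gram determinants of two solutions near 1 *)

Section DenseRange.
Variable R : realType.
Implicit Types (t a b c e s C K M x y : R) (f p v q u h : R -> R).
Local Notation mu := (@lebesgue_measure R).

Definition gram (u v : R -> R) x y : R :=
  prim (fun t => weight t * (u t * v t)) 2^-1 y - prim (fun t => weight t * (u t * v t)) 2^-1 x.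

Lemma gramE f a u1 p1 u2 p2 v r c1 c2 x y : rsol f a u1 p1 -> rsol f a u2 p2 -> rsol f a v r ->
  0 < x -> x <= y -> y < 1 ->
  gram (fun t => c1 * u1 t + c2 * u2 t) v x y = c1 * gram u1 v x y + c2 * gram u2 v x y.
Proof.
move=> h1 h2 k x0 xy y1; rewrite /gram.
have -> : (fun t => weight t * ((c1 * u1 t + c2 * u2 t) * v t)) =
   (fun t => c1 * (weight t * (u1 t * v t)) + c2 * (weight t * (u2 t * v t))) by apply/funext => t; ring.
by apply: (prim_lin _ _ (half01 R)) => // t ht; [exact: rsol_contw h1 k ht|exact: rsol_contw h2 k ht].
Qed.

Lemma gramC u v x y : gram u v x y = gram v u x y.
Proof. by rewrite /gram; have -> : (fun t => weight t * (u t * v t)) = (fun t => weight t * (v t * u t)) by apply/funext => t; rewrite [u t * _]mulrC. Qed.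

Lemma gram_sqr f a u1 p1 u2 p2 c1 c2 x y : rsol f a u1 p1 -> rsol f a u2 p2 ->
  0 < x -> x <= y -> y < 1 ->
  gram (fun t => c1 * u1 t + c2 * u2 t) (fun t => c1 * u1 t + c2 * u2 t) x y =
  c1 ^+ 2 * gram u1 u1 x y + 2 * c1 * c2 * gram u1 u2 x y + c2 ^+ 2 * gram u2 u2 x y.
Proof.
move=> h1 h2 x0 xy y1; have hc := rsolD (rsolZ c1 h1) (rsolZ c2 h2).
rewrite (gramE c1 c2 h1 h2 hc x0 xy y1) (gramC u1) (gramC u2).
rewrite (gramE c1 c2 h1 h2 h1 x0 xy y1) (gramE c1 c2 h1 h2 h2 x0 xy y1) (gramC u2 u1); ring.
Qed.

Lemma gram_le f a u p x y z : rsol f a u p -> 0 < x -> x <= y -> y <= z -> z < 1 ->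
  gram u u x y <= gram u u x z.
Proof.
move=> h x0 xy yz z1; rewrite /gram lerD2r.
have sub t : y <= t <= z -> 0 < t < 1 by exact: (sub01 (lt_le_trans x0 xy) z1).
apply: (dv_mono yz (fun t ht => prim_dv (fun t ht => rsol_contw h h ht) (half01 R) (sub t ht))) => t /andP[? ?].
by rewrite mulr_ge0 -?expr2 ?sqr_ge0// ltW// weight_gt0// sub// !ltW.
Qed.

(* Otherwise the minimizers [s] would accumulate at some [s0], and [u1 - s0 u2] would be square
   integrable near 1. *)
Lemma gram_unbounded f f1 n a u1 p1 u2 p2 x M : wave_profile f f1 n -> 0 <= a -> rsol f a u1 p1 -> rsol f a u2 p2 ->
  0 < x -> x < 1 -> u1 x * p2 x - u2 x * p1 x != 0 ->
  exists y s, [/\ x < y < 1, gram (fun t => 1 * u1 t + - s * u2 t) u2 x y = 0 &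
    M <= gram (fun t => 1 * u1 t + - s * u2 t) (fun t => 1 * u1 t + - s * u2 t) x y].
Proof.
move=> wp a0 h1 h2 x0 x1 Wn; have hx : 0 < x < 1 by rewrite x0.
have n2 : u2 x != 0 \/ p2 x != 0.
  by have [e|] := eqVneq (u2 x) 0; [right|left] => //; apply: contraNneq Wn => e'; rewrite e e' mulr0 mul0r subr0.
have g22 y : x < y -> y < 1 -> 0 < gram u2 u2 x y by move=> xy y1; exact: gram_pos wp h2 x0 xy y1 hx n2.
apply: contrapT => hn.
have hs s : rsol f a (fun t => 1 * u1 t + - s * u2 t) (fun t => 1 * p1 t + - s * p2 t).
  exact: rsolD (rsolZ 1 h1) (rsolZ (- s) h2).
have key y : x < y -> y < 1 -> gram (fun t => 1 * u1 t + - (gram u1 u2 x y / gram u2 u2 x y) * u2 t)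
    (fun t => 1 * u1 t + - (gram u1 u2 x y / gram u2 u2 x y) * u2 t) x y < M.
  move=> xy y1; rewrite ltNge; apply/negP => h; apply: hn.
  exists y, (gram u1 u2 x y / gram u2 u2 x y); split => //; first by rewrite xy.
  by rewrite (gramE _ _ h1 h2 h2 x0 (ltW xy) y1) mul1r mulNr divfK ?subrr// gt_eqF// g22.
pose yy k := 1 - (1 - x) / k.+2%:R.
have inv2 k : 0 < (k.+2%:R : R)^-1 <= 2^-1.
  by rewrite invr_gt0 ltr0n lef_pV2 ?posrE ?ltr0n// ler_nat.
have hyy k : yy 0%N <= yy k < 1.
  have /andP[i1 i2] := inv2 k; have m : 0 < 1 - x by rewrite subr_gt0.
  have := mulr_gt0 m i1; have := ler_wpM2l (ltW m) i2; have -> : yy 0%N = 1 - (1 - x) * 2^-1 by [].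
  rewrite /yy; move: (k.+2%:R^-1); clear => i A1 A2.
  by apply/andP; split; order_lra.
have yE : yy 0%N = 1 - (1 - x) * 2^-1 by [].
have y0 : x < yy 0%N by rewrite yE; order_lra.
have hxy k : x < yy k by have /andP[h _] := hyy k; exact: lt_le_trans h.
pose S k := gram u1 u2 x (yy k) / gram u2 u2 x (yy k).
have y01 : yy 0%N < 1 by have /andP[] := hyy 0%N.
pose B := 2 * (`|M| + gram u1 u1 x (yy 0%N)) / gram u2 u2 x (yy 0%N).
have G0 := g22 _ y0 y01.
have ex s y : x <= y -> y < 1 -> gram (fun t => 1 * u1 t + - s * u2 t) (fun t => 1 * u1 t + - s * u2 t) x y =
   gram u1 u1 x y - 2 * s * gram u1 u2 x y + s ^+ 2 * gram u2 u2 x y.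
  by move=> xy y1; rewrite (gram_sqr _ _ h1 h2 x0 xy y1); ring.
have gnn u p y : rsol f a u p -> x <= y -> y < 1 -> 0 <= gram u u x y.
  move=> hu xy y1; have := gram_le hu x0 (lexx x) xy y1.
  by rewrite /gram subrr.
have SB k : `|S k| <= B + 1.
  have /andP[b1 b2] := hyy k; have kM := key _ (hxy k) b2; rewrite -/(S k) in kM.
  have H1 := le_lt_trans (gram_le (hs (S k)) x0 (ltW y0) b1 b2) kM.
  (* Twice the inequality [H1], minus the nonnegative square of [2 u1 - S k u2], bounds [(S k)^2] by
     a quantity that does not depend on [k]. *)
  have P := gnn _ _ _ (rsolD (rsolZ 2 h1) (rsolZ (- S k) h2)) (ltW y0) y01.
  have E2 : gram (fun t => 2 * u1 t + - S k * u2 t) (fun t => 2 * u1 t + - S k * u2 t) x (yy 0%N) =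
     4 * gram u1 u1 x (yy 0%N) - 4 * S k * gram u1 u2 x (yy 0%N) + S k ^+ 2 * gram u2 u2 x (yy 0%N).
    by rewrite (gram_sqr _ _ h1 h2 x0 (ltW y0) y01); ring.
  rewrite E2 in P; rewrite ex ?(ltW y0)// in H1.
  have : S k ^+ 2 <= B.
    rewrite /B ler_pdivlMr//; have := ler_norm M.
    move: (gram u1 u1 _ _) (gram u1 u2 _ _) (gram u2 u2 _ _) (S k ^+ 2) (S k) H1 P; clear => *; order_lra.
  have := sqr_ge0 (`|S k| - 1); rewrite -(real_normK (num_real (S k))); have := normr_ge0 (S k); rewrite !expr2; nra.
have SB' k (i : 'I_1) : `|S k| <= B + 1 by exact: SB.
have [z hz] := bolzano_weierstrass_fin SB'; pose s := z ord0.
have hss := hs s.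
suff Sm : summ1 x (fun t => weight t * (1 * u1 t + - s * u2 t) ^+ 2).
  have u0 t (ht : 0 < t < 1) := rsol_end1 wp a0 hss hx Sm ht.
  have [p0 _] := hsol_zero_data (rsol_hsol erefl hss) hx (fun t ht => conj (u0 t ht) erefl).
  have := u0 x hx; move: p0; rewrite !mul1r !mulNr => /eqP + /eqP; rewrite !subr_eq0 => /eqP e1 /eqP e2.
  by move: Wn; rewrite e1 e2 => /negP; apply; apply/eqP; ring.
exists (2 * `|M| + 1) => c d xc cd d1.
have cd0 : 0 < c by exact: lt_le_trans xc.
have xd : x <= d by exact: le_trans cd.
have m1 : prim (fun t => weight t * (1 * u1 t + - s * u2 t) ^+ 2) 2^-1 d - prim (fun t => weight t * (1 * u1 t + - s * u2 t) ^+ 2) 2^-1 c <=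
   gram (fun t => 1 * u1 t + - s * u2 t) (fun t => 1 * u1 t + - s * u2 t) x d.
  have -> : (fun t => weight t * (1 * u1 t + - s * u2 t) ^+ 2) = (fun t => weight t * ((1 * u1 t + - s * u2 t) * (1 * u1 t + - s * u2 t))).
    by apply/funext => t; rewrite expr2.
  by have := gnn _ _ c hss xc (le_lt_trans cd d1); rewrite /gram; order_lra.
apply: (le_trans m1).
pose e := (1 + gram u2 u2 x d)^-1 / 2.
have gd : 0 <= gram u2 u2 x d by exact: gnn h2 xd d1.
have e0 : 0 < e by rewrite divr_gt0// invr_gt0; order_lra.
have e1 : 2 * e * (1 + gram u2 u2 x d) = 1 by rewrite /e; field; rewrite gt_eqF//; order_lra.
have eg : 0 <= e * gram u2 u2 x d by rewrite mulr_ge0// ltW.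
have eh : e <= 2^-1 by move: e1 eg e0; rewrite mulrDr mulr1 -mulrA; order_lra.
have [N hN] : exists N, forall k, (N <= k)%N -> d <= yy k.
  exists (Num.truncn ((1 - x) / (1 - d))).+1 => k hk.
  have d1' : 0 < 1 - d by rewrite subr_gt0.
  suff : (1 - x) / k.+2%:R <= 1 - d by rewrite /yy; move: ((1 - x) / _); clear => A hA; order_lra.
  rewrite ler_pdivrMr ?ltr0n// mulrC -ler_pdivrMr//.
  apply: ltW; apply: lt_le_trans (truncnS_gt _) _; rewrite ler_nat.
  by apply: leq_trans hk _; exact: leq_trans (leqnSn _) (leqnSn _).
have [k Nk hk] := hz e e0 N; have {}hk := hk ord0; rewrite -/s in hk.
have /andP[b1 b2] := hyy k; have kM := key _ (hxy k) b2; rewrite -/(S k) in kM.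
have H1 := le_lt_trans (gram_le (hs (S k)) x0 xd (hN k Nk) b2) kM.
(* Parallelogram identity: the squares of [u1 - s u2] and of its reflection [u1 - (2 S k - s) u2]
   add up to twice that of [u1 - S k u2] plus [2 (S k - s)^2] times that of [u2]. *)
have P := gnn _ _ _ (rsolD (rsolZ 1 h1) (rsolZ (- (2 * S k - s)) h2)) xd d1.
rewrite ex// in P; rewrite ex// in H1; rewrite ex//.
have sq : (S k - s) ^+ 2 <= e ^+ 2 by rewrite -(real_normK (num_real (S k - s))) lerXn2r ?nnegrE ?(ltW e0)// ltW.
have := ler_wpM2r gd sq; have : e ^+ 2 * gram u2 u2 x d <= 2^-1.
  have : e * (e * gram u2 u2 x d) <= 2^-1 * (e * gram u2 u2 x d) by rewrite ler_wpM2r.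
  by move: e1 e0; rewrite expr2 mulrDr mulr1 -!mulrA; order_lra.
have := ler_norm M; move: (gram u1 u1 _ _) (gram u1 u2 _ _) (gram u2 u2 _ _) (S k) H1 P; clear => A B C r *; order_lra.
Qed.

End DenseRange.

(** * Approximation of a right hand side by elements of the range *)

Section RangeDensity.
Variable R : realType.
Implicit Types (t a b c e s C K M x y : R) (f p v q u h k : R -> R).
Local Notation mu := (@lebesgue_measure R).

(** Shape of the approximation error: zero on [A], bounded by the tail [r] outside, with an
    additional correction [q] on [B]. *)
Lemma int01_split (F r q : R -> R) (A B : set R) : measurable A -> measurable B -> B `<=` @I01 R ->
  measurable_fun (@I01 R) F -> measurable_fun (@I01 R) r -> measurable_fun (@I01 R) q ->
  (forall x, I01 x -> 0 <= F x) -> (forall x, I01 x -> 0 <= r x) -> (forall x, I01 x -> 0 <= q x) ->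
  (forall x, I01 x -> A x -> F x = 0) ->
  (forall x, I01 x -> ~ A x -> B x -> F x <= r x + q x) ->
  (forall x, I01 x -> ~ A x -> ~ B x -> F x <= r x) ->
  (\int[mu]_(x in @I01 R) (F x)%:E <= \int[mu]_(x in @I01 R `\` A) (r x)%:E + \int[mu]_(x in B) (q x)%:E)%E.
Proof.
move=> mA mB sB mF mr mq F0 r0 q0 h1 h2 h3; have mI := @measurable_I01 R.
have mnA : measurable (~` A) by exact: measurableC.
have er : (\int[mu]_(x in @I01 R `\` A) (r x)%:E = \int[mu]_(x in @I01 R) ((EFin \o r) \_ (~` A)) x)%E.
  by rewrite setDE integral_mkcondr.
have eq : (\int[mu]_(x in B) (q x)%:E = \int[mu]_(x in @I01 R) ((EFin \o q) \_ B) x)%E.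
  by rewrite -integral_mkcondr setIidr.
have Mr : measurable_fun (@I01 R) ((EFin \o r) \_ (~` A)).
  apply/(measurable_restrict (EFin \o r) mnA mI); apply: measurable_funS (_ : measurable_fun (@I01 R) _) => //.
  exact/measurable_EFinP.
have Mq : measurable_fun (@I01 R) ((EFin \o q) \_ B).
  apply/(measurable_restrict (EFin \o q) mB mI); apply: measurable_funS (_ : measurable_fun (@I01 R) _) => //.
  exact/measurable_EFinP.
have nr x : I01 x -> (0 <= ((EFin \o r) \_ (~` A)) x)%E.
  by move=> Ix; rewrite patchE; case: ifP => // _; rewrite lee_fin r0.
have nq x : I01 x -> (0 <= ((EFin \o q) \_ B) x)%E.
  by move=> Ix; rewrite patchE; case: ifP => // _; rewrite lee_fin q0.
rewrite er eq -ge0_integralD//; apply: ge0_le_integral => //.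
- exact/measurable_EFinP.
- exact: emeasurable_funD.
move=> x Ix; rewrite !patchE.
have [Ax|nA] := pselect (A x).
  rewrite h1//; apply: adde_ge0; case: ifP => // _; rewrite lee_fin; [exact: r0|exact: q0].
rewrite (mem_set (nA : (~` A) x)); have [Bx|nB] := pselect (B x).
  by rewrite (mem_set Bx) -EFinD lee_fin h2.
by rewrite (memNset nB) adde0 lee_fin h3.
Qed.

Lemma isol_ex f f1 n a h t0 x y : wave_profile f f1 n -> 0 < t0 < 1 -> L1loc (fun t => weight t * h t) ->
  exists u p, [/\ u t0 = x, p t0 = y & isol f a h u p].
Proof.
move=> wp ht0 lh.
have [u [p [u2 [p2 [e1 e2 _ _ /csol_isol[hi _]]]]]] := csol_ex a 0 x y x y wp ht0 lh lh.
by exists u, p.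
Qed.

Lemma weighted_norm_le (w s : R) : 0 <= w -> `|w * s| <= w + w * s ^+ 2.
Proof.
move=> w0; rewrite normrM ger0_norm// -[X in X + _]mulr1 -mulrDr ler_wpM2l//.
by have := sqr_ge0 (`|s| - 2^-1); rewrite -(real_normK (num_real s)) !expr2; order_lra.
Qed.

(** [k] equals [h] on [A], a correction [kap * psi] on [B], and 0 elsewhere; the solution starts
    from zero data at [x0] and must reach zero data at [y]. With [W (u, u2) = 0] at the start of
    [B], it suffices that [psi] is orthogonal to [u2] on [B] and that [kap] cancels the other
    Wronskian [om]. The correction has squared norm [om^2 / D], and [D] can be made as large as
    desired. *)
Lemma isol_dense f f1 n a h e : wave_profile f f1 n -> 0 <= a -> measurable_fun (@I01 R) h ->
  (\int[mu]_(x in @I01 R) (weight x * h x ^+ 2)%:E < +oo)%E -> 0 < e ->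
  exists k u p, [/\ isol f a k u p, measurable_fun (@I01 R) k, summable01 (fun t => weight t * u t ^+ 2) &
    (\int[mu]_(x in @I01 R) (weight x * (k x - h x) ^+ 2)%:E < e%:E)%E].
Proof.
move=> wp a0 mh hfin e0; have hh := half01 R.
have mw := @measurable_weight R.
have mwh : measurable_fun (@I01 R) (fun x => weight x * h x ^+ 2) by apply: measurable_funM => //; exact: measurable_funX.
have wh0 x : I01 x -> 0 <= weight x * h x ^+ 2.
  by move=> /I01P hx; rewrite mulr_ge0 ?sqr_ge0// ltW// weight_gt0.
have e8 : 0 < e / 8 by rewrite divr_gt0.
have [N hN] := int01_tail mwh wh0 hfin e8.
have [lwh _] := int01_prim mwh wh0 hfin.
pose x0 : R := N.+2%:R^-1; pose b0 : R := 1 - N.+2%:R^-1.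
have x00 : 0 < x0 by exact: itvn_gt0.
have xb : x0 <= b0 by exact: itvn_le.
have b01 : b0 < 1 by exact: itvn_lt1.
have b00 : 0 < b0 by exact: lt_le_trans xb.
have hb0 : 0 < b0 < 1 by rewrite b00.
have hx0 : 0 < x0 < 1 by rewrite x00 (le_lt_trans xb).
have lw : L1loc (@weight R) by apply: cont_L1loc => x; exact: cont_weight.
have lh : L1loc (fun t => weight t * h t).
  apply: (L1loc_le _ _ (L1locD lw lwh)); first exact: measurable_funM.
  by move=> x hx; apply: weighted_norm_le; exact: ltW (weight_gt0 hx).
have [u0 [p0 [z1 z2 hu0]]] := isol_ex a 0 0 wp hx0 lh.
(* [u2] continues the data of [u0] at [b0], so their Wronskian is zero, and [u1] takes the rotated
   data; if these data vanish, any basis will do. *)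
have [u1 [p1 [u2 [p2 [h1 h2 Wn W0]]]]] : exists u1 p1 u2 p2, [/\ rsol f a u1 p1, rsol f a u2 p2,
    u1 b0 * p2 b0 - u2 b0 * p1 b0 != 0 & u0 b0 * p2 b0 - u2 b0 * p0 b0 = 0].
  have [z|nz] := boolP ((u0 b0 == 0) && (p0 b0 == 0)).
    have /andP[/eqP g1 /eqP g2] := z.
    have [u1 [p1 [e1 e2 h1]]] := rsol_ex a 1 0 wp hb0; have [u2 [p2 [e3 e4 h2]]] := rsol_ex a 0 1 wp hb0.
    exists u1, p1, u2, p2; split => //; first by rewrite e1 e2 e3 e4 mulr1 mulr0 subr0 oner_neq0.
    by rewrite g1 g2 mul0r mulr0 subrr.
  have [u1 [p1 [e1 e2 h1]]] := rsol_ex a (- p0 b0) (u0 b0) wp hb0.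
  have [u2 [p2 [e3 e4 h2]]] := rsol_ex a (u0 b0) (p0 b0) wp hb0.
  exists u1, p1, u2, p2; split => //; last by rewrite e3 e4 mulrC subrr.
  rewrite e1 e2 e3 e4 mulNr -opprD oppr_eq0 paddr_eq0 -?expr2 ?sqr_ge0// !sqrf_eq0 andbC.
  exact: nz.
pose om := u0 b0 * p1 b0 - u1 b0 * p0 b0.
(* This makes the correction contribute [2 om^2 / D <= e / 4]; the tail of [h] contributes less than
   [2 * (e / 8)]. The summand 1 keeps [D] positive even if [om = 0]. *)
have [y [s [/andP[by0 y1] G2 GM]]] := gram_unbounded (8 * om ^+ 2 / e + 1) wp a0 h1 h2 b00 b01 Wn.
pose psi t := 1 * u1 t + - s * u2 t; pose psip t := 1 * p1 t + - s * p2 t.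
have hpsi : rsol f a psi psip by exact: rsolD (rsolZ 1 h1) (rsolZ (- s) h2).
pose D := gram psi psi b0 y.
have om0 : 0 <= 8 * om ^+ 2 / e by rewrite divr_ge0 ?(ltW e0)// mulr_ge0 ?sqr_ge0.
have D0 : 0 < D by apply: lt_le_trans GM; order_lra.
have G1 : gram psi u1 b0 y = D.
  have := gramE 1 (- s) h1 h2 hpsi b00 (ltW by0) y1; rewrite -/psi -/D => ->.
  by rewrite (gramC u1) (gramC u2) -/psi [gram psi u2 _ _]G2 mulr0 addr0 mul1r.
pose kap := om / D.
pose A : set R := `]x0, b0]%classic; pose B : set R := `]b0, y]%classic.
pose k t := \1_A t * h t + \1_B t * (kap * psi t).
have mA : measurable A by exact: measurable_itv.
have mB : measurable B by exact: measurable_itv.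
have cpsi t : 0 < t < 1 -> {for t, continuous psi} by move=> ht; exact: (rsol_cont hpsi ht).1.
have mpsi : measurable_fun (@I01 R) psi by exact: cont_measurable01.
have mk : measurable_fun (@I01 R) k.
  apply: measurable_funD; apply: measurable_funM; [exact: measurable_indic|exact: mh|exact: measurable_indic|].
  by apply: measurable_funM => //; exact: measurable_cst.
have inA t : (t \in A) = (x0 < t <= b0) by rewrite mem_setE in_itv.
have inB t : (t \in B) = (b0 < t <= y) by rewrite mem_setE in_itv.
have kA t : x0 < t <= b0 -> k t = h t.
  move=> ht; rewrite /k !indicE inA inB ht mul1r; have /andP[_ tb] := ht.
  by rewrite [b0 < t]ltNge tb /= mul0r addr0.
have kB t : b0 < t <= y -> k t = kap * psi t.
  move=> ht; rewrite /k !indicE inA inB ht mul1r; have /andP[tb _] := ht.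
  by rewrite [t <= b0]leNgt tb andbF mul0r add0r.
have k0 t : t <= x0 \/ y < t -> k t = 0.
  move=> ht; rewrite /k !indicE inA inB.
  case: ht => ht; first by rewrite [x0 < t]ltNge ht [b0 < t]ltNge (le_trans ht xb) !mul0r addr0.
  by rewrite [t <= y]leNgt ht [t <= b0]leNgt (lt_trans by0 ht) !andbF !mul0r addr0.
have lk : L1loc (fun t => weight t * k t).
  have lp : L1loc (fun t => weight t * (kap * psi t) ^+ 2).
    apply: cont_L1loc => t ht; apply: cvgM; first exact: cont_weight.
    by rewrite expr2; apply: cvgM; apply: cvgM; try exact: cpsi; exact: cvg_cst.
  apply: (L1loc_le _ _ (L1locD (L1locD lw lwh) lp)); first exact: measurable_funM.
  move=> x hx; have w0 := ltW (weight_gt0 hx).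
  apply: le_trans (weighted_norm_le (k x) w0) _; rewrite -addrA lerD2l.
  have q1 : 0 <= weight x * h x ^+ 2 by rewrite mulr_ge0 ?sqr_ge0.
  have q2 : 0 <= weight x * (kap * psi x) ^+ 2 by rewrite mulr_ge0 ?sqr_ge0.
  have [ha|na] := boolP (x0 < x <= b0); first by rewrite kA// lerDl.
  have [hb|nb] := boolP (b0 < x <= y); first by rewrite kB// lerDr.
  by rewrite /k !indicE inA inB (negPf na) (negPf nb) !mul0r addr0 expr0n /= mulr0 addr_ge0.
have [u [p [ux px hu]]] := isol_ex a 0 0 wp hx0 lk.
have Wb v q : rsol f a v q -> u b0 * q b0 - v b0 * p b0 = u0 b0 * q b0 - v b0 * p0 b0.
  move=> hv; have := acd_eq x00 xb b01 (isol_green wp hu hv) (isol_green wp hu0 hv).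
  rewrite ux px z1 z2 !mul0r !mulr0 !subrr !subr0; apply => t /andP[t1 t2].
  by rewrite kA// t1 ltW.
have Wy v q : rsol f a v q -> u y * q y - v y * p y = u0 b0 * q b0 - v b0 * p0 b0 - kap * gram psi v b0 y.
  move=> hv; have aP := prim_acd (cont_L1loc (fun t ht => rsol_contw hpsi hv ht)) hh.
  have E := acd_eq b00 (ltW by0) y1 (isol_green wp hu hv) (acdZ (- kap) aP).
  have {}E : u y * q y - v y * p y - (u b0 * q b0 - v b0 * p b0) =
    - kap * prim (fun t => weight t * (psi t * v t)) 2^-1 y - - kap * prim (fun t => weight t * (psi t * v t)) 2^-1 b0.
    by apply: E => t /andP[t1 t2]; rewrite kB ?t1 ?ltW//; ring.
  by rewrite -(Wb v q hv) /gram; move: E; order_lra.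
have Wyn : u1 y * p2 y - u2 y * p1 y != 0 by rewrite -(W2_const h1 h2 b00 (ltW by0) y1).
have y0 : 0 < y by exact: lt_trans by0.
have hy : 0 < y < 1 by rewrite y0.
have [uy py] : u y = 0 /\ p y = 0.
  apply: (W_zero Wyn); rewrite (Wy _ _ h1, Wy _ _ h2).
    by rewrite G1 -/om /kap divfK ?subrr// gt_eqF.
  by rewrite W0 [gram _ _ _ _]G2 mulr0 subrr.
have uL t : 0 < t <= x0 -> u t = 0.
  move=> /andP[t0 tx]; have kz r : t < r < x0 -> k r = 0 by move=> /andP[_ rx]; apply: k0; left; exact: ltW.
  have hx : t <= x0 <= x0 by rewrite tx lexx.
  have [v [q [hv E]]] := isol_extend wp hu t0 (le_lt_trans xb b01) kz hx.
  have [v0 q0] : v x0 = 0 /\ q x0 = 0 by have [<- <-] := E x0 hx.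
  have ht : 0 < t < 1 by rewrite t0 (le_lt_trans tx)//; case/andP: hx0.
  have ht' : t <= t <= x0 by rewrite lexx.
  by have [-> _] := E t ht'; have [] := rsol_uniq wp hv hx0 v0 q0 ht.
have uR t : y <= t < 1 -> u t = 0.
  move=> /andP[yt t1]; have kz r : y < r < t -> k r = 0 by move=> /andP[ry _]; apply: k0; right.
  have hx : y <= y <= t by rewrite yt lexx.
  have [v [q [hv E]]] := isol_extend wp hu y0 t1 kz hx.
  have [v0 q0] : v y = 0 /\ q y = 0 by have [<- <-] := E y hx.
  have ht : 0 < t < 1 by rewrite t1 (lt_le_trans y0).
  have ht' : y <= t <= t by rewrite lexx andbT.
  by have [-> _] := E t ht'; have [] := rsol_uniq wp hv hy v0 q0 ht.
exists k, u, p; split => //.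
- have [du _] := hu; have cu t (ht : 0 < t < 1) := cont_wu2 du ht.
  have [C C0 hC] := @cont_bounded R (fun s => weight s * u s ^+ 2) x0 y (fun t ht => cu t (sub01 x00 y1 ht)).
  exists C => c d c0 cd d1.
  have : prim (fun s => weight s * u s ^+ 2) 2^-1 d - prim (fun s => weight s * u s ^+ 2) 2^-1 c <= C * d - C * c.
    apply: (@dv_le R _ _ (fun s => C * s) (fun=> C) c d cd (fun t ht => prim_dv cu hh (sub01 c0 d1 ht))).
      by move=> t _; apply: dv_eq (dvZ C (dv_id t)) _; rewrite mulr1.
    move=> t /andP[t1 t2]; have [tx|/ltW xt] := leP t x0.
      by rewrite uL ?expr0n /= ?mulr0 ?(ltW C0)// tx (lt_trans c0).
    have [ty|/ltW yt] := leP t y; last by rewrite uR ?expr0n /= ?mulr0 ?(ltW C0)// yt (lt_trans t2).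
    by apply: le_trans (ler_norm _) (hC t _); rewrite xt.
  rewrite -mulrBr => H; apply: (le_trans H); rewrite ler_piMr ?(ltW C0)//.
  by move: c0 d1; clear; lra.
have sB : B `<=` @I01 R.
  by move=> t; rewrite /B /= in_itv /= => /andP[t1 t2]; apply/I01P; rewrite (lt_trans b00 t1) (le_lt_trans t2 y1).
pose F x := weight x * (k x - h x) ^+ 2.
pose r x := 2 * (weight x * h x ^+ 2); pose q x := 2 * kap ^+ 2 * (weight x * (psi x * psi x)).
have q0 x : I01 x -> 0 <= q x.
  move=> /I01P hx; have w0 := ltW (weight_gt0 hx); have psi2 := sqr_ge0 (psi x).
  by apply: mulr_ge0; [apply: mulr_ge0 => //; exact: sqr_ge0|apply: mulr_ge0].
have cq t : 0 < t < 1 -> {for t, continuous q}.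
  by move=> ht; apply: cvgM; [exact: cvg_cst|exact: (rsol_contw hpsi hpsi ht)].
have H := @int01_split F r q A B mA mB sB.
have {}H : (\int[mu]_(x in @I01 R) (F x)%:E <= \int[mu]_(x in @I01 R `\` A) (r x)%:E + \int[mu]_(x in B) (q x)%:E)%E.
  apply: H => //.
  - by apply: measurable_funM => //; apply: measurable_funX; exact: measurable_funB.
  - by apply: measurable_funM => //; exact: measurable_cst.
  - exact: cont_measurable01.
  - by move=> x /I01P hx; rewrite mulr_ge0 ?sqr_ge0// ltW// weight_gt0.
  - by move=> x Ix; rewrite mulr_ge0// wh0.
  - by move=> x Ix; rewrite /A /= in_itv /= => hx; rewrite /F kA// subrr expr0n /= mulr0.
  - move=> x /I01P hx _; rewrite /B /= in_itv /= => hb; rewrite /F kB// /r /q.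
    have w0 := ltW (weight_gt0 hx); have := mulr_ge0 w0 (sqr_ge0 (kap * psi x + h x)); rewrite !expr2.
    clear; lra.
  - move=> x /I01P hx; rewrite /A /B /= !in_itv /= => /negP na /negP nb; rewrite /F /r.
    rewrite /k !indicE inA inB (negPf na) (negPf nb) !mul0r addr0 sub0r sqrrN.
    by have := wh0 x ((I01P x).2 hx); order_lra.
apply: (le_lt_trans H).
have -> : (\int[mu]_(x in B) (q x)%:E = (2 * kap ^+ 2 * D)%:E)%E.
  rewrite /B (integral_prim (cont_L1loc cq) hh b00 (ltW by0) y1); congr (_%:E).
  have eq : q = (fun t => 2 * kap ^+ 2 * (weight t * (psi t * psi t)) + 0 * (weight t * (psi t * psi t))).
    by apply/funext => t; rewrite mul0r addr0.
  have cc t (ht : 0 < t < 1) := rsol_contw hpsi hpsi ht.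
  by rewrite eq (prim_lin _ _ hh cc cc b00 (ltW by0) y1) mul0r addr0 /D /gram.
have -> : (\int[mu]_(x in @I01 R `\` A) (r x)%:E = 2%:E * \int[mu]_(x in @I01 R `\` A) (weight x * h x ^+ 2)%:E)%E.
  rewrite -ge0_integralZl_EFin//.
  - by apply: measurableD; [exact: measurable_I01|].
  - by move=> x [Ix _]; rewrite lee_fin wh0.
  - apply/measurable_EFinP; apply: measurable_funS mwh; [exact: measurable_I01|by move=> x []].
set I := (\int[mu]_(x in _) _)%E in hN *.
have I0 : (0 <= I)%E by apply: integral_ge0 => x [Ix _]; rewrite lee_fin wh0.
have If : I \is a fin_num by rewrite ge0_fin_numE// (lt_trans hN)// ltry.
move: hN; rewrite -(fineK If) lte_fin => hN.
rewrite -EFinM -EFinD lte_fin.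
have kD : kap ^+ 2 * D * D = om ^+ 2 by rewrite /kap; field; rewrite gt_eqF.
have : 2 * kap ^+ 2 * D <= e / 4.
  have i : 8 * om ^+ 2 / e * e = 8 * om ^+ 2 by rewrite divfK// gt_eqF.
  have : (8 * om ^+ 2 / e + 1) * e <= D * e by rewrite ler_wpM2r// ltW.
  rewrite mulrDl i mul1r => j.
  have E : 2 * kap ^+ 2 * D * D = 2 * om ^+ 2 by rewrite -kD; ring.
  by rewrite -(ler_pM2r D0) E; move: j e0; clear; lra.
by move: hN e0; order_lra.
Qed.

End RangeDensity.

(** * The continuous and the residual spectrum *)
Section Spectrum.
Variable R : realType.
Implicit Types (t a b c e C K M x y : R) (f : R -> R) (u h w : R -> R[i]) (lam : R[i]).
Local Notation mu := (@lebesgue_measure R).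

Lemma surjective_off f f1 n lam : wave_profile f f1 n -> complex.Im lam != 0 \/ complex.Re lam < 0 ->
  res_injective (potential f) lam -> res_surjective (potential f) lam.
Proof.
move=> wp hl /(res_injectiveP _ wp) no h hh; have [l0 l1 l2] := inH_L1loc hh; have [m1 [m2 hf]] := hh.
have [_ [C hC]] := int01_prim (measurable_dens m1 m2) (@dens_ge0 R h) hf.
have hC' x y : 0 < x -> x <= y -> y < 1 -> prim (fun t => weight t * (ReF h t ^+ 2 + ImF h t ^+ 2)) 2^-1 y -
    prim (fun t => weight t * (ReF h t ^+ 2 + ImF h t ^+ 2)) 2^-1 x <= C by exact: hC (half01 R).
have [u1 [p1 [u2 [p2 [hu S]]]]] := csol_surjective wp hl no l1 l2 l0 hC'.
have [c1 c2] := csol_contu hu.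
pose u t := Complex (u1 t) (u2 t); exists u.
have hU : inH u by apply/inH_contP.
exact: (@csol_graph R f f1 n lam u h p1 p2 wp hu hh hU).
Qed.

Lemma inH_bounded h K : measurable_fun (@I01 R) (ReF h) -> measurable_fun (@I01 R) (ImF h) ->
  (forall x, 0 < x < 1 -> weight x * (ReF h x ^+ 2 + ImF h x ^+ 2) <= K) -> inH h.
Proof.
move=> m1 m2 hK; apply/inHP; split => //.
have cK x : 0 < x < 1 -> {for x, continuous (fun=> K)} by move=> _; exact: cvg_cst.
have iK : mu.-integrable (@I01 R) (EFin \o (fun=> K)).
  have K0 : 0 <= K.
    have hh := half01 R; apply: le_trans (hK _ hh).
    by rewrite mulr_ge0 ?addr_ge0 ?sqr_ge0// ltW// weight_gt0.
  apply/integrable_ge0P => //; apply/(summable01P cK) => //.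
  exists K => a b a0 ab b1.
  have : prim (fun=> K) 2^-1 b - prim (fun=> K) 2^-1 a <= K * b - K * a.
    apply: (@dv_le R _ _ (fun s => K * s) (fun=> K) a b ab (fun t ht => prim_dv cK (half01 R) (sub01 a0 b1 ht))) => //.
    by move=> t _; apply: dv_eq (dvZ K (dv_id t)) _; rewrite mulr1.
  by rewrite -mulrBr => H; apply: (le_trans H); rewrite ler_piMr//; order_lra.
apply: integrable01_le iK; first exact: measurable_dens.
move=> x Ix; rewrite ger0_norm; first by apply: hK; exact/I01P.
exact: (dens_ge0 h Ix).
Qed.

Lemma not_surjective_on f f1 n lam : wave_profile f f1 n -> complex.Im lam = 0 -> 0 <= complex.Re lam ->
  ~ res_surjective (potential f) lam.
Proof.
move=> wp im re S; have [h [K [mh hK no]]] := isol_not_surjective wp re.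
pose H t := Complex (h t) 0.
have hH : inH H.
  apply: (@inH_bounded H K); [exact: mh|exact: measurable_cst|] => x hx; have -> : ReF H x ^+ 2 + ImF H x ^+ 2 = h x ^+ 2; last exact: hK.
  by rewrite /ReF /ImF /H /= expr0n addr0.
have [u /(graph_csol wp)[_ hu [p1 [p2 c]]]] := S H hH.
rewrite im in c; have [i1 _] := (csol_isol f (complex.Re lam) (ReF H) (ImF H) (ReF u) p1 (ImF u) p2).1 c.
apply: (no (ReF u) p1 i1); have [c1 c2] := csol_contu c; have [[d1 _] [_ _ d2 _]] := (i1, c).
have := (inH_contP c1 c2).1 hu; apply: summable_le => t ht; [exact: cont_wu2 d1 ht|exact: (@cont_wY R (ReF u) p1 (ImF u) p2 d1 d2 t ht)|].
by rewrite ler_wpM2l ?(ltW (weight_gt0 ht))// lerDl sqr_ge0.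
Qed.

Lemma dense_on f f1 n lam : wave_profile f f1 n -> complex.Im lam = 0 -> 0 <= complex.Re lam ->
  res_dense_range (potential f) lam.
Proof.
move=> wp im re h hh eps eps0; have [m1 [m2 hf]] := hh.
have mw := @measurable_weight R.
have fin (v : R -> R) : measurable_fun (@I01 R) v -> (forall x, v x ^+ 2 <= ReF h x ^+ 2 + ImF h x ^+ 2) ->
   (\int[mu]_(x in @I01 R) (weight x * v x ^+ 2)%:E < +oo)%E.
  move=> mv hv; apply: le_lt_trans hf; apply: ge0_le_integral => //.
  - exact: measurable_I01.
  - by move=> x /I01P hx; rewrite lee_fin mulr_ge0 ?sqr_ge0// ltW// weight_gt0.
  - by apply/measurable_EFinP; apply: measurable_funM => //; exact: measurable_funX.
  - by apply/measurable_EFinP; exact: measurable_dens.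
  - by move=> x /I01P hx; rewrite lee_fin ler_wpM2l// ltW// weight_gt0.
have f1' := fin _ m1 (fun x => ltac:(by rewrite lerDl sqr_ge0)).
have f2' := fin _ m2 (fun x => ltac:(by rewrite lerDr sqr_ge0)).
have e2 : 0 < eps / 2 by rewrite divr_gt0.
have [k1 [u1 [p1 [i1 mk1 S1 E1]]]] := isol_dense wp re m1 f1' e2.
have [k2 [u2 [p2 [i2 mk2 S2 E2]]]] := isol_dense wp re m2 f2' e2.
pose u t := Complex (u1 t) (u2 t); pose k t := Complex (k1 t) (k2 t).
have c : csol f (complex.Re lam) (complex.Im lam) (ReF k) (ImF k) (ReF u) p1 (ImF u) p2.
  by rewrite im; apply/csol_isol.
have [c1 c2] := csol_contu c; have [d1 _] := i1; have [d2 _] := i2.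
have Ru : ReF u = u1 by []. have Iu : ImF u = u2 by [].
have hu : inH u.
  apply/(inH_contP c1 c2).
  have [A hA] := S1; have [B hB] := S2; exists (A + B) => x y x0 xy y1.
  have cu1 t (ht : 0 < t < 1) := cont_wu2 d1 ht; have cu2 t (ht : 0 < t < 1) := cont_wu2 d2 ht.
  have -> : (fun x => weight x * (ReF u x ^+ 2 + ImF u x ^+ 2)) = (fun t => 1 * (weight t * u1 t ^+ 2) + 1 * (weight t * u2 t ^+ 2)).
    by apply/funext => t; rewrite !mul1r -mulrDr.
  rewrite (prim_lin 1 1 (half01 R) cu1 cu2 x0 xy y1) !mul1r.
  by have := hA x y x0 xy y1; have := hB x y x0 xy y1; order_lra.
pose d t := k t - h t.
have Rd : ReF d = (fun t => k1 t - ReF h t) by apply/funext => t; rewrite /ReF /d /k; case: (h t).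
have Id : ImF d = (fun t => k2 t - ImF h t) by apply/funext => t; rewrite /ImF /d /k; case: (h t).
have md1 : measurable_fun (@I01 R) (ReF d) by rewrite Rd; exact: measurable_funB.
have md2 : measurable_fun (@I01 R) (ImF d) by rewrite Id; exact: measurable_funB.
have Nd : (Hnorm2 d < eps%:E)%E.
  rewrite /Hnorm2 Rd Id.
  have -> : (\int[mu]_(x in @I01 R) (weight x * ((k1 x - ReF h x) ^+ 2 + (k2 x - ImF h x) ^+ 2))%:E =
    \int[mu]_(x in @I01 R) (weight x * (k1 x - ReF h x) ^+ 2)%:E + \int[mu]_(x in @I01 R) (weight x * (k2 x - ImF h x) ^+ 2)%:E)%E.
    rewrite -ge0_integralD//.
    - by apply: eq_integral => x _; rewrite -EFinD mulrDr.
    - exact: measurable_I01.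
    - by move=> x /I01P hx; rewrite lee_fin mulr_ge0 ?sqr_ge0// ltW// weight_gt0.
    - by apply/measurable_EFinP; apply: measurable_funM => //; apply: measurable_funX; exact: measurable_funB.
    - by move=> x /I01P hx; rewrite lee_fin mulr_ge0 ?sqr_ge0// ltW// weight_gt0.
    - by apply/measurable_EFinP; apply: measurable_funM => //; apply: measurable_funX; exact: measurable_funB.
  have -> : eps = eps / 2 + eps / 2 by field.
  by rewrite EFinD; exact: lteD.
have hd : inH d by split => //; split => //; apply: lt_trans Nd _; exact: ltry.
have hk : inH k.
  apply: (inH_le (u := d) (h := h) (C := 2)) => // x _.
  rewrite Rd Id; have -> : ReF k x = k1 x by []. have -> : ImF k x = k2 x by [].
  have := sqr_ge0 (k1 x - 2 * ReF h x); have := sqr_ge0 (k2 x - 2 * ImF h x).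
  by move: (k1 x) (k2 x) (ReF h x) (ImF h x); clear => z1 z2 z3 z4; rewrite !expr2; order_lra.
exists u, k; split => //; exact: (@csol_graph R f f1 n lam u k p1 p2 wp c hk hu).
Qed.

Lemma surjective_dense f lam : res_surjective (potential f) lam -> res_dense_range (potential f) lam.
Proof.
move=> S h hh e e0; have [u hu] := S h hh; exists u, h; split => //.
rewrite /Hnorm2 integral0_eq ?lte_fin// => x _.
by rewrite /ReF /ImF subrr /= expr0n /= addr0 mulr0.
Qed.

Lemma injective_on f f1 n lam : wave_profile f f1 n -> complex.Im lam != 0 \/ 0 <= complex.Re lam ->
  res_injective (potential f) lam.
Proof.
move=> wp h; apply/(res_injectiveP _ wp).
have [e|] := eqVneq (complex.Im lam) 0; last exact: no_L2_nonreal wp.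
by case: h => [|re]; rewrite e ?eqxx//; exact: no_L2_nonneg wp re.
Qed.

Lemma sigma_cP f f1 n lam : wave_profile f f1 n ->
  sigma_c (potential f) lam <-> (complex.Im lam = 0 /\ 0 <= complex.Re lam).
Proof.
move=> wp; split => [[inj [ns _]]|[im re]]; last first.
  split; first by apply: (injective_on wp); right.
  by split; [exact: not_surjective_on wp im re|exact: dense_on wp im re].
have [e|ne] := eqVneq (complex.Im lam) 0; last first.
  by case: ns; apply: (surjective_off wp) inj; left.
split => //; rewrite leNgt; apply/negP => re.
by case: ns; apply: (surjective_off wp) inj; right.
Qed.

Lemma sigma_r_empty f f1 n lam : wave_profile f f1 n -> ~ sigma_r (potential f) lam.
Proof.
move=> wp [inj]; apply; have [e|ne] := eqVneq (complex.Im lam) 0; last first.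
  by apply: surjective_dense; apply: (surjective_off wp) inj; left.
have [re|re] := leP 0 (complex.Re lam); first exact: dense_on wp e re.
by apply: surjective_dense; apply: (surjective_off wp) inj; right.
Qed.

(** Near 0 every square integrable solution is a multiple of the regular one, so only its behaviour
    near 1 is left to decide. *)
Lemma sigma_pP f f1 n t1 lam : wave_profile f f1 n -> 0 < t1 < 1 ->
  (forall t, 0 < t <= t1 -> 1 <= Qc f (complex.Re lam) t) ->
  sigma_p (potential f) lam <-> [/\ complex.Im lam = 0, complex.Re lam < 0 &
     exists d (u p : R -> R), regsol f (complex.Re lam) t1 d u p /\ summ1 t1 (fun t => weight t * u t ^+ 2)].
Proof.
move=> wp ht1 hQ; have /andP[t10 t11] := ht1; split => [np|[im re [d [u [p [hr S]]]]]].
  have im : complex.Im lam = 0.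
    by have [//|ne] := eqVneq (complex.Im lam) 0; case: np; apply: (injective_on wp); left.
  split => //; first by rewrite ltNge; apply/negP => re; case: np; apply: (injective_on wp); right.
  have [d [u [p hr]]] := regsol_ex wp ht1 hQ; exists d, u, p; split => //.
  apply: contrapT => nS; apply: np; apply/(res_injectiveP _ wp) => u1 p1 u2 p2 hs S t ht.
  rewrite im in hs; have [r1 r2] := hsol_rsol hs; have [d1 d2] := hsol_du hs.
  have cY s (hs : 0 < s < 1) := cont_wY d1 d2 hs.
  have key v q : rsol f (complex.Re lam) v q -> (forall s, v s ^+ 2 <= u1 s ^+ 2 + u2 s ^+ 2) -> v t = 0.
    move=> hv le; have cv s (hs : 0 < s < 1) := cont_wu2 (fun t ht => (hv t ht).1) hs.
    have Sv : summable01 (fun s => weight s * v s ^+ 2).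
      by apply: summable_le S => // s hs'; rewrite ler_wpM2l// ltW// weight_gt0.
    have e s (hs : 0 < s < 1) := regsol_prop wp ht1 hQ hr hv (summable_summ0 t11 Sv) hs.
    have [v0|vn] := eqVneq (v t1) 0; first by rewrite (e t ht).1 v0 mul0r.
    case: nS; have [C hC] := summable_summ1 t10 Sv; exists ((v t1 ^+ 2)^-1 * C) => a b ta ab b1.
    have [h _ _ _] := hr; have cu s (hs : 0 < s < 1) := cont_wu2 (fun t ht => (h t ht).1) hs.
    have a0 := lt_le_trans t10 ta; have c2 : 0 < v t1 ^+ 2 by rewrite lt_def sqr_ge0 sqrf_eq0 vn.
    rewrite -(ler_pM2l c2) mulrA divff ?gt_eqF// mul1r; apply: le_trans (hC a b ta ab b1).
    have := prim_lin (v t1 ^+ 2) 0 (half01 R) cu cu a0 ab b1; rewrite mul0r addr0 => <-.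
    have cu' s : 0 < s < 1 -> {for s, continuous (fun s => v t1 ^+ 2 * (weight s * u s ^+ 2) + 0 * (weight s * u s ^+ 2))}.
      by move=> hs'; apply: cvgD; apply: cvgM; try exact: cu; exact: cvg_cst.
    apply: (dv_le ab (fun s hs => prim_dv cu' (half01 R) (sub01 a0 b1 hs)) (fun s hs => prim_dv cv (half01 R) (sub01 a0 b1 hs))).
    move=> s /andP[s1 s2]; have hs' : 0 < s < 1 by rewrite (lt_trans a0 s1) (lt_trans s2 b1).
    by rewrite (e s hs').1 mul0r addr0 exprMn mulrCA.
  by split; [apply: key r1 _ => s; rewrite lerDl sqr_ge0|apply: key r2 _ => s; rewrite lerDr sqr_ge0].
move=> /(res_injectiveP _ wp); rewrite im => no; have [h u1 _ _] := hr.
have cu s (hs : 0 < s < 1) := cont_wu2 (fun t ht => (h t ht).1) hs.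
have e : (fun t => weight t * (u t ^+ 2 + (fun=> 0 : R) t ^+ 2)) = (fun t => weight t * u t ^+ 2).
  by apply/funext => t; rewrite expr0n /= addr0.
have S01 : summable01 (fun t => weight t * (u t ^+ 2 + (fun=> 0 : R) t ^+ 2)).
  rewrite e; apply: (summ_summable ht1 cu) => //; last exact: regsol_summ0 hr.
  by move=> t ht; rewrite mulr_ge0 ?sqr_ge0// ltW// weight_gt0.
have [z _] := no _ _ _ _ (rsol_hsol erefl h) S01 t1 ht1.
by move: z; rewrite u1 => /eqP; rewrite oner_eq0.
Qed.

End Spectrum.

(** * The Prüfer angle *)
Section Trig.
Variable R : realType.
Implicit Types (t a b c d e C K M x y : R) (f F p u z q : R -> R).

Lemma sin2_sub x y : sin x ^+ 2 - sin y ^+ 2 = sin (x - y) * sin (x + y).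
Proof.
rewrite sinB sinD; have := cos2Dsin2 x; have := cos2Dsin2 y.
move: (sin x) (sin y) (cos x) (cos y) => s1 s2 c1 c2 e2 e1.
transitivity (s1 ^+ 2 * (c2 ^+ 2 + s2 ^+ 2) - s2 ^+ 2 * (c1 ^+ 2 + s1 ^+ 2)); last by ring.
by rewrite e1 e2 !mulr1.
Qed.

Lemma sin2_lip x y : `|sin x ^+ 2 - sin y ^+ 2| <= `|x - y|.
Proof.
rewrite sin2_sub normrM; apply: le_trans (norm_sin_le (x - y)).
by rewrite ler_piMr// ler_norml sin_geN1 sin_le1.
Qed.

Lemma sin2_le1 x : sin x ^+ 2 <= 1.
Proof. by rewrite -(cos2Dsin2 x) lerDr sqr_ge0. Qed.

(** The sign is that of [(-1)^j]; it may stay implicit because only squares and products of sine and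
    cosine occur. *)
Lemma sin_cos_shift (j : nat) x : exists s, [/\ s ^+ 2 = 1, sin (x + j%:R * pi) = s * sin x &
  cos (x + j%:R * pi) = s * cos x].
Proof.
elim: j => [|j [s [s2 es ec]]]; first by exists 1; rewrite expr1n mul0r addr0 !mul1r.
exists (- s); rewrite sqrrN s2; split => //.
  by rewrite -addn1 natrD mulrDl mul1r addrA sinDpi es mulNr.
by rewrite -addn1 natrD mulrDl mul1r addrA cosDpi ec mulNr.
Qed.

Lemma sin2_npi (j : nat) x : sin (x + j%:R * pi) ^+ 2 = sin x ^+ 2.
Proof. by have [s [s2 -> _]] := sin_cos_shift j x; rewrite exprMn s2 mul1r. Qed.

Lemma sincos_npi (j : nat) x : sin (x + j%:R * pi) * cos (x + j%:R * pi) = sin x * cos x.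
Proof. by have [s [s2 -> ->]] := sin_cos_shift j x; rewrite mulrACA -expr2 s2 mul1r. Qed.

Lemma sin_npi0 (j : nat) : sin (j%:R * pi : R) = 0.
Proof. by have [s [_ + _]] := sin_cos_shift j 0; rewrite add0r sin0 mulr0. Qed.

Lemma sincos_gt0 x : 0 < x < pi / 2 -> 0 < sin x * cos x.
Proof.
move=> hx; apply: mulr_gt0; first exact: sin_gt0_pihalf.
apply: cos_gt0_pihalf; have := @pi_gt0 R; move: hx => /andP[h ->] h'; rewrite andbT; order_lra.
Qed.

Lemma sin_eq0_ge0 x : 0 <= x -> sin x = 0 -> exists j : nat, x = j%:R * pi.
Proof.
move=> x0 sx; have p0 := @pi_gt0 R.
have d0 : 0 <= x / pi by apply: divr_ge0 => //; exact: ltW.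
have /andP[h1 h2] := truncn_itv d0.
exists (Num.truncn (x / pi)); move: (Num.truncn _) h1 h2 => j.
rewrite ler_pdivlMr// ltr_pdivrMr// -natr1 mulrDl mul1r => h1 h2.
pose y := x - j%:R * pi.
have e : x = y + j%:R * pi by rewrite /y subrK.
have y0 : 0 <= y by rewrite subr_ge0.
have yp : y < pi by rewrite /y; order_lra.
have sy : sin y = 0 by apply/eqP; rewrite -sqrf_eq0 -(sin2_npi j) -e sx expr0n.
have [y0'|] := eqVneq y 0; first by rewrite e y0' add0r.
move=> yn; have : 0 < sin y by apply: sin_gt0_pi; rewrite yp lt_def yn y0.
by rewrite sy ltxx.
Qed.

Lemma sin_ge_mid d y : 0 <= d -> d <= pi / 2 -> d <= y -> y <= pi - d -> sin d <= sin y.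
Proof.
move=> d0 dp dy yd; have p0 := @pi_gt0 R.
have key (z : R) : d <= z -> z <= pi / 2 -> sin d <= sin z.
  move=> dz zp; rewrite le_eqVlt; have [->|dn] := eqVneq d z; first by rewrite eqxx.
  rewrite ltr_sin ?in_itv /=; try (by apply/andP; split; lra).
  by rewrite lt_neqAle dn dz orbT.
have [h|h] := leP y (pi / 2); first exact: key.
have -> : sin y = sin (pi - y) by rewrite sinB sinpi cospi mul0r sub0r mulN1r opprK.
by apply: key; order_lra.
Qed.

(** Modulo [pi], the difference of squares is [sin (y - x) * sin (x + y - pi)], and both arguments
    lie between [d] and [pi - d]. It gives a uniform rate at which two angles separate in the half
    period where [sin^2] decreases. *)
Lemma sin2_gap (m : nat) x y d : m%:R * pi + pi / 2 <= x -> x + d <= y -> y <= m.+1%:R * pi -> 0 <= d ->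
  sin d ^+ 2 <= sin x ^+ 2 - sin y ^+ 2.
Proof.
have e : m.+1%:R * pi = m%:R * pi + pi :> R by rewrite -addn1 natrD mulrDl mul1r.
rewrite e => hx xy hy d0; have p0 := @pi_gt0 R.
pose x' := x - m%:R * pi; pose y' := y - m%:R * pi.
have -> : sin x ^+ 2 = sin x' ^+ 2 by rewrite -(sin2_npi m x') /x' subrK.
have -> : sin y ^+ 2 = sin y' ^+ 2 by rewrite -(sin2_npi m y') /y' subrK.
have h1 : pi / 2 <= x' by rewrite /x'; order_lra.
have h2 : x' + d <= y' by rewrite /x' /y'; order_lra.
have h3 : y' <= pi by rewrite /y'; order_lra.
rewrite sin2_sub.
have -> : sin (x' - y') * sin (x' + y') = sin (y' - x') * sin (x' + y' - pi).
  by rewrite -(opprB y') sinN sinB [sin (x' + y' - pi)]sinB sinpi cospi; ring.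
have sd : 0 <= sin d by apply: sin_ge0_pi; apply/andP; split; order_lra.
by rewrite expr2; apply: ler_pM => //; apply: sin_ge_mid; order_lra.
Qed.

Lemma atan_lip x y : `|atan x - atan y| <= `|x - y|.
Proof.
have da (z : R) : dv (@atan R) z (1 + z ^+ 2)^-1.
  by apply/dvP; split; [exact: derivable_atan|rewrite derive1_atan].
have key (u v : R) : u <= v -> `|atan v - atan u| <= v - u.
  move=> uv; refine (@dv_abs_le R (@atan R) (fun x => (1 + x ^+ 2)^-1) id (fun=> 1) u v uv (fun x _ => da x) (fun x _ => dv_id x) _).
  move=> x1 _; have h : 0 < 1 + x1 ^+ 2 by have := sqr_ge0 x1; order_lra.
  by rewrite ger0_norm ?invr_ge0 ?(ltW h)// invf_le1//; have := sqr_ge0 x1; order_lra.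
have [xy|/ltW xy] := leP y x; first by rewrite [leRHS]ger0_norm ?subr_ge0// key.
by rewrite distrC [leRHS]distrC [leRHS]ger0_norm ?subr_ge0// key.
Qed.

Lemma atan_gt0 x : 0 < x -> 0 < atan x.
Proof. by move=> x0; rewrite -atan0; exact: lt_atan. Qed.

Lemma dv_right_pos F x d e : dv F x d -> F x = 0 -> 0 < d -> 0 < e -> exists2 y, x < y < x + e & 0 < F y.
Proof.
move=> /dv_epsP h Fx d0 e0; have d2 : 0 < d / 2 by order_lra.
have [r r0 hr] := h _ d2; pose s := Num.min r e / 2.
have m0 : 0 < Num.min r e by rewrite lt_min r0.
have mr : Num.min r e <= r by rewrite ge_min lexx.
have me : Num.min r e <= e by rewrite ge_min lexx orbT.
have s0 : 0 < s by rewrite /s; order_lra.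
exists (x + s); first by rewrite /s; apply/andP; split; order_lra.
have := hr (x + s); rewrite addrAC subrr add0r (gtr0_norm s0) Fx subr0 => /(_ _)/ler_normlP[|h1 _].
  by rewrite /s; order_lra.
by have := mulr_gt0 d0 s0; order_lra.
Qed.

Lemma dv_left_neg F x d e : dv F x d -> F x = 0 -> 0 < d -> 0 < e -> exists2 y, x - e < y < x & F y < 0.
Proof.
move=> /dv_epsP h Fx d0 e0; have d2 : 0 < d / 2 by order_lra.
have [r r0 hr] := h _ d2; pose s := Num.min r e / 2.
have m0 : 0 < Num.min r e by rewrite lt_min r0.
have mr : Num.min r e <= r by rewrite ge_min lexx.
have me : Num.min r e <= e by rewrite ge_min lexx orbT.
have s0 : 0 < s by rewrite /s; order_lra.
exists (x - s); first by rewrite /s; apply/andP; split; order_lra.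
have := hr (x - s); rewrite addrAC subrr add0r normrN (gtr0_norm s0) Fx subr0 => /(_ _)/ler_normlP[|_ h1].
  by rewrite /s; order_lra.
by have := mulr_gt0 d0 s0; order_lra.
Qed.

(** At a first zero the derivative would be positive, although [F] is positive just before. Applied
    to levels that the Prüfer angle can cross in one direction only. *)
Lemma barrier F dF s t : s <= t -> (forall x, s <= x <= t -> dv F x (dF x)) ->
  (forall x, s <= x <= t -> F x = 0 -> 0 < dF x) -> 0 < F s -> 0 < F t.
Proof.
move=> st hd h0 Fs; rewrite ltNge; apply/negP => Ft.
have [c [/andP[sc ct] Fc hc]] := first_zero st (fun x hx => dv_cont (hd x hx)) Fs Ft.
have hc' : s <= c <= t by rewrite (ltW sc) ct.
have e0 : 0 < c - s by rewrite subr_gt0.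
have [y /andP[y1 y2] Fy] := dv_left_neg (hd c hc') Fc (h0 c hc' Fc) e0.
have : 0 < F y by apply: hc; rewrite y2 andbT; order_lra.
order_lra.
Qed.

End Trig.

(** * Construction of the angle *)

Section Pruefer.
Variable R : realType.
Implicit Types (t a b c d e C K M x y : R) (u p th : R -> R).
Variables (f f1 : R -> R) (n : nat) (rho : R).
Hypothesis wp : wave_profile f f1 n.
Hypothesis hrho : 0 < rho < 1.
Hypothesis hQ : forall t, 0 < t <= rho -> 1 <= Qc f 0 t.

(** The equation is [theta' = kk (cos^2 theta + (a - V) sin^2 theta)], rewritten so that only
    [sin^2] appears. At [rho] both [z] and [q] are positive, and the initial angle is taken in (0,
    [pi / 2]). *)
Definition prufer a d u p th := [/\ regsol f a rho d u p, th rho = atan (zz u rho / qq u p rho),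
  forall t, 0 < t < 1 -> dv th t (kk t * (1 + (a - Vc f t - 1) * sin (th t) ^+ 2)) &
  forall t, 0 < t < 1 -> exists B, [/\ B != 0, zz u t = B * sin (th t) & qq u p t = B * cos (th t)]].

Lemma Qc_ge1 a t : a <= 0 -> 0 < t <= rho -> 1 <= Qc f a t.
Proof.
move=> a0 ht; apply: le_trans (hQ ht) _; rewrite /Qc mul0r subr0 lerBrDr gerDl.
have ht' : 0 < t < 1 by have /andP[-> h] := ht; case/andP: hrho => _; exact: le_lt_trans.
by rewrite mulr_le0_ge0// ltW// weight_gt0.
Qed.

Lemma zq_rho d a u p : regsol f a rho d u p -> 0 <= d ->
  [/\ zz u rho = rho / sq rho, qq u p rho = (sq rho)^-1 + d * sq rho / rho, 0 < zz u rho & 0 < qq u p rho].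
Proof.
move=> [_ u1 p1 _] d0; have s0 := sq_gt0 hrho; have /andP[r0 _] := hrho.
rewrite /zz /qq u1 p1 mulr1 mul1r; split => //; first exact: divr_gt0.
have : 0 <= d * sq rho / rho by apply: divr_ge0; [apply: mulr_ge0 => //; exact: ltW|exact: ltW].
have : 0 < (sq rho)^-1 by rewrite invr_gt0.
by lra.
Qed.

Lemma regsol_d_ge0 a d u p : regsol f a rho d u p -> 0 <= d.
Proof. by move=> [_ _ <- h]; have /andP[r0 _] := hrho; apply: (h rho _).2; rewrite r0 lexx. Qed.

(** The angle is defined by integrating its derivative [om], so no branch of the arctangent has to
    be followed. With [A = z cos theta - q sin theta] and [N = z^2 + q^2], the quotient [A^2 / N] is
    the squared sine of the deviation from the true angle; its derivative is zero and it vanishes at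
    [rho]. *)
Lemma prufer_ex a : a <= 0 -> exists d u p th, prufer a d u p th.
Proof.
move=> a0; have [d [u [p hr]]] := regsol_ex wp hrho (fun t => Qc_ge1 a0).
have [h u1 p1 hp] := hr; have hz := rsol_zsol h.
pose z := zz u; pose q := qq u p; pose N t := z t ^+ 2 + q t ^+ 2.
have d0 := regsol_d_ge0 hr; have [_ _ z0 q0] := zq_rho hr d0.
have dz t (ht : 0 < t < 1) : dv z t (kk t * q t) := (hz t ht).1.
have dq t (ht : 0 < t < 1) : dv q t (kk t * ((Vc f t - a) * z t)) := (hz t ht).2.
have N0 t : 0 < t < 1 -> 0 < N t.
  move=> ht; rewrite lt_def addr_ge0 ?sqr_ge0// andbT paddr_eq0 ?sqr_ge0// !sqrf_eq0.
  apply/negP => /andP[/eqP e1 /eqP e2]; have [g1 g2] := zq_eq0 ht e1 e2.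
  by have [] := rsol_uniq wp h ht g1 g2 hrho; rewrite u1 => /eqP; rewrite oner_eq0.
have cz t ht := dv_cont (dz t ht); have cq t ht := dv_cont (dq t ht).
have ckk t : 0 < t < 1 -> {for t, continuous (@kk R)}.
  by move=> ht; apply: cvgV; [rewrite gt_eqF ?sub_sqr_gt0|exact: cont_1X2].
have cV t : 0 < t < 1 -> {for t, continuous (Vc f)}.
  move=> ht; have /andP[t0 _] := ht; apply: cont_div; [by rewrite expf_neq0// gt_eqF| |exact: cont_X2].
  by apply: cvgM; [apply: cvgM; [exact: cvg_cst|exact: cont_cos2f wp ht]|exact: cont_1X2].
pose om t := kk t * (q t * q t - (Vc f t - a) * (z t * z t)) / (z t * z t + q t * q t).
have NE t : z t * z t + q t * q t = N t by rewrite /N !expr2.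
have com t : 0 < t < 1 -> {for t, continuous om}.
  move=> ht; have Z := cz t ht; have Q := cq t ht.
  apply: cont_div; first by rewrite NE gt_eqF ?N0.
    apply: cvgM; first exact: ckk.
    apply: cvgB; first exact: cvgM.
    by apply: cvgM; [apply: cvgB; [exact: cV|exact: cvg_cst]|exact: cvgM].
  by apply: cvgD; exact: cvgM.
pose th t := atan (z rho / q rho) + prim om rho t.
have dth t : 0 < t < 1 -> dv th t (om t).
  by move=> ht; apply: dv_eq (dvD (dv_cst _ t) (prim_dv com hrho ht)) _; rewrite add0r.
pose A t := z t * cos (th t) - q t * sin (th t).
pose B t := z t * sin (th t) + q t * cos (th t).
have dA t : 0 < t < 1 -> dv A t (kk t * q t * cos (th t) - kk t * ((Vc f t - a) * z t) * sin (th t) - om t * B t).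
  move=> ht; have ds := @dv_comp R sin th t _ _ (dv_sin _) (dth t ht); have dc := @dv_comp R cos th t _ _ (dv_cos _) (dth t ht).
  by apply: dv_eq (dvB (dvM (dz t ht) dc) (dvM (dq t ht) ds)) _; rewrite /B; ring.
have AN t : 0 < t < 1 -> dv (fun t => A t ^+ 2 / N t) t 0.
  move=> ht; have Nn : N t != 0 by rewrite gt_eqF ?N0.
  have dN := dvD (dvX 2 (dz t ht)) (dvX 2 (dq t ht)).
  apply: dv_eq (dvM (dvX 2 (dA t ht)) (@dvV R N t _ Nn dN)) _.
  rewrite /= !expr1 /om NE.
  transitivity (2 * A t * (N t * (kk t * q t * cos (th t) - kk t * ((Vc f t - a) * z t) * sin (th t)) - kk t * (q t * q t - (Vc f t - a) * (z t * z t)) * B t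
    - A t * (kk t * (z t * q t) + kk t * ((Vc f t - a) * (z t * q t)))) / N t ^+ 2); first by field.
  suff -> : N t * (kk t * q t * cos (th t) - kk t * ((Vc f t - a) * z t) * sin (th t)) - kk t * (q t * q t - (Vc f t - a) * (z t * z t)) * B t
    - A t * (kk t * (z t * q t) + kk t * ((Vc f t - a) * (z t * q t))) = 0 by rewrite mulr0 mul0r.
  by rewrite /N /A /B; ring.
have Arho : A rho = 0.
  rewrite /A; have -> : th rho = atan (z rho / q rho) by rewrite /th prim0 addr0.
  have c0 : 0 < cos (atan (z rho / q rho)) by apply: cos_gt0_pihalf; rewrite atan_gtNpi2 atan_ltpi2.
  have : tan (atan (z rho / q rho)) = z rho / q rho by rewrite atanK.
  rewrite /tan; move: c0; move: (sin _) (cos _) => s c c0 e.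
  have {}e : s = z rho / q rho * c by rewrite -e divfK ?gt_eqF.
  by rewrite e; field; rewrite gt_eqF.
have A0 t : 0 < t < 1 -> A t = 0.
  move=> ht; have e : A t ^+ 2 / N t = A rho ^+ 2 / N rho.
    have [tr|/ltW rt] := leP t rho.
      apply: (@dv_const R (fun t => A t ^+ 2 / N t) t rho tr) => x hx; apply: AN.
      by apply: sub01 hx; [case/andP: ht|case/andP: hrho].
    apply/esym; apply: (@dv_const R (fun t => A t ^+ 2 / N t) rho t rt) => x hx; apply: AN.
    by apply: sub01 hx; [case/andP: hrho|case/andP: ht].
  move: e; rewrite Arho expr0n mul0r => /eqP; rewrite mulf_eq0 invr_eq0 (gt_eqF (N0 t ht)) orbF sqrf_eq0.
  by move=> /eqP.
exists d, u, p, th; split; first exact: hr.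
- by rewrite /th prim0 addr0.
- move=> t ht; apply: dv_eq (dth t ht) _; rewrite /om NE.
  have NN : N t != 0 by rewrite gt_eqF ?N0.
  have e1 : z t * cos (th t) = q t * sin (th t) by apply/eqP; rewrite -subr_eq0 -/(A t) A0.
  have es : N t * sin (th t) ^+ 2 = z t ^+ 2.
    have -> : N t * sin (th t) ^+ 2 = z t ^+ 2 * (cos (th t) ^+ 2 + sin (th t) ^+ 2) + ((q t * sin (th t)) ^+ 2 - (z t * cos (th t)) ^+ 2).
      by rewrite /N; ring.
    by rewrite e1 subrr cos2Dsin2 mulr1 addr0.
  have -> : sin (th t) ^+ 2 = z t ^+ 2 / N t by rewrite -es mulrAC divff ?mul1r.
  transitivity (kk t * (N t + (a - Vc f t - 1) * z t ^+ 2) / N t); last by field.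
  by congr (_ / _); rewrite /N; ring.
- move=> t ht; exists (B t).
  have e1 : z t * cos (th t) = q t * sin (th t) by apply/eqP; rewrite -subr_eq0 -/(A t) A0.
  have B2 : B t ^+ 2 = N t.
    have -> : B t ^+ 2 = N t * (cos (th t) ^+ 2 + sin (th t) ^+ 2) - (z t * cos (th t) - q t * sin (th t)) ^+ 2.
      by rewrite /B /N; ring.
    by rewrite e1 subrr expr0n /= subr0 cos2Dsin2 mulr1.
  split.
  + by apply/negP => /eqP e; have := N0 t ht; rewrite -B2 e expr0n ltxx.
  + have -> : B t * sin (th t) = z t * (cos (th t) ^+ 2 + sin (th t) ^+ 2) - cos (th t) * (z t * cos (th t) - q t * sin (th t)).
      by rewrite /B; ring.
    by rewrite e1 subrr mulr0 subr0 cos2Dsin2 mulr1.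
  + have -> : B t * cos (th t) = q t * (cos (th t) ^+ 2 + sin (th t) ^+ 2) + sin (th t) * (z t * cos (th t) - q t * sin (th t)).
      by rewrite /B; ring.
    by rewrite e1 subrr mulr0 addr0 cos2Dsin2 mulr1.
Qed.

End Pruefer.

(** * Dependence of the angle on the spectral parameter *)

Section PrueferTheory.
Variable R : realType.
Implicit Types (t a b c d e C K M x y : R) (u p th : R -> R).
Variables (f f1 : R -> R) (n : nat) (rho : R).
Hypothesis wp : wave_profile f f1 n.
Hypothesis hrho : 0 < rho < 1.
Hypothesis hQ : forall t, 0 < t <= rho -> 1 <= Qc f 0 t.
Local Notation prufer := (prufer f rho).

Let r0 : 0 < rho. Proof. by case/andP: hrho. Qed.
Let r1 : rho < 1. Proof. by case/andP: hrho. Qed.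

Lemma theta_rho a d u p th : prufer a d u p th -> 0 < th rho < pi / 2.
Proof.
move=> [hr -> _ _]; have [_ _ z0 q0] := zq_rho hrho hr (regsol_d_ge0 hrho hr).
by rewrite atan_ltpi2 andbT; apply: atan_gt0; exact: divr_gt0.
Qed.

(** At [rho], [z] is independent of the parameter and [q] is affine and increasing in the slope [d],
    which decreases with the parameter by [regsol_cmp]. Since [q >= 1] and the arctangent is
    1-Lipschitz, the Lipschitz bound carries over. *)
Lemma theta_rho_cmp a b d c u p v q th ta : prufer a d u p th -> prufer b c v q ta -> a < b -> b <= 0 ->
  th rho < ta rho /\ ta rho - th rho <= (b - a) * (1 - rho ^+ 2)^-2.
Proof.
move=> [h1 e1 _ _] [h2 e2 _ _] ab b0.
have a0 : a <= 0 by exact: ltW (lt_le_trans ab b0).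
have [cd dc] := regsol_cmp wp hrho (fun t => Qc_ge1 hrho hQ a0) (fun t => Qc_ge1 hrho hQ b0) h1 h2 ab.
have d0 := regsol_d_ge0 hrho h1; have c0 := regsol_d_ge0 hrho h2.
have [z1 q1 z10 q10] := zq_rho hrho h1 d0; have [z2 q2 z20 q20] := zq_rho hrho h2 c0.
have s0 := sq_gt0 hrho; have s2 := sq_sqr hrho.
have lt : zz u rho / qq u p rho < zz v rho / qq v q rho.
  rewrite z1 z2 ltr_pM2l ?divr_gt0// ltf_pV2 ?posrE// q1 q2 ltrD2l.
  by rewrite ltr_pM2r ?invr_gt0// ltr_pM2r.
rewrite e1 e2; split; first exact: lt_atan.
apply: le_trans (ler_norm _) _; apply: le_trans (atan_lip _ _) _.
rewrite ger0_norm ?subr_ge0 ?(ltW lt)//; apply: le_trans dc.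
have -> : zz v rho / qq v q rho - zz u rho / qq u p rho = (d - c) / (qq u p rho * qq v q rho).
  rewrite z1 z2; have -> : d - c = (qq u p rho - qq v q rho) * (rho / sq rho).
    by rewrite q1 q2; field; rewrite !gt_eqF.
  by field; rewrite !gt_eqF.
rewrite ler_piMr ?subr_ge0 ?(ltW cd)// invf_le1 ?mulr_gt0//.
have i1 : 1 <= (sq rho)^-1.
  rewrite invf_ge1//; have : sq rho ^+ 2 <= 1 by rewrite s2; have := sqr_ge0 rho; lra.
  by rewrite expr_le1 ?(ltW s0)//.
have k1 : 1 <= qq u p rho.
  rewrite q1; have : 0 <= d * sq rho / rho by rewrite divr_ge0 ?mulr_ge0 ?(ltW s0) ?(ltW r0).
  by move: i1; lra.
have k2 : 1 <= qq v q rho.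
  rewrite q2; have : 0 <= c * sq rho / rho by rewrite divr_ge0 ?mulr_ge0 ?(ltW s0) ?(ltW r0).
  by move: i1; lra.
by rewrite -[leLHS]mulr1 ler_pM.
Qed.

Lemma sub_rho1 b x : b < 1 -> rho <= x <= b -> 0 < x < 1.
Proof. exact: sub01. Qed.

Lemma theta_lip b A : rho <= b -> b < 1 -> exists2 L, 0 < L & forall a t, - A <= a <= 0 -> rho <= t <= b ->
  `|kk t * (a - Vc f t - 1)| <= L /\ kk t <= L.
Proof.
move=> rb b1; pose K := (1 - b ^+ 2)^-1.
have b0 : 0 < b by exact: lt_le_trans rb.
have hb : 0 < b < 1 by rewrite b0.
have K0 : 0 < K by rewrite invr_gt0 sub_sqr_gt0.
have V0 : 0 <= 2 / rho ^+ 2 by rewrite divr_ge0 ?sqr_ge0.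
exists (K * (`|A| + 2 / rho ^+ 2 + 1)); first by rewrite mulr_gt0//; have := normr_ge0 A; lra.
move=> a t /andP[a1 a2] ht; have /andP[rt tb] := ht.
have ht' : 0 < t < 1 := sub_rho1 b1 ht; have /andP[t0 t1] := ht'.
have kK : kk t <= K.
  by rewrite lef_pV2 ?posrE ?sub_sqr_gt0// lerD2l lerN2 lerXn2r ?nnegrE ?(ltW t0) ?(ltW b0).
have k0 := ltW (kk_gt0 ht').
have n0 := normr_ge0 A.
split.
  rewrite normrM (ger0_norm k0); apply: ler_pM => //.
  have := Vc_le2 f r0 rt t1; have := ler_norm A; rewrite !ler_norml => A1 /andP[v1 v2].
  by apply/andP; split; lra.
apply: (le_trans kK); rewrite ler_peMr ?(ltW K0)//; lra.
Qed.

(** Up to a first zero, the difference [F] of the angles satisfies [F' >= - L F], because [sin^2] is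
    Lipschitz and the change of parameter contributes a nonnegative term. Gronwall backwards from
    the zero would give [F rho <= 0]. *)
Lemma theta_lt a b d c u p v q th ta t : prufer a d u p th -> prufer b c v q ta -> a < b -> b <= 0 ->
  rho <= t < 1 -> th t < ta t.
Proof.
move=> h1 h2 ab b0 /andP[rt t1]; rewrite -subr_gt0 ltNge; apply/negP => hle.
have [lt _] := theta_rho_cmp h1 h2 ab b0; have [_ _ o1 _] := h1; have [_ _ o2 _] := h2.
pose F x := ta x - th x.
have dF x : rho <= x <= t -> dv F x (kk x * (b - Vc f x - 1) * (sin (ta x) ^+ 2 - sin (th x) ^+ 2) + kk x * (b - a) * sin (th x) ^+ 2).
  by move=> hx; have hx' := sub_rho1 t1 hx; apply: dv_eq (dvB (o2 x hx') (o1 x hx')) _; ring.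
have F0 : 0 < F rho by rewrite subr_gt0.
have [s [/andP[rs st] Fs hs]] := first_zero rt (fun x hx => dv_cont (dF x hx)) F0 hle.
have s1 : s < 1 by exact: le_lt_trans t1.
have [L L0 hL] := theta_lip (- b) (ltW rs) s1.
have sub_s x : rho <= x <= s -> rho <= x <= t by move=> /andP[-> g2]; exact: le_trans st.
have bb : - - b <= b <= 0 by rewrite opprK lexx.
have := @gronwall_left R F _ L 0 rho s (ltW rs) (ltW L0) (lexx 0) (fun x hx => dF x (sub_s x hx)).
rewrite Fs mul0r addr0 mulr0 => H.
have {}H : F rho <= 0.
  apply: H => x hx; have [h3 _] := hL b x bb hx; have hx' := sub_rho1 s1 hx.
  rewrite addr0.
  have Fx : 0 <= F x.
    have /andP[g1 g2] := hx; move: g2; rewrite le_eqVlt => /orP[/eqP ->|g2]; first by rewrite Fs.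
    by apply: ltW; apply: hs; rewrite g1.
  have p2 : 0 <= kk x * (b - a) * sin (th x) ^+ 2.
    by rewrite mulr_ge0 ?sqr_ge0// mulr_ge0 ?subr_ge0 ?(ltW ab)// ltW// kk_gt0.
  have : `|kk x * (b - Vc f x - 1) * (sin (ta x) ^+ 2 - sin (th x) ^+ 2)| <= L * F x.
    rewrite normrM; apply: ler_pM => //; apply: le_trans (sin2_lip _ _) _.
    by rewrite ger0_norm.
  by rewrite ler_norml => /andP[+ _]; move: p2; lra.
by move: F0 H; lra.
Qed.

(** Gronwall for the squared difference of the angles, which treats both signs of [a - a0] alike.
    Continuity is at a fixed [b < 1] and not uniform up to 1. *)
Lemma theta_cont a0 b e : a0 <= 0 -> rho <= b < 1 -> 0 < e -> exists2 r, 0 < r &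
  forall a d c u p v q th ta, prufer a0 d u p th -> prufer a c v q ta -> a <= 0 -> a != a0 -> `|a - a0| < r ->
    `|ta b - th b| < e.
Proof.
(* Parameters within distance 1 of [a0] are at least [- A]. *)
move=> a00 /andP[rb b1] e0; pose A := 1 - a0.
have [L L0 hL] := theta_lip A rb b1.
pose K := (1 - rho ^+ 2)^-2; have K0 : 0 <= K by rewrite invr_ge0 sqr_ge0.
pose C := expR ((2 * L + 1) * (b - rho)) * (K ^+ 2 + L ^+ 2).
have C0 : 0 <= C by rewrite mulr_ge0 ?expR_ge0// addr_ge0 ?sqr_ge0.
have main a1 a2 d c u p v q th ta : prufer a1 d u p th -> prufer a2 c v q ta -> a1 < a2 -> a2 <= 0 -> - A <= a1 ->
    (ta b - th b) ^+ 2 <= C * (a2 - a1) ^+ 2.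
  move=> h1 h2 a12 a20 Aa; have [lt le] := theta_rho_cmp h1 h2 a12 a20.
  have [_ _ o1 _] := h1; have [_ _ o2 _] := h2.
  pose F x := ta x - th x.
  have dF x (hx : rho <= x <= b) : dv (fun x => F x ^+ 2) x (2 * F x * (kk x * (a2 - Vc f x - 1) * (sin (ta x) ^+ 2 - sin (th x) ^+ 2) + kk x * (a2 - a1) * sin (th x) ^+ 2)).
    have hx' := sub_rho1 b1 hx; apply: dv_eq (dvX 2 (dvB (o2 x hx') (o1 x hx'))) _.
    by rewrite /= expr1 /F; ring.
  have L1 : 0 <= 2 * L + 1 by lra.
  have c0 : 0 <= L ^+ 2 * (a2 - a1) ^+ 2 by rewrite mulr_ge0 ?sqr_ge0.
  have G := @gronwall_right R (fun x => F x ^+ 2) _ _ _ rho b rb L1 c0 dF.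
  have a2A : - A <= a2 <= 0 by rewrite a20 andbT; lra.
  have {}G : F b ^+ 2 <= expR ((2 * L + 1) * (b - rho)) * (F rho ^+ 2 + L ^+ 2 * (a2 - a1) ^+ 2 * (b - rho)).
    apply: G => x hx; have [h3 h4] := hL a2 x a2A hx; have hx' := sub_rho1 b1 hx.
    set X := kk x * (a2 - Vc f x - 1) * _; set Z := kk x * _ * _.
    have hX : `|X| <= L * `|F x|.
      by rewrite /X normrM; apply: ler_pM => //; exact: sin2_lip.
    have hZ : `|Z| <= L * (a2 - a1).
      have a21 : 0 <= a2 - a1 by rewrite subr_ge0 ltW.
      have kx := ltW (kk_gt0 hx').
      have ka : 0 <= kk x * (a2 - a1) by exact: mulr_ge0.
      rewrite ger0_norm /Z; last by apply: mulr_ge0 => //; exact: sqr_ge0.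
      apply: (@le_trans _ _ (kk x * (a2 - a1))); last exact: ler_wpM2r.
      by rewrite ler_piMr// sin2_le1.
    have x1 : 2 * F x * X <= 2 * L * F x ^+ 2.
      have y1 : `|F x| * `|X| <= `|F x| * (L * `|F x|) by exact: ler_wpM2l.
      have y2 : F x * X <= `|F x| * `|X| by rewrite -normrM ler_norm.
      have y3 : `|F x| * (L * `|F x|) = L * F x ^+ 2 by rewrite mulrCA -expr2 real_normK ?num_real.
      by move: y1 y2; rewrite y3 -!mulrA; lra.
    have x2 : 2 * F x * Z <= F x ^+ 2 + Z ^+ 2.
      by have := sqr_ge0 (F x - Z); rewrite !expr2; lra.
    have x3 : Z ^+ 2 <= L ^+ 2 * (a2 - a1) ^+ 2.
      rewrite -exprMn -(real_normK (num_real Z)) lerXn2r ?nnegrE//.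
      by rewrite mulr_ge0 ?(ltW L0)// subr_ge0 ltW.
    by rewrite mulrDr; move: x1 x2 x3; clear; lra.
  apply: (le_trans G); rewrite /C -[leRHS]mulrA; apply: ler_wpM2l; first exact: expR_ge0.
  rewrite mulrDl; apply: lerD.
    rewrite -exprMn lerXn2r ?nnegrE ?subr_ge0 ?(ltW lt)//.
      by rewrite mulr_ge0// subr_ge0 ltW.
    by apply: (le_trans le); rewrite mulrC.
  by rewrite ler_piMr// lerBlDr; move: r0 b1; lra.
pose r := Num.min 1 (e / (1 + C)).
have C1 : 0 < 1 + C by lra.
have r0' : 0 < r by rewrite lt_min ltr01 divr_gt0.
exists r => // a d c u p v q th ta h1 h2 a0' ne har.
have ar1 : `|a - a0| < 1 by apply: (lt_le_trans har); rewrite ge_min lexx.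
have are : `|a - a0| < e / (1 + C) by apply: (lt_le_trans har); rewrite ge_min lexx orbT.
have H : (ta b - th b) ^+ 2 <= C * (a - a0) ^+ 2.
  have [lt|le] := ltP a0 a; first by apply: (main _ _ _ _ _ _ _ _ _ _ h1 h2 lt a0'); rewrite /A; lra.
  have lt : a < a0 by rewrite lt_neqAle ne.
  rewrite -sqrrN opprB -[(a - a0) ^+ 2]sqrrN opprB.
  apply: (main _ _ _ _ _ _ _ _ _ _ h2 h1 lt a00); rewrite /A.
  by move: ar1; rewrite ltr_norml => /andP[? ?]; lra.
rewrite -(@ltr_pXn2r _ 2) ?nnegrE ?(ltW e0)// real_normK ?num_real//.
apply: (le_lt_trans H).
have : (a - a0) ^+ 2 < (e / (1 + C)) ^+ 2.
  have q0 : 0 <= e / (1 + C) by apply: divr_ge0; exact: ltW.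
  by rewrite -(real_normK (num_real (a - a0))) ltrXn2r ?nnegrE.
have e2 : 0 < e ^+ 2 by rewrite exprn_gt0.
rewrite exprMn exprVn ltr_pdivlMr ?exprn_gt0// => lt2; apply: le_lt_trans lt2.
rewrite mulrC; apply: ler_wpM2l; first exact: sqr_ge0.
by rewrite expr2; have := mulr_ge0 C0 C0; lra.
Qed.

End PrueferTheory.

(** * Negative eigenvalues as thresholds of the angle *)

Section Count.
Variable R : realType.
Implicit Types (t a b c d e C K M x y mu : R) (u p th : R -> R).
Variables (f f1 : R -> R) (n : nat) (rho : R).
Hypothesis wp : wave_profile f f1 n.
Hypothesis hrho : 0 < rho < 1.
Hypothesis hQ : forall t, 0 < t <= rho -> 1 <= Qc f 0 t.
Variables (D : R -> R) (U P Th : R -> R -> R).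
Hypothesis hP : forall a, a <= 0 -> prufer f rho a (D a) (U a) (P a) (Th a).

Let r0 : 0 < rho. Proof. by case/andP: hrho. Qed.
Let r1 : rho < 1. Proof. by case/andP: hrho. Qed.
Let in01 t : rho <= t < 1 -> 0 < t < 1.
Proof. by move=> /andP[h ->]; rewrite (lt_le_trans r0). Qed.
Let pi0 : 0 < pi :> R. Proof. exact: pi_gt0. Qed.

(** At a multiple of [pi] the angle has derivative [kk > 0], so a multiple once passed stays passed.
    For [a <= 0] the condition is monotone and open in [a]. *)
Definition exceeds (j : nat) a := exists2 t, rho <= t < 1 & j%:R * pi < Th a t.

Lemma npi_succ (j : nat) : j.+1%:R * pi = j%:R * pi + pi :> R.
Proof. by rewrite -addn1 natrD mulrDl mul1r. Qed.

Lemma npi_le (i j : nat) : (i <= j)%N -> i%:R * pi <= j%:R * pi :> R.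
Proof. by move=> ij; rewrite ler_pM2r// ler_nat. Qed.

Lemma dv_Th a t : a <= 0 -> rho <= t < 1 -> dv (Th a) t (kk t * (1 + (a - Vc f t - 1) * sin (Th a t) ^+ 2)).
Proof. by move=> a0 /in01 ht; have [_ _ h _] := hP a0; exact: h. Qed.

Lemma dv_Th_npi a (j : nat) t : a <= 0 -> rho <= t < 1 -> Th a t = j%:R * pi -> dv (Th a) t (kk t).
Proof. by move=> a0 ht e; apply: dv_eq (dv_Th a0 ht) _; rewrite e sin_npi0 expr0n /= mulr0 addr0 mulr1. Qed.

Lemma Th_npi_lt a (j : nat) s t : a <= 0 -> rho <= s -> s <= t -> t < 1 -> j%:R * pi < Th a s -> j%:R * pi < Th a t.
Proof.
move=> a0 rs st t1 h; rewrite -subr_gt0.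
have sub x : s <= x <= t -> rho <= x < 1 by move=> /andP[h1 h2]; rewrite (le_trans rs h1) (le_lt_trans h2 t1).
apply: (@barrier R (fun t => Th a t - j%:R * pi) (fun t => kk t * (1 + (a - Vc f t - 1) * sin (Th a t) ^+ 2)) s t st).
- by move=> x /sub hx; apply: dv_eq (dvB (dv_Th a0 hx) (dv_cst _ x)) _; rewrite subr0.
- move=> x /sub hx /eqP; rewrite subr_eq0 => /eqP ->.
  by rewrite sin_npi0 expr0n /= mulr0 addr0 mulr1 kk_gt0// in01.
- by rewrite subr_gt0.
Qed.

Lemma Th_npi_lt_strict a (j : nat) s t : a <= 0 -> rho <= s -> s < t -> t < 1 -> Th a s = j%:R * pi -> j%:R * pi < Th a t.
Proof.
move=> a0 rs st t1 e; have hs : rho <= s < 1 by rewrite rs (lt_trans st).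
have d1 : dv (fun x => Th a x - j%:R * pi) s (kk s).
  by apply: dv_eq (dvB (dv_Th_npi a0 hs e) (dv_cst _ s)) _; rewrite subr0.
have F0 : Th a s - j%:R * pi = 0 by rewrite e subrr.
have ts : 0 < t - s by rewrite subr_gt0.
have [y /andP[sy yt]] := dv_right_pos d1 F0 (kk_gt0 (in01 hs)) ts.
rewrite subr_gt0; apply: (Th_npi_lt a0 (le_trans rs (ltW sy))) => //.
by rewrite ltW//; move: yt; rewrite addrC subrK.
Qed.

(** At an odd multiple of [pi / 2] the derivative is [kk (a - V)], so this level cannot be crossed
    upwards where [V > a]. *)
Lemma Th_mid_lt a (m : nat) s t : a <= 0 -> rho <= s -> s <= t -> t < 1 ->
  (forall x, s <= x <= t -> 0 < Vc f x - a) -> Th a s < m%:R * pi + pi / 2 -> Th a t < m%:R * pi + pi / 2.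
Proof.
move=> a0 rs st t1 hV h; rewrite -subr_gt0.
have sub x : s <= x <= t -> rho <= x < 1 by move=> /andP[h1 h2]; rewrite (le_trans rs h1) (le_lt_trans h2 t1).
apply: (@barrier R (fun t => m%:R * pi + pi / 2 - Th a t) (fun t => - (kk t * (1 + (a - Vc f t - 1) * sin (Th a t) ^+ 2))) s t st).
- by move=> x /sub hx; apply: dv_eq (dvB (dv_cst _ x) (dv_Th a0 hx)) _; rewrite sub0r.
- move=> x hx /eqP; rewrite subr_eq0 => /eqP <-; rewrite [_ * pi + _]addrC sin2_npi sin_pihalf expr1n mulr1.
  have := mulr_gt0 (kk_gt0 (in01 (sub x hx))) (hV x hx); move: (kk x) (Vc f x) => k V; lra.
- by rewrite subr_gt0.
Qed.

Lemma Th_gt0 a t : a <= 0 -> rho <= t < 1 -> 0 < Th a t.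
Proof.
move=> a0 /andP[rt t1]; have /andP[h _] := theta_rho hrho (hP a0).
by have := @Th_npi_lt a 0 rho t a0 (lexx _) rt t1; rewrite mul0r; apply.
Qed.

Lemma exceeds0 a : a <= 0 -> exceeds 0 a.
Proof. by move=> a0; exists rho; rewrite ?lexx ?r1// mul0r Th_gt0// lexx. Qed.

Lemma exceeds_le (i j : nat) a : (i <= j)%N -> exceeds j a -> exceeds i a.
Proof. by move=> ij [t ht h]; exists t => //; apply: le_lt_trans h; exact: npi_le. Qed.

Lemma exceeds_mono (j : nat) a b : a <= b -> b <= 0 -> exceeds j a -> exceeds j b.
Proof.
rewrite le_eqVlt => /orP[/eqP ->//|ab] b0 [t ht h]; exists t => //.
have a0 : a <= 0 by exact: ltW (lt_le_trans ab b0).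
exact: lt_trans h (theta_lt wp hrho hQ (hP a0) (hP b0) ab b0 ht).
Qed.

Lemma Th_cont a0 b e : a0 <= 0 -> rho <= b < 1 -> 0 < e -> exists2 r, 0 < r &
  forall a, a <= 0 -> `|a - a0| < r -> `|Th a b - Th a0 b| < e.
Proof.
move=> a00 hb e0; have [r r0' H] := theta_cont wp hrho hQ a00 hb e0.
exists r => // a a0' har; have [->|ne] := eqVneq a a0; first by rewrite subrr normr0.
exact: H (hP a00) (hP a0') a0' ne har.
Qed.

Lemma exceeds_open (j : nat) a0 : a0 <= 0 -> exceeds j a0 -> exists2 r, 0 < r &
  forall a, a <= 0 -> `|a - a0| < r -> exceeds j a.
Proof.
move=> a00 [t ht h]; have e0 : 0 < Th a0 t - j%:R * pi by rewrite subr_gt0.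
have [r rr H] := Th_cont a00 ht e0; exists r => // a a0' har; exists t => //.
by have := H a a0' har; rewrite ltr_norml => /andP[? _]; lra.
Qed.

(** Below [- 2 / rho^2] one has [V > a] on all of [[rho], 1), and the angle is trapped under
    [pi / 2]. *)
Lemma not_exceeds_below : exists M, forall a, a <= 0 -> a < M -> ~ exceeds 1 a.
Proof.
exists (- (2 / rho ^+ 2)) => a a0 aM [t /andP[rt t1]].
rewrite mul1r; apply/negP; rewrite -leNgt.
have /andP[_ h] := theta_rho hrho (hP a0).
have := @Th_mid_lt a 0 rho t a0 (lexx _) rt t1; rewrite mul0r add0r => H.
have {}H : Th a t < pi / 2.
  apply: H => // x /andP[x1 x2]; have := Vc_le2 f r0 x1 (le_lt_trans x2 t1).
  by rewrite ler_norml => /andP[? _]; lra.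
by have := pi0; lra.
Qed.

(** The last parameter at which [j pi] is not passed. These are the eigenvalues, by [threshold_L2]
    and [L2_threshold]. *)
Definition threshold (j : nat) mu := [/\ mu < 0, ~ exceeds j mu & forall a, mu < a -> a <= 0 -> exceeds j a].

(** The threshold is the infimum of the parameters for which [j pi] is passed. By openness it is not
    one of them, hence it is not 0. *)
Lemma threshold_ex (j : nat) : (0 < j)%N -> exceeds j 0 -> exists mu, threshold j mu.
Proof.
move=> j0 ej; pose S : set R := [set a | a <= 0 /\ exceeds j a].
have [M hM] := not_exceeds_below.
have lbS : lbound S (Num.min M 0).
  move=> a [a0 ea]; rewrite leNgt; apply/negP; rewrite lt_min => /andP[aM _].
  by apply: (hM a a0 aM); exact: exceeds_le ea.
have S0 : S !=set0 by exists 0; split.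
have hS : has_inf S by split => //; exists (Num.min M 0).
pose mu := inf S; exists mu.
have mlb a : a <= 0 -> exceeds j a -> mu <= a by move=> a0 ea; apply: ge_inf; [exists (Num.min M 0)|split].
have m0 : mu <= 0 by exact: mlb.
have nm : ~ exceeds j mu.
  move=> em; have [r rr H] := exceeds_open m0 em.
  have : mu <= mu - r / 2.
    apply: mlb; first by lra.
    apply: H; first by lra.
    by rewrite addrAC subrr sub0r normrN gtr0_norm; lra.
  by lra.
split => //.
- rewrite lt_neqAle m0 andbT; apply/negP => /eqP e; apply: nm; rewrite e; exact: ej.
- move=> a ma a0; have am : 0 < a - mu by rewrite subr_gt0.
  have [b [b0 eb] bl] := inf_adherent am hS.
  by apply: (exceeds_mono _ a0 eb); rewrite ltW//; move: bl; rewrite -/mu addrC subrK.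
Qed.

Lemma threshold_uniq (j : nat) x y : threshold j x -> threshold j y -> x = y.
Proof.
move=> [x0 nx hx] [y0 ny hy]; apply/eqP; rewrite eq_le; apply/andP; split.
  by rewrite leNgt; apply/negP => h; apply: nx; exact: hy (ltW x0).
by rewrite leNgt; apply/negP => h; apply: ny; exact: hx (ltW y0).
Qed.

Lemma Vc_near1 mu : mu < 0 -> exists2 T, rho <= T < 1 & forall a t, a <= mu -> T <= t < 1 -> - mu / 2 <= Vc f t - a.
Proof.
move=> m0; have d0 : 0 < - mu / 2 by lra.
have [s /andP[s0 s1] hV] := Vc_small f d0; exists (Num.max rho s); first by rewrite le_max lexx gt_max r1.
move=> a t am /andP[]; rewrite ge_max => /andP[_ st] t1; have := hV t ltac:(by rewrite st).
by rewrite ler_norml => /andP[? _]; lra.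
Qed.

(** Suppose both thresholds were [x]. The angle for [x] is at most [j pi] at [T], so for [a]
    slightly above [x] it is below [j pi + pi / 2] there and is trapped under that level afterwards.
    It could then not pass [(j + 1) pi]. *)
Lemma threshold_lt (j : nat) x y : threshold j x -> threshold j.+1 y -> x < y.
Proof.
move=> hx hy; have [x0 nx ex] := hx; have [y0 ny ey] := hy.
rewrite lt_neqAle; apply/andP; split; last first.
  by rewrite leNgt; apply/negP => h; apply: nx; apply: exceeds_le (leqnSn j) _; exact: ey (ltW x0).
apply/negP => /eqP e; have {ny hy} ey' : forall a, x < a -> a <= 0 -> exceeds j.+1 a by rewrite e.
have x20 : x / 2 < 0 by lra.
have [T hT hV] := Vc_near1 x20; have /andP[rT T1] := hT.
have p2 : 0 < pi / 2 :> R by have := pi0; lra.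
have [r rr H] := Th_cont (ltW x0) hT p2.
pose a := x + Num.min r (- x / 2) / 2.
have m1 : 0 < Num.min r (- x / 2) by rewrite lt_min rr /=; lra.
have m2 : Num.min r (- x / 2) <= r by rewrite ge_min lexx.
have m3 : Num.min r (- x / 2) <= - x / 2 by rewrite ge_min lexx orbT.
have xa : x < a by rewrite /a; lra.
have a0 : a <= 0 by rewrite /a; lra.
have ThT : Th x T <= j%:R * pi by rewrite leNgt; apply/negP => h; apply: nx; exists T.
have aT : Th a T < j%:R * pi + pi / 2.
  have : `|a - x| < r by rewrite /a addrAC subrr add0r gtr0_norm; lra.
  by move=> /(H a a0); rewrite ltr_norml => /andP[_ ?]; lra.
have [t /andP[rt t1]] := ey' a xa a0; rewrite npi_succ.
have := pi0 => pp.
have [Tt|/ltW tT] := leP T t.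
  have := @Th_mid_lt a j T t a0 rT Tt t1 _ aT => Hm.
  have {}Hm : Th a t < j%:R * pi + pi / 2.
    apply: Hm => s /andP[s1 s2]; have := hV a s ltac:(by rewrite /a; lra) ltac:(by rewrite s1 (le_lt_trans s2)).
    by lra.
  by lra.
move=> h; have := @Th_npi_lt a j.+1 t T a0 rt tT T1; rewrite npi_succ => /(_ h); lra.
Qed.

Lemma zq_sign a t : a <= 0 -> rho <= t < 1 -> exists2 B, 0 < B & zz (U a) t * qq (U a) (P a) t = B * (sin (Th a t) * cos (Th a t)).
Proof.
move=> a0 /in01 ht; have [_ _ _ h] := hP a0; have [B [Bn -> ->]] := h t ht.
by exists (B ^+ 2); [rewrite lt_def sqr_ge0 sqrf_eq0 Bn|ring].
Qed.

(* Past [T], square integrability is decided by the sign of the logarithmic derivative. *)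
Lemma L2P a T d : a <= 0 -> rho <= T < 1 -> 0 < d -> (forall t, T <= t < 1 -> d <= Vc f t - a) ->
  summ1 rho (fun t => weight t * U a t ^+ 2) <-> (forall t, T <= t < 1 -> sin (Th a t) * cos (Th a t) <= 0).
Proof.
move=> a0 hT d0 hV; have /andP[rT T1] := hT; have [[h _ _ _] _ _ _] := hP a0.
have hz := rsol_zsol h; pose z := zz (U a); pose q := qq (U a) (P a).
have T0 : 0 < T by exact: lt_le_trans rT.
have sub t : T <= t < 1 -> rho <= t < 1 by move=> /andP[g ->]; rewrite (le_trans rT).
have dg t : T <= t < 1 -> dv (fun t => z t * q t) t (kk t * (q t ^+ 2 + (Vc f t - a) * z t ^+ 2)).
  by move=> /sub/in01 ht; have [d1 d2] := hz t ht; apply: dv_eq (dvM d1 d2) _; rewrite /z /q; ring.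
have dgp t : T <= t < 1 -> d * (kk t * z t ^+ 2) <= kk t * (q t ^+ 2 + (Vc f t - a) * z t ^+ 2).
  move=> ht; have k0 := ltW (kk_gt0 (in01 (sub t ht))).
  rewrite mulrCA; apply: ler_wpM2l => //.
  have := ler_wpM2r (sqr_ge0 (z t)) (hV t ht); have := sqr_ge0 (q t); lra.
have gm s t : T <= s -> s <= t -> t < 1 -> z s * q s <= z t * q t.
  move=> Ts st t1; have sub' x : s <= x <= t -> T <= x < 1.
    by move=> /andP[g1 g2]; rewrite (le_trans Ts g1) (le_lt_trans g2 t1).
  apply: (dv_mono st (fun x hx => dg x (sub' x hx))) => x /andP[g1 g2].
  have hx : T <= x < 1 by apply: sub'; rewrite !ltW.
  apply: le_trans (dgp x hx); rewrite mulr_ge0 ?(ltW d0)// mulr_ge0 ?sqr_ge0//.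
  by rewrite ltW// kk_gt0// in01// sub.
have cu t ht := cont_wu2 (fun t ht => (h t ht).1) (t := t) ht.
have dS t : T <= t < 1 -> dv (prim (fun s => weight s * U a s ^+ 2) 2^-1) t (kk t * z t ^+ 2).
  by move=> /sub/in01 ht; apply: dv_eq (prim_dv cu (half01 R) ht) _; rewrite /z wzz.
split=> [S t ht|hneg].
- rewrite leNgt; apply/negP => pos; have [B B0 e] := zq_sign a0 (sub t ht).
  have g0 : 0 < z t * q t by rewrite /z /q e mulr_gt0.
  have /andP[Tt t1] := ht; have ht' := in01 (sub t ht).
  (* If [z q > 0] at [t], then [z q] does not decrease afterwards and [z^2] grows at least like
     [2 z q] times artanh; beyond [s] it is at least 1. *)
  have [s /andP[ts s1] hK] := K0_unbounded ((2 * (z t * q t))^-1 + K0 t) ht'.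
  apply: (zz_not_summ1 (fun t ht => (h t ht).1) (t1 := s) (d := 1)) => //.
  + by rewrite s1 andbT; case/andP: ht' => ? _; exact: lt_le_trans ts.
  + move=> x /andP[sx x1].
    have tx := le_trans ts sx.
    have sub' y : t <= y <= x -> T <= y < 1 by move=> /andP[g1 g2]; rewrite (le_trans Tt g1) (le_lt_trans g2 x1).
    have : 2 * (z t * q t) * K0 x - 2 * (z t * q t) * K0 t <= z x ^+ 2 - z t ^+ 2.
      apply: (@dv_le R (fun s => 2 * (z t * q t) * K0 s) (fun s => 2 * (z t * q t) * kk s) (fun s => z s ^+ 2) (fun s => 2 * (kk s * (z s * q s))) t x tx).
      * by move=> y hy; apply: dvZ; apply: dv_K0; apply: in01; apply: sub; exact: sub'.
      * move=> y hy; have [d1 _] := hz y (in01 (sub y (sub' y hy))).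
        by apply: dv_eq (dvX 2 d1) _; rewrite /= expr1 /z /q; ring.
      * move=> y /andP[y1 y2]; have hy : T <= y < 1 by apply: sub'; rewrite !ltW.
        have k0 := ltW (kk_gt0 (in01 (sub y hy))).
        have := ler_wpM2l k0 (gm t y Tt (ltW y1) (lt_trans y2 x1)); lra.
    have Kx : K0 s <= K0 x by apply: K0_le => //; case/andP: ht' => ? _; exact: lt_le_trans ts.
    have g2 : 0 < 2 * (z t * q t) by rewrite mulr_gt0.
    have : (2 * (z t * q t))^-1 <= K0 x - K0 t by lra.
    move=> /(ler_wpM2l (ltW g2)); rewrite mulfV ?gt_eqF// mulrBr; have := sqr_ge0 (z t); rewrite -/(z x).
    by move=> ? ? ?; lra.
  + by apply: summ1W S; exact: le_trans (le_trans rT Tt) ts.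
(* Conversely [d kk z^2 <= (z q)'], and [z q] stays between its value at [T] and 0. *)
- have key s t : T <= s -> s <= t -> t < 1 -> prim (fun s => weight s * U a s ^+ 2) 2^-1 t - prim (fun s => weight s * U a s ^+ 2) 2^-1 s <= - (z T * q T) / d.
    move=> Ts st t1; have sub' x : s <= x <= t -> T <= x < 1.
      by move=> /andP[g1 g2]; rewrite (le_trans Ts g1) (le_lt_trans g2 t1).
    have : d * prim (fun s => weight s * U a s ^+ 2) 2^-1 t - d * prim (fun s => weight s * U a s ^+ 2) 2^-1 s <= z t * q t - z s * q s.
      apply: (dv_le st (fun x hx => dvZ d (dS x (sub' x hx))) (fun x hx => dg x (sub' x hx))) => x /andP[g1 g2].
      by apply: dgp; apply: sub'; rewrite !ltW.
    have tT : T <= t < 1 by rewrite (le_trans Ts).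
    have [B B0 e] := zq_sign a0 (sub t tT).
    have : z t * q t <= 0 by rewrite /z /q e pmulr_rle0// hneg.
    have := gm T s (lexx _) Ts (le_lt_trans st t1).
    rewrite ler_pdivlMr// [_ * d]mulrC mulrBr; lra.
  have mono s t : 0 < s -> s <= t -> t < 1 -> prim (fun s => weight s * U a s ^+ 2) 2^-1 s <= prim (fun s => weight s * U a s ^+ 2) 2^-1 t.
    move=> s0 st t1; apply: (dv_mono st (fun z hz => prim_dv cu (half01 R) (sub01 s0 t1 hz))) => y /andP[y1 y2].
    by rewrite mulr_ge0 ?sqr_ge0// ltW// weight_gt0// (lt_trans s0 y1) (lt_trans y2 t1).
  set pr := prim _ _ in key mono *.
  exists (pr T - pr rho + `|- (z T * q T) / d|) => x y rx xy y1.
  change (pr y - pr x <= pr T - pr rho + `|- (z T * q T) / d|).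
  have n0 := normr_ge0 (- (z T * q T) / d); have n1 := ler_norm (- (z T * q T) / d).
  have x0 := lt_le_trans r0 rx.
  have m1 := mono rho x r0 rx (le_lt_trans xy y1).
  have [yT|/ltW Ty] := leP y T; first by have := mono y T (lt_le_trans x0 xy) yT T1; lra.
  have [xT|/ltW Tx] := leP x T; first by have := key T y (lexx _) Ty y1; lra.
  by have := mono rho T r0 rT T1; have := key x y Tx xy y1; lra.
Qed.

Lemma sincos_pos_mid x : 0 <= x -> 0 < sin x * cos x -> exists i : nat, i%:R * pi < x < i%:R * pi + pi / 2.
Proof.
move=> x0 sc; have p0 := pi0.
have d0 : 0 <= x / pi by apply: divr_ge0 => //; exact: ltW.
have /andP[h1 h2] := truncn_itv d0.
exists (Num.truncn (x / pi)); move: (Num.truncn _) h1 h2 => j.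
rewrite ler_pdivlMr// ltr_pdivrMr// npi_succ => h1 h2.
pose y := x - j%:R * pi.
have e : x = y + j%:R * pi by rewrite /y subrK.
have y0 : 0 <= y by rewrite subr_ge0.
have yp : y < pi by rewrite /y; lra.
rewrite e sincos_npi in sc.
have yn : 0 < y.
  rewrite lt_def y0 andbT; apply/negP => /eqP yz; move: sc; rewrite yz sin0 mul0r ltxx.
  by [].
suff : y < pi / 2 by move: yn; rewrite /y => *; apply/andP; split; lra.
rewrite ltNge; apply/negP => py.
have s0 : 0 < sin y by apply: sin_gt0_pi; rewrite yn yp.
move: sc; rewrite pmulr_rgt0// => c0.
have : 0 <= sin (y - pi / 2) by apply: sin_ge0_pi; apply/andP; split; lra.
by rewrite sinBpihalf; lra.
Qed.

Lemma zmode_summ0 : summ0 rho (fun t => weight t * zmode f1 t ^+ 2).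
Proof.
have [C [r [C0 /andP[rr0 rr1] hC]]] := P_near0 wp.
have hz := zmode_rsol wp.
have cz t ht := cont_wu2 (fun t ht => (hz t ht).1) (t := t) ht.
pose s := Num.min rho (r / 2).
have s0 : 0 < s by rewrite lt_min r0 divr_gt0.
have sr : s <= rho by rewrite ge_min lexx.
have sr2 : s <= r / 2 by rewrite ge_min lexx orbT.
apply: (summ0_ext s0 sr r1 cz).
  by move=> t ht; rewrite mulr_ge0 ?sqr_ge0// ltW// weight_gt0.
apply: (summ0_bounded (K := (1 - rho ^+ 2)^-2 * C ^+ 2) (le_lt_trans sr r1) cz) => t /andP[t0 ts].
have ht : 0 < t < 1 by rewrite t0 (le_lt_trans ts)// (le_lt_trans sr).
apply: ler_pM; [exact: ltW (weight_gt0 ht)|exact: sqr_ge0| |].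
  by apply: (weight_le hrho); rewrite t0 (le_trans ts).
have tr : 0 < t < r by rewrite t0; lra.
have := hC t tr; rewrite normrM (ger0_norm (sqr_ge0 t)) mulrC ler_pM2r ?exprn_gt0// => hf.
rewrite /zmode -(real_normK (num_real (_ * f1 t))) lerXn2r ?nnegrE ?(ltW C0)//.
rewrite normrM -[leRHS]mul1r; apply: ler_pM => //.
have sq1 : sq t <= 1.
  have := sq_sqr ht; have := sqr_ge0 t; have := ltW (sq_gt0 ht) => q0 q1 q2.
  by rewrite -(@ler_pXn2r _ 2) ?nnegrE// expr1n q2; lra.
rewrite -/(sq t) normrM !ger0_norm ?(ltW t0) ?(ltW (sq_gt0 ht))//.
by case/andP: ht => _ /ltW t1; rewrite mulr_ile1 ?(ltW t0) ?sqrtr_ge0.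
Qed.

(** The zero mode is square integrable near 0, hence a multiple of the regular solution [U 0]; the
    factor is not zero because [f'] does not vanish identically. *)
Lemma U0_zero t : 0 < t < 1 -> (U 0 t == 0) = (f1 t == 0).
Proof.
move=> ht; have [hr _ _ _] := hP (lexx 0); have hz := zmode_rsol wp.
have e s (hs : 0 < s < 1) : zmode f1 s = zmode f1 rho * U 0 s.
  by have [] := regsol_prop wp hrho (fun t => Qc_ge1 hrho hQ (lexx 0)) hr hz zmode_summ0 hs.
have zf s : 0 < s < 1 -> (zmode f1 s == 0) = (f1 s == 0).
  move=> hs; have /andP[s0 _] := hs; have q0 := sq_gt0 hs.
  by rewrite /zmode -/(sq s) !mulf_eq0 (gt_eqF s0) (gt_eqF q0).
have c0 : zmode f1 rho != 0.
  apply/negP => /eqP c0; have [_ _ _ _ ex] := wp; have h2 : 2^-1 < 1 :> R by have /andP[] := half01 R.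
  apply: (infinite_zeros h2 ex) => s hs _; apply/eqP; rewrite -zf// e// c0 mul0r eqxx.
  by [].
by rewrite -zf// e// mulf_eq0 (negPf c0).
Qed.

Lemma U_zero_Th a t : a <= 0 -> rho <= t < 1 -> (U a t == 0) = (sin (Th a t) == 0).
Proof.
move=> a0 ht; have ht' := in01 ht; have [_ _ _ h] := hP a0; have [B [Bn e _]] := h t ht'.
by rewrite -zz_eq0// e mulf_eq0 (negPf Bn).
Qed.

(** On its way past [j pi] the angle takes the values [pi], ..., [j pi], which gives [j] distinct
    zeros of [f']. *)
Lemma exceeds_le_n (j : nat) : exceeds j 0 -> (j <= n)%N.
Proof.
move=> [t ht h]; have /andP[rt t1] := ht; have [_ _ _ _ [l [ul <- hl]]] := wp.
have /choice[X hX] i : exists x, (1 <= i <= j)%N -> rho <= x < 1 /\ Th 0 x = i%:R * pi.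
  have [hi|hi] := boolP (1 <= i <= j)%N; last by exists 0.
  have /andP[i1 ij] := hi.
  have sub x : rho <= x <= t -> rho <= x < 1 by move=> /andP[-> g]; exact: le_lt_trans t1.
  have prod : (Th 0 rho - i%:R * pi) * (Th 0 t - i%:R * pi) <= 0.
    have /andP[_ g1] := theta_rho hrho (hP (lexx 0)).
    have g2 := npi_le i1; rewrite mul1r in g2; have g3 := npi_le ij; have p0 := pi0.
    by rewrite mulr_le0_ge0//; lra.
  have cF x (hx : rho <= x <= t) : {for x, continuous (fun x => Th 0 x - i%:R * pi)}.
    exact: dv_cont (dvB (dv_Th (lexx 0) (sub x hx)) (dv_cst (i%:R * pi) x)).
  have [x hx e] := ivt0 rt cF prod.
  exists x => _; split; first exact: sub.
  by apply/eqP; rewrite -subr_eq0 e.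
have sub (x : R) : x \in [seq X i | i <- iota 1 j] -> x \in l.
  move=> hx0; have [i + ->] := elimT (@mapP nat R X (iota 1 j) x) hx0.
  rewrite mem_iota add1n ltnS => hi; have [hx e] := hX i hi.
  apply/hl; have hx' := in01 hx; split => //.
  by apply/eqP; rewrite -U0_zero// U_zero_Th// e sin_npi0.
have ux : uniq [seq X i | i <- iota 1 j].
  rewrite map_inj_in_uniq ?iota_uniq// => i k; rewrite !mem_iota !add1n !ltnS => hi hk e.
  have [_ e1] := hX i hi; have [_ e2] := hX k hk.
  have := e2; rewrite -e e1 => /(mulIf (lt0r_neq0 pi0)) /eqP; rewrite eqr_nat => /eqP.
  by [].
by have := uniq_leq_size ux sub; rewrite size_map size_iota.
Qed.

(** Each of the [n] zeros of [f'] lies beyond [rho], where [U 0] is no longer known to be positive,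
    and has its own positive multiple of [pi]. If [n pi] were never passed, only [n - 1] multiples
    would be available. *)
Lemma exceeds_n : exceeds n 0.
Proof.
have [n0|n0] := posnP n; first by rewrite n0; exact: exceeds0.
apply: contrapT => ne; have [_ _ _ _ [l [ul sl hl]]] := wp.
have le t : rho <= t < 1 -> Th 0 t <= n%:R * pi.
  by move=> ht; rewrite leNgt; apply/negP => h; apply: ne; exists t.
have inl x : x \in l -> rho <= x < 1 /\ sin (Th 0 x) = 0.
  move=> /hl[hx /eqP fx]; rewrite -U0_zero// in fx.
  have rx : rho <= x.
    rewrite leNgt; apply/negP => xr; have [hr _ _ _] := hP (lexx 0).
    have /andP[x0 _] := hx.
    by have := regsol_gt0 wp hrho hr (t := x); rewrite x0 (ltW xr) (eqP fx) ltxx => /(_ isT).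
  have hx' : rho <= x < 1 by rewrite rx; case/andP: hx.
  by split => //; apply/eqP; rewrite -U_zero_Th.
have /choice[I hI] x : exists i : nat, x \in l -> Th 0 x = i%:R * pi.
  have [xl|xl] := boolP (x \in l); last by exists 0%N.
  have [hx sx] := inl x xl; have [i e] := sin_eq0_ge0 (ltW (Th_gt0 (lexx 0) hx)) sx.
  by exists i.
(* The multiple [n pi] itself is excluded as a value at a zero, since the angle passes it
   immediately afterwards. *)
have := @uniq_leq_size _ (map I l) (iota 1 n.-1) _ _.
rewrite size_map sl size_iota => H.
suff : (n <= n.-1)%N by rewrite -ltnS prednK// ltnn.
apply: H.
  rewrite map_inj_in_uniq// => x y xl yl e.
  have [hx _] := inl x xl; have [hy _] := inl y yl; have ex := hI x xl; have ey := hI y yl.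
  have /andP[rx x1] := hx; have /andP[ry y1] := hy.
  have [xy|yx|//] := ltgtP x y.
    by have := Th_npi_lt_strict (lexx 0) rx xy y1 ex; rewrite ey e ltxx.
  by have := Th_npi_lt_strict (lexx 0) ry yx x1 ey; rewrite ex e ltxx.
move=> i /mapP[x xl ->]; have [hx _] := inl x xl; have ex := hI x xl; have /andP[rx x1] := hx.
rewrite mem_iota add1n prednK//; apply/andP; split.
  rewrite lt0n; apply/negP => /eqP i0; have := Th_gt0 (lexx 0) hx.
  by rewrite ex i0 mul0r ltxx.
rewrite ltnNge; apply/negP => ni.
pose y := (x + 1) / 2.
have xy : x < y by rewrite /y; lra.
have y1 : y < 1 by rewrite /y; lra.
have := Th_npi_lt_strict (lexx 0) rx xy y1 ex.
have := le y ltac:(by rewrite y1 (le_trans rx (ltW xy))); have := npi_le ni; lra.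
Qed.

Lemma max_class a : a <= 0 -> exists m, exceeds m a /\ ~ exceeds m.+1 a.
Proof.
move=> a0; apply: contrapT => h.
have H m : exceeds m a.
  elim: m => [|m IH]; first exact: exceeds0.
  by apply: contrapT => h'; apply: h; exists m.
have := exceeds_le_n (exceeds_mono a0 (lexx 0) (H n.+1)).
by rewrite ltnn.
Qed.

(** Otherwise [L2P] gives a point near 1 where the angle lies in ([i pi], [i pi + pi / 2]) with
    [i < j]. By continuity it is still below the upper bound there for parameters slightly above
    [mu] and is trapped under it, so [j pi] would not be passed for them. *)
Lemma threshold_L2 (j : nat) mu : (0 < j)%N -> threshold j mu -> summ1 rho (fun t => weight t * U mu t ^+ 2).
Proof.
move=> j0 [m0 nm em]; have m20 : mu / 2 < 0 by lra.
have [T hT hV] := Vc_near1 m20; have /andP[rT T1] := hT.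
have d0 : 0 < - (mu / 2) / 2 by lra.
have mum : mu <= mu / 2 by lra.
apply/(L2P (ltW m0) hT d0 (fun t => hV mu t mum)) => t ht.
rewrite leNgt; apply/negP => pos; have /andP[Tt t1] := ht.
have ht' : rho <= t < 1 by rewrite t1 (le_trans rT).
have rt : rho <= t by case/andP: ht'.
have [i /andP[i1 i2]] := sincos_pos_mid (ltW (Th_gt0 (ltW m0) ht')) pos.
have ij : (i < j)%N.
  by rewrite ltnNge; apply/negP => ji; apply: nm; apply: exceeds_le ji _; exists t.
have e0 : 0 < i%:R * pi + pi / 2 - Th mu t by rewrite subr_gt0.
have [r rr H] := Th_cont (ltW m0) ht' e0.
pose a := mu + Num.min r (- mu / 2) / 2.
have n1 : 0 < Num.min r (- mu / 2) by rewrite lt_min rr /=; lra.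
have n2 : Num.min r (- mu / 2) <= r by rewrite ge_min lexx.
have n3 : Num.min r (- mu / 2) <= - mu / 2 by rewrite ge_min lexx orbT.
have xa : mu < a by rewrite /a; lra.
have am : a <= mu / 2 by rewrite /a; lra.
have a0 : a <= 0 by lra.
have aT : Th a t < i%:R * pi + pi / 2.
  have : `|a - mu| < r by rewrite /a addrAC subrr add0r gtr0_norm; lra.
  by move=> /(H a a0); rewrite ltr_norml => /andP[_ ?]; lra.
have ji := npi_le ij; rewrite npi_succ in ji.
have p0 := pi0.
have [s /andP[rs s1] hs] := em a xa a0.
have [ts|/ltW st] := leP t s.
  have Hm := @Th_mid_lt a i t s a0 rt ts s1.
  have {}Hm : Th a s < i%:R * pi + pi / 2.
    apply: Hm => // x /andP[x1 x2].
    have := hV a x am ltac:(by rewrite (le_trans Tt x1) (le_lt_trans x2 s1)); lra.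
  by lra.
by have := Th_npi_lt a0 rs st t1 hs; lra.
Qed.

(** Let [m pi] be the last multiple passed at [mu]. Square integrability keeps the angle above
    [m pi + pi / 2] near 1. If some larger parameter did not pass [(m + 1) pi], both angles would
    stay in the same half period, where [V > a] makes their difference grow without bound in
    artanh. *)
Lemma L2_threshold mu : mu < 0 -> summ1 rho (fun t => weight t * U mu t ^+ 2) ->
  exists2 j : nat, (0 < j <= n)%N & threshold j mu.
Proof.
move=> m0 S; have m20 : mu / 2 < 0 by lra.
have [T hT hV] := Vc_near1 m20; have /andP[rT T1] := hT.
have d0 : 0 < - (mu / 2) / 2 by lra.
have mum : mu <= mu / 2 by lra.
have neg := (L2P (ltW m0) hT d0 (fun t => hV mu t mum)).1 S.
have [m [[s /andP[rs s1] hs] nm]] := max_class (ltW m0).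
pose S0 := Num.max T s.
have TS : T <= S0 by rewrite le_max lexx.
have sS : s <= S0 by rewrite le_max lexx orbT.
have S1 : S0 < 1 by rewrite gt_max T1.
have rS : rho <= S0 by exact: le_trans TS.
have subS t : S0 <= t < 1 -> rho <= t < 1 by move=> /andP[g ->]; rewrite (le_trans rS).
have p0 := pi0.
have low t : S0 <= t < 1 -> m%:R * pi + pi / 2 <= Th mu t.
  move=> ht; have /andP[St t1] := ht; rewrite leNgt; apply/negP => lt.
  have gt := Th_npi_lt (ltW m0) rs (le_trans sS St) t1 hs.
  have := neg t ltac:(by rewrite t1 (le_trans TS)); rewrite leNgt => /negP; apply.
  rewrite -[Th mu t](subrK (m%:R * pi)) sincos_npi; apply: sincos_gt0.
  by apply/andP; split; lra.
have thr : threshold m.+1 mu; last first.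
  exists m.+1 => //=; apply: exceeds_le_n; have [_ _ h] := thr; exact: h.
split => // a ma a0; apply: contrapT => na.
(* Lowering the parameter keeps the assumption by monotonicity and ensures [V - b > 0] beyond
   [T]. *)
pose b := Num.min a (mu / 2).
have ba : b <= a by rewrite ge_min lexx.
have bm : b <= mu / 2 by rewrite ge_min lexx orbT.
have mb : mu < b by rewrite lt_min ma /=; lra.
have b0 : b <= 0 by lra.
have nb : ~ exceeds m.+1 b by move=> h; apply: na; exact: exceeds_mono ba a0 h.
have up t : S0 <= t < 1 -> Th b t <= m.+1%:R * pi.
  by move=> /subS ht; rewrite leNgt; apply/negP => h; apply: nb; exists t.
pose F t := Th b t - Th mu t.
have F0 t : S0 <= t < 1 -> 0 < F t.
  by move=> /subS ht; have H := theta_lt wp hrho hQ (hP (ltW m0)) (hP b0) mb b0 ht; rewrite subr_gt0.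
have dF t : S0 <= t < 1 -> dv F t (kk t * (1 + (b - Vc f t - 1) * sin (Th b t) ^+ 2) - kk t * (1 + (mu - Vc f t - 1) * sin (Th mu t) ^+ 2)).
  by move=> /subS ht; exact: dvB (dv_Th b0 ht) (dv_Th (ltW m0) ht).
have gap t d : S0 <= t < 1 -> 0 <= d -> d <= F t -> kk t * sin d ^+ 2 <=
    kk t * (1 + (b - Vc f t - 1) * sin (Th b t) ^+ 2) - kk t * (1 + (mu - Vc f t - 1) * sin (Th mu t) ^+ 2).
  move=> ht dd dF'; have /andP[St t1] := ht.
  have G := sin2_gap (low t ht) (_ : Th mu t + d <= Th b t) (up t ht) dd.
  have {}G := G ltac:(by move: dF'; rewrite /F; lra).
  have k0 := ltW (kk_gt0 (in01 (subS t ht))).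
  rewrite -mulrBr; apply: ler_wpM2l => //.
  have v1 := hV b t bm ltac:(by rewrite t1 (le_trans TS)).
  have v2 : Vc f t - b <= Vc f t - mu by lra.
  have d2 := sqr_ge0 (sin d); have s2 := sqr_ge0 (sin (Th b t)).
  move: G v1 v2 d2 s2; move: (sin d ^+ 2) (sin (Th b t) ^+ 2) (sin (Th mu t) ^+ 2) (Vc f t) => x1 x2 x3 V G v1 v2 d2 s2.
  have vb : 0 <= V - b by lra.
  have x23 : x2 <= x3 by lra.
  have q1 := ler_wpM2l vb x23; have x30 : 0 <= x3 by lra.
  have q2 := ler_wpM2r x30 v2.
  by move: q1 q2 G; lra.
have mono x y : S0 <= x -> x <= y -> y < 1 -> F x <= F y.
  move=> Sx xy y1; have sub z : x <= z <= y -> S0 <= z < 1.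
    by move=> /andP[g1 g2]; rewrite (le_trans Sx g1) (le_lt_trans g2 y1).
  apply: (dv_mono xy (fun z hz => dF z (sub z hz))) => z /andP[g1 g2].
  have hz : S0 <= z < 1 by apply: sub; rewrite !ltW.
  apply: le_trans (gap z 0 hz (lexx 0) (ltW (F0 z hz))).
  by rewrite sin0 expr0n /= mulr0.
have hS : S0 <= S0 < 1 by rewrite lexx.
pose d := F S0; have dd := F0 S0 hS.
have Fle t : S0 <= t < 1 -> F t <= pi / 2.
  by move=> ht; have := low t ht; have := up t ht; rewrite npi_succ /F; lra.
have sd : 0 < sin d ^+ 2.
  rewrite exprn_gt0//; apply: sin_gt0_pi; rewrite dd /=; have := Fle S0 hS; rewrite -/d; lra.
(* By [gap] the difference grows at rate at least [sin^2 d] in artanh, so it gains [pi] by [t],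
   while both angles lie in an interval of length [pi / 2]. *)
have [t /andP[St t1] hK] := K0_unbounded (pi / (sin d ^+ 2) + K0 S0) (in01 (subS S0 hS)).
have sub z : S0 <= z <= t -> S0 <= z < 1 by move=> /andP[-> g2]; exact: le_lt_trans t1.
have : sin d ^+ 2 * K0 t - sin d ^+ 2 * K0 S0 <= F t - F S0.
  apply: (@dv_le R (fun z => sin d ^+ 2 * K0 z) (fun z => sin d ^+ 2 * kk z) F _ S0 t St _ (fun z hz => dF z (sub z hz))).
    by move=> z /sub/subS/in01 hz; apply: dvZ; exact: dv_K0.
  move=> z /andP[g1 g2]; have hz : S0 <= z < 1 by apply: sub; rewrite !ltW.
  by rewrite mulrC; apply: gap => //; [exact: ltW|apply: mono => //; [exact: ltW|exact: lt_trans t1]].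
have := Fle t ltac:(by rewrite St); have : pi / (sin d ^+ 2) <= K0 t - K0 S0 by lra.
rewrite ler_pdivrMr// [_ * sin d ^+ 2]mulrC mulrBr.
by move: dd p0; rewrite /d; lra.
Qed.

Lemma L2_list : exists l : seq R, [/\ size l = n, sorted (fun x y => y < x) (0 :: l) &
  forall mu, (mu < 0 /\ summ1 rho (fun t => weight t * U mu t ^+ 2)) <-> mu \in l].
Proof.
have /choice[L hL] (j : nat) : exists mu, (0 < j <= n)%N -> threshold j mu.
  have [hj|hj] := boolP (0 < j <= n)%N; last by exists 0.
  have /andP[j0 jn] := hj; have [mu h] := threshold_ex j0 (exceeds_le jn exceeds_n).
  by exists mu.
have Lneg j : (0 < j <= n)%N -> L j < 0 by move=> /hL[].
(* Thresholds increase with their index, so listing them from [n] down to 1 gives the decreasing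
   order below 0. *)
pose l := [seq L (n - i)%N | i <- iota 0 n]; exists l; split.
- by rewrite size_map size_iota.
- apply/(pathP 0) => i; rewrite size_map size_iota => hi.
  have e k : (k < n)%N -> nth 0 l k = L (n - k)%N.
    by move=> hk; rewrite (nth_map 0%N) ?size_iota// nth_iota.
  rewrite e//; case: i hi => [|i] hi /=.
    by rewrite subn0 Lneg// leqnn andbT.
  rewrite e; last exact: ltnW.
  have h1 : (0 < n - i.+1 <= n)%N by rewrite subn_gt0 hi leq_subr.
  have h2 : (0 < n - i <= n)%N by rewrite subn_gt0 (ltnW hi) leq_subr.
  have t2 : threshold (n - i.+1).+1 (L (n - i)%N) by rewrite subnSK ?(ltnW hi)//; exact: hL h2.
  exact: threshold_lt (hL _ h1) t2.
- move=> mu; split => [[m0 S]|hm].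
    have [j /andP[j0 jn] hj] := L2_threshold m0 S.
    have h : (0 < j <= n)%N by rewrite j0.
    rewrite (threshold_uniq hj (hL j h)); apply: (introT (@mapP nat R _ (iota 0 n) (L j))); exists (n - j)%N; last by rewrite subKn.
    by rewrite mem_iota add0n /= ltn_subrL j0 (leq_trans j0 jn).
  have [i + ->] := elimT (@mapP nat R _ (iota 0 n) mu) hm.
  rewrite mem_iota add0n /= => hi.
  have h : (0 < n - i <= n)%N by rewrite subn_gt0 hi leq_subr.
  have [j0 _] := andP h; split; first exact: Lneg.
  exact: threshold_L2 j0 (hL _ h).
Qed.

End Count.

Theorem mainTheorem4 (R : realType) (n : nat) (f : R -> R) :
  wm_profile n f ->
  (forall lam : R[i], sigma_c (potential f) lam <->
     (complex.Im lam = 0 /\ 0 <= complex.Re lam)) /\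
  (forall lam : R[i], ~ sigma_r (potential f) lam) /\
  (exists l : seq R,
     [/\ size l = n, sorted (fun x y => y < x) (0 :: l) &
         forall lam : R[i], sigma_p (potential f) lam <-> exists2 x, x \in l & lam = x%:C%C]).
Proof.
move=> /wm_wave_profile wp; split; first by move=> lam; exact: sigma_cP wp.
split; first by move=> lam; exact: sigma_r_empty wp.
have [rho [rho0 rho1 hQ']] := Qc_ge 0 wp.
have hrho : 0 < rho < 1 by rewrite rho0.
have hQ t : 0 < t <= rho -> 1 <= Qc f 0 t by move=> /hQ'[].
(* One family of regular solutions and angles is fixed for all [a <= 0], as the thresholds compare
   its members; positive [a] get a dummy value. *)
have /choice[X hX] a : exists X : R * ((R -> R) * ((R -> R) * (R -> R))),
    a <= 0 -> prufer f rho a X.1 X.2.1 X.2.2.1 X.2.2.2.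
  have [a0|a0] := boolP (a <= 0); last by exists (0, (fun=> 0, (fun=> 0, fun=> 0))).
  by have [d [u [p [th h]]]] := prufer_ex wp hrho hQ a0; exists (d, (u, (p, th))).
have [l [sl ol hl]] := L2_list wp hrho hQ hX.
exists l; split => // lam.
have reg a (a0 : a <= 0) : regsol f a rho (X a).1 (X a).2.1 (X a).2.2.1 by have [] := hX a a0.
split => [sp|[x xl ->]].
  have re : complex.Re lam <= 0.
    rewrite leNgt; apply/negP => re; apply: sp; apply: (injective_on wp); right; exact: ltW.
  have [im re' [d [u [p [hr S]]]]] := (sigma_pP wp hrho (fun t => Qc_ge1 hrho hQ re)).1 sp.
  exists (complex.Re lam).
    apply/hl; split => //; have [h _ _ _] := reg _ re.
    (* The regular solution in the description of the eigenvalue need not be the chosen one, but the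
       two are proportional and agree at [rho]. *)
    have e t (ht : 0 < t < 1) := regsol_prop wp hrho (fun t => Qc_ge1 hrho hQ re) hr h (regsol_summ0 hrho (reg _ re)) ht.
    have c : (X (complex.Re lam)).2.1 rho = 1 by have [] := reg _ re.
    have cu t ht := cont_wu2 (fun t ht => (h t ht).1) (t := t) ht; have [k _ _ _] := hr.
    have cv t ht := cont_wu2 (fun t ht => (k t ht).1) (t := t) ht.
    apply: (summ1_le rho0 cu cv _ S) => t /andP[t0 t1].
    by have [-> _] := e t ltac:(by rewrite t1 (lt_le_trans rho0 t0)); rewrite c mul1r.
  by apply/eqP; rewrite eq_complex /= im !eqxx.
have [x0 S] := (hl x).2 xl; have x0' := ltW x0.
apply/(sigma_pP (lam := x%:C%C) wp hrho (fun t => Qc_ge1 hrho hQ x0')); split => //.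
by exists (X x).1, (X x).2.1, (X x).2.2.1; split => //; exact: reg.
Qed.
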